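(* There exist constants $c$ and $d$ such that the TAR, TJ and TS versions of each of the reconfiguration problems for \textsc{Independent Set} (IS-R), \textsc{Vertex Cover} (VC-R), \textsc{Feedback Vertex Set} (FVS-R), \textsc{Induced Forest} (IF-R), \textsc{Odd Cycle Transversal} (OCT-R) and \textsc{Induced Bipartite Subgraph} (IBS-R) are $\mathsf{PSPACE}$-complete, even when restricted to planar graphs of bandwidth at most $c$ and maximum degree at most $d$.
   Context: For a graph $G=(V,E)$, the feasible vertex sets are: independent sets (IS); vertex covers (VC, a set meeting every edge); feedback vertex sets (FVS, a set whose removal leaves a forest); sets inducing a forest (IF); odd cycle transversals (OCT, a set whose removal leaves a bipartite graph); sets inducing a bipartite subgraph (IBS). TAR version: given $G$, two feasible sets $S_s,S_g$ and an integer threshold $k$, is there a sequence of feasible sets $S_1=S_s,\dots,S_n=S_g$ with each $S_{i+1}$ obtained from $S_i$ by adding or removing one vertex, such that $|S_i|\ge k$ for all $i$ (for IS, IF, IBS) or $|S_i|\le k$ for all $i$ (for VC, FVS, OCT)? TJ (token jumping) version: given $G$ and feasible sets $S_s,S_g$ of equal size, is there a sequence of feasible sets from $S_s$ to $S_g$ where each $S_{i+1}=(S_i\setminus\{u\})\cup\{v\}$ for some $u\in S_i$, $v\notin S_i$? TS (token sliding) version: as TJ but $u$ and $v$ must additionally be adjacent. The bandwidth of a graph $G=(V,E)$ is the minimum, over all bijections $f:V\to\{1,\dots,|V|\}$, of $\max_{\{u,v\}\in E}|f(u)-f(v)|$. *)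

(* Defs.v *)
From mathcomp Require Import all_boot all_order all_algebra.
From mathcomp Require Import all_classical all_reals all_analysis.

Set Implicit Arguments.
Unset Strict Implicit.
Unset Printing Implicit Defensive.

Import numFieldNormedType.Exports.

(** * Deterministic multi-tape Turing machines *)

Section Tapes.
Variable A : Type.

(** [before] is stored in reverse order, nearest cell first.  Cells are never
    discarded, so [tape_size] counts the input cells together with all the
    cells visited so far. *)
Record tape := Tape { before : seq A; scanned : A; after : seq A }.

Definition tape_size (t : tape) : nat := (size (before t) + size (after t)).+1.

Inductive direction := MoveLeft | Stay | MoveRight.

Definition write_move (blank a : A) (m : direction) (t : tape) : tape :=
  match m with
  | Stay => Tape (before t) a (after t)
  | MoveLeft =>
      if before t is b :: l then Tape l b (a :: after t)
      else Tape [::] blank (a :: after t)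
  | MoveRight =>
      if after t is b :: r then Tape (a :: before t) b r
      else Tape (a :: before t) blank [::]
  end.

Definition tape_of (blank : A) (s : seq A) : tape :=
  if s is a :: s' then Tape [::] a s' else Tape [::] blank [::].

End Tapes.

(** The tape alphabet is [option (bool + aux)]: [None] is the blank,
    [Some (inl b)] are the input/output letters and [Some (inr a)] are
    auxiliary letters. *)
Definition cell (aux : finType) : finType := option (bool + aux)%type.

Record machine := Machine {
  extra_tapes : nat;
  state : finType;
  aux : finType;
  start : state;
  halting : pred state;
  accepting : pred state;
  delta : state -> {ffun 'I_extra_tapes.+1 -> cell aux} ->
          state * {ffun 'I_extra_tapes.+1 -> cell aux * direction}
}.

Section Runs.
Variable M : machine.

Record config := Config {
  control : state M;
  tapes : 'I_(extra_tapes M).+1 -> tape (cell (aux M))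
}.

(** Tape [ord0] carries the input and, for transducers, the output. *)
Definition init (x : seq bool) : config :=
  Config (start M)
    (fun i => tape_of None (if i == ord0 then [seq Some (inl b) | b <- x]
                            else [::])).

Definition step (c : config) : config :=
  if halting (control c) then c else
  let: (q, w) := delta (control c) [ffun i => scanned (tapes c i)] in
  Config q (fun i => write_move None (w i).1 (w i).2 (tapes c i)).

Definition run (t : nat) (x : seq bool) : config := iter t step (init x).

Definition halted (c : config) : bool := halting (control c).

Definition space_used (c : config) : nat :=
  \sum_(i < (extra_tapes M).+1) tape_size (tapes c i).

Fixpoint leading_bits (s : seq (cell (aux M))) : seq bool :=
  if s is Some (inl b) :: s' then b :: leading_bits s' else [::].

(** The output is the maximal block of letters starting at the head. *)
Definition output (c : config) : seq bool :=
  let t := tapes c ord0 in leading_bits (scanned t :: after t).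

End Runs.

(** * Complexity classes *)

Definition language := seq bool -> Prop.

Definition PSPACE (L : language) : Prop :=
  exists (M : machine) (p : {poly nat}), forall x : seq bool,
    (forall t, space_used (run M t x) <= p.[size x]%R) /\
    exists2 t, halted (run M t x) & (accepting (control (run M t x)) <-> L x).

Definition polytime (f : seq bool -> seq bool) : Prop :=
  exists (M : machine) (p : {poly nat}), forall x : seq bool,
    halted (run M p.[size x]%R x) /\ output (run M p.[size x]%R x) = f x.

Record decision_problem := DecisionProblem {
  instance : Type;
  encode : instance -> seq bool;
  yes : instance -> Prop
}.

Definition language_of (Q : decision_problem) : language :=
  fun x => exists2 i : instance Q, encode i = x & yes i.

(** Every language in PSPACE has a polynomial-time many-one reduction to [Q]
    all of whose values are encodings of instances in [C]. *)
Definition PSPACE_hard_on (Q : decision_problem) (C : instance Q -> Prop) :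
    Prop :=
  forall L : language, PSPACE L ->
  exists2 f : seq bool -> seq bool, polytime f &
  forall x, exists i : instance Q, [/\ C i, f x = encode i & (L x <-> yes i)].

(** [Q] is PSPACE-complete, even when restricted to the instances in [C].
    The restriction is a promise: no algorithm is asked to recognise [C].
    When [C] is always true this is plain PSPACE-completeness. *)
Definition PSPACE_complete_on (Q : decision_problem) (C : instance Q -> Prop) :
    Prop :=
  PSPACE (language_of Q) /\ PSPACE_hard_on C.

(** * Graphs *)

Record sgraph (T : finType) := SGraph {
  adj :> rel T;
  adj_sym : symmetric adj;
  adj_irr : irreflexive adj
}.

Section Graphs.
Variables (T : finType) (G : sgraph T).
Implicit Types (S : {set T}).

Definition edges : {set {set T}} :=
  [set e : {set T} | [exists u, exists v, G u v && (e == [set u; v])]]%SET.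

Definition max_degree : nat := \max_(v : T) #|G v|.

(** [f] is numbered from 0; an injection into ['I_#|T|] is a bijection. *)
Definition stretch (f : {ffun T -> 'I_#|T|}) : nat :=
  \max_(u : T) \max_(v : T | G u v) `|(f u : nat) - (f v : nat)|%N.

Definition bandwidth : nat :=
  stretch [arg min_(f < [ffun x : T => enum_rank x] | injectiveb f) stretch f].

Definition independent S : Prop :=
  forall u v, u \in S -> v \in S -> ~~ G u v.

Definition vertex_cover S : Prop :=
  forall u v, G u v -> (u \in S) || (v \in S).

Definition induces_forest S : Prop :=
  ~ exists s : seq T, [/\ {subset s <= S}, 2 < size s & ucycle G s].

Definition induces_bipartite S : Prop :=
  exists col : T -> bool,
  forall u v, u \in S -> v \in S -> G u v -> col u != col v.

End Graphs.

(** [pos] places the vertices in the plane and [arc e], restricted to [0, 1],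
    is a simple arc joining the ends of the edge [e]. *)
Definition planar (R : realType) (T : finType) (G : sgraph T) : Prop :=
  exists (pos : T -> R * R) (arc : {set T} -> R -> R * R),
  [/\ injective pos,
      forall e, e \in edges G ->
        [/\ {within [set` `[0, 1]%R]%classic, continuous (arc e)}%classic,
            {in `[0, 1]%R &, injective (arc e)} &
            exists u v, [/\ e = [set u; v]%SET, arc e 0%R = pos u
                          & arc e 1%R = pos v]],
      forall e, e \in edges G ->
        {in `]0, 1[%R, forall t w, arc e t <> pos w}
    & forall e e', e \in edges G -> e' \in edges G -> e != e' ->
        {in `]0, 1[%R &, forall s t, arc e s <> arc e' t}].

(** * Reconfiguration problems *)

Inductive vertex_problem :=
  | IndependentSet | VertexCover | FeedbackVertexSet
  | InducedForest | OddCycleTransversal | InducedBipartite.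

Section Reconfiguration.
Variables (P : vertex_problem) (T : finType) (G : sgraph T).
Implicit Types (X Y : {set T}) (k : int).

Definition feasible X : Prop :=
  match P with
  | IndependentSet => independent G X
  | VertexCover => vertex_cover G X
  | FeedbackVertexSet => induces_forest G (~: X)
  | InducedForest => induces_forest G X
  | OddCycleTransversal => induces_bipartite G (~: X)
  | InducedBipartite => induces_bipartite G X
  end.

Definition respects_threshold k X : Prop :=
  match P with
  | IndependentSet | InducedForest | InducedBipartite => (k <= #|X|%:Z)%R
  | VertexCover | FeedbackVertexSet | OddCycleTransversal => (#|X|%:Z <= k)%R
  end.

Definition TAR_step : rel {set T} := fun X Y =>
  [exists v, (v \notin X) && (Y == v |: X) || (v \in X) && (Y == X :\ v)]%SET.

Definition TJ_step : rel {set T} := fun X Y =>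
  [exists u, exists v, [&& u \in X, v \notin X & Y == v |: (X :\ u)]]%SET.

Definition TS_step : rel {set T} := fun X Y =>
  [exists u, exists v,
    [&& u \in X, v \notin X, G u v & Y == v |: (X :\ u)]]%SET.

Definition reconfigurable (adjacent : rel {set T}) (ok : {set T} -> Prop) X Y :
    Prop :=
  exists s : seq {set T},
    [/\ path adjacent X s, last X s = Y & forall Z, Z \in X :: s -> ok Z].

End Reconfiguration.

Record reconf_instance (P : vertex_problem) := ReconfInstance {
  order_of : nat;
  graph : sgraph 'I_order_of;
  source : {set 'I_order_of};
  target : {set 'I_order_of};
  source_feasible : feasible P graph source;
  target_feasible : feasible P graph target
}.

Record threshold_instance (P : vertex_problem) := ThresholdInstance {
  threshold_base :> reconf_instance P;
  threshold : int
}.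

Record token_instance (P : vertex_problem) := TokenInstance {
  token_base :> reconf_instance P;
  token_size : #|source token_base| = #|target token_base|
}.

Definition set_bits (n : nat) (X : {set 'I_n}) : seq bool :=
  [seq v \in X | v <- enum 'I_n].

(** The order in unary, the adjacency matrix row by row, and the
    characteristic vectors of the two sets. *)
Definition encode_base P (I : reconf_instance P) : seq bool :=
  rcons (nseq (order_of I) true) false ++
  [seq graph I u v | u <- enum 'I_(order_of I), v <- enum 'I_(order_of I)] ++
  set_bits (source I) ++ set_bits (target I).

(** Binary, least significant bit first. *)
Definition nat_bits (n : nat) : seq bool :=
  [seq odd (n %/ 2 ^ i) | i <- iota 0 (trunc_log 2 n).+1].

Definition int_bits (k : int) : seq bool := (k < 0)%R :: nat_bits `|k|%N.

Definition TAR_problem (P : vertex_problem) : decision_problem :=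
  @DecisionProblem (threshold_instance P)
    (fun I => encode_base I ++ int_bits (threshold I))
    (fun I => reconfigurable (@TAR_step _)
       (fun X => feasible P (graph I) X /\ respects_threshold P (threshold I) X)
       (source I) (target I)).

Definition TJ_problem (P : vertex_problem) : decision_problem :=
  @DecisionProblem (token_instance P) (fun I => encode_base I)
    (fun I => reconfigurable (@TJ_step _) (feasible P (graph I))
       (source I) (target I)).

Definition TS_problem (P : vertex_problem) : decision_problem :=
  @DecisionProblem (token_instance P) (fun I => encode_base I)
    (fun I => reconfigurable (TS_step (graph I)) (feasible P (graph I))
       (source I) (target I)).

Definition planar_bounded (R : realType) (c d : nat) (P : vertex_problem)
    (I : reconf_instance P) : Prop :=
  [/\ planar R (graph I), bandwidth (graph I) <= c
    & max_degree (graph I) <= d].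

(* Main.v *)
(** Membership: a number below [2 ^ n] encodes a set of vertices, and
    reachability is decided as in Savitch's theorem, by an and-or tree that
    guesses midpoints.  A position in this tree is a number of [n * n.+1] bits,
    and the tree is searched with short circuits: the value of a leaf determines
    the next leaf to be visited.  Everything is expressed by primitive recursions
    with polynomially bounded values and compiled through stack programs to
    Turing machines.  The length of a value in binary is what matters for space,
    its size for time: applied to the number that encodes the input such
    recursions run in polynomial space, applied to its length they run in
    polynomial time.

    Hardness: a machine with bounded space is turned into rules that are tried in
    a cyclic order, stored on a ring of instructions, and executed by an agent
    that sweeps over an array of fixed finite alphabet while it carries the ring
    around.  The array is deterministic and its steps change one site, guarded
    by the two neighbours, so that confluence makes its symmetric closure as
    strong as the computation itself.  A word whose letters hold two adjacent
    sites is then reconfigured letter by letter, subject to a constraint between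
    neighbouring letters only.

    Such words are drawn in the plane: variable [i] sends its signal along row [i]
    and column [i] of a triangular grid, and a gadget at the crossing of row [i]
    with column [j] forbids two conflicting letters [i] and [j].  As only adjacent
    positions interact, a strip of constant width suffices, whence the bounds on
    bandwidth and degree.  The vertices are partitioned into cliques with at most
    one token each, and the independent sets considered are the maximum ones, in
    which tokens can only slide.  The complements are the minimum vertex covers.
    Adding a vertex adjacent to both ends of every edge makes every edge a
    triangle, and then minimum feedback vertex sets and minimum odd cycle
    transversals move like minimum vertex covers. *)
From Stdlib Require Import ZArith.
Require Import Defs.
From mathcomp Require Import all_boot all_order all_algebra.
From mathcomp Require Import zify ssrZ lra.
From Stdlib Require Import FunctionalExtensionality.

Set Implicit Arguments.
Unset Strict Implicit.
Unset Printing Implicit Defensive.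

(** * Programs over stacks of bits *)

(** The bounds on bandwidth and degree are fixed before the language is given, so neither the states
    nor the tape symbols of its machine may enter the alphabet of the words: this is why the array
    is universal and why the program travels through it as data.

    Reconfiguration steps can be undone, so going backwards must not help. Enabled sites of the
    array are never adjacent, hence two different steps commute, and whatever is connected to a
    terminal configuration runs forward into it within a bounded number of steps. A rejecting
    computation has to run forever, which the cyclic rules provide, and an accepting one has to end
    in a configuration that has forgotten the tapes, which is why the accepting site floods the
    array.

    One clique with a vertex per letter would not be planar. A letter is therefore spread over a
    chain of triangles that tell whether it, an earlier or a later one is selected.

    The drawing is periodic, so planarity comes down to finitely many pairs of thin triangles and
    points, decided by an exact computation with integers. *)

Definition stacks := nat -> seq bool.

Definition upd (T : Type) (f : nat -> T) (r : nat) (v : T) : nat -> T :=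
  fun i => if i == r then v else f i.

Lemma upd_same T (f : nat -> T) r v : upd f r v r = v.
Proof. by rewrite /upd eqxx. Qed.

Lemma upd_other T (f : nat -> T) r v i : i != r -> upd f r v i = f i.
Proof. by rewrite /upd => /negPf ->. Qed.

Lemma upd_upd T (f : nat -> T) r v w : upd (upd f r v) r w = upd f r w.
Proof. by apply: functional_extensionality => i; rewrite /upd; case: eqP. Qed.

Lemma upd_id T (f : nat -> T) r : upd f r (f r) = f.
Proof. by apply: functional_extensionality => i; rewrite /upd; case: eqP => // ->. Qed.

Lemma upd_comm T (f : nat -> T) r r' v w : r != r' ->
  upd (upd f r v) r' w = upd (upd f r' w) r v.
Proof.
move=> n; apply: functional_extensionality => i; rewrite /upd.
by case: (i =P r) => // ->; rewrite (negPf n).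
Qed.

Inductive cmd :=
  | Skip
  | Push of nat & bool
  | Pop of nat
  | Seq of cmd & cmd
  | If of nat & pred (option bool) & cmd & cmd
  | While of nat & pred (option bool) & cmd.

Definition top (s : stacks) r := ohead (s r).

Definition bounded B (s : stacks) := forall r, size (s r) <= B.

(** The costs are the exact numbers of steps of the compiled machine: a push takes two, a move and a
    write. Only a push can make a stack grow, so only there is [B] checked. *)
Inductive exec (B : nat) : cmd -> stacks -> stacks -> nat -> Prop :=
  | exec_skip s : exec B Skip s s 1
  | exec_push s r b : size (s r) < B -> exec B (Push r b) s (upd s r (b :: s r)) 2
  | exec_pop s r b l : s r = b :: l -> exec B (Pop r) s (upd s r l) 1
  | exec_seq c1 c2 s1 s2 s3 t1 t2 : exec B c1 s1 s2 t1 -> exec B c2 s2 s3 t2 ->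
      exec B (Seq c1 c2) s1 s3 (t1 + t2)
  | exec_if1 r (P : pred (option bool)) c1 c2 s s' t : P (top s r) ->
      exec B c1 s s' t -> exec B (If r P c1 c2) s s' t.+1
  | exec_if0 r (P : pred (option bool)) c1 c2 s s' t : ~~ P (top s r) ->
      exec B c2 s s' t -> exec B (If r P c1 c2) s s' t.+1
  | exec_while0 r (P : pred (option bool)) c s : ~~ P (top s r) ->
      exec B (While r P c) s s 1
  | exec_while1 r (P : pred (option bool)) c s s' s'' t t' : P (top s r) ->
      exec B c s s' t -> exec B (While r P c) s' s'' t' ->
      exec B (While r P c) s s'' (t + t').+1.

Fixpoint regs (c : cmd) : nat :=
  match c with
  | Skip => 0
  | Push r _ | Pop r => r
  | Seq a b => maxn (regs a) (regs b)
  | If r _ a b => maxn r (maxn (regs a) (regs b))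
  | While r _ a => maxn r (regs a)
  end.

(** Costs are bounded from above only, so that bounds of composed programs can be rounded up. *)
Definition runp B c s s' t := exists2 u, u <= t & exec B c s s' u.

Lemma run_skip B s s' t : s = s' -> 0 < t -> runp B Skip s s' t.
Proof. by move=> <- h; exists 1 => //; apply: exec_skip. Qed.

Lemma run_push B s s' r b t : size (s r) < B -> s' = upd s r (b :: s r) -> 1 < t ->
  runp B (Push r b) s s' t.
Proof. by move=> h -> ht; exists 2 => //; apply: exec_push. Qed.

Lemma run_pop B s s' r b l t : s r = b :: l -> s' = upd s r l -> 0 < t ->
  runp B (Pop r) s s' t.
Proof. by move=> h -> ht; exists 1 => //; apply: exec_pop h. Qed.

Lemma run_seq B c1 c2 s2 t1 t2 s1 s3 t : runp B c1 s1 s2 t1 -> runp B c2 s2 s3 t2 ->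
  t1 + t2 <= t -> runp B (Seq c1 c2) s1 s3 t.
Proof.
move=> [u1 h1 e1] [u2 h2 e2] h; exists (u1 + u2); first by lia.
exact: exec_seq e1 e2.
Qed.

Lemma run_if B r (P : pred (option bool)) c1 c2 s s' t :
  (if P (ohead (s r)) then runp B c1 s s' t else runp B c2 s s' t) ->
  runp B (If r P c1 c2) s s' t.+1.
Proof.
case: ifP => h [u hu e]; exists u.+1 => //; first exact: exec_if1.
by apply: exec_if0; rewrite ?h // /top h.
Qed.

Lemma run_while0 B r (P : pred (option bool)) c s s' t :
  ~~ P (ohead (s r)) -> s = s' -> 0 < t -> runp B (While r P c) s s' t.
Proof. by move=> h <- ht; exists 1 => //; apply: exec_while0. Qed.

Lemma run_while1 B r (P : pred (option bool)) c s1 t1 t2 s s' t :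
  P (ohead (s r)) -> runp B c s s1 t1 -> runp B (While r P c) s1 s' t2 -> t1 + t2 < t ->
  runp B (While r P c) s s' t.
Proof.
move=> h [u1 h1 e1] [u2 h2 e2] ht; exists (u1 + u2).+1; first by lia.
exact: exec_while1 e1 e2.
Qed.

Lemma run_eqs B c s1 t s s' t' : runp B c s s1 t -> s1 = s' -> t <= t' -> runp B c s s' t'.
Proof. by move=> [u h e] <- ht; exists u => //; lia. Qed.

(** * Binary arithmetic on stacks *)

(** Bijective base-2 numerals, least significant digit first: [false] and
    [true] are the digits 1 and 2, so that every bit string is a numeral. *)
Fixpoint bcode (s : seq bool) : nat := if s is b :: s' then (b + (bcode s').*2).+1 else 0.

Fixpoint incb (s : seq bool) : seq bool :=
  match s with [::] => [:: false] | false :: s' => true :: s' | true :: s' => false :: incb s' end.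

Definition bin n := iter n incb [::].

Lemma code_incb s : bcode (incb s) = (bcode s).+1.
Proof. by elim: s => [|[] s IH] //=; rewrite IH; lia. Qed.

Lemma binK n : bcode (bin n) = n.
Proof. by elim: n => //= n IH; rewrite code_incb IH. Qed.

Lemma code_inj : injective bcode.
Proof.
elim=> [|b s IH] [|c t] //= [] e.
have hb : b = c by move/(congr1 odd): e; rewrite !oddD !odd_double !addbF !oddb.
by rewrite hb in e *; rewrite (IH t) //; move/addnI/double_inj: e.
Qed.

Lemma bcodeK s : bin (bcode s) = s.
Proof. by apply: code_inj; rewrite binK. Qed.

Lemma code_size s : 2 ^ size s <= (bcode s).+1.
Proof. by elim: s => [|b s IH] //=; rewrite expnS; lia. Qed.

Lemma code_lt s : (bcode s).+1 < 2 ^ (size s).+1.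
Proof. by elim: s => [|b s IH] //=; rewrite expnS; case: b; lia. Qed.

Lemma size_code s : size s <= bcode s.
Proof. by elim: s => [|b s IH] //=; lia. Qed.

Lemma size_bin n : size (bin n) <= n.
Proof. by rewrite -{2}(binK n) size_code. Qed.

Lemma size_bin_le n B : n < 2 ^ B -> size (bin n) <= B.
Proof.
move=> h; rewrite -(@leq_exp2l 2) //; apply: leq_trans (code_size _) _.
by rewrite binK.
Qed.

Definition hd1 (o : option bool) := o == Some true.
Definition hd0 (o : option bool) := o == Some false.

Definition pump a b (P : pred (option bool)) v := While a P (Seq (Pop a) (Push b v)).

Ltac stk := apply: functional_extensionality => ?; rewrite /upd;
  repeat match goal with H : is_true (_ != _) |- _ => move/eqP: H => H end;
  repeat case: eqP => //= ?; try congruence; try (exfalso; lia).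

Lemma run_pump B (a b : nat) (P : pred (option bool)) v x j w (s : stacks) : a != b -> P (Some x) ->
  ~~ P (ohead w) -> s a = nseq j x ++ w -> size (s b) + j <= B ->
  runp B (pump a b P v) s (upd (upd s a w) b (nseq j v ++ s b)) (4 * j + 1).
Proof.
move=> ab Px Pw; have ba : b != a by rewrite eq_sym.
elim: j s => [|j IH] s ea hB.
  apply: run_while0; rewrite ?ea //.
  by rewrite /= in ea; rewrite /= -ea !upd_id.
apply: (@run_while1 _ _ _ _ (upd (upd s a (nseq j x ++ w)) b (v :: s b)) 3 (4 * j + 1)).
- by rewrite ea.
- apply: (@run_seq _ _ _ (upd s a (nseq j x ++ w)) 1 2) => //.
    by apply: run_pop; rewrite ?ea.
  by apply: run_push; rewrite ?upd_other //; lia.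
- set s1 := upd _ b _.
  have e1 : s1 a = nseq j x ++ w by rewrite /s1 upd_other // upd_same.
  have e2 : s1 b = v :: s b by rewrite /s1 upd_same.
  apply: run_eqs (IH s1 e1 _) _ _ => //; first by rewrite e2 /=; lia.
  by rewrite e2 -[v :: s b]/(nseq 1 v ++ s b) catA -nseqD addn1 /s1; stk.
- by lia.
Qed.

(** A carry turns the leading run of digits 2 into digits 1, so only the length of the run has to be
    remembered; [tmp] keeps it while the digit below is changed. *)
Definition incp r tmp :=
  Seq (pump r tmp hd1 false)
  (Seq (If r isSome (Seq (Pop r) (Push r true)) (Push r false))
       (pump tmp r isSome false)).

(** A borrow turns the leading run of digits 1 into digits 2. If no digit 2 stops it, the numeral
    becomes one digit shorter, and the digit is dropped from [tmp]. *)
Definition decp r tmp :=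
  Seq (pump r tmp hd0 false)
  (Seq (If r isSome (Seq (Pop r) (Push r false)) (Pop tmp))
       (pump tmp r isSome true)).

Definition bump (v : seq bool) := if v is _ :: s then true :: s else [:: false].

Lemma incb_shape v : exists j v', [/\ v = nseq j true ++ v', ohead v' != Some true
  & incb v = nseq j false ++ bump v'].
Proof.
elim: v => [|[] v [j [v' [e h1 h2]]]]; first by exists 0, [::].
  by exists j.+1, v'; rewrite /= -e h2.
by exists 0, (false :: v).
Qed.

Lemma run_inc B (r tmp : nat) (s : stacks) : r != tmp -> s tmp = [::] -> size (s r) < B ->
  runp B (incp r tmp) s (upd s r (incb (s r))) (8 * size (s r) + 8).
Proof.
move=> rt et hB; have [j [v [e h1 ->]]] := incb_shape (s r).
have hs : size (s r) = j + size v by rewrite e size_cat size_nseq.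
have tr : tmp != r by rewrite eq_sym.
set s1 := upd (upd s r v) tmp (nseq j false).
apply: (@run_seq _ _ _ s1 (4 * j + 1) (4 + (4 * j + 1))); last by lia.
  apply: run_eqs (@run_pump _ r tmp hd1 false true j v _ rt _ h1 e _) _ _ => //; rewrite ?et ?cats0 //=; lia.
 have e1 : s1 r = v by rewrite /s1 upd_other // upd_same.
apply: (@run_seq _ _ _ (upd s1 r (bump v)) 4 (4 * j + 1)).
- apply: run_if; rewrite e1; have [Ev|[v2 Ev]] : v = [::] \/ exists v2, v = false :: v2.
    by case: (v) h1 => [|[] v2] // _; [left|right; exists v2].
  + by rewrite Ev in e1 hs *; apply: run_push; rewrite ?e1 //=; lia.
  + rewrite Ev in e1 hs *; move: hs => /= hs.
    apply: (@run_seq _ _ _ (upd s1 r v2) 1 2) => //; first by apply: run_pop; rewrite ?e1.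
    by apply: run_push => //; rewrite ?upd_upd ?upd_same //; lia.
- apply: run_eqs (@run_pump _ tmp r isSome false false j [::] _ _ _ _ _ _) _ _ => //.
  + by rewrite /s1 upd_other // upd_same cats0.
  + by rewrite upd_same; case: (v) h1 hs => [|[] v2] //=; lia.
  + rewrite upd_same /s1; stk. 
- by [].
Qed.

Lemma run_dec B (r tmp : nat) (s : stacks) v : r != tmp -> s tmp = [::] -> size (s r) <= B -> s r = incb v ->
  runp B (decp r tmp) s (upd s r v) (8 * size (s r) + 8).
Proof.
move=> rt et hB er; have [j [v' [e h1 h2]]] := incb_shape v.
have tr : tmp != r by rewrite eq_sym.
case: v' e h1 h2 => [|[] v'] //= e _ h2; rewrite h2 in er.
  rewrite -(nseqD _ 1) addn1 in er.
  have hs : size (s r) = j.+1 by rewrite er size_nseq.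
  set s1 := upd (upd s r [::]) tmp (nseq j.+1 false).
  apply: (@run_seq _ _ _ s1 (4 * j.+1 + 1) (4 + (4 * j + 1))); last by lia.
    apply: run_eqs (@run_pump _ r tmp hd0 false false j.+1 [::] _ _ _ _ _ _) _ _ => //; rewrite ?et ?cats0 //=; lia.
  have e1 : s1 r = [::] by rewrite /s1 upd_other // upd_same.
  have e2 : s1 tmp = nseq j.+1 false by rewrite /s1 upd_same.
    apply: (@run_seq _ _ _ (upd s1 tmp (nseq j false)) 4 (4 * j + 1)) => //.
      by apply: run_if; rewrite e1 /=; apply: run_pop => //; rewrite e2.
    apply: run_eqs (@run_pump _ tmp r isSome true false j [::] _ _ _ _ _ _) _ _ => //.
    + by rewrite upd_same cats0.
    + by rewrite upd_other // e1 /=; lia.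
    + by rewrite upd_other // e1 /s1 e !cats0; stk.
have hs : size (s r) = j + (size v').+1 by rewrite er size_cat size_nseq.
set s1 := upd (upd s r (true :: v')) tmp (nseq j false).
apply: (@run_seq _ _ _ s1 (4 * j + 1) (4 + (4 * j + 1))); last by lia.
  apply: run_eqs (@run_pump _ r tmp hd0 false false j (true :: v') _ _ _ _ _ _) _ _ => //; rewrite ?et ?cats0 //=; lia.
have e1 : s1 r = true :: v' by rewrite /s1 upd_other // upd_same.
have e2 : s1 tmp = nseq j false by rewrite /s1 upd_same.
  apply: (@run_seq _ _ _ (upd s1 r (false :: v')) 4 (4 * j + 1)) => //.
    apply: run_if; rewrite e1 /=; apply: (@run_seq _ _ _ (upd s1 r v') 1 2) => //.
      by apply: run_pop; rewrite ?e1.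
    by apply: run_push => //; rewrite ?upd_upd ?upd_same //; lia.
  apply: run_eqs (@run_pump _ tmp r isSome true false j [::] _ _ _ _ _ _) _ _ => //.
  + by rewrite upd_other // e2 cats0.
  + by rewrite upd_same /=; lia.
  + by rewrite upd_same /s1 e; stk.
Qed.

(** Moves [a] onto [b], reversing it. *)
Definition mvp a b := While a isSome
  (Seq (If a hd1 (Push b true) (Push b false)) (Pop a)).

Lemma run_mv B (a b : nat) (s : stacks) : a != b -> size (s a) + size (s b) <= B ->
  runp B (mvp a b) s (upd (upd s a [::]) b (catrev (s a) (s b))) (5 * size (s a) + 1).
Proof.
move=> ab; have [l El] := ex_intro (fun l => s a = l) _ erefl.
elim: l s El => [|x l IH] s El hB; rewrite El in hB *.
  by apply: run_while0; rewrite ?El //= -El !upd_id.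
apply: (@run_while1 _ _ _ _ (upd (upd s a l) b (x :: s b)) 4 (5 * size l + 1)) => /=; last by lia.
- by rewrite El.
- apply: (@run_seq _ _ _ (upd s b (x :: s b)) 3 1) => //.
    by apply: run_if; rewrite El; case: x El hB => El /= hB; apply: run_push => //; lia.
  apply: run_pop => //; first by rewrite upd_other // El.
  by rewrite upd_comm.
- have := IH (upd (upd s a l) b (x :: s b)); rewrite upd_other // upd_same => /(_ erefl) h.
  by apply: run_eqs (h _) _ _; rewrite ?upd_same //; [move: hB => /=; lia|stk].
Qed.

Definition clearp a := While a isSome (Pop a).

Lemma run_clear B a s : runp B (clearp a) s (upd s a [::]) (2 * size (s a) + 1).
Proof.
have [l El] := ex_intro (fun l => s a = l) _ erefl.
elim: l s El => [|x l IH] s El; rewrite El.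
  by apply: run_while0; rewrite ?El // -El upd_id.
apply: (@run_while1 _ _ _ _ (upd s a l) 1 (2 * size l + 1)); rewrite ?El //=; last by lia.
  by apply: run_pop El _ _.
by apply: run_eqs (IH _ _) _ _; rewrite ?upd_same // upd_upd.
Qed.

(** Moves [a] to [b] through the empty stack [c]. *)
Definition mv2p a b c := Seq (mvp a c) (mvp c b).

Lemma run_mv2 B (a b c : nat) (s : stacks) : a != b -> a != c -> b != c -> s c = [::] -> s b = [::] ->
  size (s a) <= B ->
  runp B (mv2p a b c) s (upd (upd s a [::]) b (s a)) (10 * size (s a) + 2).
Proof.
move=> ab ac bc ec eb hB; have cb : c != b by rewrite eq_sym.
set s1 := upd (upd s a [::]) c (rev (s a)).
apply: (@run_seq _ _ _ s1 (5 * size (s a) + 1) (5 * size (s a) + 1)); last by lia.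
  by apply: run_eqs (run_mv ac _) _ _; rewrite ?ec ?addn0.
have e1 : s1 c = rev (s a) by rewrite /s1 upd_same.
have e2 : s1 b = [::] by rewrite /s1 !upd_other // eq_sym.
apply: run_eqs (run_mv cb _) _ _; rewrite ?e1 ?e2 ?size_rev ?addn0 //.
by rewrite -[catrev _ _]/(rev (rev (s a))) revK /s1; stk.
Qed.

(** Copies [a] to the empty stack [b] through the empty stack [c]. *)
Definition copyp a b c := Seq (mvp a c) (While c isSome
  (Seq (If c hd1 (Seq (Push a true) (Push b true)) (Seq (Push a false) (Push b false))) (Pop c))).

Lemma run_copy B (a b c : nat) (s : stacks) : a != b -> a != c -> b != c -> s c = [::] -> s b = [::] ->
  size (s a) <= B -> runp B (copyp a b c) s (upd s b (s a)) (15 * size (s a) + 2).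
Proof.
move=> ab ac bc ec eb hB; have cb : c != b by rewrite eq_sym.
have ca : c != a by rewrite eq_sym. have ba : b != a by rewrite eq_sym.
set s1 := upd (upd s a [::]) c (rev (s a)).
apply: (@run_seq _ _ _ s1 (5 * size (s a) + 1) (10 * size (s a) + 1)); last by lia.
  by apply: run_eqs (run_mv ac _) _ _; rewrite ?ec ?addn0.
suff H l s2 : s2 c = l -> size l + size (s2 a) <= B -> size l + size (s2 b) <= B ->
    runp B (While c isSome (Seq (If c hd1 (Seq (Push a true) (Push b true))
      (Seq (Push a false) (Push b false))) (Pop c)))
      s2 (upd (upd (upd s2 c [::]) a (catrev l (s2 a))) b (catrev l (s2 b))) (10 * size l + 1).
  have e1 : s1 c = rev (s a) by rewrite /s1 upd_same.
  have e2 : s1 b = [::] by rewrite /s1 !upd_other.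
  have e3 : s1 a = [::] by rewrite /s1 !(upd_same, upd_other).
  apply: run_eqs (H _ s1 e1 _ _) _ _; rewrite ?e2 ?e3 ?size_rev ?addn0 //.
  by rewrite -[catrev _ _]/(rev (rev (s a))) revK /s1; stk.
elim: l s2 => [|x l IH] s2 El ha hb.
  by apply: run_while0; rewrite ?El //= -El !upd_id.
set s3 := upd (upd (upd s2 a (x :: s2 a)) b (x :: s2 b)) c l.
have e1 : s3 a = x :: s2 a by rewrite /s3 !(upd_same, upd_other).
have e2 : s3 b = x :: s2 b by rewrite /s3 !(upd_same, upd_other).
move: ha hb => /= ha hb.
apply: (@run_while1 _ _ _ _ s3 6 (10 * size l + 1)) => /=; last by lia.
- by rewrite El.
- apply: (@run_seq _ _ _ (upd (upd s2 a (x :: s2 a)) b (x :: s2 b)) 5 1) => //.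
    apply: run_if; rewrite El.
    suff h : runp B (Seq (Push a x) (Push b x)) s2 (upd (upd s2 a (x :: s2 a)) b (x :: s2 b)) 4.
      by move: h; case: (x).
    apply: (@run_seq _ _ _ (upd s2 a (x :: s2 a)) 2 2) => //; apply: run_push => //.
    + by lia.
    + by rewrite upd_other //; lia.
    + by rewrite (upd_other _ _ ba).
  by apply: run_pop; rewrite ?upd_other // El.
- apply: run_eqs (IH s3 _ _ _) _ _; rewrite ?e1 ?e2 //=; try lia.
    by rewrite /s3 upd_same.
  by rewrite /s3; stk.
Qed.

(** * Bounded primitive recursion *)

(** The value 0 marks a position beyond the end; a bit is shifted to 1 or 2. *)
Definition inp (x : seq bool) j := if drop j x is b :: _ then (nat_of_bool b).+1 else 0.

(** The summand 2 lets powers of [mu] absorb constants and sums, so that polynomial bounds can be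
    stated with an exponent alone. *)
Definition mu (x : seq bool) (s : seq nat) := sumn s + size x + 2.

Definition func := seq bool -> seq nat -> nat.

Fixpoint recn (a : nat) (h : nat -> nat -> nat) n :=
  if n is n'.+1 then h n' (recn a h n') else a.

(** Functions of an input string and an environment of numbers, read with
    default 0; every value is polynomially bounded in [mu]. *)
Inductive E2 : func -> Prop :=
  | E2_var i : E2 (fun _ s => nth 0 s i)
  | E2_zero : E2 (fun _ _ => 0)
  | E2_succ f : E2 f -> E2 (fun x s => (f x s).+1)
  | E2_len : E2 (fun x _ => size x)
  | E2_inp f : E2 f -> E2 (fun x s => inp x (f x s))
  | E2_let f g : E2 f -> E2 g -> E2 (fun x s => f x (g x s :: s))
  | E2_ren f l : E2 f -> E2 (fun x s => f x [seq nth 0 s i | i <- l])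
  | E2_rec k g h n : E2 g -> E2 h -> E2 n ->
      (forall x s i, i <= n x s ->
         recn (g x s) (fun j a => h x [:: j, a & s]) i <= mu x s ^ k) ->
      E2 (fun x s => recn (g x s) (fun j a => h x [:: j, a & s]) (n x s)).

Definition polyb (T : func) := exists k, forall x s, T x s <= mu x s ^ k.

Lemma leq_exp2r' m n k : m <= n -> m ^ k <= n ^ k.
Proof. by case: k => // k; rewrite leq_exp2r. Qed.

Lemma mu_gt1 x s : 1 < mu x s. Proof. by rewrite /mu addn2. Qed.

Lemma polyb_le T T' : polyb T' -> (forall x s, T x s <= T' x s) -> polyb T.
Proof. by move=> [k h] h'; exists k => x s; apply: leq_trans (h' x s) (h x s). Qed.

Lemma polyb_mu : polyb mu. Proof. by exists 1 => x s. Qed.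

Lemma polyb_const c : polyb (fun _ _ => c).
Proof.
exists c => x s; apply: (@leq_trans (2 ^ c)); first exact/ltnW/ltn_expl.
exact/leq_exp2r'/mu_gt1.
Qed.

Lemma polyb_mul T T' : polyb T -> polyb T' -> polyb (fun x s => T x s * T' x s).
Proof. by move=> [k h] [k' h']; exists (k + k') => x s; rewrite expnD leq_mul. Qed.

Lemma polyb_add T T' : polyb T -> polyb T' -> polyb (fun x s => T x s + T' x s).
Proof.
move=> [k h] [k' h']; exists (k + k').+1 => x s; rewrite expnS expnD.
have m1 := mu_gt1 x s; move: (h x s) (h' x s).
have p1 : 0 < mu x s ^ k by rewrite expn_gt0; lia.
have p2 : 0 < mu x s ^ k' by rewrite expn_gt0; lia.
move: (mu x s ^ k) (mu x s ^ k') p1 p2 => a b p1 p2 h1 h2.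
apply: (@leq_trans (2 * (a * b))); last by rewrite leq_mul2r m1 orbT.
by apply: leq_trans (leq_add h1 h2) _; nia.
Qed.

Lemma polyb_pow T k : polyb T -> polyb (fun x s => T x s ^ k).
Proof. by move=> [j h]; exists (j * k) => x s; rewrite expnM leq_exp2r'. Qed.

Lemma polyb_subst T M (phi : seq bool -> seq nat -> seq nat) :
  polyb T -> polyb M -> (forall x s, mu x (phi x s) <= M x s) -> polyb (fun x s => T x (phi x s)).
Proof.
move=> [k h] hM hp; apply: (@polyb_le _ (fun x s => M x s ^ k)); first exact: polyb_pow.
by move=> x s; apply: leq_trans (h _ _) _; apply/leq_exp2r'/hp.
Qed.

Lemma sumn_nth s i : nth 0 s i <= sumn s.
Proof. by elim: s i => [|a s IH] [|i] //=; [lia|apply: leq_trans (IH i) _; lia]. Qed.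

Lemma sumn_ren s l : sumn [seq nth 0 s i | i <- l] <= size l * sumn s.
Proof. by elim: l => //= i l IH; have := sumn_nth s i; rewrite mulSn; lia. Qed.

Lemma polyb_let f g : polyb f -> polyb g -> polyb (fun x s => f x (g x s :: s)).
Proof.
move=> hf hg; apply: polyb_subst hf (polyb_add hg polyb_mu) _ => x s.
by rewrite /mu /=; lia.
Qed.

Lemma polyb_ren f l : polyb f -> polyb (fun x s => f x [seq nth 0 s i | i <- l]).
Proof.
move=> hf; apply: polyb_subst hf (polyb_mul (polyb_const (size l).+1) polyb_mu) _ => x s.
by have := sumn_ren s l; rewrite /mu; nia.
Qed.

Lemma E2_polyb f : E2 f -> polyb f.
Proof.
elim=> {f} [i||f _ h||f _ h|f g _ h1 _ h2|f l _ h|k g h n _ hg _ hh _ hn hR].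
- by apply: polyb_le polyb_mu _ => x s; have := sumn_nth s i; rewrite /mu; lia.
- exact: polyb_const.
- by apply: polyb_le (polyb_add h (polyb_const 1)) _ => x s; rewrite addn1.
- by apply: polyb_le polyb_mu _ => x s; rewrite /mu; lia.
- by apply: polyb_le (polyb_const 2) _ => x s; rewrite /inp; case: drop => // -[].
- exact: polyb_let.
- exact: polyb_ren.
- by exists k => x s; apply: hR.
Qed.

(** * Compilation of bounded recursion to stack programs *)

Definition env (s : stacks) (rho : seq nat) := [seq bcode (s r) | r <- rho].

(** Arguments are read from the registers [rho] below [m]; those from [m] on are scratch space,
    empty before the run and, apart from the result in [m], after it. Register 0 keeps the input,
    hence [0 < m]. The same [T] governs both resources: it bounds the time, and stacks of height [B]
    are high enough as soon as [T] is below [2 ^ B], since [T] dominates the values that occur. *)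
Definition computes (f : func) := forall (rho : seq nat) (m : nat), (forall r : nat, r \in rho -> r < m) -> 0 < m ->
  exists c T, polyb T /\ forall B s, (forall r, m <= r -> s r = [::]) -> bounded B s ->
    T (s 0) (env s rho) < 2 ^ B ->
    runp B c s (upd s m (bin (f (s 0) (env s rho)))) (T (s 0) (env s rho)).

Lemma env_upd s (rho : seq nat) (m : nat) v : (forall r : nat, r \in rho -> r < m) -> env (upd s m v) rho = env s rho.
Proof.
move=> h; apply/eq_in_map => r /h; rewrite /upd.
by case: eqP => // ->; rewrite ltnn.
Qed.

Lemma env_size s (rho : seq nat) (r : nat) : r \in rho -> size (s r) <= sumn (env s rho).
Proof.
elim: rho => //= i rho IH; rewrite inE => /orP[/eqP->|/IH]; have := size_code (s i); lia.
Qed.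

Lemma bounded_upd B s r v : bounded B s -> size v <= B -> bounded B (upd s r v).
Proof. by move=> h1 h2 i; rewrite /upd; case: eqP. Qed.

Lemma comp_zero : computes (fun _ _ => 0).
Proof.
move=> rho m hr hm; exists Skip, (fun _ _ => 1); split; first exact: polyb_const.
by move=> B s e hB _; apply: run_skip => //; rewrite -[bin 0]/[::] -(e m) // upd_id.
Qed.

Lemma comp_var i : computes (fun _ s => nth 0 s i).
Proof.
move=> rho m hr hm; have [hi|hi] := ltnP i (size rho); last first.
  have [c [T [hT h]]] := comp_zero hr hm; exists c, T; split=> // B s e hB h'.
  by rewrite nth_default ?size_map //; apply: h.
have hn : nth 0 rho i < m by apply/hr/mem_nth.
exists (copyp (nth 0 rho i) m m.+1), (fun x s => 15 * mu x s + 2); split.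
  by apply: polyb_add (polyb_mul (polyb_const 15) polyb_mu) (polyb_const 2).
move=> B s e hB _; rewrite (nth_map 0) // bcodeK.
have em : s m = [::] by apply: e.
have em1 : s m.+1 = [::] by apply: e; lia.
apply: run_eqs (run_copy _ _ _ _ _ (hB _)) _ _; rewrite ?em ?em1 //; try lia.
have hi' : nth 0 rho i \in rho by apply: mem_nth.
have := env_size s hi'; rewrite /mu; lia.
Qed.

Lemma comp_succ f : polyb f -> computes f -> computes (fun x s => (f x s).+1).
Proof.
move=> pf hf rho m hr hm; have [c [T [hT h]]] := hf rho m hr hm.
exists (Seq c (incp m m.+1)), (fun x s => T x s + (8 * f x s + 8)); split.
  by apply: polyb_add => //; apply: polyb_add (polyb_mul (polyb_const 8) pf) (polyb_const 8).
move=> B s e hB /=; set v := f _ _ => hlt.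
have sv := size_bin v; have sB : size (bin v.+1) <= B by apply: size_bin_le; lia.
apply: run_seq (h B s e hB _) _ (leqnn _); first by lia.
apply: run_eqs (@run_inc B m m.+1 _ _ _ _) _ _.
- by lia.
- by rewrite upd_other ?e //; apply/eqP; lia.
- rewrite upd_same.
  rewrite -(@ltn_exp2l 2) //; apply: leq_ltn_trans (code_size _) _; rewrite binK; lia.
- by rewrite upd_same upd_upd.
- by rewrite upd_same -/v; lia.
Qed.

Lemma comp_let f g : polyb f -> polyb g -> computes f -> computes g ->
  computes (fun x s => f x (g x s :: s)).
Proof.
move=> pf pg hf hg rho m hr hm; have [cg [Tg [hTg hg']]] := hg rho m hr hm.
have hr' r : r \in m :: rho -> r < m.+1.
  by rewrite inE => /orP[/eqP->|/hr]; rewrite ?ltnS // => /ltnW.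
have [cf [Tf [hTf hf']]] := hf (m :: rho) m.+1 hr' isT.
exists (Seq cg (Seq cf (Seq (clearp m) (mv2p m.+1 m m.+2)))),
  (fun x s => Tg x s + (Tf x (g x s :: s) + ((2 * g x s + 1) + (10 * f x (g x s :: s) + 2)))); split.
  apply: polyb_add => //; apply: polyb_add; first exact: polyb_let.
  apply: polyb_add; (apply: polyb_add; last exact: polyb_const);
    apply: polyb_mul (polyb_const _) _ => //; exact: polyb_let.
move=> B s e hB /=; set v := g _ _; set w := f _ _ => hlt.
have sv : size (bin v) <= B by apply: size_bin_le; lia.
have sw : size (bin w) <= B by apply: size_bin_le; lia.
have z0 : (0 == m) = false by lia.
apply: run_seq (hg' B s e hB _) _ (leqnn _); first by lia.
set s1 := upd s m (bin v).
have e1 : env s1 (m :: rho) = v :: env s rho by rewrite /= env_upd // /s1 upd_same binK.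
have e10 : s1 0 = s 0 by rewrite /s1 /upd z0.
apply: (@run_seq _ _ _ (upd s1 m.+1 (bin w)) _ _ _ _ _ _ _ (leqnn _)).
  apply: run_eqs (hf' B s1 _ _ _) _ _; rewrite ?e1 ?e10 //; last by lia.
    by move=> r h; rewrite /s1 upd_other ?e //; lia.
  exact: bounded_upd.
set s2 := upd s1 _ _.
have e2 : s2 m = bin v by rewrite /s2 /s1 !(upd_same, upd_other) //; lia.
have := size_bin v; have := size_bin w => hw hv.
apply: (@run_seq _ _ _ (upd s2 m [::]) _ _ _ _ _ _ _ (leqnn _)).
  by apply: run_eqs (run_clear _ _ _) _ _; rewrite ?e2 //; lia.
have em : s m.+1 = [::] by rewrite e.
have em2 : s m.+2 = [::] by rewrite e //; lia.
have e3 : upd s2 m [::] m.+1 = bin w by rewrite /s2 !(upd_same, upd_other) //; lia.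
apply: run_eqs (@run_mv2 B m.+1 m m.+2 _ _ _ _ _ _ _) _ _; rewrite ?e3 //; try lia.
- by rewrite /s2 /s1 !upd_other ?em2 //; lia.
- by rewrite upd_same.
- by rewrite /s2 /s1; stk.
Qed.

Lemma comp_ren f l : polyb f -> computes f -> computes (fun x s => f x [seq nth 0 s i | i <- l]).
Proof.
(* An index beyond the environment is sent to register [m], which is still empty and thus reads as
   the default 0. *)
move=> pf hf rho m hr hm; pose rho' := [seq nth m rho i | i <- l].
have hr' r : r \in rho' -> r < m.+1.
  move=> /mapP[i _ ->]; have [hi|hi] := ltnP i (size rho); last by rewrite nth_default.
  by rewrite ltnS ltnW // hr // mem_nth.
have [c [T [hT h]]] := hf rho' m.+1 hr' isT.
exists (Seq c (mv2p m.+1 m m.+2)),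
  (fun x s => T x [seq nth 0 s i | i <- l] + (10 * f x [seq nth 0 s i | i <- l] + 2)); split.
  apply: polyb_add; first exact: polyb_ren.
  by apply: polyb_add (polyb_mul (polyb_const _) (polyb_ren _ pf)) (polyb_const _).
move=> B s e hB /=; set w := f _ _ => hlt.
have sw : size (bin w) <= B by apply: size_bin_le; lia.
have ee : env s rho' = [seq nth 0 (env s rho) i | i <- l].
  rewrite /env -map_comp; apply: eq_map => i /=.
  have [hi|hi] := ltnP i (size rho); first by rewrite (nth_map 0) // (set_nth_default 0).
  by rewrite !nth_default ?size_map ?e.
have em : s m.+1 = [::] by rewrite e.
have em2 : s m.+2 = [::] by rewrite e //; lia.
have em0 : s m = [::] by rewrite e.
apply: (@run_seq _ _ _ (upd s m.+1 (bin w)) _ _ _ _ _ _ _ (leqnn _)).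
  rewrite -ee in hlt; apply: run_eqs (h B s _ hB _) _ _; rewrite ?ee //; last by rewrite -ee; lia.
  by move=> r hmr; apply: e; lia.
have := size_bin w => hw.
apply: run_eqs (@run_mv2 B m.+1 m m.+2 _ _ _ _ _ _ _) _ _; rewrite ?upd_same //; try lia.
- by rewrite !upd_other ?em2 //; lia.
- by rewrite !upd_other ?em0 //; lia.
- by stk.
Qed.

Lemma run_count B (m : nat) (l : seq bool) n (s : stacks) : 0 < m -> s 0 = l -> s m = bin n ->
  s m.+2 = [::] -> size l + size (s m.+1) <= B -> n + size l < 2 ^ B ->
  runp B (While 0 isSome (Seq (If 0 hd1 (Push m.+1 true) (Push m.+1 false))
                             (Seq (Pop 0) (incp m m.+2))))
    s (upd (upd (upd s 0 [::]) m.+1 (catrev l (s m.+1))) m (bin (n + size l)))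
    (size l * (8 * (n + size l) + 13) + 1).
Proof.
move=> hm; elim: l n s => [|x l IH] n s e0 em em2 hs hn.
  by apply: run_while0; rewrite ?e0 //= addn0 -em -e0 !upd_id.
move: hs hn => /= hs hn.
have m0 : m != 0 by apply/eqP; lia. have m0' : 0 != m by rewrite eq_sym.
have m1 : m.+1 != m by apply/eqP; lia. have m2 : m.+2 != m by apply/eqP; lia.
have m3 : m.+2 != m.+1 by apply/eqP; lia. have m4 : m != m.+2 by rewrite eq_sym.
have m5 : m != m.+1 by rewrite eq_sym.
set s1 := upd s m.+1 (x :: s m.+1); set s2 := upd s1 0 l.
have hbn := size_bin n.
set s3 := upd s2 m (bin n.+1).
apply: (@run_while1 _ _ _ _ s3 (8 * n + 12) (size l * (8 * (n.+1 + size l) + 13) + 1)).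
- by rewrite e0.
- apply: (@run_seq _ _ _ s1 3 (8 * n + 9)); last by lia.
    by apply: run_if; rewrite e0 /s1; case: x {e0 s1 s2 s3}; apply: run_push => //; lia.
  apply: (@run_seq _ _ _ s2 1 (8 * n + 8)); last by lia.
    by apply: run_pop; rewrite /s1 ?upd_other ?e0.
  have e2 : s2 m = bin n by rewrite /s2 /s1 !upd_other.
  apply: run_eqs (@run_inc B m m.+2 s2 _ _ _) _ _; rewrite ?e2 //.
  + by rewrite /s2 /s1 !upd_other.
  + rewrite -(@ltn_exp2l 2) //; apply: leq_ltn_trans (code_size _) _; rewrite binK; lia.
  + by lia.
- apply: run_eqs (IH n.+1 s3 _ _ _ _ _) _ _ => //.
  + by rewrite /s3 /s2 !(upd_same, upd_other).
  + by rewrite /s3 !(upd_same, upd_other).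
  + by rewrite /s3 /s2 /s1 !upd_other.
  + by rewrite /s3 /s2 /s1 !(upd_same, upd_other) //=; lia.
  + by lia.
  + by rewrite addSnnS /s3 /s2 /s1 !(upd_same, upd_other) //; stk.
- by lia.
Qed.

Lemma comp_len : computes (fun x _ => size x).
Proof.
move=> rho m hr hm.
exists (Seq (While 0 isSome (Seq (If 0 hd1 (Push m.+1 true) (Push m.+1 false))
                             (Seq (Pop 0) (incp m m.+2)))) (mvp m.+1 0)),
  (fun x s => (size x * (8 * size x + 13) + 1) + (5 * size x + 1)); split.
  have hx : polyb (fun x _ => size x).
    by apply: polyb_le polyb_mu _ => x s; rewrite /mu; lia.
  apply: polyb_add; apply: polyb_add; try exact: polyb_const; apply: polyb_mul => //.
    by apply: polyb_add; [apply: polyb_mul => //|]; apply: polyb_const.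
  exact: polyb_const.
move=> B s e hB /= hlt.
have em : s m = [::] by rewrite e.
have em1 : s m.+1 = [::] by rewrite e.
have em2 : s m.+2 = [::] by rewrite e //; lia.
have m0 : m.+1 != 0 by []. have m1 : m.+1 != m by apply/eqP; lia.
have m2 : 0 != m by apply/eqP; lia.
have h0 := hB 0.
set s1 := upd (upd (upd s 0 [::]) m.+1 (catrev (s 0) [::])) m (bin (size (s 0))).
apply: (@run_seq _ _ _ s1 _ _ _ _ _ _ _ (leqnn _)).
  apply: run_eqs (@run_count B m (s 0) 0 s hm _ _ _ _ _) _ _; rewrite ?em1 ?em2 ?add0n //.
  - by rewrite addn0.
  - by lia.
have e1 : s1 m.+1 = rev (s 0) by rewrite /s1 !(upd_same, upd_other).
have e2 : s1 0 = [::] by rewrite /s1 !(upd_same, upd_other).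
apply: run_eqs (@run_mv B m.+1 0 s1 _ _) _ _; rewrite ?e1 ?e2 ?size_rev ?addn0 //.
by rewrite -[catrev _ _]/(rev (rev (s 0))) revK /s1; stk.
Qed.

Lemma run_decn B (r tmp : nat) (s : stacks) n : r != tmp -> s tmp = [::] -> size (s r) <= B ->
  s r = bin n.+1 -> runp B (decp r tmp) s (upd s r (bin n)) (8 * n.+1 + 8).
Proof.
move=> h1 h2 h3 h4; apply: run_eqs (@run_dec B r tmp s (bin n) _ _ _ _) _ _ => //.
by have := size_bin n.+1; rewrite h4; lia.
Qed.

Lemma isSome_bin n : isSome (ohead (bin n)) = (0 < n).
Proof. by case: n => // n; have := binK n.+1; case: (bin n.+1). Qed.

(** The bits passed over are kept in reverse on [m.+1], so that a single [mvp] restores the input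
    afterwards. When the input is exhausted the countdown just goes on. *)
Definition seekp m := While m isSome (Seq (decp m m.+2)
  (If 0 isSome (Seq (If 0 hd1 (Push m.+1 true) (Push m.+1 false)) (Pop 0)) Skip)).

Lemma run_seek B m n (s : stacks) : 0 < m -> s m = bin n ->
  s m.+2 = [::] -> size (s 0) + size (s m.+1) <= B -> n < 2 ^ B ->
  runp B (seekp m)
    s (upd (upd (upd s 0 (drop n (s 0))) m.+1 (catrev (take n (s 0)) (s m.+1))) m [::])
    (n * (8 * n + 20) + 1).
Proof.
move=> hm; elim: n s => [|n IH] s em em2 hs hn.
  by apply: run_while0; rewrite ?em // -[[::]]/(bin 0) -em drop0 take0 /= !upd_id.
have m0 : m != 0 by apply/eqP; lia. have m0' : 0 != m by rewrite eq_sym.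
have m1 : m.+1 != m by apply/eqP; lia. have m2 : m.+2 != m by apply/eqP; lia.
have m3 : m.+2 != m.+1 by apply/eqP; lia. have m4 : m != m.+2 by rewrite eq_sym.
have m5 : m != m.+1 by rewrite eq_sym.
set s1 := upd s m (bin n).
set s2 := upd (upd s1 0 (drop 1 (s 0))) m.+1 (take 1 (s 0) ++ s m.+1).
have e10 : s1 0 = s 0 by rewrite /s1 upd_other.
have e11 : s1 m.+1 = s m.+1 by rewrite /s1 upd_other.
apply: (@run_while1 _ _ _ _ s2 (8 * n.+1 + 15) (n * (8 * n + 20) + 1)); last by lia.
- by rewrite em isSome_bin.
- apply: (@run_seq _ _ _ s1 (8 * n.+1 + 8) 7); last by lia.
    by apply: run_decn => //; rewrite em; apply: size_bin_le.
  apply: run_if; rewrite e10 {}/s2; case E: (s 0) => [|x l] /=.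
    by apply: run_skip => //; rewrite -E -e10 -e11 !upd_id.
  apply: (@run_seq _ _ _ (upd s1 m.+1 (x :: s m.+1)) 3 1) => //.
    rewrite E /= in hs.
    by apply: run_if; rewrite e10 E /=; case: x {E}; apply: run_push; rewrite ?e11 //; lia.
  apply: run_pop; rewrite ?upd_other ?e10 ?E // drop0 take0.
  by rewrite upd_comm.
- have e20 : s2 0 = drop 1 (s 0) by rewrite /s2 !(upd_same, upd_other).
  have e21 : s2 m.+1 = take 1 (s 0) ++ s m.+1 by rewrite /s2 !(upd_same, upd_other).
  apply: run_eqs (IH s2 _ _ _ _) _ _; rewrite ?e20 ?e21 //.
  + by rewrite /s2 /s1 !(upd_same, upd_other).
  + by rewrite /s2 /s1 !upd_other.
  + by case: (s 0) hs => [|x l] /=; rewrite ?drop0 ?take0 /=; lia.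
  + by lia.
  + rewrite drop_drop addn1 (_ : catrev _ _ = catrev (take n.+1 (s 0)) (s m.+1)).
      by rewrite /s2 /s1; stk.
    by case: (s 0) => //= x l; rewrite take0 drop0.
Qed.

(** The numerals with one digit, [[:: false]] and [[:: true]], are 1 and 2, and the empty one is 0:
    pushing the bit that was found, or nothing, already writes the value of [inp]. *)
Lemma comp_inp f : polyb f -> computes f -> computes (fun x s => inp x (f x s)).
Proof.
move=> pf hf rho m hr hm; have [c [T [hT h]]] := hf rho m hr hm.
exists (Seq c (Seq (seekp m) (Seq
  (If 0 hd1 (Push m true) (If 0 hd0 (Push m false) Skip)) (mvp m.+1 0)))),
  (fun x s => T x s + (f x s * (8 * f x s + 20) + 1 + (4 + (5 * size x + 1)))); split.
  have hx : polyb (fun x _ => size x).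
    by apply: polyb_le polyb_mu _ => x s; rewrite /mu; lia.
  apply: polyb_add => //; apply: polyb_add; apply: polyb_add; try exact: polyb_const.
    apply: polyb_mul => //; apply: polyb_add; last exact: polyb_const.
    by apply: polyb_mul => //; apply: polyb_const.
  apply: polyb_add; last exact: polyb_const.
  by apply: polyb_mul => //; apply: polyb_const.
move=> B s e hB /=; set v := f _ _ => hlt.
have em : s m = [::] by rewrite e.
have em1 : s m.+1 = [::] by rewrite e.
have em2 : s m.+2 = [::] by rewrite e //; lia.
have m0 : m.+1 != 0 by []. have m1 : m.+1 != m by apply/eqP; lia.
have m2 : 0 != m by apply/eqP; lia. have m0' : m != 0 by rewrite eq_sym.
have m3 : m.+2 != m by apply/eqP; lia. have m4 : m != m.+1 by rewrite eq_sym.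
have h0 := hB 0.
have B0 : 0 < B by case: (B) hlt => //; rewrite expn0; lia.
set s1 := upd s m (bin v).
apply: (@run_seq _ _ _ s1 _ _ _ _ _ _ _ (leqnn _)); first by apply: h => //; lia.
set s2 := upd (upd (upd s 0 (drop v (s 0))) m.+1 (rev (take v (s 0)))) m [::].
apply: (@run_seq _ _ _ s2 _ _ _ _ _ _ _ (leqnn _)).
  apply: run_eqs (@run_seek B m v s1 _ _ _ _ _) _ _; rewrite // /s1 ?(upd_same, upd_other) //.
  + by rewrite em1 addn0.
  + by lia.
  + by rewrite em1 -[catrev _ _]/(rev (take v (s 0))) /s2; stk.
set s3 := upd s2 m (bin (inp (s 0) v)).
have e20 : s2 0 = drop v (s 0) by rewrite /s2 !(upd_same, upd_other).
have e2m : s2 m = [::] by rewrite /s2 !(upd_same, upd_other).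
apply: (@run_seq _ _ _ s3 4 (5 * size (s 0) + 1)) => //.
  apply: run_if; rewrite e20 {}/s3 /inp; case E: (drop v (s 0)) => [|[] l] /=.
  - by apply: run_if; rewrite e20 E /=; apply: run_skip => //; rewrite -{1}e2m upd_id.
  - by apply: run_push; rewrite ?e2m.
  - by apply: run_if; rewrite e20 E /=; apply: run_push; rewrite ?e2m.
have e30 : s3 0 = drop v (s 0) by rewrite /s3 !(upd_same, upd_other).
have e31 : s3 m.+1 = rev (take v (s 0)) by rewrite /s3 /s2 !(upd_same, upd_other).
apply: run_eqs (@run_mv B m.+1 0 s3 _ _) _ _; rewrite ?e30 ?e31 ?size_rev //.
- by rewrite size_take size_drop; case: ltnP; lia.
- by rewrite catrevE revK cat_take_drop /s3 /s2; stk.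
- by rewrite size_take; case: ltnP; lia.
Qed.

Lemma polyb_bound T : polyb T -> exists k, forall x s M, mu x s <= M -> T x s <= M ^ k.
Proof.
by move=> [k h]; exists k => x s M hM; apply: leq_trans (h x s) (leq_exp2r' _ hM).
Qed.

Lemma comp_rec k g h n : polyb g -> polyb n -> computes g -> computes h -> computes n ->
  (forall x s i, i <= n x s -> recn (g x s) (fun j a => h x [:: j, a & s]) i <= mu x s ^ k) ->
  computes (fun x s => recn (g x s) (fun j a => h x [:: j, a & s]) (n x s)).
Proof.
move=> pg pn cg ch cn hR rho m hr hm.
have [c1 [T1 [hT1 h1]]] := cn rho m hr hm.
have hr2 r : r \in rho -> r < m.+2 by move/hr; lia.
have [c2 [T2 [hT2 h2]]] := cg rho m.+2 hr2 isT.
have hr3 r : r \in [:: m.+1, m.+2 & rho] -> r < m.+3.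
  by rewrite !inE => /or3P[/eqP->|/eqP->|/hr]; lia.
have [c3 [T3 [hT3 h3]]] := ch [:: m.+1, m.+2 & rho] m.+3 hr3 isT.
have [k3 hk3] := polyb_bound hT3.
(* Register [m] holds the number of iterations left, [m.+1] the index handed to [h], [m.+2] the
   accumulator, and [h] writes its result to [m.+3]. Below, [W] bounds one call of [h], and [S j i]
   is the state with [j] iterations left and [i] done. *)
pose body := Seq (decp m m.+3) (Seq c3 (Seq (clearp m.+2)
  (Seq (mv2p m.+3 m.+2 m.+4) (incp m.+1 m.+3)))).
pose W x s := (mu x s + n x s + mu x s ^ k) ^ k3.
pose V x s := 16 * n x s + 12 * mu x s ^ k + 40 + W x s.
exists (Seq c1 (Seq c2 (Seq (While m isSome body) (Seq (clearp m.+1) (mv2p m.+2 m m.+3))))),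
  (fun x s => T1 x s + (T2 x s + ((n x s * V x s + 1) +
     ((2 * n x s + 1) + (10 * mu x s ^ k + 2 + V x s))))); split.
  have pk : polyb (fun x s => mu x s ^ k) by apply: polyb_pow polyb_mu.
  have pc z T : polyb T -> polyb (fun x s => z * T x s).
    by move=> hT; apply: polyb_mul (polyb_const z) hT.
  have pV : polyb V.
    apply: polyb_add; last by apply: polyb_pow; do 2?apply: polyb_add => //; apply: polyb_mu.
    apply: polyb_add (polyb_const _); apply: polyb_add; exact: pc.
  do ?[apply: polyb_add => //]; try exact: pc; try exact: polyb_const.
  exact: polyb_mul.
move=> B s e hB /=; set x := s 0; set l := env s rho.
have {}hR := hR x l; have {}h1 := h1 B s e hB; rewrite -/x -/l in h1.
have {}h2 := h2 B; have {}h3 := h3 B.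
set N := n x l in hR h1 *; set a0 := g x l in hR *.
set R := recn a0 _ in hR *; set VV := V x l; set K := mu x l ^ k in hR *.
have hVV : VV = 16 * N + 12 * K + 40 + W x l by [].
move=> hlt.
have hRB i : i <= N -> R i < 2 ^ B by move/hR; lia.
have hNB : N < 2 ^ B by lia.
have z : (0 == m) = false by lia.
have e0 : s m = [::] by rewrite e.
have e1 : s m.+1 = [::] by rewrite e //; lia.
have e2 : s m.+2 = [::] by rewrite e //; lia.
have e3 : s m.+3 = [::] by rewrite e //; lia.
have e4 : s m.+4 = [::] by rewrite e //; lia.
have d1 : m != m.+1 by apply/eqP; lia. have d2 : m != m.+2 by apply/eqP; lia.
have d3 : m != m.+3 by apply/eqP; lia. have d4 : m != m.+4 by apply/eqP; lia.
have d12 : m.+1 != m.+2 by apply/eqP; lia. have d13 : m.+1 != m.+3 by apply/eqP; lia.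
have d14 : m.+1 != m.+4 by apply/eqP; lia. have d23 : m.+2 != m.+3 by apply/eqP; lia.
have d24 : m.+2 != m.+4 by apply/eqP; lia. have d34 : m.+3 != m.+4 by apply/eqP; lia.
have c10 : m.+1 != m by rewrite eq_sym. have c20 : m.+2 != m by rewrite eq_sym.
have c30 : m.+3 != m by rewrite eq_sym. have c40 : m.+4 != m by rewrite eq_sym.
have c21 : m.+2 != m.+1 by rewrite eq_sym. have c31 : m.+3 != m.+1 by rewrite eq_sym.
have c41 : m.+4 != m.+1 by rewrite eq_sym. have c32 : m.+3 != m.+2 by rewrite eq_sym.
have c42 : m.+4 != m.+2 by rewrite eq_sym. have c43 : m.+4 != m.+3 by rewrite eq_sym.
pose S j i := upd (upd (upd s m (bin j)) m.+1 (bin i)) m.+2 (bin (R i)).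
have S0 j i : S j i 0 = x by rewrite /S /upd z.
have Sm j i : S j i m = bin j by rewrite /S !(upd_same, upd_other).
have Sm1 j i : S j i m.+1 = bin i by rewrite /S !(upd_same, upd_other).
have Sm2 j i : S j i m.+2 = bin (R i) by rewrite /S !(upd_same, upd_other).
have Sm3 j i : S j i m.+3 = [::] by rewrite /S !upd_other.
have Sm4 j i : S j i m.+4 = [::] by rewrite /S !upd_other.
have Shi j i r : m.+3 <= r -> S j i r = [::].
  by move=> hmr; rewrite /S !upd_other ?e //; try (apply/eqP); lia.
have Senv j i : env (S j i) rho = l.
  by rewrite /S !env_upd // => r /hr; lia.
have SB j i : j <= N -> i <= N -> bounded B (S j i).
  by move=> hj hi; do 3?[apply: bounded_upd]; rewrite ?size_bin_le ?hRB //; lia.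
apply: (@run_seq _ _ _ (upd s m (bin N)) _ _ _ _ _ _ _ (leqnn _)); first by apply: h1; lia.
apply: (@run_seq _ _ _ (S N 0) _ _ _ _ _ _ _ (leqnn _)).
  have E : env (upd s m (bin N)) rho = l by rewrite env_upd.
  have E0 : upd s m (bin N) 0 = x by rewrite /upd z.
  apply: run_eqs (h2 (upd s m (bin N)) _ _ _) _ _; rewrite ?E ?E0 //; try lia.
  - by move=> r hmr; rewrite upd_other ?e //; try (apply/eqP); lia.
  - by apply: bounded_upd => //; apply: size_bin_le.
  - by rewrite /S -[bin 0]/[::]; stk.
apply: (@run_seq _ _ _ (S 0 N) _ _ _ _ _ _ _ (leqnn _)).
  suff loop j i : j + i = N -> runp B (While m isSome body) (S j i) (S 0 N) (j * VV + 1).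
    by apply: loop; rewrite addn0.
  elim: j i => [|j IH] i hji.
    by rewrite add0n in hji; rewrite hji; apply: run_while0; rewrite // Sm.
  apply: (@run_while1 _ _ _ _ (S j i.+1) VV.-1 (j * VV + 1)); last by rewrite mulSn; lia.
  - by rewrite Sm isSome_bin.
  - apply: (@run_seq _ _ _ (S j i) (8 * j.+1 + 8) (W x l + (2 * K + 1 + (10 * K + 2 + (8 * i + 8)))));
      last by lia.
      apply: run_eqs (@run_decn B m m.+3 (S j.+1 i) j _ _ _ _) _ _; rewrite ?Sm ?Sm3 //.
        by apply: size_bin_le; lia.
      by rewrite /S; stk.
    have Ei : env (S j i) [:: m.+1, m.+2 & rho] = [:: i, R i & l].
      by rewrite /= Sm1 Sm2 !binK Senv.
    have hW : T3 x [:: i, R i & l] <= W x l.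
      by apply: hk3; rewrite /mu /=; have := hR i; rewrite /K /mu; lia.
    have hRi : R i <= K by apply: hR; lia.
    have hRi1 : R i.+1 <= K by apply: hR; lia.
    have sbi := size_bin i; have sbR := size_bin (R i); have sbR1 := size_bin (R i.+1).
    apply: (@run_seq _ _ _ (upd (S j i) m.+3 (bin (R i.+1))) _ _ _ _ _ _ _ (leqnn _)).
      apply: run_eqs (h3 (S j i) _ _ _) _ _; rewrite ?S0 ?Ei //; try lia.
      + exact: Shi.
      + by apply: SB; lia.
    apply: (@run_seq _ _ _ (upd (upd (S j i) m.+3 (bin (R i.+1))) m.+2 [::]) _ _ _ _ _ _ _ (leqnn _)).
      by apply: run_eqs (run_clear _ _ _) _ _; rewrite // upd_other // Sm2; lia.
    set s2 := upd (upd (S j i) m.+3 _) m.+2 _.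
    have e23 : s2 m.+3 = bin (R i.+1) by rewrite /s2 !(upd_same, upd_other).
    apply: (@run_seq _ _ _ (upd (S j i) m.+2 (bin (R i.+1))) _ _ _ _ _ _ _ (leqnn _)).
      apply: run_eqs (@run_mv2 B m.+3 m.+2 m.+4 s2 _ _ _ _ _ _) _ _; rewrite ?e23 //; try lia.
      + by rewrite /s2 !upd_other.
      + by rewrite /s2 upd_same.
      + by apply: size_bin_le; lia.
      + by have q := Sm3 j i; rewrite /s2; stk.
    set s3 := upd (S j i) m.+2 _.
    have e31 : s3 m.+1 = bin i by rewrite /s3 upd_other.
    apply: run_eqs (@run_inc B m.+1 m.+3 s3 _ _ _) _ _; rewrite ?e31 //; try lia.
    + by rewrite /s3 upd_other.
    + rewrite -(@ltn_exp2l 2) //; apply: leq_ltn_trans (code_size _) _; rewrite binK; lia.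
    + by rewrite /s3 /S -[incb _]/(bin i.+1); stk.
  - by apply: IH; lia.
have sbN := size_bin N; have sbRN := size_bin (R N); have hRN := hR N (leqnn _).
apply: (@run_seq _ _ _ (upd (S 0 N) m.+1 [::]) _ _ _ _ _ _ _ (leqnn _)).
  by apply: run_eqs (run_clear _ _ _) _ _; rewrite // Sm1; lia.
set s4 := upd (S 0 N) _ _.
have e42 : s4 m.+2 = bin (R N) by rewrite /s4 upd_other.
apply: run_eqs (@run_mv2 B m.+2 m m.+3 s4 _ _ _ _ _ _) _ _; rewrite ?e42 //; try lia.
- by rewrite /s4 upd_other.
- by rewrite /s4 upd_other.
- by apply: size_bin_le; lia.
- by rewrite /s4 /S; stk.
Qed.

Theorem E2_computes f : E2 f -> computes f.
Proof.
elim=> {f} [i||f h|||f g|f l|k g h n].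
- exact: comp_var.
- exact: comp_zero.
- by move=> hc; apply: comp_succ => //; apply: E2_polyb.
- exact: comp_len.
- by move=> f h hc; apply: comp_inp => //; apply: E2_polyb.
- by move=> hf cf hg cg; apply: comp_let => //; apply: E2_polyb.
- by move=> hf cf; apply: comp_ren => //; apply: E2_polyb.
- move=> hg cg hh ch hn cn hR; apply: comp_rec hR => //; exact: E2_polyb.
Qed.

(** * Closure properties of bounded recursion *)

Lemma E2_ext f g : E2 f -> (forall x s, g x s = f x s) -> E2 g.
Proof.
move=> hf e; have -> // : g = f.
by do 2!apply: functional_extensionality => ?; apply: e.
Qed.

(** [E2_ren] can only list finitely many entries. Weakening by [behead] is a renaming because a
    function of the class looks at a bounded part of its environment. *)
Lemma E2_supp f : E2 f -> exists n, forall x s t,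
  (forall i, i < n -> nth 0 s i = nth 0 t i) -> f x s = f x t.
Proof.
elim=> {f} [i||f _ [n h]||f _ [n h]|f g _ [n h] _ [m h']|f l _ [n h]|k g h n _ [a ha] _ [b hb] _ [c hc] _].
- by exists i.+1 => x s t e; apply: e.
- by exists 0.
- by exists n => x s t e; rewrite (h x s t).
- by exists 0.
- by exists n => x s t e; rewrite (h x s t).
- exists (n + m) => x s t e; rewrite (h' x s t); last by move=> i hi; apply: e; lia.
  by apply: h => -[|i] //= hi; apply: e; lia.
- exists (sumn l).+1 => x s t e; apply: h => i _.
  have [hi|hi] := ltnP i (size l); last by rewrite !nth_default ?size_map.
  rewrite !(nth_map 0) //; apply: e; rewrite ltnS; exact: sumn_nth.
- exists (a + b + c) => x s t e; rewrite (hc x s t); last by move=> i hi; apply: e; lia.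
  elim: (n x t) => [|j IH] /=; first by apply: ha => i hi; apply: e; lia.
  by rewrite IH; apply: hb => -[|[|i]] //= hi; apply: e; lia.
Qed.

Lemma E2_behead f : E2 f -> E2 (fun x s => f x (behead s)).
Proof.
move=> hf; have [n h] := E2_supp hf; apply: (E2_ext (E2_ren (iota 1 n) hf)) => x s.
apply: h => i hi; rewrite (nth_map 0) ?size_iota // nth_iota // nth_behead; congr nth; lia.
Qed.

Lemma E2_const c : E2 (fun _ _ => c).
Proof. by elim: c => [|c IH]; [apply: E2_zero|apply: E2_succ]. Qed.

Lemma E2_lift1 (op : seq bool -> nat -> nat) : E2 (fun x s => op x (nth 0 s 0)) ->
  forall f, E2 f -> E2 (fun x s => op x (f x s)).
Proof. by move=> h f hf; apply: (E2_ext (E2_let h hf)). Qed.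

Lemma E2_lift2 (op : seq bool -> nat -> nat -> nat) :
  E2 (fun x s => op x (nth 0 s 0) (nth 0 s 1)) ->
  forall f g, E2 f -> E2 g -> E2 (fun x s => op x (f x s) (g x s)).
Proof.
by move=> h f g hf hg; apply: (E2_ext (E2_let (E2_let h (E2_behead hf)) hg)).
Qed.

Lemma E2_recb b g n (h : seq bool -> nat -> nat -> seq nat -> nat) : E2 b -> E2 g -> E2 n ->
  E2 (fun x s => h x (nth 0 s 0) (nth 0 s 1) (behead (behead s))) ->
  (forall x s i, i <= n x s -> recn (g x s) (fun j a => h x j a s) i <= b x s) ->
  E2 (fun x s => recn (g x s) (fun j a => h x j a s) (n x s)).
Proof.
move=> hb hg hn hh hR; have [k hk] := E2_polyb hb.
apply: (E2_rec (h := fun x s => h x (nth 0 s 0) (nth 0 s 1) (behead (behead s))) (k := k) hg hh hn).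
by move=> x s i hi; apply: leq_trans (hR x s i hi) (hk x s).
Qed.

Lemma E2_add f g : E2 f -> E2 g -> E2 (fun x s => f x s + g x s).
Proof.
apply: (@E2_lift2 (fun _ a b => a + b)).
have R a n : recn a (fun _ c => c.+1) n = a + n by elim: n => [|n /= ->] /=; lia.
apply: E2_ext (_ : E2 (fun x s => recn (nth 0 s 0) (fun _ c => c.+1) (nth 0 s 1))) _; last first.
  by move=> x s; rewrite R.
apply: (@E2_rec 1 _ (fun x s => (nth 0 s 1).+1)); do ?[exact: E2_var|apply: E2_succ].
move=> x s i hi; rewrite R expn1 /mu; case: s hi => [|a [|b s]] /= hi; lia.
Qed.

Lemma E2_pred f : E2 f -> E2 (fun x s => (f x s).-1).
Proof.
apply: (@E2_lift1 (fun _ a => a.-1)).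
have R n : recn 0 (fun i _ => i) n = n.-1 by case: n.
apply: E2_ext (_ : E2 (fun x s => recn 0 (fun i _ => i) (nth 0 s 0))) _; last first.
  by move=> x s; rewrite R.
apply: (@E2_recb (fun x s => nth 0 s 0) _ _ (fun x i _ s => i)); do ?[exact: E2_var|exact: E2_zero].
by move=> x s i hi; rewrite R; lia.
Qed.

Lemma E2_sub f g : E2 f -> E2 g -> E2 (fun x s => f x s - g x s).
Proof.
apply: (@E2_lift2 (fun _ a b => a - b)).
have R a n : recn a (fun _ c => c.-1) n = a - n by elim: n => [|n /= ->] /=; lia.
apply: E2_ext (_ : E2 (fun x s => recn (nth 0 s 0) (fun _ c => c.-1) (nth 0 s 1))) _; last first.
  by move=> x s; rewrite R.
apply: (@E2_recb (fun x s => nth 0 s 0) _ _ (fun x _ c s => c.-1)); do ?[exact: E2_var|apply: E2_pred].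
by move=> x s i hi; rewrite R; lia.
Qed.

Lemma E2_mul f g : E2 f -> E2 g -> E2 (fun x s => f x s * g x s).
Proof.
apply: (@E2_lift2 (fun _ a b => a * b)).
have R a n : recn 0 (fun _ c => c + a) n = a * n by elim: n => [|n /= ->] /=; lia.
apply: E2_ext (_ : E2 (fun x s => recn 0 (fun _ c => c + nth 0 s 0) (nth 0 s 1))) _; last first.
  by move=> x s; rewrite R.
apply: (@E2_rec 2 _ (fun x s => nth 0 s 1 + nth 0 s 2)); do ?[exact: E2_var|exact: E2_zero|apply: E2_add].
move=> x s i hi; rewrite /= R; case: s hi => [|a [|b s]] /= hi; rewrite ?mul0n //.
  by move: hi; rewrite leqn0 => /eqP ->; rewrite muln0.
by rewrite /mu /= expnS expn1; apply: leq_mul; lia.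
Qed.

Definition E2b (P : seq bool -> seq nat -> bool) := E2 (fun x s => nat_of_bool (P x s)).

Lemma E2b_eq0 f : E2 f -> E2b (fun x s => f x s == 0).
Proof.
apply: (@E2_lift1 (fun _ a => a == 0)).
apply: E2_ext (_ : E2 (fun x s => 1 - nth 0 s 0)) _.
  by apply: E2_sub; [apply: E2_const|apply: E2_var].
by move=> x s; case: (nth _ _ _) => //= n; lia.
Qed.

Lemma E2b_ext P Q : E2b P -> (forall x s, Q x s = P x s) -> E2b Q.
Proof. by move=> h e; apply: (E2_ext h) => x s; rewrite e. Qed.

Lemma E2b_not P : E2b P -> E2b (fun x s => ~~ P x s).
Proof. by move=> h; apply: (E2b_ext (E2b_eq0 h)) => x s; case: (P x s). Qed.

Lemma E2b_and P Q : E2b P -> E2b Q -> E2b (fun x s => P x s && Q x s).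
Proof. by move=> h k; apply: (E2_ext (E2_mul h k)) => x s; rewrite mulnb. Qed.

Lemma E2b_or P Q : E2b P -> E2b Q -> E2b (fun x s => P x s || Q x s).
Proof.
move=> h k; apply: (E2b_ext (E2b_not (E2b_and (E2b_not h) (E2b_not k)))) => x s.
by rewrite negb_and !negbK.
Qed.

Lemma E2b_imp P Q : E2b P -> E2b Q -> E2b (fun x s => P x s ==> Q x s).
Proof. by move=> h k; apply: (E2b_ext (E2b_or (E2b_not h) k)) => x s; rewrite implybE. Qed.

Lemma E2b_leq f g : E2 f -> E2 g -> E2b (fun x s => f x s <= g x s).
Proof. by move=> h k; apply: (E2b_eq0 (E2_sub h k)). Qed.

Lemma E2b_eqn f g : E2 f -> E2 g -> E2b (fun x s => f x s == g x s).
Proof.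
by move=> h k; apply: (E2b_ext (E2b_and (E2b_leq h k) (E2b_leq k h))) => x s; rewrite eqn_leq.
Qed.

Lemma E2b_const b : E2b (fun _ _ => b).
Proof. exact: E2_const. Qed.

Lemma E2b_eqb P Q : E2b P -> E2b Q -> E2b (fun x s => P x s == Q x s).
Proof. by move=> h k; apply: (E2b_ext (E2b_eqn h k)) => x s; case: (P x s) (Q x s) => [] []. Qed.

Lemma E2_if P f g : E2b P -> E2 f -> E2 g -> E2 (fun x s => if P x s then f x s else g x s).
Proof.
move=> hP hf hg; apply: (E2_ext (E2_add (E2_mul hP hf) (E2_mul (E2b_not hP) hg))) => x s.
by case: (P x s); rewrite /= ?mul1n ?mul0n ?addn0.
Qed.

Lemma E2b_if P f g : E2b P -> E2b f -> E2b g -> E2b (fun x s => if P x s then f x s else g x s).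
Proof.
by move=> hP hf hg; apply: (E2_ext (E2_if hP hf hg)) => x s; case: ifP.
Qed.

Lemma E2_var1 i : E2 (fun x s => nth 0 (behead s) i).
Proof. exact: (E2_behead (E2_var i)). Qed.

Lemma E2_var2 i : E2 (fun x s => nth 0 (behead (behead s)) i).
Proof. exact: (E2_behead (E2_var1 i)). Qed.

Lemma E2_var3 i : E2 (fun x s => nth 0 (behead (behead (behead s))) i).
Proof. exact: (E2_behead (E2_var2 i)). Qed.

Lemma E2_sum n (F : seq bool -> nat -> seq nat -> nat) : E2 n ->
  E2 (fun x s => F x (nth 0 s 0) (behead s)) -> E2 (fun x s => \sum_(0 <= i < n x s) F x i s).
Proof.
move=> hn hF.
have R a (G : nat -> nat) : recn 0 (fun i c => c + G i) a = \sum_(0 <= i < a) G i.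
  by elim: a => [|a /= ->]; rewrite ?big_nil // big_nat_recr.
apply: E2_ext (_ : E2 (fun x s => recn 0 (fun i c => c + F x i s) (n x s))) _; last first.
  by move=> x s; rewrite R.
have [kF hkF] := E2_polyb hF; have [kn hkn] := E2_polyb hn.
pose b := fun x s => mu x s ^ kn * (mu x s ^ kn + mu x s) ^ kF.
have [k hk] : polyb b.
  have pm k : polyb (fun x s => mu x s ^ k) by apply: polyb_pow polyb_mu.
  by apply: polyb_mul => //; apply: polyb_pow; apply: polyb_add => //; apply: polyb_mu.
apply: (@E2_rec k _ (fun x s => nth 0 s 1 + F x (nth 0 s 0) (behead (behead s)))) => //.
- exact: E2_zero.
- apply: E2_add; first exact: E2_var.
  have [m hm] := E2_supp hF.
  (* The renaming leaves out entry 1, the accumulator, which the summand must not see. *)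
  apply: (E2_ext (E2_ren (0 :: iota 2 m) hF)) => x s.
  refine (hm x [:: nth 0 s 0 & behead (behead s)] _ _) => -[|i] //= hi.
  rewrite (nth_map 0) ?size_iota; last by lia.
  by rewrite nth_iota ?nth_behead; last lia; congr nth; lia.
- move=> x s i hi; rewrite -[X in X <= _]/(recn 0 (fun j a => a + F x j s) i) R.
  apply: leq_trans (hk x s).
  apply: (@leq_trans (\sum_(0 <= j < i) (mu x s ^ kn + mu x s) ^ kF)).
    rewrite big_nat [X in _ <= X]big_nat; apply: leq_sum => j hj.
    apply: leq_trans (hkF x (j :: s)) _; apply: leq_exp2r'.
    by have := hkn x s; rewrite /mu /=; lia.
  rewrite sum_nat_const_nat subn0 /b leq_mul2r; apply/orP; right.
  exact: leq_trans hi (hkn x s).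
Qed.

Lemma E2b_has n (F : seq bool -> nat -> seq nat -> bool) : E2 n ->
  E2b (fun x s => F x (nth 0 s 0) (behead s)) ->
  E2b (fun x s => has (fun i => F x i s) (iota 0 (n x s))).
Proof.
move=> hn hF; apply: (E2b_ext (E2b_not (E2b_eq0 (E2_sum (F := fun x i s => F x i s) hn hF)))) => x s.
rewrite has_count -lt0n; congr (0 < _).
by rewrite -sum1_count big_mkcond /index_iota subn0; apply: eq_bigr => i _; case: (F x i s).
Qed.

Lemma E2b_all n (F : seq bool -> nat -> seq nat -> bool) : E2 n ->
  E2b (fun x s => F x (nth 0 s 0) (behead s)) ->
  E2b (fun x s => all (fun i => F x i s) (iota 0 (n x s))).
Proof.
move=> hn hF; apply: (E2b_ext (E2b_not (E2b_has (F := fun x i s => ~~ F x i s) hn (E2b_not hF)))) => x s.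
by rewrite -all_predC; apply: eq_all => i /=; rewrite negbK.
Qed.

(** For a nonzero divisor the quotient is the number of positive multiples of it up to the
    dividend. *)
Lemma E2_div f g : E2 f -> E2 g -> E2 (fun x s => f x s %/ g x s).
Proof.
apply: (@E2_lift2 (fun _ a b => a %/ b)).
apply: E2_ext (_ : E2 (fun x s => if nth 0 s 1 == 0 then 0 else
    \sum_(0 <= i < nth 0 s 0) (i.+1 * nth 0 s 1 <= nth 0 s 0))) _.
  apply: E2_if; [exact/E2b_eq0/E2_var|exact: E2_zero|].
  apply: (@E2_sum _ (fun x i s => i.+1 * nth 0 s 1 <= nth 0 s 0)); first exact: E2_var.
  by apply: E2b_leq; [apply: E2_mul; [apply/E2_succ/E2_var|apply: E2_var1]|apply: E2_var1].
move=> x s; case: eqP => [->|/eqP h]; first by rewrite divn0.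
move: (nth 0 s 0) (nth 0 s 1) h => a b b0.
have -> : \sum_(0 <= i < a) (i.+1 * b <= a) = \sum_(0 <= i < a) (i < a %/ b).
  by apply: eq_bigr => i _; rewrite leq_divRL // lt0n.
have le : a %/ b <= a by apply: leq_div.
rewrite (@big_cat_nat _ _ _ (a %/ b)) //= big_nat (eq_bigr (fun=> 1)); last by move=> i /andP[_ ->].
rewrite -big_nat sum_nat_const_nat subn0 muln1 big_nat big1 ?addn0 //.
by move=> i /andP[h _]; rewrite ltnNge h.
Qed.

Lemma E2_mod f g : E2 f -> E2 g -> E2 (fun x s => f x s %% g x s).
Proof.
move=> hf hg; apply: (E2_ext (E2_sub hf (E2_mul (E2_div hf hg) hg))) => x s.
by rewrite {2}(divn_eq (f x s) (g x s)) addKn.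
Qed.

Lemma E2b_odd f : E2 f -> E2b (fun x s => odd (f x s)).
Proof. by move=> hf; apply: (E2_ext (E2_mod hf (E2_const 2))) => x s; rewrite modn2. Qed.

(** The value at 0 is split off by a conditional and the rest is shifted by one, until the constant
    tail is reached. *)
Lemma E2_table c (h : nat -> nat) f : (forall k, c <= k -> h k = h c) -> E2 f ->
  E2 (fun x s => h (f x s)).
Proof.
elim: c h f => [|c IH] h f hh hf.
  by apply: (E2_ext (E2_const (h 0))) => x s; rewrite hh.
have IH' : E2 (fun x s => (h \o succn) (f x s).-1).
  by apply: IH; [move=> k hk /=; rewrite hh|apply: E2_pred].
apply: (E2_ext (E2_if (E2b_eq0 hf) (E2_const (h 0)) IH')) => x s /=.
by case: (f x s).
Qed.

(** Values in a finite type are represented by their ranks; every function between finite types is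
    then a table. *)
Definition E2F (T : finType) (f : seq bool -> seq nat -> T) := E2 (fun x s => enum_rank (f x s)).

Lemma E2F_nat (T : finType) (h : T -> nat) f : E2F f -> E2 (fun x s => h (f x s)).
Proof.
move=> hf.
pose h' k := if k < #|T| then (if enum T is t0 :: _ then h (nth t0 (enum T) k) else 0) else 0.
have H : E2 (fun x s => h' (enum_rank (f x s))).
  by apply: (@E2_table #|T|) => // k hk; rewrite /h' ltnn ltnNge hk.
apply: (E2_ext H) => x s; rewrite /h' ltn_ord.
case E: (enum T) => [|t0 l]; first by have := mem_enum T (f x s); rewrite E inE.
by rewrite -E -[LHS](congr1 h (enum_rankK (f x s))); congr h; rewrite (enum_val_nth t0).
Qed.

Lemma E2F_map (T U : finType) (g : T -> U) f : E2F f -> E2F (fun x s => g (f x s)).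
Proof. exact: (@E2F_nat T (fun t => enum_rank (g t))). Qed.

Lemma E2F_b f : E2b f -> E2F f.
Proof.
move=> h; pose r k : nat := enum_rank (k != 0).
apply: (E2_ext (_ : E2 (fun x s => r (f x s : nat)))); last by move=> x s; rewrite /r; case: (f x s).
by apply: (@E2_table 1) => // -[].
Qed.

Lemma E2b_F (T : finType) (h : T -> bool) f : E2F f -> E2b (fun x s => h (f x s)).
Proof. exact: (@E2F_nat T (fun t => h t : nat)). Qed.

Lemma E2F_ofnat (T : finType) (c : nat) (h : nat -> T) f : (forall k, c <= k -> h k = h c) ->
  E2 f -> E2F (fun x s => h (f x s)).
Proof. by move=> hc hf; apply: (@E2_table c (fun k => enum_rank (h k))) => // k hk; rewrite hc. Qed.

Lemma E2F_const (T : finType) (t : T) : E2F (fun _ _ => t).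
Proof. exact: E2_const. Qed.

Lemma E2F_pair (T U : finType) f g : E2F f -> E2F g -> @E2F (T * U)%type (fun x s => (f x s, g x s)).
Proof.
move=> hf hg; pose t0 := f [::] [::]; pose u0 := g [::] [::].
pose h k := if k < #|T| * #|U| then (nth t0 (enum T) (k %/ #|U|), nth u0 (enum U) (k %% #|U|))
            else (t0, u0).
have H : E2F (fun x s => h (enum_rank (f x s) * #|U| + enum_rank (g x s))).
  apply: (@E2F_ofnat _ (#|T| * #|U|)); last by do 2?[apply: E2_add => //; apply: E2_mul => //; apply: E2_const].
  by move=> k hk; rewrite /h ltnn ltnNge hk.
apply: (E2_ext H) => x s; congr (nat_of_ord (enum_rank _)); rewrite /h.
have h1 := ltn_ord (enum_rank (f x s)); have h2 := ltn_ord (enum_rank (g x s)).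
rewrite divnMDl ?(leq_ltn_trans (leq0n _) h2) // divn_small // addn0 modnMDl modn_small //.
rewrite -!enum_val_nth !enum_rankK.
case: ifP => // /negP[]; apply: (@leq_trans ((enum_rank (f x s)).+1 * #|U|)).
  by rewrite mulSn addnC ltn_add2r.
by rewrite leq_mul2r h1 orbT.
Qed.

Lemma E2F_if (T : finType) P f g : E2b P -> E2F f -> @E2F T g ->
  E2F (fun x s => if P x s then f x s else g x s).
Proof. by move=> h hf hg; apply: (E2_ext (E2_if h hf hg)) => x s; case: (P x s). Qed.

Lemma E2F_map2 (T U V : finType) (h : T -> U -> V) f g : E2F f -> E2F g ->
  E2F (fun x s => h (f x s) (g x s)).
Proof. by move=> hf hg; apply: (E2F_map (fun p => h p.1 p.2) (E2F_pair hf hg)). Qed.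

(** * The grid drawing *)

(** A cell [c = i * b.+1 + k] sits at the grid point [(i + k, - i)]; its left
    and lower neighbours are [c - 1] and [c + b]. *)
Inductive side := Own | Left | Low.

(** Edge types anchored at a cell: the two ends, as a neighbouring cell and a
    part of it.  Here [k0] and [k1] say whether the cell has [k = 0] or
    [k = 1]; 7 is the port through which a row or column wire leaves a cell,
    except that columns leave a gadget cell at 9. *)
Definition edge_ends (k1 : bool) (e : nat) : (side * nat) * (side * nat) :=
  let pt := if k1 then 7 else 9 in
  nth ((Own, 0), (Own, 0))
  [:: ((Own, 0), (Own, 1)); ((Own, 0), (Own, 2)); ((Own, 1), (Own, 2));
      ((Own, 3), (Own, 4)); ((Own, 3), (Own, 5)); ((Own, 4), (Own, 5));
      ((Own, 2), (Own, 5)); ((Own, 6), (Own, 7)); ((Own, 8), (Own, 9));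
      ((Own, 3), (Own, 6)); ((Own, 4), (Own, 6)); ((Own, 1), (Own, 8));
      ((Own, 4), (Own, 8)); ((Left, 7), (Own, 0)); ((Left, 7), (Own, 1));
      ((Low, pt), (Own, 0)); ((Low, pt), (Own, 3)); ((Left, 7), (Low, pt));
      ((Own, 6), (Own, 7)); ((Own, 7), (Own, 8)); ((Own, 6), (Own, 8));
      ((Left, 8), (Low, 6))] e.

(** Types 18 to 20 form the triangle of a diagonal cell, the others belong to crossings. Type 21
    links the diagonal cells of two consecutive rows; it is anchored at the cell [k = 1], whose left
    and lower neighbours these are. *)
Definition edge_dom (k : nat) (e : nat) : bool :=
  if k == 0 then 18 <= e < 21 else (e < 18) || ((k == 1) && (e == 21)).

Section PlaneCheck.
Local Open Scope Z_scope.

Definition scale : Z := 100.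

(** A cell owns 32 points. Those that no edge type of the cell uses are parked at distinct places
    close to its upper border, out of the way of all edges. *)
Definition part_off (k : nat) (p : nat) : Z * Z :=
  let junk := (72 + Z.of_nat (p %% 16), 97 + Z.of_nat (p %/ 16)) in
  if k == 0%N then nth junk
    [:: (72, 97); (73, 97); (74, 97); (75, 97); (76, 97); (77, 97);
        (20, 50); (60, 60); (50, 20)] p
  else nth junk
    [:: (30, 30); (30, 70); (40, 50); (70, 30); (70, 70); (60, 50);
        (85, 50); (94, 50); (50, 85); (50, 94)] p.

Definition end_off (k : nat) (sp : side * nat) : Z * Z :=
  match sp.1 with
  | Own => part_off k sp.2
  | Left => let: (x, y) := part_off k.-1 sp.2 in (x - scale, y)
  | Low => let: (x, y) := part_off k.-1 sp.2 in (x, y - scale)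
  end.

(** The extra vertex of an edge is its midpoint pushed slightly to the side. *)
Definition vert_off (k : nat) (p : nat) : Z * Z :=
  if (p < 10)%N || ~~ edge_dom k (p - 10) then part_off k p
  else let: (sa, sb) := edge_ends (k == 1%N) (p - 10) in
    let: (ax, ay) := end_off k sa in let: (bx, by') := end_off k sb in
    ((ax + bx) / 2 - Z.sgn (by' - ay), (ay + by') / 2 + Z.sgn (bx - ax)).

(** The corners of the thin triangle spanned by an edge and its extra vertex. *)
Definition corner (k e : nat) (j : nat) : Z * Z :=
  match j with
  | 0%nat => end_off k (edge_ends (k == 1%N) e).1
  | 1%nat => end_off k (edge_ends (k == 1%N) e).2
  | _ => vert_off k (10 + e)
  end.

Arguments part_off : simpl never.
Arguments end_off : simpl never.
Arguments vert_off : simpl never.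
Arguments corner : simpl never.

Definition dot (n p : Z * Z) := n.1 * p.1 + n.2 * p.2.
Definition addp (p q : Z * Z) := (p.1 + q.1, p.2 + q.2).
Definition perp (p q : Z * Z) := (q.2 - p.2, p.1 - q.1).

(** Both segments may touch the line. The last clause says that one of them is not contained in it,
    and the interior points of that one are then off the line. So common end points are permitted
    and crossings are not. A segment whose ends coincide stands for a point. *)
Definition sep (s t : (Z * Z) * (Z * Z)) := exists n c,
  [/\ dot n s.1 <= c, dot n s.2 <= c, c <= dot n t.1, c <= dot n t.2 &
      dot n s.1 + dot n s.2 < 2 * c \/ 2 * c < dot n t.1 + dot n t.2].

Lemma sep_sym s t : sep s t -> sep t s.
Proof.
move=> [n [c [h1 h2 h3 h4 h5]]]; exists (- n.1, - n.2), (- c).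
have E p : dot (- n.1, - n.2) p = - dot n p by rewrite /dot /=; ring.
by rewrite !E; split; lia.
Qed.

Definition shifted (q : Z * Z) (s : (Z * Z) * (Z * Z)) := (addp q s.1, addp q s.2).

Lemma dot_addp n p q : dot n (addp p q) = dot n p + dot n q.
Proof. rewrite /dot /=; ring. Qed.

Lemma sep_shift q s t : sep s t -> sep (shifted q s) (shifted q t).
Proof.
move=> [n [c [h1 h2 h3 h4 h5]]]; exists n, (dot n q + c); rewrite /= !dot_addp.
by split; lia.
Qed.

(** The point list [P] lies weakly on one side of a line and [Q] on the other,
    and either at most one point of [P] or no point of [Q] is on the line. *)
Definition sepl_by (P Q : seq (Z * Z)) (n : Z * Z) :=
  let vP := [seq dot n p | p <- P] in let vQ := [seq dot n q | q <- Q] in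
  let m := foldr Z.max (head 0 vP) vP in
  all (Z.leb m) vQ && ((count (Z.eqb m) vP <= 1)%N || (count (Z.eqb m) vQ == 0%N)).

(** Candidate directions are the perpendiculars, with both signs, of the lines through two points of
    a list, as one would try the sides of a convex polygon. *)
Fixpoint normals (P : seq (Z * Z)) :=
  if P is p :: P' then flatten [seq [:: perp p q; perp q p] | q <- P'] ++ normals P' else [::].

Definition sepl P Q := has (sepl_by P Q)
  ([:: (1, 0); (-1, 0); (0, 1); (0, -1)] ++ normals P ++ normals Q).

Lemma sepl_by3 n p0 p1 p2 Q a b c d : sepl_by [:: p0; p1; p2] Q n ->
  [\/ (a, b) = (p0, p1), (a, b) = (p0, p2) | (a, b) = (p2, p1)] -> c \in Q -> d \in Q ->
  sep (a, b) (c, d).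
Proof.
rewrite /sepl_by; set m := foldr _ _ _ => /andP[/allP hQ h] hab hc hd.
have h0 : dot n p0 <= m by rewrite /m /=; lia.
have h1 : dot n p1 <= m by rewrite /m /=; lia.
have h2 : dot n p2 <= m by rewrite /m /=; lia.
have /Z.leb_le hc' := hQ _ (map_f (dot n) hc); have /Z.leb_le hd' := hQ _ (map_f (dot n) hd).
exists n, m; clearbody m; clear hQ; case/orP: h => h.
  have hh : ((Z.eqb m (dot n p0) : nat) + ((Z.eqb m (dot n p1) : nat) + Z.eqb m (dot n p2)) <= 1)%N.
    by move: h; rewrite /= addn0.
  have [h01 h12] : (m = dot n p0 -> m <> dot n p1 /\ m <> dot n p2) /\ (m = dot n p1 -> m <> dot n p2).
    by move: hh; case: Z.eqb_spec => e0; case: Z.eqb_spec => e1; case: Z.eqb_spec => e2 //= _; lia.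
  by case: hab => -[-> ->]; split; cbn [fst snd] => //; left; lia.
have nm q : q \in Q -> dot n q <> m.
  move=> hq e; move: h; rewrite -leqn0 leqNgt -has_count => /hasP[].
  by exists (dot n q); [apply: map_f|apply/Z.eqb_eq].
have := nm _ hc; have := nm _ hd.
by case: hab => -[-> ->]; split; cbn [fst snd] => //; right; lia.
Qed.

Lemma sepl3 p0 p1 p2 Q a b c d : sepl [:: p0; p1; p2] Q ->
  [\/ (a, b) = (p0, p1), (a, b) = (p0, p2) | (a, b) = (p2, p1)] -> c \in Q -> d \in Q ->
  sep (a, b) (c, d).
Proof. by move=> h; have [n _ hn] := hasP h; apply: sepl_by3 hn. Qed.

Lemma sepl1 p0 p1 q0 q1 : sepl [:: p0; p1] [:: q0; q1] -> sep (p0, p1) (q0, q1).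
Proof.
move=> h; have [n _] := hasP h; rewrite /sepl_by; set m := foldr _ _ _.
move=> /andP[/and3P[/Z.leb_le h1 /Z.leb_le h2 _] h3].
have h4 : dot n p0 <= m by rewrite /m /=; lia.
have h5 : dot n p1 <= m by rewrite /m /=; lia.
by exists n, m; split=> //; move: h3; rewrite /=; lia.
Qed.

Arguments sepl : simpl never.

Definition tri (k e : nat) := [:: corner k e 0; corner k e 1; corner k e 2].
Definition tris (k : nat) := [seq e <- iota 0 22 | edge_dom k e].
Definition shifts q (P : seq (Z * Z)) := [seq addp q p | p <- P].

(** The triangle must not be degenerate: its sides meet in corners only. The segments with equal
    ends stand for the corners themselves. *)
Definition tri_ok (a b w : Z * Z) :=
  [&& sepl [:: a; b] [:: a; w], sepl [:: a; b] [:: w; b], sepl [:: a; w] [:: w; b],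
      sepl [:: a; b] [:: a; a], sepl [:: a; b] [:: b; b], sepl [:: a; b] [:: w; w],
      sepl [:: a; w] [:: a; a], sepl [:: a; w] [:: b; b], sepl [:: a; w] [:: w; w],
      sepl [:: w; b] [:: a; a], sepl [:: w; b] [:: b; b] & sepl [:: w; b] [:: w; w]].

Definition tri_ok_at (k e : nat) := tri_ok (corner k e 0) (corner k e 1) (corner k e 2).

Definition check_pair (k k' : nat) (q : Z * Z) (z : bool) :=
  [&& all (fun e => all (fun e' => (z && (e == e')) || sepl (tri k e) (shifts q (tri k' e')))
             (tris k')) (tris k),
      all (fun e => all (fun p => let v := addp q (vert_off k' p) in
             (v \in tri k e) || sepl (tri k e) [:: v]) (iota 0 32)) (tris k)
    & all (fun p => all (fun p' => (z && (p == p')) || (vert_off k p != addp q (vert_off k' p')))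
             (iota 0 32)) (iota 0 32)].

Definition deltas : seq Z := [:: (-1); 0; 1].

(** Whether cells with column numbers capped at 2 to [k] and [k'] can differ by [d]. *)
Definition admissible (k k' : nat) (d : Z) :=
  if (k < 2)%N then (if (k' < 2)%N then Z.of_nat k' =? Z.of_nat k + d else 2 <=? Z.of_nat k + d)
  else if (k' < 2)%N then 2 <=? Z.of_nat k' - d else true.

Definition check_pairs := all (fun k => all (fun k' => all (fun dx => all (fun dy =>
     admissible k k' (dx + dy) ==>
     check_pair k k' (scale * dx, scale * dy) ((dx =? 0) && (dy =? 0))) deltas) deltas)
   (iota 0 3)) (iota 0 3).

Lemma check_trisE : all (fun k => all (tri_ok_at k) (tris k)) (iota 0 3).
Proof. by vm_cast_no_check (erefl true). Qed.

(** Since the drawing is periodic and a column number matters only up to the cap 2, this single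
    evaluation settles all pairs of equal or adjacent cells of all grids. *)
Lemma check_pairsE : check_pairs.
Proof. by vm_cast_no_check (erefl true). Qed.

Definition inbox (p : Z * Z) := [&& -50 <=? p.1, p.1 <=? 98, -50 <=? p.2 & p.2 <=? 98].

Lemma check_box : all (fun k => all (fun p => inbox (vert_off k p)) (iota 0 32) &&
  all (fun e => all inbox (tri k e)) (tris k)) (iota 0 3).
Proof. by vm_compute. Qed.

(** The drawing of a cell distinguishes only [k = 0], [k = 1] and larger [k]; the case 1 is special
    because the neighbours to the left and below are diagonal cells. The lemmas on [minn k 2]
    transport the finite check to every [k]. *)
Lemma part_off_min k p : part_off (minn k 2) p = part_off k p.
Proof. by case: k => [|[|k]]. Qed.

Lemma part_off_min1 k p : part_off (minn k 2).-1 p = part_off k.-1 p.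
Proof. by case: k => [|[|[|k]]]. Qed.

Lemma end_off_min k sp : end_off (minn k 2) sp = end_off k sp.
Proof. by case: sp => -[] p; rewrite /end_off /= ?part_off_min ?part_off_min1. Qed.

Lemma min0 k : (minn k 2 == 0%N) = (k == 0%N). Proof. by case: k => [|[|[|k]]]. Qed.
Lemma min1 k : (minn k 2 == 1%N) = (k == 1%N). Proof. by case: k => [|[|[|k]]]. Qed.

Lemma edge_dom_min k e : edge_dom (minn k 2) e = edge_dom k e.
Proof. by rewrite /edge_dom min0 min1. Qed.

Lemma vert_off_min k p : vert_off (minn k 2) p = vert_off k p.
Proof.
rewrite /vert_off edge_dom_min part_off_min min1.
by case: ifP => // _; case: edge_ends => a b; rewrite !end_off_min.
Qed.

Lemma corner_min k e j : corner (minn k 2) e j = corner k e j.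
Proof. by case: j => [|[|j]]; rewrite /corner ?vert_off_min ?min1 ?end_off_min. Qed.

Lemma tri_min k e : tri (minn k 2) e = tri k e.
Proof. by rewrite /tri !corner_min. Qed.

Definition cell_at (i k : nat) : Z * Z := (scale * Z.of_nat (i + k), - (scale * Z.of_nat i)).
Definition vert_at i k p := addp (cell_at i k) (vert_off k p).
Definition corner_at i k e j := addp (cell_at i k) (corner k e j).

Definition seg (k e j : nat) := match j with
  | 0%nat => (corner k e 0, corner k e 1)
  | 1%nat => (corner k e 0, corner k e 2)
  | _ => (corner k e 2, corner k e 1)
  end.
Definition seg_at i k e j := shifted (cell_at i k) (seg k e j).

Lemma trisP k e : edge_dom k e -> e \in tris (minn k 2).
Proof.
move=> h; rewrite mem_filter edge_dom_min h mem_iota /=.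
move: h; rewrite /edge_dom. move=> h; apply: contraT; rewrite -leqNgt => h2; move: h. case: (k == 0%N) => //=; first by move=> /andP[_]; rewrite ltnNge (leq_trans _ h2). by case/orP => [|/andP[_ /eqP E]]; [rewrite ltnNge (leq_trans _ h2)|rewrite E in h2].
Qed.

Lemma min2_iota k : minn k 2 \in iota 0 3.
Proof. by rewrite mem_iota; lia. Qed.

Lemma inboxP p : inbox p -> -50 <= p.1 <= 98 /\ -50 <= p.2 <= 98.
Proof. by move=> /and4P[/Z.leb_le ? /Z.leb_le ? /Z.leb_le ? /Z.leb_le ?]; split. Qed.

Lemma vert_box k p : (p < 32)%N -> inbox (vert_off k p).
Proof.
move=> hp; have /andP[/allP h _] := allP check_box _ (min2_iota k).
by rewrite -vert_off_min; apply: h; rewrite mem_iota.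
Qed.

Lemma corner_box k e j : edge_dom k e -> inbox (corner k e j).
Proof.
move=> /trisP he; have /andP[_ /allP h] := allP check_box _ (min2_iota k).
have /and4P[h0 h1 h2 _] := h _ he; rewrite -corner_min.
by case: j => [|[|j]].
Qed.

Lemma seg_box k e j : edge_dom k e -> inbox (seg k e j).1 /\ inbox (seg k e j).2.
Proof. by move=> h; case: j => [|[|j]]; split; apply: corner_box. Qed.

(** Objects of cells that are not adjacent are separated by an axis-parallel line. *)
Lemma far_sep i k i' k' s t :
  inbox s.1 -> inbox s.2 -> inbox t.1 -> inbox t.2 ->
  let dx := Z.of_nat (i' + k') - Z.of_nat (i + k) in let dy := Z.of_nat i - Z.of_nat i' in
  1 < Z.abs dx \/ 1 < Z.abs dy -> sep (shifted (cell_at i k) s) (shifted (cell_at i' k') t).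
Proof.
move=> /inboxP[a1 a2] /inboxP[a3 a4] /inboxP[b1 b2] /inboxP[b3 b4] dx dy hx.
have [h|[h|[h|h]]] : dx <= -2 \/ 2 <= dx \/ dy <= -2 \/ 2 <= dy by lia.
- exists (-1, 0), (- (scale * Z.of_nat (i + k) - 50)).
  by rewrite /shifted /cell_at /addp /dot /scale; cbn [fst snd]; split; lia.
- exists (1, 0), (scale * Z.of_nat (i + k) + 98).
  by rewrite /shifted /cell_at /addp /dot /scale; cbn [fst snd]; split; lia.
- exists (0, -1), (scale * Z.of_nat i + 50).
  by rewrite /shifted /cell_at /addp /dot /scale; cbn [fst snd]; split; lia.
- exists (0, 1), (- (scale * Z.of_nat i) + 98).
  by rewrite /shifted /cell_at /addp /dot /scale; cbn [fst snd]; split; lia.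
Qed.

Lemma near_check i k i' k' : 
  let dx := Z.of_nat (i' + k') - Z.of_nat (i + k) in let dy := Z.of_nat i - Z.of_nat i' in
  Z.abs dx <= 1 /\ Z.abs dy <= 1 ->
  check_pair (minn k 2) (minn k' 2) (scale * dx, scale * dy) ((dx =? 0) && (dy =? 0)).
Proof.
move=> dx dy hx.
have hd z : Z.abs z <= 1 -> z \in deltas.
  by move=> hz; have [->|[->|->]] : z = -1 \/ z = 0 \/ z = 1 by lia.
have hdx : dx \in deltas by apply: hd; case: hx.
have hdy : dy \in deltas by apply: hd; case: hx.
move: check_pairsE; rewrite /check_pairs => /allP H.
move: (H _ (min2_iota k)) => {H} /allP H; move: (H _ (min2_iota k')) => {H} /allP H.
move: (H _ hdx) => {H} /allP H; move: (H _ hdy) => {H} /implyP; apply.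
have e : Z.of_nat k' = Z.of_nat k + (dx + dy) by rewrite /dx /dy; lia.
rewrite /admissible; move: (dx + dy) e => d e.
by case: ifP => h1; case: ifP => h2 //; first (apply/Z.eqb_eq); try (apply/Z.leb_le); lia.
Qed.

Lemma cell_shift i k i' k' p : 
  addp (cell_at i' k') p = addp (cell_at i k)
   (addp (scale * (Z.of_nat (i' + k') - Z.of_nat (i + k)), scale * (Z.of_nat i - Z.of_nat i')) p).
Proof. by rewrite /addp /cell_at; cbn [fst snd]; congr (_, _); ring. Qed.

Lemma same_cell i k i' k' :
  (Z.of_nat (i' + k') - Z.of_nat (i + k) =? 0) && (Z.of_nat i - Z.of_nat i' =? 0) ->
  i = i' /\ k = k'.
Proof. by move=> /andP[/Z.eqb_eq h1 /Z.eqb_eq h2]; have e : i = i' by [lia]; split; lia. Qed.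

Lemma near_far i k i' k' :
  let dx := Z.of_nat (i' + k') - Z.of_nat (i + k) in let dy := Z.of_nat i - Z.of_nat i' in
  (Z.abs dx <= 1 /\ Z.abs dy <= 1) \/ (1 < Z.abs dx \/ 1 < Z.abs dy).
Proof. by move=> dx dy; clearbody dx dy; lia. Qed.

Lemma check_pairP k k' q z : check_pair k k' q z -> [/\
  forall e e', e \in tris k -> e' \in tris k' ->
    (z && (e == e')) || sepl (tri k e) (shifts q (tri k' e')),
  forall e p, e \in tris k -> (p < 32)%N ->
    (addp q (vert_off k' p) \in tri k e) || sepl (tri k e) [:: addp q (vert_off k' p)]
  & forall p p', (p < 32)%N -> (p' < 32)%N ->
    (z && (p == p')) || (vert_off k p != addp q (vert_off k' p'))].
Proof.
rewrite /check_pair => /and3P[/allP h1 /allP h2 /allP h3].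
have hI p : (p < 32)%N -> p \in iota 0 32 by rewrite mem_iota.
split.
- by move=> e e' he he'; apply: (allP (h1 _ he)).
- by move=> e p he hp; apply: (allP (h2 _ he) _ (hI _ hp)).
- by move=> p p' hp hp'; apply: (allP (h3 _ (hI _ hp)) _ (hI _ hp')).
Qed.

Opaque vert_off corner sepl scale check_pair tri_ok.

Lemma allP2 (T U : eqType) (P : T -> U -> bool) (f : T -> seq U) (l : seq T) :
  all (fun x => all (P x) (f x)) l -> forall x y, x \in l -> y \in f x -> P x y.
Proof. by move=> /allP h x y hx hy; apply: (allP (h x hx)). Qed.

Lemma tri_okP0 k e : k \in iota 0 3 -> e \in tris k -> tri_ok_at k e.
Proof. exact: (@allP2 _ _ tri_ok_at tris _ check_trisE k e). Qed.

Lemma tri_okP k e : edge_dom k e -> tri_ok (corner k e 0) (corner k e 1) (corner k e 2).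
Proof.
move=> /trisP he; rewrite -(corner_min k e 0) -(corner_min k e 1) -(corner_min k e 2).
exact: tri_okP0 (min2_iota k) he.
Qed.

Transparent tri_ok.

Lemma shift_vert i k p : shifted (cell_at i k) (vert_off k p, vert_off k p) = (vert_at i k p, vert_at i k p).
Proof. by rewrite /shifted /vert_at; cbn [fst snd]. Qed.

Lemma sep_irr v : ~ sep (v, v) (v, v).
Proof. by move=> [n [c [h1 h2 h3 h4 h5]]]; move: h1 h2 h3 h4 h5; cbn [fst snd]; lia. Qed.

Lemma vert_neq i k p i' k' p' : (p < 32)%N -> (p' < 32)%N -> (i, k, p) <> (i', k', p') ->
  vert_at i k p <> vert_at i' k' p'.
Proof.
move=> hp hp' ne e; have [h|h] := near_far i k i' k'; last first.
  apply: (@sep_irr (vert_at i k p)).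
  have := @far_sep i k i' k' (vert_off k p, vert_off k p) (vert_off k' p', vert_off k' p')
    (vert_box k hp) (vert_box k hp) (vert_box k' hp') (vert_box k' hp') h.
  by rewrite !shift_vert e.
have [_ _ H] := check_pairP (near_check h).
have := H _ _ hp hp'; rewrite !vert_off_min => /orP[/andP[/same_cell[h1 h2] /eqP h3]|/eqP].
  by apply: ne; rewrite h1 h2 h3.
apply; move: e; rewrite /vert_at (cell_shift i k i' k'); move: (addp _ (vert_off k' p')) => q.
by case: (vert_off k p) q => a b [a' b']; rewrite /addp /= => -[e1 e2]; congr (_, _); lia.
Qed.

Lemma seg_cases k e j : [\/ seg k e j = (corner k e 0, corner k e 1),
  seg k e j = (corner k e 0, corner k e 2) | seg k e j = (corner k e 2, corner k e 1)].
Proof. by case: j => [|[|j]]; [constructor 1|constructor 2|constructor 3]. Qed.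

Lemma seg_mem k e j : (seg k e j).1 \in tri k e /\ (seg k e j).2 \in tri k e.
Proof. by case: j => [|[|j]]; split; rewrite !inE eqxx ?orbT. Qed.

Theorem vert_seg i k e j i' k' p : edge_dom k e -> (p < 32)%N ->
  sep (seg_at i k e j) (vert_at i' k' p, vert_at i' k' p).
Proof.
move=> he hp; have [h|h] := near_far i k i' k'; last first.
  have [b1 b2] := seg_box j he.
  have := @far_sep i k i' k' (seg k e j) (vert_off k' p, vert_off k' p) b1 b2
    (vert_box k' hp) (vert_box k' hp) h.
  by rewrite shift_vert.
have [_ H _] := check_pairP (near_check h).
have := H _ _ (trisP he) hp.
rewrite /vert_at (cell_shift i k i' k') vert_off_min tri_min; move: (addp _ (vert_off k' p)) => v.
have -> : (addp (cell_at i k) v, addp (cell_at i k) v) = shifted (cell_at i k) (v, v) by [].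
move=> hv; apply: sep_shift.
case/orP: hv => [|hv]; last first.
  rewrite [seg k e j]surjective_pairing; apply: (sepl3 hv); rewrite ?inE //.
  by rewrite -surjective_pairing; apply: seg_cases.
move: (tri_okP he); rewrite /tri_ok => /and5P[_ _ _ h1] /and5P[h2 h3 h4 h5] /and4P[h6 h7 h8 h9].
rewrite !inE; case: j => [|[|j]] /or3P[] /eqP->; exact: sepl1.
Qed.

(** Cells that are far apart fall under [far_sep]; for close ones the triangles of different edges
    are separated by the finite check, and the sides of one triangle are separated by [tri_ok]. *)
Theorem seg_seg i k e j i' k' e' j' : edge_dom k e -> edge_dom k' e' -> (j < 3)%N -> (j' < 3)%N ->
  (i, k, e, j) <> (i', k', e', j') -> sep (seg_at i k e j) (seg_at i' k' e' j').
Proof.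
move=> he he' hj hj' ne; have [h|h] := near_far i k i' k'; last first.
  have [b1 b2] := seg_box j he; have [b3 b4] := seg_box j' he'.
  exact: (@far_sep i k i' k' (seg k e j) (seg k' e' j') b1 b2 b3 b4 h).
have [H _ _] := check_pairP (near_check h).
have := H _ _ (trisP he) (trisP he').
rewrite !tri_min => /orP[/andP[/same_cell[h1 h2] /eqP h3]|hs]; last first.
  have -> : seg_at i' k' e' j' = shifted (cell_at i k) (shifted
    (scale * (Z.of_nat (i' + k') - Z.of_nat (i + k)), scale * (Z.of_nat i - Z.of_nat i')) (seg k' e' j')).
    by rewrite /seg_at /shifted (cell_shift i k i' k') [in X in (_, X)](cell_shift i k i' k').
  apply: sep_shift; have [m1 m2] := seg_mem k' e' j'.
  rewrite [seg k e j]surjective_pairing; apply: (sepl3 hs); rewrite ?map_f //.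
  by rewrite -surjective_pairing; apply: seg_cases.
subst i' k' e'; apply: sep_shift.
move: (tri_okP he); rewrite /tri_ok => /and4P[/sepl1 h1 /sepl1 h2 /sepl1 h3 _].
have {}ne : j <> j' by move=> E; apply: ne; rewrite E.
by case: j j' hj hj' ne => [|[|[|j]]] [|[|[|j']]] //= _ _ _; apply: sep_sym.
Qed.

End PlaneCheck.

(** * Reconfiguration of words *)

Inductive star (T : Type) (R : T -> T -> Prop) (x : T) : T -> Prop :=
  | star0 : star R x x
  | starS y z : star R x y -> R y z -> star R x z.

Lemma star1 T (R : T -> T -> Prop) x y : R x y -> star R x y.
Proof. exact: starS (star0 _ _). Qed.

Lemma star_trans T (R : T -> T -> Prop) x y z : star R x y -> star R y z -> star R x z.
Proof. by move=> h; elim=> // a b _; apply: starS. Qed.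

Lemma star_map T U (R : T -> T -> Prop) (S : U -> U -> Prop) (f : T -> U) :
  (forall x y, R x y -> star S (f x) (f y)) -> forall x y, star R x y -> star S (f x) (f y).
Proof.
move=> h x y; elim=> [|a b _ IH hab]; first exact: star0.
exact: star_trans IH (h _ _ hab).
Qed.

Lemma star_impl T (R S : T -> T -> Prop) : (forall x y, R x y -> S x y) -> forall x y, star R x y -> star S x y.
Proof. by move=> h x y; apply: (star_map (f := id)) => a b /h; apply: star1. Qed.

Lemma star_sym T (R : T -> T -> Prop) : (forall x y, R x y -> R y x) ->
  forall x y, star R x y -> star R y x.
Proof.
move=> h x y; elim=> [|a b _ IH hab]; first exact: star0.
exact: star_trans (star1 (h _ _ hab)) IH.
Qed.

(** ** Sets of letters

  A word over letters [a < D] at positions [p < P] is turned into one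
  three-valued variable [t i] for each [i = p * D + a]: the letter is selected
  ([None]), or some earlier ([Some false]) or later ([Some true]) letter at
  the same position is. *)
Section Tri.
Variables (P D : nat) (R : nat -> nat -> nat -> bool).
Hypothesis D0 : 0 < D.

Definition word_ok (y : nat -> nat) :=
  (forall p, p < P -> y p < D) /\ (forall p, p.+1 < P -> R p (y p) (y p.+1)).

Definition word_step (y y' : nat -> nat) :=
  [/\ word_ok y, word_ok y' & exists p a, p < P /\ y' = upd y p a].

Definition conf i j := (j %/ D == (i %/ D).+1) && ~~ R (i %/ D) (i %% D) (j %% D).

Definition tri_state := nat -> option bool.

(** Several letters may be selected at one position, as happens while one replaces another. This is
    harmless: every selected letter is compatible with all letters selected at the neighbouring
    positions, so any choice among them gives a correct word. *)
Definition tri_valid (t : tri_state) := forall i, i < P * D ->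
  [/\ (i %% D == 0) -> t i <> Some false,
      (i.+1 %% D == 0) -> t i <> Some true,
      i.+1 < P * D -> i.+1 %% D != 0 -> t i = Some true -> t i.+1 <> Some false
    & forall j, j < P * D -> conf i j -> t i = None -> t j <> None].

Definition tri_step (t t' : tri_state) :=
  [/\ tri_valid t, tri_valid t' & exists i v, i < P * D /\ t' = upd t i v].

Definition tri_of (y : nat -> nat) : tri_state := fun i =>
  if i %% D == y (i %/ D) then None else Some (i %% D < y (i %/ D)).

Definition word_of (t : tri_state) : nat -> nat := fun p =>
  find (fun a => t (p * D + a) == None) (iota 0 D).

Lemma idx_div p a : a < D -> (p * D + a) %/ D = p.
Proof. by move=> h; rewrite divnMDl // divn_small // addn0. Qed.

Lemma idx_mod p a : a < D -> (p * D + a) %% D = a.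
Proof. by move=> h; rewrite modnMDl modn_small. Qed.

Lemma idx_lt p a : p < P -> a < D -> p * D + a < P * D.
Proof.
move=> hp ha; apply: (@leq_trans (p.+1 * D)); first by rewrite mulSn addnC ltn_add2r.
by rewrite leq_mul2r hp orbT.
Qed.

Lemma div_lt i : i < P * D -> i %/ D < P. Proof. by move=> h; rewrite ltn_divLR. Qed.
Lemma mod_lt i : i %% D < D. Proof. by rewrite ltn_mod. Qed.

(** If no letter were selected, the chain condition would carry the value [Some true] from the first
    letter of the position to the last one, where it is forbidden. *)
Lemma tri_sel t p : tri_valid t -> p < P -> exists2 a, a < D & t (p * D + a) = None.
Proof.
move=> ht hp.
suff H a : a < D -> (exists2 c, c < D & t (p * D + c) = None) \/ t (p * D + a) = Some true.
  have hD : D.-1 < D by rewrite prednK.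
  case: (H _ hD) => // e; have [_ h _ _] := ht _ (idx_lt hp hD).
  by case: h => //; rewrite -addnS prednK // -mulSnr modnMl.
elim: a => [|a IH] ha.
  have [h _ _ _] := ht _ (idx_lt hp ha); move: h; rewrite idx_mod // => /(_ isT).
  by case E: (t _) => [[]|] // _; [right|left; exists 0].
case: (IH (ltnW ha)) => [|e]; first by left.
have [_ _ h _] := ht _ (idx_lt hp (ltnW ha)); move: h; rewrite -addnS idx_mod // idx_lt //.
move=> /(_ isT isT e); case E: (t _) => [[]|] // _; [by right|by left; exists a.+1].
Qed.

Lemma word_of_sel t p : tri_valid t -> p < P ->
  word_of t p < D /\ t (p * D + word_of t p) = None.
Proof.
move=> ht hp; have [a ha e] := tri_sel ht hp.
have hh : has (fun a => t (p * D + a) == None) (iota 0 D).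
  by apply/hasP; exists a; rewrite ?mem_iota ?e.
have hs : word_of t p < D by move: hh; rewrite has_find size_iota.
by split=> //; have /eqP := nth_find 0 hh; rewrite nth_iota.
Qed.

Lemma tri_word_ok t : tri_valid t -> word_ok (word_of t).
Proof.
move=> ht; split=> p hp; first by have [] := word_of_sel ht hp.
have [h1 e1] := word_of_sel ht (ltnW hp); have [h2 e2] := word_of_sel ht hp.
have [_ _ _ h] := ht _ (idx_lt (ltnW hp) h1).
apply: contraT => nR; case: (h _ (idx_lt hp h2) _ e1); rewrite ?e2 //.
by rewrite /conf !idx_div // !idx_mod // eqxx.
Qed.

Lemma tri_word_step t t' : tri_step t t' -> star word_step (word_of t) (word_of t').
Proof.
move=> [ht ht' [i [v [hi e]]]]; apply: star1; split; try exact: tri_word_ok.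
exists (i %/ D), (word_of t' (i %/ D)); split; first exact: div_lt.
apply: functional_extensionality => p; rewrite /upd; case: eqP => [->//|hp].
rewrite /word_of e; apply: eq_in_find => a; rewrite mem_iota => /andP[_ ha].
by rewrite upd_other //; apply/eqP => E; apply: hp; rewrite -E idx_div.
Qed.

Lemma tri_ofN y i : (tri_of y i == None) = (i %% D == y (i %/ D)).
Proof. by rewrite /tri_of; case: ifP. Qed.

Lemma word_of_tri_of y p : y p < D -> word_of (tri_of y) p = y p.
Proof.
move=> hy; rewrite /word_of.
have -> : find (fun a => tri_of y (p * D + a) == None) (iota 0 D) = find (pred1 (y p)) (iota 0 D).
  by apply: eq_in_find => a; rewrite mem_iota => /andP[_ ha]; rewrite tri_ofN idx_mod // idx_div.
rewrite -/(index (y p) (iota 0 D)) -{1}[y p](nth_iota 0 0 hy).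
by rewrite index_uniq ?size_iota ?iota_uniq.
Qed.

Lemma tri_ofP y i v : tri_of y i = Some v ->
  if v then i %% D < y (i %/ D) else y (i %/ D) < i %% D.
Proof.
by rewrite /tri_of; case: ltngtP => // h [] <-.
Qed.

(** While a letter changes, some variables follow the old word and some the new one. The chain
    condition compares consecutive variables only, so it matters just where the source changes: old
    before new is harmless if the letter grows, new before old if it decreases. *)
Lemma mix_valid y p a (sel : nat -> bool) t : p < P -> word_ok y -> word_ok (upd y p a) ->
  (forall i, t i = if sel (i %% D) then tri_of y i else tri_of (upd y p a) i) ->
  (forall e, e.+1 < D -> sel e != sel e.+1 -> (sel e -> y p < a) /\ (~~ sel e -> a < y p)) ->
  tri_valid t.
Proof.
move=> hp [hy1 hy2] [hy1' hy2'] ht hsel i hi.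
have hd := div_lt hi; have hm := mod_lt i.
have hyi := hy1 _ hd; have hyi' := hy1' _ hd.
split.
- by move=> /eqP h; rewrite ht; case: ifP => _ /tri_ofP; rewrite h.
- move=> /eqP h.
  have em : i %% D = D.-1.
    have : (i %% D).+1 %% D = 0 by rewrite -addn1 modnDml addn1.
    by have [hh|hh] := ltnP (i %% D).+1 D; [rewrite modn_small|lia].
  by rewrite ht; case: ifP => _ /tri_ofP; rewrite em; lia.
- move=> hi1 hm1 e1 e2.
  have em : i.+1 %% D = (i %% D).+1 /\ i.+1 %/ D = i %/ D /\ (i %% D).+1 < D.
    have [hh|hh] := ltnP (i %% D).+1 D; last first.
      by case/eqP: hm1; rewrite -addn1 -modnDml addn1 (_ : (i %% D).+1 = D) ?modnn //; lia.
    split; first by rewrite -addn1 -modnDml addn1 modn_small.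
    split=> //; by rewrite [in LHS](divn_eq i D) -addnS divnMDl // [X in _ + X]divn_small ?addn0.
  case: em => em [ed hlt].
  move: e1 e2; rewrite !ht em.
  have [E|E] := eqVneq (i %/ D) p; last first.
    have E' : tri_of (upd y p a) i = tri_of y i by rewrite /tri_of /upd (negPf E).
    have E'' : tri_of (upd y p a) i.+1 = tri_of y i.+1 by rewrite /tri_of /upd ed (negPf E).
    by rewrite E' E'' !if_same => /tri_ofP h1 /tri_ofP; rewrite ed em; lia.
  have := hsel _ hlt.
  by case: (sel (i %% D)); case: (sel (i %% D).+1) => h /tri_ofP h1 /tri_ofP;
    move: h1; rewrite ed em E ?upd_same => h1 h2; try lia;
    case: (h isT) => h3 h4; first [have := h3 isT | have := h4 isT]; lia.
- move=> j hj /andP[/eqP e nR] ei ej.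
  have hdj := div_lt hj.
  have Ei : i %% D = y (i %/ D) \/ i %% D = upd y p a (i %/ D).
    by move: ei; rewrite ht; case: ifP => _ /eqP; rewrite tri_ofN => /eqP; [left|right].
  have Ej : j %% D = y (j %/ D) \/ j %% D = upd y p a (j %/ D).
    by move: ej; rewrite ht; case: ifP => _ /eqP; rewrite tri_ofN => /eqP; [left|right].
  case/negP: nR; rewrite e in hdj.
  have h1 := hy2 _ hdj; have h2 := hy2' _ hdj; rewrite -e in h1 h2.
  have [E|E] := eqVneq (i %/ D) p.
    have ne : (j %/ D == p) = false by rewrite e E; lia.
    rewrite [upd y p a (j %/ D)]/upd ne in Ej h2.
    by case: Ej => ->; case: Ei => ->.
  rewrite [upd y p a (i %/ D)]/upd (negPf E) in Ei h2.
  by case: Ei => ->; case: Ej => ->.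
Qed.

Lemma tri_of_valid y : 0 < P -> word_ok y -> tri_valid (tri_of y).
Proof.
move=> hP hy; apply: (@mix_valid y 0 (y 0) (fun=> true)); rewrite ?upd_id //.
Qed.

Lemma word_tri_step y y' : word_step y y' -> star tri_step (tri_of y) (tri_of y').
Proof.
move=> [hy hy' [p [a [hp E]]]]; subst y'.
(* A growing letter is updated from the last variable down to the first, a decreasing one from the
   first up to the last; [c] is the boundary between the two sources. *)
pose T (up : bool) c i := if (i %% D < c) == up then tri_of y i else tri_of (upd y p a) i.
have hT (up : bool) c : (up -> y p < a) -> (~~ up -> a < y p) -> tri_valid (T up c).
  move=> h1 h2; apply: (@mix_valid y p a (fun e => (e < c) == up)) => // e he.
  by case: up h1 h2 => h1 h2; split; lia.
have dec i : i %/ D = p -> i = p * D + i %% D by move=> <-; rewrite -divn_eq.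
have same i : i %/ D <> p -> tri_of (upd y p a) i = tri_of y i.
  by rewrite /tri_of /upd => /eqP/negPf ->.
have sT (up : bool) c : c < D -> (up -> y p < a) -> (~~ up -> a < y p) ->
    exists v w, T up c = upd (T up c.+1) (p * D + c) v /\ T up c.+1 = upd (T up c) (p * D + c) w.
  move=> hc h1 h2; exists (T up c (p * D + c)), (T up c.+1 (p * D + c)); split;
    apply: functional_extensionality => i; rewrite /upd; case: eqP => [->//|hne];
    rewrite /T; (have [Ei|Ei] := eqVneq (i %/ D) p; last by rewrite same ?if_same //; apply/eqP);
    have hne' : i %% D <> c by [move=> e; apply: hne; rewrite (dec _ Ei) e];
    by have -> : (i %% D < c) = (i %% D < c.+1) by lia.
have T0 up : T up 0 = if up then tri_of (upd y p a) else tri_of y.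
  by apply: functional_extensionality => i; rewrite /T ltn0; case: up.
have TD up : T up D = if up then tri_of y else tri_of (upd y p a).
  by apply: functional_extensionality => i; rewrite /T mod_lt; case: up.
have [h|h|h] := ltngtP (y p) a.
- suff H c : c <= D -> star tri_step (T true D) (T true (D - c)).
    by have := H D (leqnn _); rewrite subnn T0 TD.
  elim: c => [|c IH] hc; first by rewrite subn0; apply: star0.
  apply: starS (IH (ltnW hc)) _; split; try exact: hT.
  have hlt : D - c.+1 < D by lia.
  have hn : ~~ true -> a < y p by [].
  have [v [_ [e1 _]]] := sT true _ hlt (fun _ => h) hn.
  exists (p * D + (D - c.+1)), v; split; first exact: idx_lt.
  by rewrite e1 (_ : (D - c.+1).+1 = D - c) //; lia.
- suff H c : c <= D -> star tri_step (T false 0) (T false c).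
    by have := H D (leqnn _); rewrite T0 TD.
  elim: c => [|c IH] hc; first exact: star0.
  apply: starS (IH (ltnW hc)) _; split; try exact: hT.
  have hn : false -> y p < a by [].
  have [_ [w [_ e2]]] := sT false c hc hn (fun _ => h).
  by exists (p * D + c), w; split=> //; apply: idx_lt.
- by rewrite -h upd_id; apply: star0.
Qed.

Theorem word_tri y y' : 0 < P -> word_ok y -> word_ok y' -> (forall p, P <= p -> y p = y' p) ->
  star word_step y y' <-> star tri_step (tri_of y) (tri_of y').
Proof.
move=> hP hy hy' hh; split.
  elim=> [|a b _ IH hab]; first exact: star0.
  exact: star_trans IH (word_tri_step hab).
(* [word_of] says nothing about positions from [P] on; they are filled with the common tail of [y]
   and [y']. *)
pose fix' (w : nat -> nat) := fun p => if p < P then w p else y p.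
have fixok w : word_ok w -> word_ok (fix' w).
  move=> [h1 h2]; split=> p hp; rewrite /fix' ?hp ?(ltnW hp) //; [exact: h1|exact: h2].
have st w w' : word_step w w' -> star word_step (fix' w) (fix' w').
  move=> [h1 h2 [p [a [hp E]]]]; apply: star1; split; try exact: fixok.
  exists p, a; split=> //; apply: functional_extensionality => q; rewrite /fix' E /upd.
  by case: (q =P p) => [->|//]; rewrite hp.
have back w : word_ok w -> (forall p, P <= p -> w p = y p) -> fix' (word_of (tri_of w)) = w.
  move=> [h1 _] h2; apply: functional_extensionality => q; rewrite /fix'.
  by case: ltnP => hq; [rewrite word_of_tri_of // h1|rewrite h2].
move=> h; rewrite -(back _ hy) // -(back _ hy' (fun p hp => esym (hh p hp))).
elim: h => [|a b _ IH hab]; first exact: star0.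
apply: star_trans IH _; apply: (star_map st); exact: tri_word_step.
Qed.

End Tri.

(** * The grid graph *)

Section Grid.
Variables (I b : nat) (conf : nat -> nat -> bool) (fstg lstg : nat -> bool).
Hypothesis b0 : 0 < b.

Definition ncell := I * b.+1.
Definition cidx i k := i * b.+1 + k.

Definition nbc (c : nat) (s : side) := match s with Own => c | Left => c.-1 | Low => c + b end.

Variable Q : nat.
Hypothesis Q10 : 10 <= Q.

Definition ends (c e : nat) : nat * nat :=
  let sp := edge_ends (c %% b.+1 == 1) e in
  (nbc c sp.1.1 * Q + sp.1.2, nbc c sp.2.1 * Q + sp.2.2).

(** Whether edge type [e] is present at cell [c]. *)
Definition pres (c e : nat) : bool :=
  let i := c %/ b.+1 in let k := c %% b.+1 in
  [&& edge_dom k e, (e == 17) ==> conf i (i + k), (e == 18) ==> ~~ fstg i,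
      (e == 19) ==> ~~ lstg i, (e == 20) ==> ~~ (fstg i || lstg i) & (e == 21) ==> ~~ lstg i].

Definition vtx i k p := cidx i k * Q + p.

Lemma cidx_div i k : k <= b -> cidx i k %/ b.+1 = i.
Proof. by move=> h; rewrite /cidx divnMDl // divn_small ?addn0. Qed.
Lemma cidx_mod i k : k <= b -> cidx i k %% b.+1 = k.
Proof. by move=> h; rewrite /cidx modnMDl modn_small. Qed.

Lemma cidx_lt i k : i < I -> k <= b -> cidx i k < ncell.
Proof.
move=> hi hk; apply: (@leq_trans (i.+1 * b.+1)); first by rewrite /cidx mulSn addnC ltn_add2r ltnS.
by rewrite leq_mul2r hi orbT.
Qed.

Lemma vtx_lt i k p : i < I -> k <= b -> p < Q -> vtx i k p < ncell * Q.
Proof.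
move=> hi hk hp; apply: (@leq_trans ((cidx i k).+1 * Q)); first by rewrite /vtx mulSn addnC ltn_add2r.
by rewrite leq_mul2r cidx_lt ?orbT.
Qed.

(** Cells of the last row have no lower neighbour; the bounds on the two ends discard the edges that
    would lead there. *)
Definition indep (s : nat -> bool) := forall c e, c < ncell -> pres c e ->
  (ends c e).1 < ncell * Q -> (ends c e).2 < ncell * Q -> ~~ (s (ends c e).1 && s (ends c e).2).

Definition nb_i i (s : side) := if s is Low then i.+1 else i.
Definition nb_k k (s : side) := if s is Own then k else k.-1.

Lemma nbcE i k s : k <= b -> (s <> Own -> 0 < k) ->
  nbc (cidx i k) s = cidx (nb_i i s) (nb_k k s).
Proof.
move=> hk; case: s => // h; have {}h : 0 < k by apply: h.
  by rewrite /nbc /cidx /=; lia.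
by rewrite /nbc /cidx /= mulSn; lia.
Qed.

Lemma edge_sides k e : e < 22 -> edge_dom k e ->
  ((edge_ends (k == 1) e).1.1 <> Own \/ (edge_ends (k == 1) e).2.1 <> Own -> 0 < k).
Proof.
by case: k => // he; do 22?[case: e he => [|e] he //]; move=> _ [].
Qed.

Lemma pres_dom c e : pres c e -> edge_dom (c %% b.+1) e.
Proof. by case/andP. Qed.

Lemma dom_lt k e : edge_dom k e -> e < 22.
Proof.
rewrite /edge_dom; case: ifP => _; first by case/andP=> _ h; apply: ltn_trans h _.
by case/orP => [h|/andP[_ /eqP ->]] //; apply: ltn_trans h _.
Qed.

Lemma endsE i k e : k <= b -> edge_dom k e ->
  let sp := edge_ends (k == 1) e in
  ends (cidx i k) e = (vtx (nb_i i sp.1.1) (nb_k k sp.1.1) sp.1.2, vtx (nb_i i sp.2.1) (nb_k k sp.2.1) sp.2.2).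
Proof.
move=> hk he; have := edge_sides (dom_lt he) he.
rewrite /ends cidx_mod // => h /=.
by rewrite !nbcE //; move=> hs; apply: h; [right|left].
Qed.

(** The groups: every token group is a clique, named by one of its vertices. *)
Definition rep i k p : nat :=
  if k == 0 then
    if (p == 6) && ~~ fstg i then 7 else if (p == 8) && ~~ lstg i then 7 else p
  else if p < 3 then 2 else if p < 6 then 5 else if p < 8 then 6 else 8.

Definition full (s : nat -> bool) := forall i k p, i < I -> k <= b -> p < 10 ->
  exists q, [/\ q < 10, rep i k q = rep i k p & s (vtx i k q)].

(** *** From tokens to selected letters *)
Section Sound.
Variable s : nat -> bool.
Hypotheses (hs : indep s) (hf : full s).

Lemma indepE i k e : i < I -> k <= b -> pres (cidx i k) e ->
  let sp := edge_ends (k == 1) e in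
  (sp.1.1 = Low \/ sp.2.1 = Low -> i.+1 < I) -> sp.1.2 < 10 -> sp.2.2 < 10 ->
  ~~ (s (vtx (nb_i i sp.1.1) (nb_k k sp.1.1) sp.1.2) && s (vtx (nb_i i sp.2.1) (nb_k k sp.2.1) sp.2.2)).
Proof.
move=> hi hk hp /= hl h1 h2; have he := pres_dom hp; rewrite cidx_mod // in he.
have := hs (cidx_lt hi hk) hp; rewrite endsE //= => h; apply: h; apply: vtx_lt.
- by case E: _.1.1 hl => //=; move=> hl; apply: hl; left.
- by case E: _.1.1 => /=; lia.
- exact: leq_trans h1 Q10.
- by case E: _.2.1 hl => //=; move=> hl; apply: hl; right.
- by case E: _.2.1 => /=; lia.
- exact: leq_trans h2 Q10.
Qed.

Lemma presE i k e : k <= b -> pres (cidx i k) e = [&& edge_dom k e, (e == 17) ==> conf i (i + k),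
  (e == 18) ==> ~~ fstg i, (e == 19) ==> ~~ lstg i, (e == 20) ==> ~~ (fstg i || lstg i)
  & (e == 21) ==> ~~ lstg i].
Proof. by move=> hk; rewrite /pres cidx_mod // cidx_div. Qed.

Lemma gad_edge i k e : i < I -> 0 < k <= b -> e < 17 ->
  let sp := edge_ends (k == 1) e in (sp.1.1 = Low -> i.+1 < I) ->
  ~~ (s (vtx (nb_i i sp.1.1) (nb_k k sp.1.1) sp.1.2) && s (vtx (nb_i i sp.2.1) (nb_k k sp.2.1) sp.2.2)).
Proof.
move=> hi /andP[k0 hk] he sp hl; apply: indepE => //.
- rewrite presE // /edge_dom -[k == 0]negbK -lt0n k0 /= (ltn_trans he) //=.
  by clear sp hl; do 17?[case: e he => [|e] he //].
- by case=> [|h]; [exact: hl|move: h; clear sp hl; do 17?[case: e he => [|e] he //]].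
- by clear sp hl; case: (k == 1); do 17?[case: e he => [|e] he //].
- by clear sp hl; case: (k == 1); do 17?[case: e he => [|e] he //].
Qed.

Lemma grpA i k : i < I -> 0 < k <= b -> s (vtx i k 0) || s (vtx i k 1) || s (vtx i k 2).
Proof.
move=> hi /andP[k0 hk]; have [q [hq e h]] := hf hi hk (isT : 2 < 10).
move: e h; rewrite /rep -[k == 0]negbK -lt0n k0 /=.
by do 10?[case: q hq => [|q] hq //]; move=> _ ->; rewrite ?orbT.
Qed.

Lemma grpB i k : i < I -> 0 < k <= b -> s (vtx i k 3) || s (vtx i k 4) || s (vtx i k 5).
Proof.
move=> hi /andP[k0 hk]; have [q [hq e h]] := hf hi hk (isT : 5 < 10).
move: e h; rewrite /rep -[k == 0]negbK -lt0n k0 /=.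
by do 10?[case: q hq => [|q] hq //]; move=> _ ->; rewrite ?orbT.
Qed.

Lemma grpH i k : i < I -> 0 < k <= b -> s (vtx i k 6) || s (vtx i k 7).
Proof.
move=> hi /andP[k0 hk]; have [q [hq e h]] := hf hi hk (isT : 6 < 10).
move: e h; rewrite /rep -[k == 0]negbK -lt0n k0 /=.
by do 10?[case: q hq => [|q] hq //]; move=> _ ->; rewrite ?orbT.
Qed.

Lemma grpV i k : i < I -> 0 < k <= b -> s (vtx i k 8) || s (vtx i k 9).
Proof.
move=> hi /andP[k0 hk]; have [q [hq e h]] := hf hi hk (isT : 8 < 10).
move: e h; rewrite /rep -[k == 0]negbK -lt0n k0 /=.
by do 10?[case: q hq => [|q] hq //]; move=> _ ->; rewrite ?orbT.
Qed.

Ltac gad e hi hk := move: (@gad_edge _ _ e hi hk isT); rewrite /=.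

(** The signal in the left wire excludes 0 and 1, so the first triangle holds 2; this excludes 5, so
    the second holds 3 or 4, and either of them excludes 6. The state of the column is free
    throughout: this is one half of a planar crossover. *)
Lemma row_prop i k : i < I -> 0 < k <= b -> s (vtx i k.-1 7) -> s (vtx i k 7).
Proof.
move=> hi hk h; have := grpA hi hk; have := grpB hi hk; have := grpH hi hk.
gad 13 hi hk => /(_ (fun e => ltac:(discriminate e))); rewrite h /= => /negPf ->.
gad 14 hi hk => /(_ (fun e => ltac:(discriminate e))); rewrite h /= => /negPf ->.
gad 6 hi hk => /(_ (fun e => ltac:(discriminate e))) h6.
gad 9 hi hk => /(_ (fun e => ltac:(discriminate e))) h9.
gad 10 hi hk => /(_ (fun e => ltac:(discriminate e))) h10.
move: h6 h9 h10; case: (s (vtx i k 2)) => //=.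
by do 4!case: (s _).
Qed.

(** The signal from below excludes 0 and 3. The first triangle then holds 1 or 2 and the second 4 or
    5, and as 2 and 5 are adjacent, 1 or 4 is occupied; both exclude 8. This is the other half of
    the crossover. *)
Lemma col_prop i k : i.+1 < I -> 0 < k <= b ->
  s (vtx i.+1 k.-1 (if k == 1 then 7 else 9)) -> s (vtx i k 9).
Proof.
move=> hi1 hk h; have hi := ltnW hi1.
have := grpA hi hk; have := grpB hi hk; have := grpV hi hk.
gad 15 hi hk => /(_ (fun _ => hi1)); rewrite h /= => /negPf ->.
gad 16 hi hk => /(_ (fun _ => hi1)); rewrite h /= => /negPf ->.
gad 6 hi hk => /(_ (fun e => ltac:(discriminate e))) h6.
gad 11 hi hk => /(_ (fun e => ltac:(discriminate e))) h9.
gad 12 hi hk => /(_ (fun e => ltac:(discriminate e))) h10.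
by move: h6 h9 h10; do 6!case: (s _).
Qed.

Lemma row_all i k : i < I -> k <= b -> s (vtx i 0 7) -> s (vtx i k 7).
Proof.
move=> hi; elim: k => // k IH hk h.
by apply: row_prop => //=; apply: IH => //; apply: ltnW.
Qed.

Lemma col_all i k : i + k < I -> k <= b -> s (vtx (i + k) 0 7) ->
  s (vtx i k (if k == 0 then 7 else 9)).
Proof.
elim: k i => [|k IH] i hi hk h; first by rewrite addn0 in h.
apply: col_prop => //=; first by lia.
rewrite addnS in hi h; rewrite eqSS; apply: IH; by [|apply: ltnW|rewrite addSn].
Qed.

(** At a first letter, vertex 6 is a group of its own and always carries a token, hence the test of
    [fstg]. *)
Definition tri_tok (i : nat) : option bool :=
  if s (vtx i 0 7) then None else if s (vtx i 0 6) && ~~ fstg i then Some false else Some true.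

(** Row [i] brings its signal to the left neighbour of the crossing and column [i + k] brings its
    signal to the lower one; the edge of type 17, present because of the conflict, joins the two
    ports. *)
Lemma tok_conf i k : i + k < I -> 0 < k <= b -> conf i (i + k) -> s (vtx i 0 7) -> ~~ s (vtx (i + k) 0 7).
Proof.
move=> hik /andP[k0 hk] hc hi; apply/negP => hj.
have hiI : i < I by lia.
have h1 : s (vtx i k.-1 7) by apply: row_all => //; lia.
have h2 : s (vtx i.+1 k.-1 (if k == 1 then 7 else 9)).
  have := @col_all i.+1 k.-1; rewrite addSn -addnS prednK // => /(_ hik); rewrite -eqSS prednK //.
  by apply=> //; lia.
have hp : pres (cidx i k) 17 by rewrite presE // /edge_dom -[k == 0]negbK -lt0n k0 /= hc.
have := indepE hiI hk hp; rewrite /= h1 h2 /=.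
by move=> H; suff : false by []; apply: H; [lia|by []|case: (k == 1)].
Qed.

Lemma tok_first i : fstg i -> tri_tok i <> Some false.
Proof. by rewrite /tri_tok => ->; rewrite andbF; case: ifP. Qed.

Lemma tok_last i : i < I -> lstg i -> tri_tok i <> Some true.
Proof.
move=> hi hl; rewrite /tri_tok; case: ifP => // /negP h7; case: ifP => // h6 _.
have [q [hq e h]] := hf hi (leq0n b) (isT : 7 < 10).
move: e h; rewrite /rep /= hl andbF.
case: (q =P 7) => [->//|n7]; case: (q =P 6) => [->|n6] /=; last by move=> h; case: n7.
by case: (fstg i) h6 => //=; rewrite andbT => ->.
Qed.

Lemma tok_chain i : i.+1 < I -> ~~ lstg i -> tri_tok i = Some true -> tri_tok i.+1 <> Some false.
Proof.
move=> hi hl; rewrite /tri_tok; case: ifP => // h7; case: ifP => // h6 _.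
have h8 : s (vtx i 0 8).
  have [q [hq e h]] := hf (ltnW hi) (leq0n b) (isT : 7 < 10).
  move: e h; rewrite /rep /= hl andbT.
  case: (q =P 8) => [->//|n8]; case: (q =P 6) => [->|n6] /=; last by move=> ->; rewrite h7.
  by case: (fstg i) h6 => //=; rewrite andbT => ->.
case: ifP => // _; case: ifP => // /andP[h6' _] _.
have hp : pres (cidx i 1) 21 by rewrite presE //= hl.
have := indepE (ltnW hi) b0 hp; rewrite /= h8 h6' /= => H.
by suff : false by []; apply: H.
Qed.

End Sound.

(** *** From selected letters to tokens

  [rho i] and [gam j] count how far the signals of row [i] and column [j] are
  raised: the bits of a wire are numbered outwards from the diagonal, those of
  the cell [k] being [3 * k - 2], [3 * k - 1] and [3 * k], and the bits from the
  threshold on are set. *)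
Definition kpart (t : nat -> option bool) (rho gam : nat -> nat) (i k p : nat) : bool :=
  if k == 0 then
    if p == 7 then t i == None else if p == 6 then fstg i || (t i == Some false)
    else if p == 8 then lstg i || (t i == Some true) else true
  else
    let a := rho i <= 3 * k - 2 in let bb := rho i <= 3 * k - 1 in let h := rho i <= 3 * k in
    let va := gam (i + k) <= 3 * k - 2 in let vb := gam (i + k) <= 3 * k - 1 in
    let v := gam (i + k) <= 3 * k in
    nth false [:: ~~ a && ~~ va; ~~ a && va; a; bb && ~~ vb; bb && vb; ~~ bb; ~~ h; h; ~~ v; v] p.

Definition kst t rho gam : nat -> bool := fun u =>
  (u %% Q < 10) && kpart t rho gam (u %/ Q %/ b.+1) (u %/ Q %% b.+1) (u %% Q).

(** The implications along a wire point away from the diagonal, so a signal is raised from the far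
    end inwards. A letter counts as soon as one bit of one of its wires is set, that is, as soon as
    a threshold drops to [3 * b]; the threshold [(3 * b).+1] is silence. *)
Definition active (t : nat -> option bool) (rho gam : nat -> nat) i :=
  [|| t i == None, rho i <= 3 * b | gam i <= 3 * b].

Definition kvalid t rho gam := forall i, i < I ->
  [/\ (t i = None -> rho i <= 1 /\ gam i <= 1), (fstg i -> t i <> Some false),
      (lstg i -> t i <> Some true),
      (i.+1 < I -> ~~ lstg i -> t i = Some true -> t i.+1 <> Some false)
    & forall j, conf i j -> ~~ (active t rho gam i && active t rho gam j)].

Hypothesis confI : forall i j, conf i j -> j < I.
Hypothesis fst_lst : forall i, fstg i.+1 = lstg i.

Lemma vtx_div i k p : p < Q -> vtx i k p %/ Q = cidx i k.
Proof. by move=> h; rewrite /vtx divnMDl ?divn_small ?addn0 //; apply: leq_ltn_trans h. Qed.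
Lemma vtx_mod i k p : p < Q -> vtx i k p %% Q = p.
Proof. by move=> h; rewrite /vtx modnMDl modn_small. Qed.

Lemma kstE t rho gam i k p : k <= b -> p < 10 -> kst t rho gam (vtx i k p) = kpart t rho gam i k p.
Proof.
move=> hk hp; have hpQ : p < Q by apply: leq_trans hp Q10.
by rewrite /kst vtx_div // vtx_mod // cidx_div // cidx_mod // hp.
Qed.

Lemma kst_own t rho gam i k : 0 < k -> forall p q,
  (p, q) \in [:: (0,1); (0,2); (1,2); (3,4); (3,5); (4,5); (2,5); (6,7); (8,9); (3,6); (4,6); (1,8); (4,8)] ->
  ~~ (kpart t rho gam i k p && kpart t rho gam i k q).
Proof.
case: k => // k _ p q; rewrite !inE /kpart /=.
have l1 : 3 * k.+1 - 2 <= 3 * k.+1 - 1 by lia.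
have l2 : 3 * k.+1 - 1 <= 3 * k.+1 by lia.
move: (rho i) (gam _) (3 * k.+1) (3 * k.+1 - 1) (3 * k.+1 - 2) l1 l2 => x y c d e l1 l2.
by do ![case/orP]; move=> /eqP [-> ->] /=; lia.
Qed.

Lemma kst_indep t rho gam : kvalid t rho gam -> indep (kst t rho gam).
Proof.
move=> hv c e hc hp h1 h2.
have hi : c %/ b.+1 < I by rewrite ltn_divLR.
have hk : c %% b.+1 <= b by rewrite -ltnS ltn_mod.
have he := pres_dom hp; move: hp h1 h2.
have -> : c = cidx (c %/ b.+1) (c %% b.+1) by rewrite /cidx -divn_eq.
move: (c %/ b.+1) (c %% b.+1) hi hk he => i k hi hk he {c hc}.
rewrite presE // he andTb endsE // => /and5P[p17 p18 p19 p20 p21] h1 h2.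
have hb : 0 < b.+1 by [].
have low s p : p < 10 -> vtx (nb_i i s) (nb_k k s) p < ncell * Q -> s = Low -> i.+1 < I.
  move=> hp' hl es; rewrite es /= in hl.
  have hpQ : p < Q by apply: leq_trans hp' Q10.
  have : vtx i.+1 k.-1 p %/ Q < ncell by rewrite ltn_divLR //; lia.
  rewrite vtx_div // => hl'; have : cidx i.+1 k.-1 %/ b.+1 < I by rewrite ltn_divLR.
  by rewrite cidx_div //; lia.
have [v1 v2 v3 v4 v5] := hv i hi.
have e22 := dom_lt he.
case: (posnP k) => [k0|k0].
  subst k; move: he; rewrite /edge_dom /= => he.
  have [E|[E|E]] : e = 18 \/ e = 19 \/ e = 20 by lia.
  - subst e; rewrite !kstE //= /kpart /=; rewrite /= in p18.
    by rewrite (negPf p18); case: (t i) => [[]|].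
  - subst e; rewrite !kstE //= /kpart /=; rewrite /= in p19.
    by rewrite (negPf p19); case: (t i) => [[]|].
  - subst e; rewrite !kstE //= /kpart /=; rewrite /= in p20.
    by move: p20; rewrite negb_or => /andP[/negPf -> /negPf ->]; case: (t i) => [[]|].
have k1 : k.-1 <= b by lia.
have kz : (k == 0) = false by lia.
have left7 : kpart t rho gam i k.-1 7 -> rho i <= 3 * k - 2.
  rewrite /kpart; case: (k =P 1) => [->|nk] /=; first by move=> /eqP /v1[].
  by have -> : (k.-1 == 0) = false by [lia]; rewrite /=; lia.
have lowv : i.+1 < I -> kpart t rho gam i.+1 k.-1 (if k == 1 then 7 else 9) -> gam (i + k) <= 3 * k - 2.
  move=> hi1; rewrite /kpart; case: (k =P 1) => [->|nk] /=.
    by have [w1 _ _ _ _] := hv _ hi1; rewrite addn1 => /eqP /w1[].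
  have -> : (k.-1 == 0) = false by lia.
  by rewrite /= addSnnS prednK //; lia.
have leftL p : p < 10 -> kst t rho gam (vtx i k p) -> kst t rho gam (vtx i k.-1 7) ->
    p \in [:: 0; 1] -> False.
  move=> hp'; rewrite !kstE // => e1 /left7 e2; move: e1; rewrite /kpart kz !inE.
  by move=> e1 /orP[] /eqP E; move: e1; rewrite E /= e2.
have lowL p : p < 10 -> i.+1 < I -> kst t rho gam (vtx i k p) ->
    kst t rho gam (vtx i.+1 k.-1 (if k == 1 then 7 else 9)) -> p \in [:: 0; 3] -> False.
  move=> hp' hi1; rewrite (@kstE _ _ _ _ k p) // kstE //; last by case: (k == 1).
  move=> e1 /(lowv hi1) e2; move: e1; rewrite /kpart kz !inE => e1 /orP[] /eqP E; move: e1; rewrite E /=.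
    by rewrite e2 andbF.
  by rewrite (_ : gam (i + k) <= 3 * k - 1) ?andbF //; lia.
move: he; rewrite /edge_dom kz => he.
have own := @kst_own t rho gam i k k0.
have [E|[E|[E|[E|[E|[E|[E1 E]]]]]]] : e < 13 \/ e = 13 \/ e = 14 \/ e = 15 \/ e = 16 \/ e = 17
  \/ k = 1 /\ e = 21 by lia.
- clear p17 p18 p19 p20 p21 h1 h2 he e22.
  by do 13?[case: e E => [|e] E; first by rewrite /= !kstE //; apply: own].
- by subst e; apply/negP => /andP[/= e1 e2]; apply: (leftL 0).
- by subst e; apply/negP => /andP[/= e1 e2]; apply: (leftL 1).
- subst e; apply/negP => /andP[/= e1 e2]; apply: (lowL 0) => //.
  by apply: (low Low _ _ h1) => //=; case: (k == 1).
- subst e; apply/negP => /andP[/= e1 e2]; apply: (lowL 3) => //.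
  by apply: (low Low _ _ h1) => //=; case: (k == 1).
- subst e; have hi1 : i.+1 < I by apply: (low Low _ _ h2) => //=; case: (k == 1).
  apply/negP => /andP[/= e1 e2]; have /negP := v5 _ (p17 : conf i (i + k)); apply.
  rewrite kstE // in e1; rewrite kstE // in e2; last by case: (k == 1).
  rewrite /active; apply/andP; split.
    by have := left7 e1; move=> h; apply/or3P; constructor 2; lia.
  by have := lowv hi1 e2; move=> h; apply/or3P; constructor 3; lia.
- subst e k; rewrite /= in h1 h2 p21 *.
  have hi1 : i.+1 < I by apply: (low Low _ _ h2).
  rewrite !kstE // /kpart /=; apply/negP => /andP[].
  rewrite fst_lst (negPf p21) /= => /eqP e1.
  by move/eqP => e2; apply: (v4 hi1 p21 e1).
Qed.

Lemma kst_full t rho gam : kvalid t rho gam -> full (kst t rho gam).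
Proof.
move=> hv i k p hi hk hp; have [v1 v2 v3 _ _] := hv i hi.
suff [q [hq e h]] : exists q, [/\ q < 10, rep i k q = rep i k p & kpart t rho gam i k q].
  by exists q; split=> //; rewrite kstE.
rewrite /kpart /rep; case: (k =P 0) => [k0|k0].
  case E: ((p == 6) && ~~ fstg i || (p == 8) && ~~ lstg i || (p == 7)).
    have -> : (if (p == 6) && ~~ fstg i then 7 else if (p == 8) && ~~ lstg i then 7 else p) = 7.
      move: E; case: (_ && _) => //=; case: (_ && _) => //= /eqP //.
    case Et: (t i) v2 v3 => [[]|] v2 v3.
    + exists 8; rewrite /= orbT; split=> //; case El: (lstg i) v3 => //=.
      by move=> /(_ isT).
    + exists 6; rewrite /= orbT; split=> //; case El: (fstg i) v2 => //=.
      by move=> /(_ isT).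
    + by exists 7.
  exists p; split=> //; move: E; case: (p =P 7) => [->|n7]; first by rewrite orbT.
  rewrite orbF; case: (p =P 6) => [_|_] /=; first by case: (fstg i).
  by case: (p =P 8) => //= _; case: (lstg i).
set x := rho i <= _; set y := rho i <= _; set z := rho i <= _.
set u := gam _ <= _; set v := gam _ <= _; set w := gam _ <= _.
have [|h3] := ltnP p 3; last have [|h6] := ltnP p 6; last have [|h8] := ltnP p 8.
- by move=> _; case: x; [exists 2|case: u; [exists 1|exists 0]].
- by move=> h; case: y; [case: v; [exists 4|exists 3]|exists 5].
- by move=> h; case: z; [exists 7|exists 6].
- by case: w; [exists 9|exists 8].
Qed.

(** Lowering a threshold by one sets a single bit of the wire, and each of the three bits in a cell
    is read by one group: the first triangle, the second triangle, the outgoing wire. *)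
Lemma kpart_rho t rho gam i q i' k p : 0 < k -> p < 10 -> rho i = q.+1 ->
  kpart t (upd rho i q) gam i' k p != kpart t rho gam i' k p ->
  i' = i /\ ((q == 3 * k - 2) && (p < 3) \/ (q == 3 * k - 1) && (3 <= p < 6) \/ (q == 3 * k) && (6 <= p < 8)).
Proof.
move=> k0 hp hr; rewrite /kpart -[k == 0]negbK -lt0n k0 /= /upd.
case: (i' =P i) => [->|_]; last by rewrite eqxx.
rewrite hr; have h1 : 3 * k - 2 < 3 * k - 1 by lia.
have h2 : 3 * k - 1 < 3 * k by lia.
move: (3 * k - 2) (3 * k - 1) (3 * k) h1 h2 => x y z h1 h2.
move=> H; split=> //; move: H.
by do 10?[case: p hp => [|p] hp //=]; rewrite ?eqxx //; lia.
Qed.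

Lemma kpart_gam t rho gam j q i' k p : 0 < k -> p < 10 -> gam j = q.+1 ->
  kpart t rho (upd gam j q) i' k p != kpart t rho gam i' k p ->
  i' + k = j /\ ((q == 3 * k - 2) && (p < 3) \/ (q == 3 * k - 1) && (3 <= p < 6) \/ (q == 3 * k) && (8 <= p)).
Proof.
move=> k0 hp hr; rewrite /kpart -[k == 0]negbK -lt0n k0 /= /upd.
case: (i' + k =P j) => [->|_]; last by rewrite eqxx.
rewrite hr; have h1 : 3 * k - 2 < 3 * k - 1 by lia.
have h2 : 3 * k - 1 < 3 * k by lia.
move: (3 * k - 2) (3 * k - 1) (3 * k) h1 h2 => x y z h1 h2.
move=> H; split=> //; move: H.
by do 10?[case: p hp => [|p] hp //=]; rewrite ?eqxx //; lia.
Qed.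

Lemma rep_adj i k p q : i < I -> k <= b -> p < 10 -> q < 10 -> p < q -> rep i k p = rep i k q ->
  exists2 e, e < 22 & pres (cidx i k) e /\ ends (cidx i k) e = (vtx i k p, vtx i k q).
Proof.
move=> hi hk hp hq pq; rewrite /rep; case: (posnP k) => [k0|k0].
  subst k => /= E.
  have [[e1 e2 e3]|[[e1 e2 e3 e4]|[e1 e2 e3]]] : [/\ p = 6, q = 7 & ~~ fstg i] \/ [/\ p = 6, q = 8, ~~ fstg i & ~~ lstg i] \/
      [/\ p = 7, q = 8 & ~~ lstg i].
    move: E; case: (fstg i); case: (lstg i); rewrite ?andbT ?andbF;
    (do 10?[case: p hp pq => [|p] hp pq //]); (do 10?[case: q hq pq => [|q] hq pq //=]) => _; by [left|right; left|right; right].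
  - by exists 18; rewrite // presE // endsE // e1 e2 e3.
  - by exists 20; rewrite // presE // endsE // e1 e2 negb_or e3 e4.
  - by exists 19; rewrite // presE // endsE // e1 e2 e3.
move=> e; have kz : (k == 0) = false by lia.
have [e' [h1 h2 h3]] : exists e', [/\ e' < 13, (edge_ends (k == 1) e') = ((Own, p), (Own, q)) & True].
  move: e; do 10?[case: p hp pq => [|p] hp pq //=]; do 10?[case: q hq pq => [|q] hq pq //=] => _.
  - by exists 0. - by exists 1. - by exists 2. - by exists 3. - by exists 4. - by exists 5. - by exists 7.
  by exists 8.
have hd : edge_dom k e' by rewrite /edge_dom kz (ltn_trans h1).
exists e'; first exact: ltn_trans h1 _.
split; last by rewrite endsE // h2.
rewrite presE // hd /=; clear h2; do 13?[case: e' h1 hd => [|e'] h1 hd //].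
Qed.

Lemma ends_neq c e : c < ncell -> pres c e -> (ends c e).1 <> (ends c e).2.
Proof.
move=> hc hp; have hk : c %% b.+1 <= b by rewrite -ltnS ltn_mod.
have he := pres_dom hp; have e22 := dom_lt he.
have -> : c = cidx (c %/ b.+1) (c %% b.+1) by rewrite /cidx -divn_eq.
move: (c %/ b.+1) (c %% b.+1) hk he => i k hk he.
rewrite endsE //= => E.
have hq s : s < 10 -> s < Q by move=> h; apply: leq_trans h Q10.
have hm s s' : vtx (nb_i i (edge_ends (k == 1) e).1.1) (nb_k k (edge_ends (k == 1) e).1.1) s =
   vtx (nb_i i (edge_ends (k == 1) e).2.1) (nb_k k (edge_ends (k == 1) e).2.1) s' ->
   s < 10 -> s' < 10 -> s = s'.
  by move=> E' h h'; have := congr1 (modn^~ Q) E'; rewrite !vtx_mod //; apply: hq.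
(* Only type 17 at [k = 1] joins two parts with the same number, and these lie in different rows. *)
have := hm _ _ E; case: (e =P 17) => [e17|n17].
  subst e; move: E; case: (k =P 1) => [->|_] /= E; last by move=> /(_ isT isT).
  have := congr1 (divn^~ Q) E; rewrite !vtx_div ?hq //.
  by move=> /(congr1 (divn^~ b.+1)); rewrite !cidx_div //; lia.
clear E hm he hp; case: (k == 1); do 22?[case: e e22 n17 => [|e] e22 n17 //=]; by move=> /(_ isT isT).
Qed.

End Grid.

(** * Covers of the grid graph *)

Section Graph.
Variables (P D : nat) (R : nat -> nat -> nat -> bool).
Hypothesis D0 : 0 < D.

Definition gconf i j := (j < P * D) && conf D R i j.
Definition gfst i := i %% D == 0.
Definition glst i := i.+1 %% D == 0.

Local Notation I := (P * D).
Local Notation b := (2 * D).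
Local Notation gpres := (pres b gconf gfst glst).
Local Notation gends := (ends b 32).
Local Notation nc := (ncell I b).
Local Notation V := (vtx b 32).

Lemma b0 : 0 < b. Proof. by rewrite muln_gt0. Qed.

(** The factor 32 stands for the ten parts of a cell and one extra vertex for each of the 22 edge
    types. *)
Definition gord := nc * 32.

(** The extension has a triangle on every edge; [j] selects one of its sides. *)
Definition sege c e j : nat * nat :=
  nth (gends c e) [:: gends c e; ((gends c e).1, c * 32 + 10 + e); (c * 32 + 10 + e, (gends c e).2)] j.

Definition gseg (ext : bool) c e j :=
  [&& c < nc, gpres c e, (gends c e).1 < gord, (gends c e).2 < gord, e < 22, j < 3 & ext || (j == 0)].

Definition gadj ext u v := has (fun c => has (fun e => has (fun j =>
  gseg ext c e j && ((sege c e j == (u, v)) || (sege c e j == (v, u)))) (iota 0 3)) (iota 0 22)) (iota 0 nc).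

Lemma gadjP ext u v : reflect (exists c e j, gseg ext c e j /\ (sege c e j = (u, v) \/ sege c e j = (v, u)))
  (gadj ext u v).
Proof.
apply: (iffP hasP) => [[c _ /hasP[e _ /hasP[j _ /andP[h1 /orP[]/eqP h2]]]]|[c [e [j [h1 h2]]]]].
- by exists c, e, j; split=> //; left.
- by exists c, e, j; split=> //; right.
have /and5P[hc _ _ _ /and3P[he hj _]] := h1.
exists c; rewrite ?mem_iota //; apply/hasP; exists e; rewrite ?mem_iota //.
apply/hasP; exists j; rewrite ?mem_iota // h1 /=.
by case: h2 => ->; rewrite eqxx ?orbT.
Qed.

Lemma ends_mod c e : gpres c e -> (gends c e).1 %% 32 < 10 /\ (gends c e).2 %% 32 < 10.
Proof.
move=> hp; have := dom_lt (pres_dom hp); rewrite /ends => he.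
suff [h1 h2] : (edge_ends (c %% b.+1 == 1) e).1.2 < 10 /\ (edge_ends (c %% b.+1 == 1) e).2.2 < 10.
  by split; rewrite /= modnMDl modn_small //; [apply: ltn_trans h1 _|apply: ltn_trans h2 _].
by clear hp; case: (_ == 1); do 22?[case: e he => [|e] he //].
Qed.

Lemma wmod c e : e < 22 -> (c * 32 + 10 + e) %% 32 = 10 + e.
Proof. by move=> h; rewrite -addnA modnMDl modn_small //; lia. Qed.

Lemma sege_neq ext c e j : gseg ext c e j -> (sege c e j).1 <> (sege c e j).2.
Proof.
case/and5P=> hc hp h1 h2 /and3P[he hj _].
have [m1 m2] := ends_mod hp; have := wmod c he; have n := ends_neq b0 (isT : 10 <= 32) hc hp.
rewrite /sege; move: (gends c e) m1 m2 n {h1 h2} => [x y] /= m1 m2 n; move: hj; case: j => [|[|[|j]]] //= _ hw E.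
- by move: m1; rewrite E hw.
- by move: m2; rewrite -E hw.
Qed.

Lemma gadj_sym ext (u v : nat) : gadj ext u v = gadj ext v u.
Proof.
have H x y : gadj ext x y -> gadj ext y x.
  by move=> /gadjP[c [e [j [h1 h2]]]]; apply/gadjP; exists c, e, j; split=> //; case: h2; [right|left].
by apply/idP/idP; apply: H.
Qed.

Lemma gadj_irr ext u : gadj ext u u = false.
Proof. by apply/negP => /gadjP[c [e [j [h1 [] h2]]]]; have := sege_neq h1; rewrite h2. Qed.

Definition ggraph ext : sgraph 'I_gord :=
  @SGraph 'I_gord (fun u v => gadj ext u v) (fun u v => gadj_sym ext u v) (fun u => gadj_irr ext u).

Local Notation G := (ggraph false).
Implicit Types (X Y : {set 'I_gord}).

Definition s_of X (u : nat) : bool := if insub u is Some u' then u' \notin X else false.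

Lemma s_ofE X (u : 'I_gord) : s_of X u = (u \notin X).
Proof. by rewrite /s_of valK. Qed.

Lemma s_of_out X u : gord <= u -> s_of X u = false.
Proof. by move=> h; rewrite /s_of insubF // ltnNge h. Qed.

Lemma vc_indep X : vertex_cover G X <-> indep I b gconf gfst glst 32 (s_of X).
Proof.
split=> [h c e hc hp h1 h2|h u v /gadjP[c [e [j [/and5P[hc hp h1 h2 /and3P[he hj /= /eqP j0]] E]]]]].
  have := h (Ordinal h1) (Ordinal h2).
  have -> : G (Ordinal h1) (Ordinal h2).
    apply/gadjP; exists c, e, 0; split; last by left; rewrite /sege /=; apply: surjective_pairing.
    by rewrite /gseg hc hp h1 h2 (dom_lt (pres_dom hp)).
  by move=> /(_ isT); rewrite -[_.1]/(val (Ordinal h1)) -[_.2]/(val (Ordinal h2)) !s_ofE negb_and !negbK.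
have := h c e hc hp h1 h2; move: E; rewrite j0 /sege; move: (gends c e) => xy E.
by case: E => /= -> /=; rewrite !s_ofE negb_and !negbK // orbC.
Qed.

(** An extra vertex is a group by itself; a minimum cover, which leaves out a vertex of every group,
    thus contains no extra vertex. *)
Definition grepn (u : nat) : nat :=
  if u %% 32 < 10 then V (u %/ 32 %/ b.+1) (u %/ 32 %% b.+1)
    (rep gfst glst (u %/ 32 %/ b.+1) (u %/ 32 %% b.+1) (u %% 32)) else u.

Lemma vtxP (u : 'I_gord) : exists i k p, [/\ i < I, k <= b, p < 32 & val u = V i k p].
Proof.
exists (u %/ 32 %/ b.+1), (u %/ 32 %% b.+1), (u %% 32).
have h1 : u %/ 32 < nc by rewrite ltn_divLR //; apply: ltn_ord.
have h2 : u %/ 32 %/ b.+1 < I by rewrite ltn_divLR.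
split=> //; first by rewrite -ltnS ltn_mod.
  by rewrite ltn_mod.
by rewrite /vtx /cidx -divn_eq -divn_eq.
Qed.

Lemma rep_lt i k p : p < 10 -> rep gfst glst i k p < 10.
Proof. by move=> h; rewrite /rep; do ?case: ifP => //. Qed.

Lemma grepnE i k p : k <= b -> p < 10 -> grepn (V i k p) = V i k (rep gfst glst i k p).
Proof.
move=> hk hp; have hp' : p < 32 by apply: ltn_trans hp _.
by rewrite /grepn vtx_mod // vtx_div // cidx_div // cidx_mod // hp.
Qed.

Lemma grepn_lt (u : 'I_gord) : grepn u < gord.
Proof.
have [i [k [p [hi hk hp ->]]]] := vtxP u; have [hp'|hp'] := ltnP p 10.
  by rewrite grepnE //; apply: vtx_lt => //; apply: ltn_trans (rep_lt _ _ hp') _.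
by rewrite /grepn vtx_mod // [p < 10]ltnNge hp' /=; apply: vtx_lt.
Qed.

Definition grep (u : 'I_gord) : 'I_gord := Ordinal (grepn_lt u).

Lemma vtx_inj i k p i' k' p' : k <= b -> k' <= b -> p < 32 -> p' < 32 -> V i k p = V i' k' p' ->
  [/\ i = i', k = k' & p = p'].
Proof.
move=> hk hk' hp hp' E.
have := congr1 (modn^~ 32) E; rewrite !vtx_mod // => ->.
have := congr1 (divn^~ 32) E; rewrite !vtx_div // => E'.
have := congr1 (divn^~ b.+1) E'; rewrite !cidx_div // => ->.
by have := congr1 (modn^~ b.+1) E'; rewrite !cidx_mod // => ->.
Qed.

Lemma grep_same (u v : 'I_gord) : grep u = grep v -> u <> v -> exists i k p q,
  [/\ i < I, k <= b, p < 10 & q < 10] /\ [/\ val u = V i k p, val v = V i k q & rep gfst glst i k p = rep gfst glst i k q].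
Proof.
move=> /(congr1 val) /= E n.
have [i [k [p [hi hk hp eu]]]] := vtxP u; have [i' [k' [p' [hi' hk' hp' ev]]]] := vtxP v.
move: E; rewrite eu ev; have [hp1|hp1] := ltnP p 10; have [hp1'|hp1'] := ltnP p' 10.
- rewrite !grepnE // => /vtx_inj[] //; try by apply: ltn_trans (rep_lt _ _ _) _.
  by move=> ? ?; subst i' k' => e; exists i, k, p, p'.
- rewrite grepnE // /grepn vtx_mod // [p' < 10]ltnNge hp1' /= => /vtx_inj[] //.
    by apply: ltn_trans (rep_lt _ _ _) _.
  by move=> _ _ e; have := rep_lt i k hp1; rewrite e ltnNge hp1'.
- rewrite (grepnE _ hk') // /grepn vtx_mod // [p < 10]ltnNge hp1 /= => /vtx_inj[] //.
    by apply: ltn_trans (rep_lt _ _ _) _.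
  by move=> _ _ e; have := rep_lt i' k' hp1'; rewrite -e ltnNge hp1.
- rewrite /grepn !vtx_mod // ltnNge hp1 /= ltnNge hp1' /= -eu -ev => /val_inj e.
  by case: n.
Qed.

Lemma grep_adj (u v : 'I_gord) : grep u = grep v -> u <> v -> G u v.
Proof.
move=> E n; have [i [k [p [q [[hi hk hp hq] [eu ev er]]]]]] := grep_same E n.
have npq : p <> q by move=> e; apply: n; apply: val_inj; rewrite eu ev e.
wlog lt : u v p q E n hp hq eu ev er npq / p < q.
  move=> W; have [pq|qp|//] := ltngtP p q; first by apply: (W u v p q).
  by rewrite [G u v]adj_sym; apply: (W v u q p) => //; [move=> e; apply: n|move=> e; apply: npq].
have [e he [hp' Ee]] := rep_adj gconf b0 (isT : 10 <= 32) hi hk hp hq lt er.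
have hcl := cidx_lt hi hk.
apply/gadjP; exists (cidx b i k), e, 0; rewrite /sege /= Ee -eu -ev; split; last by left.
by rewrite /gseg hcl hp' Ee /= -eu -ev !ltn_ord he.
Qed.

Definition kappa := gord - #|[set grep u | u in [set: 'I_gord]]|.

Lemma card_compl X : #|X| + #|~: X| = gord.
Proof. by rewrite cardsC card_ord. Qed.

Lemma grep_inj X : vertex_cover G X -> {in ~: X &, injective grep}.
Proof.
move=> h u v; rewrite !inE => hu hv E; apply/eqP/negPn/negP => /eqP n.
by have := h u v (grep_adj E n); rewrite (negPf hu) (negPf hv).
Qed.

(** Groups are cliques, so a cover leaves out at most one vertex of each. *)
Lemma vc_min X : vertex_cover G X -> kappa <= #|X|.
Proof.
move=> /grep_inj /card_in_imset h; rewrite /kappa; have := card_compl X; have := max_card [set grep u | u in [set: 'I_gord]]; rewrite card_ord -h.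
have : #|grep @: (~: X)| <= #|[set grep u | u in [set: 'I_gord]]| by apply/subset_leq_card/imsetS/subsetT.
by move: #|_ @: ~: X| #|_ @: [set: _]| #|X| => x y z; lia.
Qed.

Lemma vc_fullP X : vertex_cover G X -> (#|X| = kappa <-> forall u, exists2 v, v \notin X & grep v = grep u).
Proof.
move=> h; have hi := card_in_imset (grep_inj h); have hc := card_compl X.
have hs : grep @: (~: X) \subset [set grep u | u in [set: 'I_gord]] by apply/imsetS/subsetT.
have hle : #|[set grep u | u in [set: 'I_gord]]| <= gord by rewrite -[X in _ <= X]card_ord max_card.
split=> [E u|E].
  have /eqP E' : grep @: (~: X) == [set grep u | u in [set: 'I_gord]].
    by rewrite eqEcard hs hi; rewrite /kappa in E; lia.
  have : grep u \in [set grep u | u in [set: 'I_gord]] by apply: imset_f.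
  by rewrite -E' => /imsetP[v]; rewrite inE => h1 h2; exists v.
have E' : grep @: (~: X) = [set grep u | u in [set: 'I_gord]].
  apply/eqP; rewrite eqEsubset hs; apply/subsetP => _ /imsetP[u _ ->].
  by have [v hv <-] := E u; apply: imset_f; rewrite inE.
by rewrite /kappa -E' hi; lia.
Qed.

Definition mincover X := vertex_cover G X /\ #|X| = kappa.

Lemma mincover_full X : mincover X -> full I b gfst glst 32 (s_of X).
Proof.
move=> [h /(vc_fullP h) E] i k p hi hk hp.
have hp' : p < 32 by apply: ltn_trans hp _.
have [v hv ev] := E (Ordinal (vtx_lt hi hk hp')).
set w := Ordinal _ in ev; case: (v =P w) => [e|n].
  by rewrite e in hv; exists p; split=> //; rewrite -[V i k p]/(val w) s_ofE.
have [i' [k' [q [q' [[hi' hk' hq hq'] [e1 /= e2 e3]]]]]] := grep_same ev n.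
have [] := vtx_inj hk hk' hp' _ e2; first by apply: ltn_trans hq' _.
move=> ? ? ?; subst i' k' q'; exists q; split=> //.
by rewrite -e1 s_ofE.
Qed.

Definition tok X := tri_tok b gfst 32 (s_of X).

(** Conflicting letters stand at consecutive positions, so their indices differ by less than
    [2 * D]. This is where the constant width of the strip comes from. *)
Lemma conf_lt i j : conf D R i j -> exists k, j = i + k /\ 0 < k <= b.
Proof.
case/andP=> /eqP h _; exists (j - i).
have h1 := divn_eq i D; have h2 := divn_eq j D.
have h3 : i %% D < D by rewrite ltn_mod.
have h4 : j %% D < D by rewrite ltn_mod.
by rewrite h mulSn in h2; lia.
Qed.

Lemma tok_valid X : mincover X -> tri_valid P D R (tok X).
Proof.
move=> h i hi; have hf := mincover_full h; have [/vc_indep hv _] := h; split.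
- by move=> e; apply: (tok_first (i := i) e).
- by move=> e; exact: (tok_last hf hi).
- by move=> h1 h2; exact: (tok_chain b0 (isT : 10 <= 32) hv hf h1 h2).
move=> j hj hc; have [k [ej hk]] := conf_lt hc; subst j.
rewrite /tok /tri_tok; case h7: (s_of X (V i 0 7)); last by case: (s_of _ _ && _).
case h7': (s_of X (V (i + k) 0 7)) => _; last by case: (s_of _ _ && _).
have hg : gconf i (i + k) by rewrite /gconf hj.
by have := tok_conf b0 (isT : 10 <= 32) hv hf hj hk hg h7; rewrite h7'.
Qed.

(** The group of [v] needs a vertex outside [Y]. That vertex cannot have been outside [X], where [v]
    was the only one of its group, so it is [u]. *)
Lemma TJ_same X Y u v : mincover X -> mincover Y -> u \in X -> v \notin X -> Y = v |: (X :\ u) ->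
  grep u = grep v.
Proof.
move=> [hX _] [hY cY] hu hv EY; have [w hw ew] := (vc_fullP hY).1 cY v.
move: hw; rewrite EY !inE negb_or negb_and negbK => /andP[nv /orP[/eqP <- //|wX]].
have := grep_inj hX; move=> /(_ w v); rewrite !inE wX hv => /(_ isT isT ew) e.
by rewrite e eqxx in nv.
Qed.

Lemma tok_step X Y : mincover X -> mincover Y -> TJ_step X Y ->
  tok X = tok Y \/ tri_step P D R (tok X) (tok Y).
Proof.
move=> hX hY /existsP[u /existsP[v /and3P[hu hv /eqP EY]]].
have E := TJ_same hX hY hu hv EY.
have n : u <> v by move=> e; rewrite -e hu in hv.
have [i [k [p [q [[hi hk hp hq] [eu ev er]]]]]] := grep_same E n.
right; split; try exact: tok_valid.
exists i, (tok Y i); split=> //; apply: functional_extensionality => j; rewrite /upd.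
case: (j =P i) => [-> //|nj]; rewrite /tok /tri_tok.
have H r : r < 10 -> s_of Y (V j 0 r) = s_of X (V j 0 r).
  move=> hr; have hr' : r < 32 by apply: ltn_trans hr _.
  have [h|h] := ltnP (V j 0 r) gord; last by rewrite !s_of_out.
  rewrite -[V j 0 r]/(val (Ordinal h)) !s_ofE EY !inE.
  have -> : (Ordinal h == v) = false.
    apply/eqP => /(congr1 val) /= e; rewrite ev in e.
    by have [] := vtx_inj (leq0n _) hk hr' (ltn_trans hq (isT : 10 < 32)) e.
  have -> : (Ordinal h == u) = false.
    apply/eqP => /(congr1 val) /= e; rewrite eu in e.
    by have [] := vtx_inj (leq0n _) hk hr' (ltn_trans hp (isT : 10 < 32)) e.
  by [].
by rewrite !H.
Qed.

(** ** Sliding tokens along a step *)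

Definition Kset t rho gam : {set 'I_gord} :=
  [set u : 'I_gord | (u %% 32 < 10) && ~~ kst b gfst glst 32 t rho gam u].

Local Notation kval := (kvalid I b gconf gfst glst).
Local Notation kpt := (kpart gfst glst).

Lemma fst_lst i : gfst i.+1 = glst i. Proof. by []. Qed.

Lemma Kset_in t rho gam (u : 'I_gord) i k p : val u = V i k p -> k <= b -> p < 32 ->
  (u \in Kset t rho gam) = (p < 10) && ~~ kpt t rho gam i k p.
Proof.
move=> e hk hp; rewrite inE e vtx_mod //; case: (ltnP p 10) => //= hp'.
by rewrite kstE.
Qed.

Lemma Kset_s t rho gam u : u < gord -> u %% 32 < 10 -> s_of (Kset t rho gam) u = kst b gfst glst 32 t rho gam u.
Proof. by move=> h hm; rewrite -[u]/(val (Ordinal h)) s_ofE inE /= hm /= negbK. Qed.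

Lemma Kset_min t rho gam : kval t rho gam -> mincover (Kset t rho gam).
Proof.
move=> h; have hv : vertex_cover G (Kset t rho gam).
  apply/vc_indep => c e hc hp h1 h2; have [m1 m2] := ends_mod hp.
  by rewrite !Kset_s //; exact: (kst_indep b0 (isT : 10 <= 32) fst_lst h hc hp h1 h2).
split=> //; apply/(vc_fullP hv) => u.
have [i [k [p [hi hk hp eu]]]] := vtxP u.
have [hp'|hp'] := ltnP p 10; last first.
  by exists u => //; rewrite (Kset_in _ _ _ eu hk hp) ltnNge hp'.
have [q [hq er hs]] := kst_full (isT : 10 <= 32) h hi hk hp'.
have hq' : q < 32 by apply: ltn_trans hq _.
exists (Ordinal (vtx_lt hi hk hq')); first by rewrite inE /= hs andbF.
by apply: val_inj; rewrite /= eu !grepnE // er.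
Qed.

Definition slide X Y := [/\ mincover X, mincover Y & TS_step G X Y].

Lemma slide_sym X Y : slide X Y -> slide Y X.
Proof.
move=> [hX hY /existsP[u /existsP[v /and4P[hu hv huv /eqP e]]]]; split=> //.
apply/existsP; exists v; apply/existsP; exists u.
have n : u != v by apply/eqP => e'; rewrite -e' hu in hv.
apply/and4P; split; rewrite ?e ?inE ?eqxx ?(negPf n) //; first by rewrite adj_sym.
apply/eqP/setP => w; rewrite !inE.
have [->|nw] := eqVneq w u; first by rewrite hu.
by have [->|] := eqVneq w v => //=; rewrite (negPf hv).
Qed.

(** Each of the two covers leaves out exactly one vertex of the group [r]. As a group is a clique,
    these two vertices are adjacent and exchanging them is a slide. *)
Lemma slide_group X Y r : mincover X -> mincover Y -> (forall u, grep u != r -> (u \in X) = (u \in Y)) ->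
  star slide X Y.
Proof.
move=> hX hY h; have [->|n] := eqVneq X Y; first exact: star0.
have [u hu] : exists u, (u \in X) != (u \in Y).
  apply/existsP; apply: contraNT n => /existsPn n; apply/eqP/setP => w.
  by apply/eqP; rewrite -[_ == _]negbK; apply: n.
have ru : grep u = r by apply/eqP; apply: contraNT hu => /h ->.
have [vX cX] := hX; have [vY cY] := hY.
have [x hx ex] := (vc_fullP vX).1 cX u; have [y hy ey] := (vc_fullP vY).1 cY u.
rewrite ru in ex ey.
have uX w : grep w = r -> (w \in X) = (w != x).
  move=> e; have [->|nw] := eqVneq w x; first by rewrite (negPf hx).
  apply/negPn/negP => hw; case/eqP: nw; apply: (grep_inj vX); rewrite ?inE // e ex //.
have uY w : grep w = r -> (w \in Y) = (w != y).
  move=> e; have [->|nw] := eqVneq w y; first by rewrite (negPf hy).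
  apply/negPn/negP => hw; case/eqP: nw; apply: (grep_inj vY); rewrite ?inE // e ey //.
have nxy : y != x by apply: contraNneq hu => e; rewrite uX // uY // e.
apply: star1; split=> //; apply/existsP; exists y; apply/existsP; exists x.
apply/and4P; split=> //; [by rewrite uX|by apply: grep_adj; [rewrite ex ey|apply/eqP]|].
apply/eqP/setP => w; rewrite !inE.
have [e|e] := eqVneq (grep w) r; last first.
  rewrite -(h w e); have [e'|_] := eqVneq w x; first by rewrite e' ex eqxx in e.
  by have [e'|_] := eqVneq w y; first by rewrite e' ey eqxx in e.
rewrite uX // uY //; have [->|] := eqVneq w x; first by rewrite eq_sym nxy.
by rewrite andbT.
Qed.

Lemma slide_k t rho gam t' rho' gam' i k r : kval t rho gam -> kval t' rho' gam' -> i < I -> k <= b -> r < 10 ->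
  (forall i' k' p, i' < I -> k' <= b -> p < 10 -> kpt t' rho' gam' i' k' p != kpt t rho gam i' k' p ->
    [/\ i' = i, k' = k & rep gfst glst i' k' p = r]) ->
  star slide (Kset t rho gam) (Kset t' rho' gam').
Proof.
move=> h h' hi hk hr H; have hr' : r < 32 by apply: ltn_trans hr _.
apply: (@slide_group _ _ (Ordinal (vtx_lt hi hk hr'))); try exact: Kset_min.
move=> u; have [i' [k' [p [hi' hk' hp eu]]]] := vtxP u.
rewrite !(Kset_in _ _ _ eu) //; case: (ltnP p 10) => //= hp' n.
case: (eqVneq (kpt t' rho' gam' i' k' p) (kpt t rho gam i' k' p)) => [-> //|/H[] // e1 e2 e3].
by case/eqP: n; apply: val_inj; rewrite /= eu grepnE // e3 e1 e2.
Qed.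

Lemma slide_t t rho gam i v : i < I -> kval t rho gam -> kval (upd t i v) rho gam ->
  star slide (Kset t rho gam) (Kset (upd t i v) rho gam).
Proof.
move=> hi h h'.
have K k p i' : kpt (upd t i v) rho gam i' k p != kpt t rho gam i' k p -> i' = i /\ k = 0.
  rewrite /kpart /upd; case: (i' =P i) => [->|_]; last by rewrite eqxx.
  by case: (k =P 0) => // _; rewrite eqxx.
apply: (@slide_k _ _ _ _ _ _ i 0 7) => // i' k p hi' hk hp n.
have [? ?] := K _ _ _ n; subst i' k; split=> //; move: n.
rewrite /kpart /rep /= /upd eqxx.
case: (p =P 7) => [->//|_]; case: (p =P 6) => [->|_] /=; first by case: (gfst i); rewrite ?eqxx.
by case: (p =P 8) => [->|_]; [case: (glst i); rewrite ?eqxx|rewrite eqxx].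
Qed.

Lemma group_index q : 0 < q -> q <= 3 * b -> exists k, [/\ 0 < k, k <= b &
   [\/ q = 3 * k - 2, q = 3 * k - 1 | q = 3 * k]].
Proof.
move=> h0 h; exists ((q + 2) %/ 3); have := divn_eq (q + 2) 3.
have : (q + 2) %% 3 < 3 by rewrite ltn_mod.
move: ((q + 2) %/ 3) ((q+2) %% 3) => x y hy e.
split; [lia|lia|]. 
case: y hy e => [|[|[|y]]] // _ e; [constructor 1|constructor 2|constructor 3]; lia.
Qed.

Lemma slide_rho t rho gam i q : i < I -> 0 < q -> q <= 3 * b -> rho i = q.+1 -> kval t rho gam ->
  kval t (upd rho i q) gam -> star slide (Kset t rho gam) (Kset t (upd rho i q) gam).
Proof.
move=> hi q0 hq e h h'; have [k [k0 hk hE]] := group_index q0 hq.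
pose r := if q == 3 * k - 2 then 2 else if q == 3 * k - 1 then 5 else 6.
apply: (@slide_k _ _ _ _ _ _ i k r) => //; first by rewrite /r; do ?case: ifP.
move=> i' k' p hi' hk' hp; case: (posnP k') => [->|k0']; first by rewrite /kpart /= eqxx.
move=> /(kpart_rho b0 (isT : 10 <= 32) k0' hp e) [-> H].
have ek : k' = k by case: hE H => -> H; lia.
split=> //; subst k'; rewrite /r /rep -[k == 0]negbK -lt0n k0 /=.
by case: H => [/andP[/eqP -> h1]|[/andP[/eqP -> h1]|/andP[/eqP -> h1]]]; do ?case: ifP => //; lia.
Qed.

Lemma slide_gam t rho gam j q : j < I -> 0 < q -> q <= 3 * b -> gam j = q.+1 -> kval t rho gam ->
  kval t rho (upd gam j q) -> star slide (Kset t rho gam) (Kset t rho (upd gam j q)).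
Proof.
move=> hj q0 hq e h h'; have [k [k0 hk hE]] := group_index q0 hq.
pose r := if q == 3 * k - 2 then 2 else if q == 3 * k - 1 then 5 else 8.
have [hkj|hkj] := leqP k j.
  apply: (@slide_k _ _ _ _ _ _ (j - k) k r) => //; [lia|by rewrite /r; do ?case: ifP|].
  move=> i' k' p hi' hk' hp; case: (posnP k') => [->|k0']; first by rewrite /kpart /= eqxx.
  move=> /(kpart_gam b0 (isT : 10 <= 32) k0' hp e) [ej H].
  have ek : k' = k by case: hE H => -> H; lia.
  split; [lia|by []|]; subst k'; rewrite /r /rep -[k == 0]negbK -lt0n k0 /=.
  by case: H => [/andP[/eqP -> h1]|[/andP[/eqP -> h1]|/andP[/eqP -> h1]]]; do ?case: ifP => //; lia.
(* Here the column has left the grid at the top before distance [k], so no vertex changes and any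
   group may be named. *)
apply: (@slide_k _ _ _ _ _ _ 0 0 0) => //; first by lia.
move=> i' k' p hi' hk' hp; case: (posnP k') => [->|k0']; first by rewrite /kpart /= eqxx.
move=> /(kpart_gam b0 (isT : 10 <= 32) k0' hp e) [ej H].
have ek : k' = k by case: hE H => -> H; lia.
by lia.
Qed.

(** Thresholds as high as the letters permit. *)
Definition thr (t : tri_state) i := if t i == None then 1 else (3 * b).+1.

Lemma thr_active t i : active b t (thr t) (thr t) i = (t i == None).
Proof. by rewrite /active /thr; case: (t i == None) => //=; lia. Qed.

Lemma kval_of t rho gam (A : nat -> bool) : tri_valid P D R t -> (forall i, t i = None -> rho i <= 1 /\ gam i <= 1) ->
  (forall i, active b t rho gam i -> A i) -> (forall i j, i < I -> j < I -> conf D R i j -> ~~ (A i && A j)) -> kval t rho gam.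
Proof.
move=> h h1 h2 h3 i hi; have [a1 a2 a3 a4] := h i hi; split=> //.
- by move=> e; apply: h1.
by move=> j /andP[hj hc]; apply: contra (h3 _ _ hi hj hc) => /andP[/h2 -> /h2 ->].
Qed.

Lemma kval_thr t : tri_valid P D R t -> kval t (thr t) (thr t).
Proof.
move=> h; apply: (kval_of (A := fun i => t i == None)) => //.
- by move=> i e; rewrite /thr e eqxx.
- by move=> i; rewrite thr_active.
move=> i j hi hj hc; have [_ _ _ a4] := h i hi.
by apply/negP => /andP[/eqP e1 /eqP e2]; exact: (a4 j hj hc e1 e2).
Qed.

Definition Kt t := Kset t (thr t) (thr t).

(** Signals are raised while the letter still counts as selected. *)
Lemma slide_raise t i v : i < I -> tri_valid P D R t -> tri_valid P D R (upd t i v) -> t i = None -> v <> None ->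
  star slide (Kt t) (Kt (upd t i v)).
Proof.
move=> hi h h' ti hv; set t' := upd t i v.
have t'i : t' i = v by rewrite /t' upd_same.
(* Conflicts are judged by the letters selected in the old state [t]: there [i] is selected, so its
   signals may be at any height in the meantime. *)
have H rho gam : (forall j, j <> i -> rho j = thr t j /\ gam j = thr t j) -> kval t' rho gam.
  move=> hr; apply: (kval_of (A := fun i => t i == None)) => //.
  - move=> j e; case: (j =P i) => [ej|nj]; first by case: hv; rewrite -e ej t'i.
    have [-> ->] := hr _ nj; move: e; rewrite /t' /upd; case: (j =P i) => // _ e.
    by rewrite /thr e eqxx.
  - move=> j; case: (j =P i) => [-> _|nj]; first by rewrite ti.
    rewrite /active; have [-> ->] := hr _ nj; have -> : t' j = t j by rewrite /t' upd_other //; apply/eqP.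
    by move: (thr_active t j); rewrite /active => ->.
  move=> i' j hi' hj hc; have [_ _ _ a4] := h i' hi'.
  by apply/negP => /andP[/eqP e1 /eqP e2]; exact: (a4 j hj hc e1 e2).
have s1 : star slide (Kt t) (Kset t' (thr t) (thr t)).
  by apply: slide_t => //; [apply: kval_thr|apply: H].
have E : thr t = upd (thr t) i 1.
  by apply: functional_extensionality => j; rewrite /upd /thr; case: (j =P i) => // ->; rewrite ti eqxx.
have E' : thr t' = upd (thr t) i (3 * b).+1.
  apply: functional_extensionality => j; rewrite /upd /thr; case: (j =P i) => [->|nj].
    by rewrite t'i; case: v hv {t' h' t'i H s1}.
  by rewrite /t' /upd; case: (j =P i).
have s2 q : q <= 3 * b -> star slide (Kset t' (thr t) (thr t)) (Kset t' (upd (thr t) i q.+1) (thr t)).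
  elim: q => [|q IH] hq; first by rewrite -E; apply: star0.
  apply: star_trans (IH (ltnW hq)) _; apply: (star_sym slide_sym).
  have -> : upd (thr t) i q.+1 = upd (upd (thr t) i q.+2) i q.+1 by rewrite upd_upd.
  apply: slide_rho => //; first by rewrite upd_same.
    by apply: H => j nj; rewrite upd_other //; apply/eqP.
  by apply: H => j nj; rewrite !upd_other //; apply/eqP.
have s3 q : q <= 3 * b -> star slide (Kset t' (thr t') (thr t)) (Kset t' (thr t') (upd (thr t) i q.+1)).
  elim: q => [|q IH] hq; first by rewrite -E; apply: star0.
  apply: star_trans (IH (ltnW hq)) _; apply: (star_sym slide_sym).
  have -> : upd (thr t) i q.+1 = upd (upd (thr t) i q.+2) i q.+1 by rewrite upd_upd.
  apply: slide_gam => //; first by rewrite upd_same.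
    by apply: H => j nj; rewrite E' !upd_other //; apply/eqP.
  by apply: H => j nj; rewrite E' !upd_other //; apply/eqP.
apply: star_trans s1 _; have := s2 _ (leqnn _); rewrite -E' => s2'.
by apply: star_trans s2' _; have := s3 _ (leqnn _); rewrite -E'.
Qed.

Lemma slide_step t t' : tri_step P D R t t' -> star slide (Kt t) (Kt t').
Proof.
move=> [h h' [i [v [hi e]]]]; subst t'.
case: (t i =P None) => [ti|ti]; case: (v =P None) => [vi|vi].
- have -> : upd t i v = t by rewrite vi -ti upd_id.
  exact: star0.
- exact: slide_raise.
- apply: (star_sym slide_sym); rewrite -[X in star _ _ (Kt X)](upd_id t i) -[upd t i (t i)](upd_upd t i v).
  by apply: slide_raise; rewrite // ?upd_same // upd_upd upd_id.
have E : thr (upd t i v) = thr t.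
  apply: functional_extensionality => j; rewrite /thr /upd; case: (j =P i) => // ->.
  by case: v vi {h'} => // ? _; case: (t i) ti.
by rewrite /Kt E; apply: slide_t => //; [apply: kval_thr|rewrite -E; apply: kval_thr].
Qed.

Lemma Kt_min t : tri_valid P D R t -> mincover (Kt t).
Proof. by move=> h; apply/Kset_min/kval_thr. Qed.

Lemma tok_Kt t i : tri_valid P D R t -> i < I -> tok (Kt t) i = t i.
Proof.
move=> h hi; have [a1 a2 _ _] := h i hi; rewrite /tok /tri_tok.
have m p : p < 32 -> V i 0 p %% 32 = p by move=> hp; rewrite vtx_mod.
rewrite !Kset_s ?m // ?vtx_lt // !kstE // /kpart /= /gfst.
case: (t i) a1 a2 => [[]|] //= a1 a2; case: eqP => //= /eqP e; by have := a1 e.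
Qed.

End Graph.

(** * From covers to the six problems *)

Lemma reconf_star (T : finType) (e : rel {set T}) (ok : {set T} -> Prop) X Y :
  reconfigurable e ok X Y <-> ok X /\ star (fun A B => [/\ ok A, ok B & e A B]) X Y.
Proof.
split=> [[s [hp hl hs]]|[hX h]].
  split; first by apply: hs; rewrite inE eqxx.
  elim: s X hp hl hs => [|Z s IH] X /= hp hl hs; first by rewrite hl; apply: star0.
  case/andP: hp => h1 h2; apply: (@star_trans _ _ _ Z).
    by apply: star1; split=> //; apply: hs; rewrite !inE eqxx ?orbT.
  by apply: IH => // A hA; apply: hs; rewrite inE hA orbT.
elim: h => [|A B _ [s [h1 h2 h3]] [a1 a2 a3]].
  by exists [::]; split=> // Z; rewrite inE => /eqP ->.
exists (rcons s B); rewrite rcons_path h1 h2 last_rcons; split=> // Z.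
by rewrite -rcons_cons mem_rcons inE => /orP[/eqP -> //|]; apply: h3.
Qed.

Section Steps.
Variable T : finType.
Implicit Types A B X Y : {set T}.

Lemma setC_swap A u v : u \in A -> v \notin A -> ~: (v |: (A :\ u)) = u |: (~: A :\ v).
Proof.
move=> hu hv; apply/setP => w; rewrite !inE negb_or negb_and negbK.
have [->|nu] := eqVneq w u; first by rewrite andbT; apply: contraNneq hv => <-.
by have [->|nv] := eqVneq w v.
Qed.

Lemma TS_setC (G : sgraph T) A B : TS_step G A B -> TS_step G (~: A) (~: B).
Proof.
move=> /existsP[u /existsP[v /and4P[hu hv huv /eqP ->]]].
apply/existsP; exists v; apply/existsP; exists u.
by apply/and4P; split; rewrite ?inE ?hu ?hv // ?[_ u]adj_sym // setC_swap.
Qed.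

Lemma TJ_setC A B : TJ_step A B -> TJ_step (~: A) (~: B).
Proof.
move=> /existsP[u /existsP[v /and3P[hu hv /eqP ->]]].
apply/existsP; exists v; apply/existsP; exists u.
by apply/and3P; split; rewrite ?inE ?hu ?hv // setC_swap.
Qed.

Lemma TAR_setC A B : TAR_step A B -> TAR_step (~: A) (~: B).
Proof.
move=> /existsP[v /orP[]/andP[hv /eqP ->]]; apply/existsP; exists v; apply/orP; [right|left].
  by rewrite inE hv; apply/eqP/setP => w; rewrite !inE negb_or andbC.
by rewrite inE negbK hv; apply/eqP/setP => w; rewrite !inE negb_and negbK.
Qed.

Lemma TS_TJ (G : sgraph T) A B : TS_step G A B -> TJ_step A B.
Proof.
move=> /existsP[u /existsP[v /and4P[hu hv _ h]]].
by apply/existsP; exists u; apply/existsP; exists v; rewrite hu hv.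
Qed.

Lemma TJ_card A B : TJ_step A B -> #|B| = #|A|.
Proof.
move=> /existsP[u /existsP[v /and3P[hu hv /eqP ->]]].
by rewrite cardsU1 [#|A|](cardsD1 u) hu !inE (negPf hv) andbF.
Qed.

End Steps.

(** * Feasible sets of minimum size under the three rules *)

Section Small.
Variables (T : finType) (G G1 : sgraph T) (F : {set T} -> Prop) (kap : nat) (mc : {set T} -> Prop) (h : {set T} -> {set T}).
Hypotheses (Gsub : forall u v, G u v -> G1 u v) (Fmin : forall X, F X -> kap <= #|X|)
  (Fmc : forall X, mc X -> F X) (cmc : forall X, mc X -> #|X| = kap)
  (Fmon : forall X Y : {set T}, F X -> X \subset Y -> F Y)
  (hmc : forall X, F X -> #|X| = kap -> mc (h X))
  (hstep : forall X Y, F X -> F Y -> #|X| = kap -> TJ_step X Y -> h X = h Y \/ TJ_step (h X) (h Y)).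
Implicit Types X Y Z : {set T}.

Definition smallTJ X Y := [/\ F X, F Y, #|X| = kap & TJ_step X Y].
Definition coverTJ X Y := [/\ mc X, mc Y & TJ_step X Y].
Definition coverTS X Y := [/\ mc X, mc Y & TS_step G X Y].

(** The retraction [h] takes minimum feasible sets to minimum covers and turns a jump into a jump or
    into nothing; both ends are fixed by it. *)
Lemma small_cover X Y : h X = X -> h Y = Y -> star smallTJ X Y -> star coverTJ X Y.
Proof.
move=> eX eY; rewrite -{2}eX -{2}eY; apply: star_map => A B [hA hB cA s].
have cB : #|B| = kap by rewrite (TJ_card s).
by case: (hstep hA hB cA s) => [->|e]; [exact: star0|apply: star1; split=> //; apply: hmc].
Qed.

Lemma cover_TS X Y : star coverTS X Y -> star (fun A B => [/\ F A, F B & TS_step G1 A B]) X Y.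
Proof.
apply: star_impl => A B [hA hB /existsP[u /existsP[v /and4P[hu hv huv e]]]].
split; try exact: Fmc.
by apply/existsP; exists u; apply/existsP; exists v; apply/and4P; split=> //; apply: Gsub.
Qed.

Lemma TJ_small X Y : #|X| = kap -> star (fun A B => [/\ F A, F B & TJ_step A B]) X Y -> star smallTJ X Y.
Proof.
move=> cX s; suff [] : star smallTJ X Y /\ #|Y| = kap by [].
elim: s => [|A B _ [IH cA] [hA hB s]]; first by split=> //; apply: star0.
by split; [apply: starS IH _|rewrite (TJ_card s)].
Qed.

Definition small_ok X := F X /\ #|X| <= kap.+1.

(** A slide is an addition followed by a removal; the intermediate set is feasible by monotonicity
    and explains the threshold [kap.+1]. *)
Lemma cover_TAR X Y : star coverTS X Y -> star (fun A B => [/\ small_ok A, small_ok B & TAR_step A B]) X Y.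
Proof.
apply: (star_map (f := id)) => A B [hA hB /existsP[u /existsP[v /and4P[hu hv _ /eqP e]]]].
have n : u != v by apply: contraNneq hv => <-.
have cA := cmc hA; have cB := cmc hB.
have okA : small_ok A by split; [apply: Fmc|rewrite cA].
have okB : small_ok B by split; [apply: Fmc|rewrite cB].
have okV : small_ok (v |: A).
  by split; [apply: Fmon (Fmc hA) (subsetUr _ _)|rewrite cardsU1 hv cA].
apply: (@star_trans _ _ _ (v |: A)); apply: star1; split=> //; apply/existsP.
  by exists v; rewrite hv eqxx.
exists u; rewrite !inE hu orbT /=; apply/eqP; rewrite e; apply/setP => w; rewrite !inE.
by have [->|] := eqVneq w u; rewrite //= ?(negPf n).
Qed.

(** All sets have size [kap] or [kap.+1], so additions and removals alternate. The invariant after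
    an addition refers to every feasible set that one removal may produce: it is a jump away from
    the set before the addition, or that set itself. *)
Lemma TAR_small X Y : #|X| = kap -> #|Y| = kap ->
  star (fun A B => [/\ small_ok A, small_ok B & TAR_step A B]) X Y -> star smallTJ X Y.
Proof.
move=> cX cY s.
have H : (#|Y| = kap /\ star smallTJ X Y) \/
  (#|Y| = kap.+1 /\ forall v, v \in Y -> F (Y :\ v) -> star smallTJ X (Y :\ v)); last first.
  by case: H => [[]|[c _]] //; move: c; rewrite cY; lia.
elim: s {cY} => [|A B _ IH [[hA cA] [hB cB] /existsP[v /orP[]/andP[hv /eqP e]]]].
- by left; split=> //; apply: star0.
- have cB' : #|B| = #|A|.+1 by rewrite e cardsU1 hv.
  case: IH => [[cA' IH]|[cA' _]]; last by lia.
  right; split; first by rewrite cB' cA'.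
  move=> u; rewrite e !inE => hu hF; have [eu|n] := eqVneq u v.
    rewrite eu; have -> : (v |: A) :\ v = A; last by [].
    by apply/setP => w; rewrite !inE; case: (eqVneq w v) => [->|_] //=; rewrite (negPf hv).
  rewrite (negPf n) /= in hu.
  have E : (v |: A) :\ u = v |: (A :\ u).
    by apply/setP => w; rewrite !inE; case: (eqVneq w v) => [->|_] //=; rewrite eq_sym n.
  rewrite E in hF *; apply: starS IH _; split=> //.
  by apply/existsP; exists u; apply/existsP; exists v; rewrite hu hv eqxx.
have cB' : #|A| = #|B|.+1 by rewrite [#|A|](cardsD1 v) hv e.
have := Fmin hB; case: IH => [[cA' IH]|[cA' IH]] hm; first by lia.
left; split; first by lia.
by rewrite e in hB *; apply: IH.
Qed.

End Small.

Section Problems.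
Variables (P D : nat) (R : nat -> nat -> nat -> bool).
Hypotheses (P0 : 0 < P) (D0 : 0 < D).

Local Notation N := (gord P D).
Local Notation G := (ggraph P R D0).
Local Notation mc := (@mincover P D R D0).
Local Notation kap := (kappa P D).
Implicit Types (X Y : {set 'I_N}) (u v : 'I_N).

Lemma G_sub u v : G false u v -> G true u v.
Proof.
move=> /gadjP[c [e [j [/and5P[h1 h2 h3 h4 /and3P[h5 h6 h7]] h]]]]; apply/gadjP; exists c, e, j.
by split=> //; rewrite /gseg h1 h2 h3 h4 h5 h6.
Qed.

Definition isw u := 10 <= u %% 32.

Definition triang c e (a w v : 'I_N) :=
  [/\ ends (2 * D) 32 c e = (val a, val v), val w = c * 32 + 10 + e, e < 22 & [/\ G false a v, G true a w, G true w v & ~~ isw a && ~~ isw v]].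

Lemma triang_isw c e a w v : triang c e a w v -> isw w.
Proof. by case=> _ ew he _; rewrite /isw ew wmod // leq_addr. Qed.

Lemma gseg_ends ext c e j : gseg P D R ext c e j -> exists a w v, triang c e a w v.
Proof.
case/and5P=> hc hp h1 h2 /and3P[he hj _].
have hw : c * 32 + 10 + e < N.
  by apply: (@leq_trans (c.+1 * 32)); [rewrite mulSn; lia|rewrite leq_mul2r hc orbT].
have [m1 m2] := ends_mod hp.
have H ext' j' : j' < 3 -> ext' || (j' == 0) -> gseg P D R ext' c e j'.
  by move=> k1 k2; rewrite /gseg hc hp h1 h2 he k1.
have Ep : ends (2 * D) 32 c e = ((ends (2 * D) 32 c e).1, (ends (2 * D) 32 c e).2) by exact: surjective_pairing.
exists (Ordinal h1), (Ordinal hw), (Ordinal h2); split=> //; split.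
- by apply/gadjP; exists c, e, 0; split; [apply: H|left; rewrite /sege -[nth _ _ _]/(ends (2 * D) 32 c e)].
- by apply/gadjP; exists c, e, 1; split; [apply: H|left].
- by apply/gadjP; exists c, e, 2; split; [apply: H|left].
by rewrite /isw -!ltnNge m1 m2.
Qed.

Lemma triang_w c e a w v c' e' a' v' : triang c e a w v -> triang c' e' a' w v' -> a = a' /\ v = v'.
Proof.
move=> [h1 h2 h3 _] [h1' h2' h3' _].
have ec : c = c'.
  have := congr1 (divn^~ 32) h2; have := congr1 (divn^~ 32) h2'.
  have hd x z : z < 22 -> (x * 32 + 10 + z) %/ 32 = x by move=> hz; rewrite -addnA divnMDl // divn_small ?addn0 //; lia.
  by rewrite !hd // => -> ->.
have ee : e = e' by move: h2; rewrite h2' ec; lia.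
by subst c' e'; move: h1; rewrite h1' => -[/val_inj -> /val_inj ->].
Qed.

Lemma adj_triang ext u v : G ext u v -> exists c e a w z, triang c e a w z /\
  [\/ (u, v) = (a, z) \/ (u, v) = (z, a), ext /\ ((u, v) = (a, w) \/ (u, v) = (w, a)) |
      ext /\ ((u, v) = (w, z) \/ (u, v) = (z, w))].
Proof.
move=> /gadjP[c [e [j [h1 h2]]]]; have [a [w [z ht]]] := gseg_ends h1.
exists c, e, a, w, z; split=> //; have [e1 e2 _ _] := ht.
have hx : ext || (j == 0) by case/and5P: h1 => _ _ _ _ /and3P[].
have hj : j < 3 by case/and5P: h1 => _ _ _ _ /and3P[].
move: h2; rewrite /sege e1 -e2; case: j hj hx {h1} => [|[|[|j]]] // _; rewrite ?orbF => hx; cbn [nth fst snd].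
- by move=> h; constructor 1; case: h => -[/val_inj -> /val_inj ->]; [left|right].
- by move=> h; constructor 2; split=> //; case: h => -[/val_inj -> /val_inj ->]; [left|right].
- by move=> h; constructor 3; split=> //; case: h => -[/val_inj -> /val_inj ->]; [left|right].
Qed.

Lemma adj_base u v : G false u v -> ~~ isw u /\ ~~ isw v.
Proof.
by move=> /adj_triang[c [e [a [w [z [[_ _ _ [_ _ _ /andP[h1 h2]]] [|[]|[]] // h]]]]]]; case: h => -[-> ->].
Qed.

Lemma adj_kind u v : G true u v -> G false u v \/ isw u != isw v.
Proof.
move=> /adj_triang[c [e [a [w [z [h H]]]]]]; have hw := triang_isw h; case: h => _ _ _ [h1 _ _ /andP[/negPf h2 /negPf h3]].
case: H => [H|[_ H]|[_ H]].
- by left; case: H => -[-> ->] //; rewrite [G false z a]adj_sym.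
- by right; case: H => -[-> ->]; rewrite hw ?h2.
- by right; case: H => -[-> ->]; rewrite hw ?h3.
Qed.

Lemma adj_wP w u : isw w -> G true w u -> exists c e a z, triang c e a w z /\ (u = a \/ u = z).
Proof.
move=> hw /adj_triang[c [e [a [w' [z [h H]]]]]]; exists c, e, a, z.
have [_ _ _ [_ _ _ /andP[h2 h3]]] := h.
case: H => [[]|[_ []]|[_ []]] [e1 e2]; subst; rewrite ?hw // in h2 h3 *; split=> //; by [left|right].
Qed.

(** An extra vertex has just two neighbours, the ends of its edge. *)
Lemma adj_w w u v : isw w -> G true w u -> G true w v -> u <> v -> G false u v.
Proof.
move=> hw /(adj_wP hw)[c [e [a [z [h H]]]]] /(adj_wP hw)[c' [e' [a' [z' [h' H']]]]] n.
have [? ?] := triang_w h h'; subst a' z'; have [_ _ _ [k _ _ _]] := h.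
by case: H n => ->; case: H' => -> // n; rewrite [G false z a]adj_sym.
Qed.

(** An extra vertex is replaced by an end of its edge. *)
Definition shove u : 'I_N := if isw u then odflt u [pick v | G true u v] else u.
Definition shoves X := [set shove u | u in X].

(** Feedback vertex sets and odd cycle transversals meet every triangle on an edge; the argument for
    both uses this property only. *)
Definition hits X := forall a w v, G false a v -> G true a w -> G true w v -> isw w -> [|| a \in X, w \in X | v \in X].

(** The triangle on an edge is met either in an end, which stays, or in the extra vertex, which is
    moved to one of the ends. *)
Lemma shoves_cover X : hits X -> vertex_cover (G false) (shoves X).
Proof.
move=> h u v huv; have [nu nv] := adj_base huv.
have [c [e [a [w [z [ht H]]]]]] := adj_triang huv.
have hw := triang_isw ht; have [_ _ _ [k1 k2 k3 _]] := ht.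
have auv : G true u w /\ G true w v.
  case: H => [[]|[]|[]] // [-> ->] //; split; by rewrite adj_sym.
have := h _ _ _ huv auv.1 auv.2 hw.
have sh x : x \in X -> shove x \in shoves X by move=> hx; apply: imset_f.
case/or3P => hx; have := sh _ hx; rewrite /shove ?(negPf nu) ?(negPf nv) => // hs.
- by rewrite hs.
- move: hs; rewrite hw; case: pickP => [y hy|/(_ v)]; last by rewrite auv.2.
  have -> : (odflt w (Some y)) = y by [].
  have [->|/eqP n1] := eqVneq y u; first by move=> ->.
  have [->|/eqP n2] := eqVneq y v; first by move=> ->; rewrite orbT.
  have [c1 [e1 [a1 [z1 [t1 H1]]]]] := adj_wP hw hy.
  have [? ?] := triang_w ht t1; subst a1 z1.
  by case: H => [[]|[]|[]] // [? ?]; subst; case: H1.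
- by rewrite hs orbT.
Qed.

Lemma shoves_card X : #|shoves X| <= #|X|.
Proof. exact: leq_imset_card. Qed.

Lemma shoves_id X : {in X, forall u, ~~ isw u} -> shoves X = X.
Proof.
move=> h; rewrite -[RHS](imset_id X); apply: eq_in_imset => u /h; rewrite /shove.
by move/negPf => ->.
Qed.

Lemma hits_min X : hits X -> kap <= #|X|.
Proof. by move=> h; apply: leq_trans (vc_min (shoves_cover h)) (shoves_card X). Qed.

Lemma shoves_mc X : hits X -> #|X| = kap -> mc (shoves X).
Proof.
move=> h c; split; first exact: shoves_cover.
by apply/eqP; rewrite eqn_leq (vc_min (shoves_cover h)) andbT -c shoves_card.
Qed.

(** Shoving cannot merge vertices of a set of minimum size, as the resulting cover would be too
    small. So it is injective on [X] and on [Y], and the images of the exchanged vertices either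
    coincide or are exchanged by a jump. *)
Lemma shoves_step X Y : hits X -> hits Y -> #|X| = kap -> TJ_step X Y ->
  shoves X = shoves Y \/ TJ_step (shoves X) (shoves Y).
Proof.
move=> hX hY cX s; have cY : #|Y| = kap by rewrite (TJ_card s).
have [_ dX] := shoves_mc hX cX; have [_ dY] := shoves_mc hY cY.
have iX : {in X &, injective shove} by apply/imset_injP; rewrite -/(shoves X) dX cX.
have iY : {in Y &, injective shove} by apply/imset_injP; rewrite -/(shoves Y) dY cY.
case/existsP: s => u /existsP[v /and3P[hu hv /eqP e]].
have E : shoves (X :\ u) = shoves X :\ shove u.
  apply/setP => w; rewrite !inE; apply/imsetP/andP => [[x]|[n /imsetP[x hx ex]]].
    rewrite !inE => /andP[nx hx] ->; split; last exact: imset_f.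
    by apply: contra_neq nx => /iX ->.
  by exists x => //; rewrite !inE hx andbT; apply: contra_neq n => <-.
have EY : shoves Y = shove v |: (shoves X :\ shove u) by rewrite e -E /shoves imsetU1.
have [e'|n] := eqVneq (shove v) (shove u).
  left; rewrite EY e'; apply/setP => w; rewrite !inE.
  by have [->|] := eqVneq w (shove u) => //=; rewrite imset_f.
right; apply/existsP; exists (shove u); apply/existsP; exists (shove v).
rewrite imset_f //= EY eqxx andbT; apply/negP => hs.
have : #|shove v |: (shoves X :\ shove u)| = kap by rewrite -EY.
rewrite cardsU1 !inE n hs /= add0n; have := cardsD1 (shove u) (shoves X).
by rewrite imset_f //= dX => -> /eqP; rewrite eqn_leq add1n ltnn andbF.
Qed.

(** *** Feasibility on the small side *)
Definition small (p : vertex_problem) : bool :=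
  match p with VertexCover | FeedbackVertexSet | OddCycleTransversal => true | _ => false end.
Definition pext (p : vertex_problem) : bool :=
  match p with VertexCover | IndependentSet => false | _ => true end.
Definition pside (p : vertex_problem) X : {set 'I_N} := if small p then X else ~: X.
Definition pF (p : vertex_problem) X : Prop :=
  match p with
  | VertexCover | IndependentSet => vertex_cover (G false) X
  | FeedbackVertexSet | InducedForest => induces_forest (G true) (~: X)
  | _ => induces_bipartite (G true) (~: X)
  end.

Lemma pF_feasible p X : feasible p (G (pext p)) (pside p X) <-> pF p X.
Proof.
case: p; rewrite /pF /pside /feasible //=.
split=> h u v; first by move=> huv; apply/negPn; rewrite negb_or; apply/negP => /andP[h1 h2];
  have := h u v; rewrite !inE h1 h2 huv => /(_ isT isT).
by rewrite !inE => h1 h2; apply/negP => /h; rewrite (negPf h1) (negPf h2).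
Qed.

Lemma pF_mon p X Y : pF p X -> X \subset Y -> pF p Y.
Proof.
move=> h /subsetP s; have sC u : u \notin Y -> u \notin X by apply: contra; apply: s.
case: p h => /= h.
- by move=> u v /h /orP[] /s ->; rewrite ?orbT.
- by move=> u v /h /orP[] /s ->; rewrite ?orbT.
- move=> [c [h1 h2 h3]]; apply: h; exists c; split=> // x /h1; rewrite !inE; apply: sC.
- move=> [c [h1 h2 h3]]; apply: h; exists c; split=> // x /h1; rewrite !inE; apply: sC.
- have [col hc] := h; exists col => u v; rewrite !inE => h1 h2; by apply: hc; rewrite !inE; apply: sC.
- have [col hc] := h; exists col => u v; rewrite !inE => h1 h2; by apply: hc; rewrite !inE; apply: sC.
Qed.

Lemma forest_hits X : induces_forest (G true) (~: X) -> hits X.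
Proof.
move=> h a w v h1 h2 h3 _; apply/negPn/negP; rewrite !negb_or => /and3P[ha hw hv].
apply: h; exists [:: a; w; v]; split=> //.
  by move=> x; rewrite !inE => /or3P[] /eqP ->.
have n (x y : 'I_N) e : G e x y -> x != y by apply: contraTneq => ->; rewrite adj_irr.
apply/andP; split; first by apply/and4P; split=> //; rewrite adj_sym; apply: G_sub.
by rewrite /= !inE negb_or (n _ _ _ h2) (n _ _ _ h1) (n _ _ _ h3).
Qed.

Lemma bipartite_hits X : induces_bipartite (G true) (~: X) -> hits X.
Proof.
move=> [col h] a w v h1 h2 h3 _; apply/negPn/negP; rewrite !negb_or => /and3P[ha hw hv].
have := h a w; have := h w v; have := h a v; rewrite !inE ha hw hv (G_sub h1) h2 h3.
by move=> /(_ isT isT isT) + /(_ isT isT isT) + /(_ isT isT isT); do 3!case: (col _).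
Qed.

(** Outside a cover no original edge is left, so every remaining edge joins an extra vertex to an
    original one. *)
Lemma mc_bipartite X : mc X -> induces_bipartite (G true) (~: X).
Proof.
move=> [hX _]; exists isw => u v; rewrite !inE => hu hv /adj_kind[] // /hX.
by rewrite (negPf hu) (negPf hv).
Qed.

(** An extra vertex on a cycle would have two different neighbours there, namely the ends of its
    edge, both missed by the cover. A cycle without extra vertices would consist of original edges,
    none of which survives. *)
Lemma mc_forest X : mc X -> induces_forest (G true) (~: X).
Proof.
move=> [hX _] [s [hs sz /andP[hc hu]]].
have key w : w \in s -> isw w -> False.
  move=> hw iw; have nw : next s w \in s by rewrite mem_next.
  have pw : prev s w \in s by rewrite mem_prev.
  have a1 : G true w (next s w) by exact: next_cycle hc hw.
  have a2 : G true w (prev s w) by rewrite adj_sym; exact: prev_cycle hc hw.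
  have n : next s w <> prev s w.
    move=> e; have E : next s (next s w) = w by rewrite e (next_prev hu).
    have [i si ei] := rot_to hw; have hu' : uniq (w :: si) by rewrite -ei rot_uniq.
    have E' : next (w :: si) (next (w :: si) w) = w by rewrite -ei !next_rot.
    have sz' : size (w :: si) = size s by rewrite -ei size_rot.
    case: si hu' E' sz' {ei} => [|y [|z t]] /= hu' E' sz'; try by rewrite -sz' in sz.
    move: hu'; rewrite !inE !negb_or => /and3P[/and3P[wy wz _] _ _].
    move: E'; rewrite eqxx eq_sym (negPf wy) eqxx => E'; by rewrite E' eqxx in wz.
  have := hX _ _ (adj_w iw a1 a2 n).
  by have := hs _ nw; have := hs _ pw; rewrite !inE => /negPf -> /negPf ->.
case: s sz hs hc hu key => [|x [|y s]] // sz hs hc hu key.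
have hxy : G true x y by case/andP: hc.
have [hx hy] : x \notin X /\ y \notin X.
  by have := hs x; have := hs y; rewrite !inE !eqxx !orbT => /(_ isT) -> /(_ isT) ->.
case: (adj_kind hxy) => [/hX|]; first by rewrite (negPf hx) (negPf hy).
have kx := key x; have ky := key y; rewrite !inE !eqxx !orbT in kx ky.
case: (isw x) kx => [/(_ isT isT)//|_]; case: (isw y) ky => [/(_ isT isT)//|_] //.
Qed.

Definition pcanon (p : vertex_problem) X := if pext p then shoves X else X.

Lemma pF_hits p X : pext p -> pF p X -> hits X.
Proof. by case: p => //= _; [apply: forest_hits|apply: forest_hits|apply: bipartite_hits|apply: bipartite_hits]. Qed.

Lemma pF_vc p X : pext p = false -> pF p X = vertex_cover (G false) X.
Proof. by case: p. Qed.

Lemma pF_min p X : pF p X -> kap <= #|X|.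
Proof.
case E: (pext p); first by move=> h; apply/hits_min/(pF_hits E h).
by rewrite pF_vc // => h; apply: (vc_min h).
Qed.

Lemma pF_mc p X : mc X -> pF p X.
Proof.
by move=> h; case: p; rewrite /pF; try exact: (h.1); try exact: mc_forest; exact: mc_bipartite.
Qed.

Lemma pcanon_mc p X : pF p X -> #|X| = kap -> mc (pcanon p X).
Proof.
rewrite /pcanon; case E: (pext p); first by move=> h; apply/shoves_mc/(pF_hits E h).
by rewrite pF_vc.
Qed.

Lemma pcanon_step p X Y : pF p X -> pF p Y -> #|X| = kap -> TJ_step X Y ->
  pcanon p X = pcanon p Y \/ TJ_step (pcanon p X) (pcanon p Y).
Proof.
rewrite /pcanon; case E: (pext p); last by move=> _ _ _; right.
by move=> h1 h2; apply: shoves_step; apply: pF_hits E _.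
Qed.

Lemma G_ext p u v : G false u v -> G (pext p) u v.
Proof. by case: (pext p) => //; apply: G_sub. Qed.

(** *** Words as instances *)
Definition wset (y : nat -> nat) : {set 'I_N} := Kt P D (tri_of D y).
Definition winst p y : {set 'I_N} := pside p (wset y).

Section Words.
Variables (p : vertex_problem) (y y' : nat -> nat).
Hypotheses (hy : word_ok P D R y) (hy' : word_ok P D R y') (hyy : forall q, P <= q -> y q = y' q).

Lemma wset_mc z : word_ok P D R z -> mc (wset z).
Proof. by move=> hz; apply/Kt_min/tri_of_valid. Qed.

Lemma wset_canon z : pcanon p (wset z) = wset z.
Proof.
rewrite /pcanon; case: (pext p) => //; apply: shoves_id => u.
by rewrite inE /isw -ltnNge => /andP[].
Qed.

Lemma winst_feasible z : word_ok P D R z -> feasible p (G (pext p)) (winst p z).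
Proof. by move=> hz; apply/pF_feasible/pF_mc/wset_mc. Qed.

Lemma winst_card : #|winst p y| = #|winst p y'|.
Proof.
have [_ c1] := wset_mc hy; have [_ c2] := wset_mc hy'.
rewrite /winst /pside; case: (small p); first by rewrite c1 c2.
by have := cardsC (wset y); have := cardsC (wset y'); lia.
Qed.

Lemma word_cover : star (word_step P D R) y y' -> star (coverTS (G false) mc) (wset y) (wset y').
Proof.
move=> /(word_tri D0 P0 hy hy' hyy) h.
by apply: (star_map (f := Kt P D)) h => t t'; apply: slide_step.
Qed.

Lemma cover_word : star (coverTJ mc) (wset y) (wset y') -> star (word_step P D R) y y'.
Proof.
move=> h; apply/(word_tri D0 P0 hy hy' hyy).
pose nrm (t : tri_state) : tri_state := fun i => if i < P * D then t i else tri_of D y i.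
have e z : word_ok P D R z -> (forall q, P <= q -> y q = z q) -> nrm (tok (wset z)) = tri_of D z.
  move=> hz hyz; apply: functional_extensionality => i; rewrite /nrm; case: ltnP => hi.
    by rewrite (tok_Kt (R := R)) //; apply: tri_of_valid.
  have hP : P <= i %/ D by rewrite leq_divRL.
  by rewrite /tri_of hyz.
rewrite -(e y) // -(e y') //.
have nv t : tri_valid P D R t -> tri_valid P D R (nrm t).
  move=> ht i hi; have [a1 a2 a3 a4] := ht i hi; rewrite /nrm hi; split=> //.
    by move=> h1 h2; rewrite h1; apply: a3.
  by move=> j hj; rewrite hj; apply: a4.
apply: (star_map (f := fun X => nrm (tok X))) h => A B [hA hB s].
have [->|[v1 v2 [i [v [hi ev]]]]] := tok_step hA hB s; first exact: star0.
apply: star1; split; try exact: nv.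
exists i, v; split=> //; apply: functional_extensionality => j; rewrite /nrm ev /upd.
by case: (j =P i) => // ->; rewrite hi.
Qed.

Lemma pside_star (e : rel {set 'I_N}) (ok : {set 'I_N} -> Prop) X Y :
  (forall A B, e A B -> e (~: A) (~: B)) ->
  star (fun A B => [/\ ok (pside p A), ok (pside p B) & e A B]) X Y <->
  star (fun A B => [/\ ok A, ok B & e A B]) (pside p X) (pside p Y).
Proof.
move=> he; have pK A : pside p (pside p A) = A by rewrite /pside; case: small; rewrite ?setCK.
have pe A B : e A B -> e (pside p A) (pside p B) by rewrite /pside; case: small => //; apply: he.
split; first by apply: star_map => A B [h1 h2 h3]; apply: star1; split=> //; apply: pe.
move=> h; rewrite -[X]pK -[Y]pK; apply: (star_map (f := pside p)) h => A B [h1 h2 h3].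
by apply: star1; rewrite !pK; split=> //; apply: pe.
Qed.

Lemma glue_small (e : rel {set 'I_N}) (ok ok' : {set 'I_N} -> Prop) :
  (forall A B, e A B -> e (~: A) (~: B)) -> (forall A, ok (pside p A) <-> ok' A) ->
  ok' (wset y) ->
  (star (word_step P D R) y y' -> star (fun A B => [/\ ok' A, ok' B & e A B]) (wset y) (wset y')) ->
  (star (fun A B => [/\ ok' A, ok' B & e A B]) (wset y) (wset y') -> star (word_step P D R) y y') ->
  reconfigurable e ok (winst p y) (winst p y') <-> star (word_step P D R) y y'.
Proof.
move=> he hok h0 h1 h2; rewrite reconf_star; split=> [[_]|h].
  by rewrite /winst -pside_star // => h; apply/h2/(star_impl _ h) => A B [/hok a1 /hok a2 a3].
split; first by apply/hok.
by rewrite /winst -pside_star //; apply: (star_impl _ (h1 h)) => A B [/hok a1 /hok a2 a3].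
Qed.

Let cTJ := small_cover (@pcanon_mc p) (@pcanon_step p) (wset_canon y) (wset_canon y').
Let mck X : mc X -> #|X| = kap := fun h => h.2.

Theorem glue_TJ : reconfigurable (@TJ_step _) (feasible p (G (pext p))) (winst p y) (winst p y') <->
  star (word_step P D R) y y'.
Proof.
apply: (@glue_small _ _ (pF p)).
- exact: TJ_setC. - exact: pF_feasible. - exact/pF_mc/wset_mc.
- move=> /word_cover /(cover_TS (@G_ext p) (@pF_mc p)); apply: star_impl => A B [h1 h2 /TS_TJ h3]; by split.
by move=> h; apply/cover_word/cTJ/TJ_small/h; apply/mck/wset_mc.
Qed.

Theorem glue_TS : reconfigurable (TS_step (G (pext p))) (feasible p (G (pext p))) (winst p y) (winst p y') <->
  star (word_step P D R) y y'.
Proof.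
apply: (@glue_small _ _ (pF p)).
- exact: TS_setC. - exact: pF_feasible. - exact/pF_mc/wset_mc.
- by move=> /word_cover /(cover_TS (@G_ext p) (@pF_mc p)).
move=> h; apply/cover_word/cTJ/TJ_small; first by apply/mck/wset_mc.
by apply: star_impl h => A B [h1 h2 /TS_TJ h3].
Qed.

(** The small sets may exceed the minimum by one. *)
Definition wthreshold : int := if small p then Posz kap.+1 else (Posz N - Posz kap.+1)%R.

Lemma wthresholdP X : respects_threshold p wthreshold (pside p X) <-> #|X| <= kap.+1.
Proof.
have := card_compl X; rewrite /wthreshold /pside.
by case: p => /=; lia.
Qed.

Theorem glue_TAR : reconfigurable (@TAR_step _)
   (fun X => feasible p (G (pext p)) X /\ respects_threshold p wthreshold X) (winst p y) (winst p y') <->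
  star (word_step P D R) y y'.
Proof.
apply: (@glue_small _ _ (small_ok (pF p) kap)).
- exact: TAR_setC.
- by move=> A; rewrite pF_feasible wthresholdP.
- by split; [exact/pF_mc/wset_mc|rewrite (mck (wset_mc hy))].
- by move=> /word_cover; apply: cover_TAR; [exact: pF_mc|exact: mck|exact: pF_mon].
by move=> h; apply/cover_word/cTJ/(TAR_small (@pF_min p) _ _ h); apply/mck/wset_mc.
Qed.

End Words.
End Problems.

(** * Guarded flips *)

(** The sites [1 .. n] lie between two walls; a site is flipped when its two
    neighbours permit. *)
Section Flips.
Variables (S : finType) (om : S) (flip : S -> S -> S -> S -> bool).
Hypothesis flip_sym : forall l a c r, flip l a c r = flip l c a r.
Variable n : nat.
Hypothesis n0 : 0 < n.

Definition sites := nat -> S.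
Definition walled (x : sites) := x 0 = om /\ x n.+1 = om.
Definition gstep (x x' : sites) := exists p c, [/\ 0 < p, p <= n, flip (x p.-1) (x p) c (x p.+1) & x' = upd x p c].

(** A letter holds two adjacent sites, or it holds the whole neighbourhood of a
    site that is being flipped. *)
Definition letter : finType := ((S * S) + (S * S * S * S))%type.

(** In front of a letter that announces a flip, the letter to the left may hold either value of the
    site in question; changing it is the flip. Two announcing letters cannot be adjacent, so the
    neighbours of the site are frozen in the meantime. *)
Definition compat (u v : letter) : bool :=
  match u, v with
  | inl (a, b), inl (c, d) => b == c
  | inl (a, b), inr (l, a', c, r) => [&& flip l a' c r, a == l & (b == a') || (b == c)]
  | inr (l, a, c, r), inl (u, v) => u == r
  | inr _, inr _ => false
  end.

Definition opens (u : letter) := if u is inl (a, _) then a == om else false.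
Definition closes (u : letter) := match u with inl (_, b) => b == om | inr (_, _, _, r) => r == om end.
Definition rcompat p u v := [&& compat u v, (p == 0) ==> opens u & (p.+1 == n) ==> closes v].
Definition okl (w : nat -> letter) := forall p, p < n -> rcompat p (w p) (w p.+1).

Definition right_of (u : letter) : S := match u with inl (_, b) => b | inr (_, _, _, r) => r end.

Definition sites_of (w : nat -> letter) : sites :=
  fun q => if q is q'.+1 then (if q' <= n then right_of (w q') else om) else om.

Lemma compat_right u a b : compat u (inl (a, b)) -> right_of u = a.
Proof. by case: u => [[c d]|[[[l a'] c] r]] /= /eqP. Qed.

(** The right part of a letter is determined by an ordinary letter that follows, and by the wall at
    the end. So it changes only in front of an announcing letter, whose two values are then the old
    and the new one. *)
Lemma sites_step w p v : okl w -> okl (upd w p v) -> p <= n ->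
  star gstep (sites_of w) (sites_of (upd w p v)).
Proof.
move=> h h' hp; set w' := upd w p v.
have ow q : q != p -> w' q = w q by move=> ne; rewrite /w' upd_other.
have [e|ne] := eqVneq (right_of (w p)) (right_of (w' p)).
  suff -> : sites_of w' = sites_of w by apply: star0.
  apply: functional_extensionality => -[|q] //=; case: (q =P p) => [->|/eqP nq]; first by rewrite e.
  by rewrite ow.
have pn : p < n.
  rewrite ltn_neqAle hp andbT; apply/eqP => pn; case/eqP: ne.
  have [q ep] : exists q, p = q.+1 by exists p.-1; lia.
  have hq : q < n by lia.
  have /and3P[_ _ l1] := h q hq; have /and3P[_ _ l2] := h' q hq.
  rewrite -/w' -ep pn eqxx /= in l1 l2; rewrite pn.
  by case: (w _) l1 => [[? ?]|[[[? ?] ?] ?]] /= /eqP ->; case: (w' _) l2 => [[? ?]|[[[? ?] ?] ?]] /= /eqP ->.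
have /and3P[c1 o1 _] := h p pn; have /and3P[c2 o2 _] := h' p pn.
have op1 : w' p.+1 = w p.+1 by rewrite ow // neq_ltn ltnSn orbT.
rewrite -/w' op1 in c2; case E : (w p.+1) => [[a b]|[[[l a] c] r]] in c1 c2 op1.
  by case/eqP: ne; rewrite (compat_right c1) (compat_right c2).
case E1 : (w p) => [[x y]|[[[? ?] ?] ?]] in c1 o1 ne *; last by [].
case E2 : (w' p) => [[x' y']|[[[? ?] ?] ?]] in c2 o2 ne *; last by [].
move: c1 c2 ne => /= /and3P[f /eqP ex hy] /and3P[_ /eqP ex' hy'] ne.
have el : sites_of w p = l.
  case: (posnP p) => [p0|p0]; first by rewrite p0 /=; move: o1; rewrite p0 ex => /eqP.
  have hp1 : p.-1 < n by lia.
  have /and3P[c3 _ _] := h p.-1 hp1; rewrite prednK // E1 ex in c3.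
  have -> : sites_of w p = right_of (w p.-1) by rewrite -{1}(prednK p0) /= ltnW.
  exact: compat_right c3.
apply: star1; exists p.+1, y'; split=> //.
  have -> : sites_of w p.+1.-1 = l by [].
  rewrite /= (ltnW pn) pn E E1 /=.
  case/orP: hy hy' ne => /eqP -> /orP[]/eqP ->; rewrite ?eqxx // => _; by rewrite // flip_sym.
apply: functional_extensionality => q; rewrite /upd; case: q => [|q] //=.
rewrite eqSS; case: (q =P p) => [->|/eqP nq]; first by rewrite hp E2.
by rewrite ow.
Qed.

Definition letters_of (x : sites) : nat -> letter :=
  fun p => if p <= n then inl (x p, x p.+1) else inl (om, om).

Lemma letters_ok x : walled x -> okl (letters_of x).
Proof.
move=> [h1 h2] p hp; rewrite /letters_of (ltnW hp) hp /rcompat /compat eqxx /=.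
apply/andP; split; apply/implyP => /eqP e; first by rewrite e h1.
by rewrite e h2.
Qed.

Lemma sites_letters x : walled x -> (forall q, n < q -> x q = om) -> sites_of (letters_of x) = x.
Proof.
move=> [h1 h2] ho; apply: functional_extensionality => -[|q] //=; rewrite /letters_of.
by case: leqP => h //; rewrite ho //; apply: ltnW.
Qed.

Definition lstep (w w' : nat -> letter) := [/\ okl w, okl w' & exists p v, p <= n /\ w' = upd w p v].

Lemma okl_upd w p v : okl w -> (0 < p -> rcompat p.-1 (w p.-1) v) -> (p < n -> rcompat p v (w p.+1)) -> okl (upd w p v).
Proof.
move=> h h1 h2 k hk; case: (k =P p) => [ek|/eqP nk].
  by subst k; rewrite upd_same upd_other; [apply: h2|apply/eqP; lia].
rewrite (upd_other _ _ nk); case: (k.+1 =P p) => [ek|/eqP nk']; last by rewrite upd_other //; apply: h.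
by subst p; rewrite upd_same; apply: h1.
Qed.

Lemma letters_step x x' : walled x -> gstep x x' -> star lstep (letters_of x) (letters_of x').
Proof.
move=> hw [p [c [p0 pn f ->]]]; have hw' : walled (upd x p c).
  by case: hw => h1 h2; split; rewrite upd_other //; apply/eqP; lia.
have ok0 := letters_ok hw; have ok3 := letters_ok hw'.
have [q eq] : exists q, p = q.+1 by exists p.-1; rewrite prednK.
subst p; rewrite /= in f.
set w0 := letters_of x in ok0 *; set w3 := letters_of _ in ok3 *.
(* A flip of site [q.+1] takes three changes: letter [q.+1] announces it, letter [q] adopts the new
   value, and letter [q.+1] returns to an ordinary pair. *)
pose t : letter := inr (x q, x q.+1, c, x q.+2).
pose w1 := upd w0 q.+1 t; pose w2 := upd w1 q (inl (x q, c)).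
have e3 : w3 = upd w2 q.+1 (inl (c, x q.+2)).
  apply: functional_extensionality => k; rewrite /w3 /w2 /w1 /w0 /letters_of /upd.
  case: (k =P q.+1) => [->|nk]; first by rewrite pn; case: eqP => // e; lia.
  case: (k =P q) => [->|nk']; first by rewrite (ltnW pn) eqxx.
  by rewrite eqSS; case: (k =P q) => // _; case: leqP => //.
have w0E k : k <= n -> w0 k = inl (x k, x k.+1) by move=> hk; rewrite /w0 /letters_of hk.
have [x0 xn] := hw.
have n1 k : k != q.+1 -> w1 k = w0 k by move=> nk; rewrite /w1 upd_other.
have ok1 : okl w1.
  apply: okl_upd => // h.
    rewrite w0E ?(ltnW pn) // /rcompat /compat /t f !eqxx /=.
    by apply/andP; split; apply/implyP => /eqP e; [rewrite e x0|rewrite e xn].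
  by rewrite w0E // /rcompat /compat /t /= eqxx; apply/implyP => /eqP e; rewrite e xn.
have ok2 : okl w2.
  apply: okl_upd => // h.
    have q1 : q.-1 <= n by lia.
    have e1 : q.-1.+1 = q by lia.
    rewrite (n1 q.-1); last by apply/eqP; lia.
    rewrite (w0E _ q1) /rcompat /compat e1 eqxx /=.
    apply/andP; split; apply/implyP => /eqP e; first by rewrite e x0.
    by lia.
  rewrite /w1 upd_same /rcompat /compat /t f !eqxx /= orbT /=.
  by apply/andP; split; apply/implyP => /eqP e; [rewrite e x0|rewrite e xn].
apply: (@star_trans _ _ _ w1); first by apply: star1; split=> //; exists q.+1, t.
apply: (@star_trans _ _ _ w2); first by apply: star1; split=> //; exists q, (inl (x q, c)); split=> //; apply: ltnW.
by apply: star1; split=> //; exists q.+1, (inl (c, x q.+2)).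
Qed.

Lemma gstep_walled x x' : walled x -> gstep x x' -> walled x'.
Proof.
move=> hw [p [c [p0 pn f ->]]].
by case: hw => h1 h2; split; rewrite upd_other //; apply/eqP; lia.
Qed.

(** ** Letters as numbers *)
Definition lnum (u : letter) : nat := index u (enum letter).
Definition numl (k : nat) : letter := nth (inl (om, om)) (enum letter) k.
Definition nletters := #|letter|.
Definition RW p a b := rcompat p (numl a) (numl b).

Lemma lnumK : cancel lnum numl.
Proof. by move=> u; rewrite /numl /lnum nth_index // mem_enum. Qed.
Lemma lnum_lt u : lnum u < nletters.
Proof. by rewrite /nletters cardE index_mem mem_enum. Qed.
Lemma nletters_gt0 : 0 < nletters. Proof. exact: leq_ltn_trans (lnum_lt (inl (om, om))). Qed.

Definition wnum (w : nat -> letter) : nat -> nat := fun p => lnum (w p).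

Lemma word_okP y : word_ok n.+1 nletters RW y -> okl (fun p => numl (y p)).
Proof. by move=> [h1 h2] p hp; apply: h2. Qed.

Lemma wnum_ok w : okl w -> word_ok n.+1 nletters RW (wnum w).
Proof. by move=> h; split=> [p _|p hp]; [exact: lnum_lt|rewrite /RW /wnum !lnumK; apply: h]. Qed.

Definition word_of_sites x := wnum (letters_of x).

Theorem flips_word x x' : walled x -> walled x' -> (forall q, n < q -> x q = om) -> (forall q, n < q -> x' q = om) ->
  star (word_step n.+1 nletters RW) (word_of_sites x) (word_of_sites x') <-> star gstep x x'.
Proof.
move=> hx hx' ox ox'; split=> h.
  rewrite -(sites_letters hx ox) -(sites_letters hx' ox').
  have E z : letters_of z = fun p => numl (word_of_sites z p).
    by apply: functional_extensionality => p; rewrite /word_of_sites /wnum lnumK.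
  rewrite (E x) (E x'); apply: (star_map (f := fun y => sites_of (fun p => numl (y p)))) h.
  move=> y y' [/word_okP h1 /word_okP h2 [p [a [hp e]]]].
  have e' : (fun p => numl (y' p)) = upd (fun p => numl (y p)) p (numl a).
    by apply: functional_extensionality => q; rewrite e /upd; case: eqP.
  by rewrite e' in h2 *; apply: sites_step.
have [_ //] : walled x' /\ star (word_step n.+1 nletters RW) (word_of_sites x) (word_of_sites x').
clear hx' ox'; elim: h => [|z z' _ [hz IH] s]; first by split=> //; apply: star0.
split; first exact: gstep_walled hz s.
apply: star_trans IH _; apply: (star_map (f := wnum)) (letters_step hz s) => w w' [h1 h2 [p [v [hp e]]]].
apply: star1; split; try exact: wnum_ok.
exists p, (lnum v); split=> //; apply: functional_extensionality => q.
by rewrite e /wnum /upd; case: eqP.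
Qed.

Lemma word_of_sites_ok x : walled x -> word_ok n.+1 nletters RW (word_of_sites x).
Proof. by move=> h; apply/wnum_ok/letters_ok. Qed.

Lemma word_of_sites_out x p : n < p -> word_of_sites x p = lnum (inl (om, om)).
Proof. by move=> h; rewrite /word_of_sites /wnum /letters_of leqNgt h. Qed.

End Flips.

(** * Confluent systems *)

Section Confluence.
Variables (T : Type) (R : T -> T -> Prop).

Fixpoint reach k x y := if k is k'.+1 then exists2 z, R x z & reach k' z y else x = y.

Lemma reach_cat k l x y z : reach k x y -> reach l y z -> reach (k + l) x z.
Proof. by elim: k x => [x -> //|k IH x [u h1 h2] h3]; exists u => //; apply: IH h2 h3. Qed.

Lemma reach_star k x y : reach k x y -> star R x y.
Proof.
elim: k x => [x ->|k IH x [u h /IH]]; first exact: star0.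
exact: star_trans (star1 h).
Qed.

Variable V : T -> Prop.
Hypotheses (V_R : forall x y, V x -> R x y -> V y) (V_R' : forall x y, V y -> R x y -> V x)
  (diam : forall x y z, V x -> R x y -> R x z -> y = z \/ exists2 w, R y w & R z w).
Variable t : T.
Hypotheses (tV : V t) (term : forall y, ~ R t y).

(** The diamond closes with exactly one step on either side, so replacing the first step of a path
    to [t] by another one keeps the length of the path. *)
Lemma reach_step k x y : V x -> reach k x t -> R x y -> exists2 l, k = l.+1 & reach l y t.
Proof.
elim: k x y => [x y hx e h|k IH x y hx [z h1 h2] h]; first by case: (term (y := y)); rewrite -e.
exists k => //; case: (diam hx h h1) => [-> //|[w hw hw']].
have [l ek hl] := IH _ _ (V_R hx h1) h2 hw'.
by rewrite ek; exists w.
Qed.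

(** Going backwards prepends a step to the forward path to [t]; going forwards shortens that path by
    [reach_step]. Undoing steps therefore gains nothing. *)
Lemma sym_reach x : star (fun a b => R a b \/ R b a) t x -> V x /\ exists k, reach k x t.
Proof.
elim=> [|a b _ [hV [k hk]] [h|h]]; first by split=> //; exists 0.
  have [l _ hl] := reach_step hV hk h; split; last by exists l.
  exact: V_R hV h.
by split; [exact: V_R' hV h|exists k.+1, a].
Qed.

(** It is used in the contrapositive: an array that can run for arbitrarily many steps is not
    connected to the terminal configuration. *)
Lemma reach_bound k x : V x -> reach k x t -> forall l y, reach l x y -> l <= k.
Proof.
move=> hV hk l; elim: l k x hV hk => // l IH k x hV hk y [z h1 h2].
have [k' -> hk'] := reach_step hV hk h1.
exact: IH (V_R hV h1) hk' _ h2.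
Qed.

End Confluence.

(** * The universal array *)

(** Operations on the accumulator and a memory bit: 1 resets the accumulator,
    2 tests the bit, 3 and 4 conditionally set and clear it, 5 halts. *)
Definition exec_op (o : nat) (r d : bool) : bool * bool :=
  match o with 1 => (true, d) | 2 => (r && d, d) | 3 => (r, d || r) | 4 => (r, d && ~~ r) | _ => (r, d) end.

Definition plet : finType := (bool * 'I_6)%type.
Definition acell : finType := (bool * plet)%type.
(** Active flag, accumulator, carried letter, halting flag. *)
Definition agent : finType := (bool * bool * plet * bool)%type.
(** [inl true] and [inl false] mark the cells to the left and to the right of
    the agent; an agent has a direction ([true] is right) and is ready or has
    just arrived. *)
Definition mark : finType := (bool + bool * bool * agent)%type.
(** [inl true] is the wall and [inl false] the accepting site. *)
Definition site : finType := (bool + acell * mark)%type.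

(** The agent exchanges its letter with the one of the cell and executes the latter. *)
Definition process (first : bool) (x : acell) (s : agent) : acell * agent :=
  let: (d, p) := x in let: (act, r, c, _) := s in
  let act' := if first then p.1 else act && ~~ p.1 in
  let rd := if act' then exec_op p.2 r d else (r, d) in
  ((rd.2, c), (act', rd.1, p, [&& act', p.2 == 5 :> nat & r])).

Definition lm (x : acell) : site := inr (x, inl true).
Definition rm (x : acell) : site := inr (x, inl false).
Definition ag (x : acell) dir rdy s : site := inr (x, inr (dir, rdy, s)).
Definition wall : site := inl true.
Definition acc : site := inl false.

(** A move of the agent takes three flips: it appears in the next cell, it vanishes from the
    previous one, and it settles by becoming ready, turning around or accepting. Each flip is
    visible to its two neighbours, so the order of the three is forced. An accepting site overwrites
    first the cells next to it and then all others, so that nothing of the tapes remains. *)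
Definition fwd (l a r : site) : option site :=
  match a with
  | inr (x, inl false) => match l, r with
      | inl false, inl true => Some acc
      | inl false, inr (_, inl false) => Some acc
      | inr (_, inr (true, true, s)), _ => let: (x', s') := process false x s in Some (ag x' true false s')
      | _, _ => None end
  | inr (x, inl true) => match r, l with
      | inl false, inl true => Some acc
      | inl false, inr (_, inl true) => Some acc
      | inr (_, inr (false, true, s)), _ => Some (ag x false false s)
      | _, _ => None end
  | inr (x, inr (true, true, s)) => if r is inr (_, inr (true, false, _)) then Some (lm x) else None
  | inr (x, inr (true, false, s)) => match l, r with
      | inr (_, inl true), inl true => Some (if s.2 then acc else ag x false true s)
      | inr (_, inl true), inr (_, inl false) => Some (if s.2 then acc else ag x true true s)
      | _, _ => None end
  | inr (x, inr (false, true, s)) => if l is inr (_, inr (false, false, _)) then Some (rm x) else None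
  | inr (x, inr (false, false, s)) => match l, r with
      | inl true, inr (_, inl false) => let: (x', s') := process true x s in Some (ag x' true true s')
      | inr (_, inl true), inr (_, inl false) => Some (ag x false true s)
      | _, _ => None end
  | _ => None
  end.

Definition kind (a : site) : nat :=
  match a with
  | inl true => 0 | inl false => 1 | inr (_, inl true) => 2 | inr (_, inl false) => 3
  | inr (_, inr (true, true, _)) => 4 | inr (_, inr (true, false, _)) => 5
  | inr (_, inr (false, true, _)) => 6 | inr (_, inr (false, false, _)) => 7
  end.

(** Which kind may stand immediately to the left of which. *)
Definition allowed (a b : nat) : bool :=
  b \in nth [::] [:: [:: 1; 2; 4; 5; 6; 7];
    [:: 0; 1; 3];
    [:: 1; 2; 4; 5; 6; 7];
    [:: 0; 3];
    [:: 0; 3; 5];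
    [:: 0; 3];
    [:: 0; 3];
    [:: 0; 3; 6]] a.

Definition aok (a b : site) := allowed (kind a) (kind b).

Ltac sites a := destruct a as [[|]|[? [[|]|[[[|] [|]] ?]]]].

Lemma fwd_ok l a r c : fwd l a r = Some c -> aok l a -> aok a r -> aok l c && aok c r.
Proof.
sites a; sites l; (try by []); sites r; (try by []);
  first [by case=> <- | by rewrite /fwd; case: process => ? ? [<-] | by rewrite /fwd; case: ifP => _ [<-]].
Qed.

Lemma fwd_ok' l a r c : fwd l a r = Some c -> aok l c -> aok c r -> aok l a && aok a r.
Proof.
sites a; sites l; (try by []); sites r; (try by []);
  first [by case=> <- | by rewrite /fwd; case: process => ? ? [<-] | by rewrite /fwd; case: ifP => _ [<-]].
Qed.

(** Adjacent sites are never enabled together. Steps at other sites commute, since none of them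
    changes a neighbour on which the other depends; this gives the diamond property. *)
Lemma fwd_apart a b c d : aok a b -> aok b c -> aok c d -> fwd a b c <> None -> fwd b c d = None.
Proof.
move=> h1 h2 h3; sites b; sites c; try discriminate h2; sites a; try discriminate h1;
  try (by case); sites d; try discriminate h3; by [].
Qed.

Section Array.
Variable n : nat.
Hypothesis n2 : 1 < n.

Definition flipf (l a c r : site) : bool := (fwd l a r == Some c) || (fwd l c r == Some a).

Lemma flipf_sym l a c r : flipf l a c r = flipf l c a r.
Proof. by rewrite /flipf orbC. Qed.

Local Notation sites := (nat -> site).
Implicit Types x y z : sites.

Definition fstep x x' := exists p c, [/\ 0 < p, p <= n, fwd (x p.-1) (x p) (x p.+1) = Some c & x' = upd x p c].
Definition avalid x := forall q, q <= n -> aok (x q) (x q.+1).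

Lemma upd_aok x p c : 0 < p -> p <= n -> (forall q, q <= n -> q != p -> q.+1 != p -> aok (x q) (x q.+1)) ->
  aok (x p.-1) c -> aok c (x p.+1) -> avalid (upd x p c).
Proof.
move=> p0 pn h h1 h2 q hq; case: (q =P p) => [->|/eqP nq].
  by rewrite upd_same upd_other //; apply/eqP; lia.
case: (q.+1 =P p) => [e|/eqP nq']; first by rewrite e upd_same upd_other // -e in h1 *.
by rewrite !upd_other //; apply: h.
Qed.

Lemma fstep_valid x y : avalid x -> fstep x y -> avalid y.
Proof.
move=> h [p [c [p0 pn e ->]]].
have h1 := h p.-1; rewrite prednK // in h1; have h2 := h p pn.
have /andP[k1 k2] := fwd_ok e (h1 (leq_trans (leq_pred _) pn)) h2.
by apply: upd_aok => // q hq _ _; apply: h.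
Qed.

(** Validity must also survive backward steps, because the symmetric closure is explored from its
    terminal configuration. *)
Lemma fstep_valid' x y : avalid y -> fstep x y -> avalid x.
Proof.
move=> h [p [c [p0 pn e ey]]].
have yo q : q != p -> y q = x q by move=> nq; rewrite ey upd_other.
have yp : y p = c by rewrite ey upd_same.
have h1 := h p.-1; rewrite prednK // yp yo in h1; last by apply/eqP; lia.
have h2 := h p pn; rewrite yp yo in h2; last by apply/eqP; lia.
have /andP[k1 k2] := fwd_ok' e (h1 (leq_trans (leq_pred _) pn)) h2.
rewrite -[x](upd_id x p); apply: upd_aok => // q hq nq nq'.
by have := h q hq; rewrite !yo.
Qed.

Lemma fstep_diam x y z : avalid x -> fstep x y -> fstep x z -> y = z \/ exists2 w, fstep y w & fstep z w.
Proof.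
move=> h [p [c [p0 pn e ->]]] [q [d [q0 qn e' ->]]].
have ap p' c' : p'.+1 <= n -> 0 < p' -> fwd (x p'.-1) (x p') (x p'.+1) = Some c' -> fwd (x p'.+1.-1) (x p'.+1) (x p'.+2) = None.
  move=> h1 h2 h3; apply: fwd_apart (_ : fwd (x p'.-1) (x p') (x p'.+1) <> None); rewrite ?h3 //; try apply: h; try lia.
  by have := h p'.-1; rewrite prednK //; apply; lia.
case: (p =P q) => [epq|npq]; first by subst q; left; move: e'; rewrite e => -[->].
case: (q =P p.+1) => [eq|nq]; first by subst q; have := ap p c qn p0 e; rewrite e'.
case: (p =P q.+1) => [ep|np]; first by subst p; have := ap q d pn q0 e'; rewrite e.
right; exists (upd (upd x p c) q d).
  by exists q, d; split=> //; rewrite !upd_other //; apply/eqP; lia.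
rewrite upd_comm; last by apply/eqP.
by exists p, c; split=> //; rewrite !upd_other //; apply/eqP; lia.
Qed.

Lemma gstep_fstep x y : gstep flipf n x y <-> (fstep x y \/ fstep y x).
Proof.
split=> [[p [c [p0 pn /orP[]/eqP e ->]]]|[[p [c [p0 pn e ->]]]|[p [c [p0 pn e ->]]]]].
- by left; exists p, c.
- right; exists p, (x p); rewrite upd_upd upd_id upd_same !upd_other; [by []|apply/eqP; lia|apply/eqP; lia].
- by exists p, c; split=> //; rewrite /flipf e eqxx.
exists p, (y p); rewrite upd_upd upd_id upd_same !upd_other; [|apply/eqP; lia|apply/eqP; lia].
by split=> //; rewrite /flipf e eqxx orbT.
Qed.

(** The target carries no trace of the computation and has no enabled site. *)
Definition allacc : sites := fun q => if (q == 0) || (n < q) then wall else acc.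

Lemma allacc_valid : avalid allacc.
Proof.
move=> q hq; rewrite /allacc [q.+1 == 0]/= orFb ltnS [n < q]ltnNge hq orbF.
case: (posnP q) => [->|q0]; first by rewrite /= ifF //; lia.
by case: ifP.
Qed.

Lemma allacc_term y : ~ fstep allacc y.
Proof.
move=> [p [c [p0 pn]]].
have -> : allacc p = acc by rewrite /allacc ifF //; lia.
by [].
Qed.

Definition Kc (cl : nat -> acell) p (a : site) : sites := fun q =>
  if (q == 0) || (n < q) then wall else if q < p then lm (cl q) else if q == p then a else rm (cl q).

Lemma Kl cl p a : 0 < p -> p <= n -> Kc cl p a p.-1 = if p == 1 then wall else lm (cl p.-1).
Proof.
move=> p0 pn; rewrite /Kc; case: (p =P 1) => [->//|n1].
by rewrite (_ : (p.-1 == 0) || (n < p.-1) = false) 1?(_ : p.-1 < p) //; lia.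
Qed.
Lemma Kp cl p a : 0 < p -> p <= n -> Kc cl p a p = a.
Proof. by move=> p0 pn; rewrite /Kc ltnn eqxx ifF //; lia. Qed.
Lemma Kr cl p a : 0 < p -> p <= n -> Kc cl p a p.+1 = if p == n then wall else rm (cl p.+1).
Proof.
move=> p0 pn; rewrite /Kc /= ltnS leq_eqVlt eq_sym; case: (p =P n) => [->//|n1].
by rewrite (_ : n < p = false) /= 1?(_ : p.+1 < p = false) 1?(_ : p.+1 == p = false) //; lia.
Qed.

Lemma Kc_upd cl p a b : 0 < p -> p <= n -> upd (Kc cl p a) p b = Kc cl p b.
Proof.
move=> p0 pn; apply: functional_extensionality => q; rewrite /upd /Kc.
by case: (q =P p) => // ->; rewrite ltnn ifF //; lia.
Qed.

(** Only lower bounds on the number of steps are kept: to refute termination it is enough that the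
    paths get arbitrarily long. *)
Definition far k x y := exists2 l, k <= l & reach fstep l x y.

Lemma far_cat k l x y z : far k x y -> far l y z -> far (k + l) x z.
Proof. by move=> [k' h1 h2] [l' h3 h4]; exists (k' + l'); [lia|exact: reach_cat h2 h4]. Qed.

Lemma far1 x y : fstep x y -> far 1 x y. Proof. by move=> h; exists 1 => //; exists y. Qed.

Lemma far_le k l x y : k <= l -> far l x y -> far k x y.
Proof. by move=> h [l' h1 h2]; exists l' => //; lia. Qed.

Lemma step_at x p c : 0 < p -> p <= n -> fwd (x p.-1) (x p) (x p.+1) = Some c -> far 1 x (upd x p c).
Proof. by move=> h1 h2 h3; apply: far1; exists p, c. Qed.

Definition settled (p : nat) (x : acell) (s : agent) : site :=
  if s.2 then acc else ag x (p != n) true s.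

Lemma move_right cl p s : 0 < p -> p < n ->
  let y := process false (cl p.+1) s in
  far 1 (Kc cl p (ag (cl p) true true s)) (Kc (upd cl p.+1 y.1) p.+1 (settled p.+1 y.1 y.2)).
Proof.
move=> p0 pn; cbv zeta; case E: process => [x' s']; cbn [fst snd]; have pn' := ltnW pn.
set k0 := Kc _ _ _; have pe : (p == n) = false by lia.
have h1 : far 1 k0 (upd k0 p.+1 (ag x' true false s')).
  apply: step_at => //; rewrite [_.-1]/= {1}/k0 Kp // {1}/k0 Kr // pe /= E //.
have e1 : upd (upd k0 p.+1 (ag x' true false s')) p (lm (cl p)) = Kc (upd cl p.+1 x') p.+1 (ag x' true false s').
  apply: functional_extensionality => q; rewrite /k0 /Kc /upd.
  case: (q =P p) => [->|nq]; first by rewrite ltnSn ifF ?ifF //; lia.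
  case: (q =P p.+1) => [->|nq']; first by rewrite ltnn ifF //; lia.
  case: ifP => // _; rewrite (_ : (q < p.+1) = (q < p)) //; lia.
have h2 : far 1 (upd k0 p.+1 (ag x' true false s')) (Kc (upd cl p.+1 x') p.+1 (ag x' true false s')).
  rewrite -e1; apply: step_at => //; rewrite upd_same !upd_other; try by apply/eqP; lia.
  by rewrite {2}/k0 Kp.
apply: (@far_le _ 3) => //; apply: (@far_cat 2 1 _ _ _ (far_cat h1 h2)).
rewrite -[X in far _ _ X](Kc_upd _ (ag x' true false s')) //; apply: step_at => //.
rewrite Kl // Kp // Kr // [p.+1 == 1](_ : _ = false) /=; last by lia.
by rewrite /settled; case: (p.+1 =P n) => _ /=; case: s'.2.
Qed.

Definition Kstart cl (s : agent) := Kc cl 1 (ag (cl 1) false false s).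

Lemma settle_first cl s : let y := process true (cl 1) s in
  far 1 (Kstart cl s) (Kc (upd cl 1 y.1) 1 (ag y.1 true true y.2)).
Proof.
cbv zeta; case E: process => [x' s']; cbn [fst snd].
have -> : Kc (upd cl 1 x') 1 (ag x' true true s') = Kc cl 1 (ag x' true true s').
  apply: functional_extensionality => q; rewrite /Kc /upd; case: (q =P 1) => // ->.
  by rewrite ltnn.
have n0 := ltnW n2.
rewrite -[X in far _ _ X](Kc_upd _ (ag (cl 1) false false s)) //; apply: step_at => //.
by rewrite /Kstart Kl // Kp // Kr // (_ : (1 == n) = false) /= ?E //; lia.
Qed.

Lemma settle_left cl p s : 1 < p -> p < n ->
  far 1 (Kc cl p (ag (cl p) false false s)) (Kc cl p (ag (cl p) false true s)).
Proof.
move=> p1 pn; have pn' := ltnW pn; have p0 := ltnW p1.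
rewrite -[X in far _ _ X](Kc_upd _ (ag (cl p) false false s)) //; apply: step_at => //.
rewrite Kl // Kp // Kr // (_ : (p == n) = false); last by lia.
by rewrite (_ : (p == 1) = false); last by lia.
Qed.

Lemma move_left cl p s : 0 < p -> p < n ->
  far 1 (Kc cl p.+1 (ag (cl p.+1) false true s)) (Kc cl p (ag (cl p) false false s)).
Proof.
move=> p0 pn; have pn' := ltnW pn.
set k0 := Kc _ p.+1 _; have pe : (p.+1 == 1) = false by lia.
have h1 : far 1 k0 (upd k0 p (ag (cl p) false false s)).
  apply: step_at => //; rewrite {3}/k0 Kp // {2}/k0 -[X in Kc _ _ _ X]/(p.+1.-1) Kl // pe /=.
  by case: (k0 p.-1) => [[]|].
have e1 : upd (upd k0 p (ag (cl p) false false s)) p.+1 (rm (cl p.+1)) = Kc cl p (ag (cl p) false false s).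
  apply: functional_extensionality => q; rewrite /k0 /Kc /upd.
  case: (q =P p.+1) => [->|nq]; first by do 3?[case: ifP => //= ?]; lia.
  case: (q =P p) => [->|nq']; first by rewrite ltnn ifF //; lia.
  case: ifP => // _; rewrite (_ : (q < p.+1) = (q < p)) //; lia.
apply: (@far_le _ 2) => //; apply: (far_cat h1); rewrite -e1.
apply: step_at => //; rewrite [_.-1]/= upd_same !upd_other; try by apply/eqP; lia.
by rewrite {1}/k0 Kp.
Qed.

Lemma move_back cl p s : 0 < p -> p < n ->
  far 1 (Kc cl p.+1 (ag (cl p.+1) false true s)) (Kstart cl s).
Proof.
elim: p => // p IH _ pn; have h := move_left cl s (isT : 0 < p.+1) pn.
case: p IH pn h => [|p] IH pn h; first exact: h.
apply: (@far_le _ 3) => //; apply: (@far_cat 2 1); last by apply: IH => //; apply: ltnW.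
by apply: far_cat h _; apply: settle_left.
Qed.

Lemma Kc_ext cl cl' p a : (forall q, 0 < q -> q <= n -> cl q = cl' q) -> Kc cl p a = Kc cl' p a.
Proof.
move=> h; apply: functional_extensionality => q; rewrite /Kc.
by case: ifP => // hq; rewrite h //; lia.
Qed.

Lemma acc_spread cl p : 0 < p -> p <= n -> far 0 (Kc cl p acc) allacc.
Proof.
move=> p0 pn.
(* The accepting sites form the interval from [i] to [j]; it is extended to the left first and to
   the right afterwards. *)
pose E i j : sites := fun q => if (q == 0) || (n < q) then wall else if q < i then lm (cl q) else if q <= j then acc else rm (cl q).
have e0 : Kc cl p acc = E p p.
  apply: functional_extensionality => q; rewrite /Kc /E; case: ifP => // _; case: ifP => // h.
  by rewrite leq_eqVlt h orbF.
have e1 : E 1 n = allacc.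
  apply: functional_extensionality => q; rewrite /E /allacc; case: ifP => // h.
  by rewrite ifF ?ifT //; lia.
have s1 i : 0 < i -> i <= p -> far 0 (E i p) (E 1 p).
  elim: i => [//|[|i] IH] i0 hi; first by exists 0.
  apply: (@far_cat 0 0 _ (E i.+1 p)); last by apply: IH => //; apply: ltnW.
  have -> : E i.+1 p = upd (E i.+2 p) i.+1 acc.
    apply: functional_extensionality => q; rewrite /E /upd; case: (q =P i.+1) => [->|nq].
      by rewrite ltnn ifF ?ifT //; lia.
    by rewrite (_ : (q < i.+2) = (q < i.+1)) //; lia.
  apply: (@far_le _ 1) => //; apply: step_at => //; first by lia.
  rewrite /E [_.-1]/= ltnSn ltnn [i.+2 <= p]hi [i.+2 == 0]/= [i.+1 == 0]/= !orFb.
  rewrite (_ : n < i.+2 = false) 1?(_ : n < i.+1 = false) 1?(_ : n < i = false) ?orbF; try by lia.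
  by case: (i == 0) => //=; rewrite ltnS leqnSn.
have s2 j : j <= n - p -> far 0 (E 1 p) (E 1 (p + j)).
  elim: j => [|j IH] hj; first by exists 0; rewrite ?addn0.
  apply: (@far_cat 0 0 _ _ _ (IH (ltnW hj))).
  have -> : E 1 (p + j.+1) = upd (E 1 (p + j)) (p + j.+1) acc.
    apply: functional_extensionality => q; rewrite /E /upd; case: (q =P p + j.+1) => [->|nq].
      by do 3?[case: ifP => //= ?]; lia.
    by rewrite (_ : (q <= p + j.+1) = (q <= p + j)) //; lia.
  apply: (@far_le _ 1) => //; apply: step_at => //; [lia|lia|].
  rewrite /E addnS /= leqnn ltnn (_ : (p + j == 0) || (n < p + j) = false); last by lia.
  rewrite (_ : p + j < 1 = false) 1?(_ : n < (p + j).+1 = false) 1?(_ : (p + j).+2 <= p + j = false) //=; try lia.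
  by case: (n < _).
rewrite e0 -e1; apply: (@far_cat 0 0 _ _ _ (s1 p p0 (leqnn _))).
by have := s2 _ (leqnn _); rewrite subnKC.
Qed.

Lemma Kc_valid cl p (x : acell) dir rdy s : 0 < p -> p <= n -> avalid (Kc cl p (ag x dir rdy s)).
Proof.
move=> p0 pn q hq; rewrite /Kc [q.+1 == 0]/= orFb ltnS [n < q]ltnNge hq orbF.
case: (posnP q) => [->|q0].
  rewrite /= ifF; last by lia.
  by case: (ltngtP 1 p) => //= [|_]; [lia|case: dir; case: rdy].
have [h|h|h] := ltngtP q p.
- rewrite (_ : n <= q = false); last by lia.
  by case: (ltngtP q.+1 p) => //= [|_]; [lia|case: dir; case: rdy].
- rewrite (_ : q.+1 < p = false) 1?(_ : q.+1 == p = false); try lia.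
  by case: ifP.
- subst q; rewrite (_ : p.+1 < p = false) 1?(_ : p.+1 == p = false); try lia.
  by case: ifP => _; case: dir; case: rdy.
Qed.

(** The two parts serve the two directions of the simulation: a run without end contradicts the
    first, and a run that meets an accepting site satisfies the second. *)
Theorem array_halts cl s :
  (star (gstep flipf n) (Kstart cl s) allacc -> exists k, forall l y, far l (Kstart cl s) y -> l <= k) /\
  (forall cl' p, 0 < p -> p <= n -> far 0 (Kstart cl s) (Kc cl' p acc) -> star (gstep flipf n) (Kstart cl s) allacc).
Proof.
have hV : avalid (Kstart cl s) by apply: Kc_valid => //; lia.
split=> [h|cl' p p0 pn h].
  have h' : star (fun a b => fstep a b \/ fstep b a) allacc (Kstart cl s).
    apply: star_sym => [x y []|]; [by right|by left|].
    by apply: star_impl h => x y /gstep_fstep.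
  have [_ [k hk]] := sym_reach fstep_valid fstep_valid' fstep_diam allacc_valid allacc_term h'.
  exists k => l y [l' h1 h2]; apply: leq_trans h1 _.
  exact: (reach_bound fstep_valid fstep_diam allacc_term hV hk h2).
have [l _ hl] := @far_cat 0 0 _ _ _ h (acc_spread cl' p0 pn).
by apply: star_impl (reach_star hl) => x y hxy; apply/gstep_fstep; left.
Qed.

End Array.

(** ** One round of the agent *)

Lemma far_seq n k l j x y z : j <= k + l -> far n k x y -> far n l y z -> far n j x z.
Proof. by move=> h [k' h1 h2] [l' h3 h4]; exists (k' + l'); [lia|exact: reach_cat h2 h4]. Qed.

Section Round.
Variable n : nat.
Hypothesis n2 : 1 < n.

Section OneRound.
Variables (d : nat -> bool) (W : nat -> plet) (r : bool).

(** These are the flags of the agent after cell [q]; the letter it carries at the start is [W 0]. It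
    is active only if a block starts in cell 1, and the start of the next block switches it off, so
    one round executes at most one block, aligned with the cells. *)
Fixpoint act_at q := if q is q'.+1 then (if q' == 0 then (W 1).1 else act_at q' && ~~ (W q).1) else false.
Fixpoint acc_at q := if q is q'.+1 then
  (if act_at q then (exec_op (W q).2 (acc_at q') (d q)).1 else acc_at q') else r.
Definition new_bit q := if act_at q then (exec_op (W q).2 (acc_at q.-1) (d q)).2 else d q.
Definition halt_at q := [&& act_at q, (W q).2 == 5 :> nat & acc_at q.-1].
Definition agent_at q : agent := (act_at q, acc_at q, W q, halt_at q).
Definition cells : nat -> acell := fun q => (d q, W q).
Definition cells_at q : nat -> acell := fun i => if (0 < i) && (i <= q) then (new_bit i, W i.-1) else cells i.

Lemma process_at q a h : process (q == 0) (cells q.+1) (if q == 0 then a else act_at q, acc_at q, W q, h) =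
  ((new_bit q.+1, W q), agent_at q.+1).
Proof.
rewrite /process /cells /agent_at /new_bit /halt_at /=; case: (posnP q) => [->|q0] /=.
  by case: ((W 1).1).
by case: (_ && _).
Qed.

Lemma cells_atS q : upd (cells_at q) q.+1 (new_bit q.+1, W q) = cells_at q.+1.
Proof.
apply: functional_extensionality => i; rewrite /upd /cells_at.
case: (i =P q.+1) => [->|ni]; first by rewrite leqnn.
by rewrite (_ : (i <= q.+1) = (i <= q)) //; lia.
Qed.

Definition Kround a h := Kstart n cells (a, r, W 0, h).

(** Cell 1 is processed while the agent turns at the wall, and the halting flag is not consulted
    there. Hence the condition [1 < i], and hence programs whose blocks do not begin with operation
    5. *)
Lemma sweep a h q : 0 < q -> q <= n -> (forall i, 1 < i -> i <= q -> ~~ halt_at i) ->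
  far n 1 (Kround a h) (Kc n (cells_at q) q (ag (cells_at q q) (q != n) true (agent_at q))).
Proof.
have cS i : cells_at i i.+1 = cells i.+1 by rewrite /cells_at ltnn andbF.
have cS' i : cells_at i.+1 i.+1 = (new_bit i.+1, W i) by rewrite /cells_at leqnn.
elim: q => // q IH _ hq hh; case: (posnP q) => [q0|q0].
  subst q; have S := settle_first n2 cells (a, r, W 0, h).
  have E : process true (cells 1) (a, r, W 0, h) = ((new_bit 1, W 0), agent_at 1) := process_at 0 a h.
  rewrite E in S; move: S; cbn [fst snd]; have -> : (1 != n) by lia.
  have <- := cells_atS 0; rewrite upd_same /Kround.
  have -> // : upd cells 1 (new_bit 1, W 0) = upd (cells_at 0) 1 (new_bit 1, W 0).
  by congr upd; apply: functional_extensionality => i; rewrite /cells_at; case: i.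
have hq' := ltnW hq.
have := IH q0 hq' (fun i h1 h2 => hh i h1 (leqW h2)).
rewrite (_ : (q != n)); last by lia.
move=> f; apply: (far_seq (isT : 1 <= 1 + 1) f).
have := move_right n2 (cells_at q) (agent_at q) q0 hq.
rewrite cS; have := process_at q (act_at q) (halt_at q); rewrite if_same -/(agent_at q).
rewrite (_ : (q == 0) = false); last by lia.
move=> ->; cbn [fst snd]; rewrite cells_atS cS' /settled.
by rewrite (_ : (agent_at q.+1).2 = false) //; apply/negbTE/hh.
Qed.

Lemma sweep_halt a h q : 0 < q -> q < n -> (forall i, 1 < i -> i <= q -> ~~ halt_at i) -> halt_at q.+1 ->
  exists cl, far n 0 (Kround a h) (Kc n cl q.+1 acc).
Proof.
move=> q0 hq hh hs; have f := sweep a h q0 (ltnW hq) hh.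
rewrite (_ : (q != n)) in f; last by lia.
have := move_right n2 (cells_at q) (agent_at q) q0 hq.
have -> : cells_at q q.+1 = cells q.+1 by rewrite /cells_at ltnn andbF.
have := process_at q (act_at q) (halt_at q); rewrite if_same -/(agent_at q).
rewrite (_ : (q == 0) = false); last by lia.
move=> ->; cbn [fst snd]; rewrite cells_atS /settled.
rewrite (_ : (agent_at q.+1).2 = true) // => f'.
by exists (cells_at q.+1); apply: far_seq f f'.
Qed.

Lemma round a h : (forall i, 1 < i -> i <= n -> ~~ halt_at i) ->
  far n 1 (Kround a h) (Kstart n (cells_at n) (agent_at n)).
Proof.
move=> hh; have n0 : 0 < n by lia.
have f := sweep a h n0 (leqnn n) hh.
rewrite eqxx /= in f; apply: (far_seq (isT : 1 <= 1 + 1) f).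
have e : n = n.-1.+1 by lia.
have := @move_back n n2 (cells_at n) n.-1 (agent_at n); rewrite -e; apply; lia.
Qed.

Lemma idle : ~~ (W 1).1 -> [/\ forall q, act_at q = false, forall q, acc_at q = r & forall q, new_bit q = d q].
Proof.
move=> h; have A q : act_at q = false.
  elim: q => // q IH; have -> : act_at q.+1 = if q == 0 then (W 1).1 else act_at q && ~~ (W q.+1).1 by [].
  by rewrite (negPf h) IH if_same.
split=> // q; last by rewrite /new_bit A.
by elim: q => //= q ->; have := A q.+1; rewrite /= => ->.
Qed.

End OneRound.

(** ** Block programs *)

(** [B] blocks of [m] instructions; the [o]-th one of a block concerns the [o]-th bit. *)
Variables (B m : nat) (prog : nat -> nat -> nat).
Hypotheses (B1 : 1 < B) (m0 : 0 < m) (nE : n.+1 = B * m) (prog6 : forall j o, prog j o < 6) (prog0 : forall j, prog j 0 != 5).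

Definition bacc j r (d : nat -> bool) := fix f o := if o is o'.+1 then (exec_op (prog j o') (f o') (d o')).1 else r.
Definition bbit j r d o := if o < m then (exec_op (prog j o) (bacc j r d o) (d o)).2 else d o.
Definition bhalt j r d := has (fun o => (prog j o == 5) && bacc j r d o) (iota 0 m).

Fixpoint brun j (rd : bool * (nat -> bool)) :=
  if j is j'.+1 then let: (r, d) := brun j' rd in (bacc (j' %% B) r d m, bbit (j' %% B) r d) else rd.

Definition ord6 (o : nat) : 'I_6 := inord o.
(** The ring of letters rotates towards the right, so that its blocks are listed backwards. *)
Definition ring (u : nat) : plet := (u %% m == 0, ord6 (prog ((B - u %/ m) %% B) (u %% m))).
(** As [n] is congruent to -1 modulo [n.+1], this is the rotation by [t] places to the right,
    written without subtraction. The ring has [n.+1] letters: one in each cell and the one carried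
    by the agent. *)
Definition ring_at t (i : nat) : plet := ring ((i + t * n) %% n.+1).

Lemma ring_rot t i : (if i == 0 then ring_at t n else ring_at t i.-1) = ring_at t.+1 i.
Proof.
rewrite /ring_at mulSn; case: (posnP i) => [->|i0]; first by rewrite add0n.
congr ring.
have -> : i + (n + t * n) = i.-1 + t * n + n.+1 by lia.
by rewrite modnDr.
Qed.

Definition rot_letters (W : nat -> plet) i := if i == 0 then W n else W i.-1.

Lemma rot_ring t : rot_letters (ring_at t) = ring_at t.+1.
Proof. by apply: functional_extensionality => i; apply: ring_rot. Qed.

Lemma round_rot d W r a h : (forall i, 1 < i -> i <= n -> ~~ halt_at d W r i) ->
  far n 1 (Kround d W r a h) (Kround (new_bit d W r) (rot_letters W) (acc_at d W r n) (act_at W n) (halt_at d W r n)).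
Proof.
move=> hh; have := round a h hh; rewrite /Kround /Kstart.
have -> : rot_letters W 0 = W n by [].
have e q : 0 < q -> q <= n -> cells_at d W r n q = cells (new_bit d W r) (rot_letters W) q.
  by case: q => // q q0 hq; rewrite /cells_at q0 hq.
by rewrite (Kc_ext n2 1 _ e) // e //; lia.
Qed.

Lemma back_sum j : B %| (B - j %% B) %% B + j.
Proof.
by rewrite /dvdn -modnDmr modnDml subnK ?modnn // ltnW // ltn_mod; lia.
Qed.

Lemma ring_idx j q : 0 < q -> (q + (j * m).+1 * n) %% n.+1 = (q.-1 + ((B - j %% B) %% B) * m) %% n.+1.
Proof.
move=> q0; apply/eqP; rewrite -(eqn_modDr (j * m)).
have -> : q + (j * m).+1 * n + j * m = (j * m).+1 * n.+1 + q.-1.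
  by rewrite mulnS -[q in LHS](prednK q0); lia.
rewrite modnMDl -addnA -mulnDl; have /dvdnP[k ->] := back_sum j.
by rewrite -mulnA -nE addnC modnMDl.
Qed.

(** At time [t.+1], cell 1 holds the letter with index [- t] modulo [n.+1], and blocks have length
    [m], which divides [n.+1]. So a block is aligned once in [m] rounds. *)
Lemma ring_first t : (ring_at t.+1 1).1 = (m %| t).
Proof.
rewrite /ring_at /= modn_dvdm; last by rewrite nE dvdn_mull.
rewrite -/(dvdn m (1 + t.+1 * n)).
have e : 1 + t.+1 * n + t = t.+1 * n.+1 by rewrite mulnS; lia.
have hd : m %| 1 + t.+1 * n + t by rewrite e nE mulnA dvdn_mull.
by apply/idP/idP => h; [rewrite -(dvdn_addr t h)|rewrite -(dvdn_addl _ h)].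
Qed.

(** *** A synchronised round executes one block *)
Section Block.
Variables (j : nat) (r : bool) (d : nat -> bool).
Let W := ring_at (j * m).+1.
Let dd q := d q.-1.

Lemma W_sync q : 0 < q -> (W q).1 = (m %| q.-1).
Proof.
move=> q0; rewrite /W /ring_at ring_idx //= modn_dvdm; last by rewrite nE dvdn_mull.
by rewrite addnC modnMDl.
Qed.

Lemma W_op q : q < m -> (W q.+1).2 = prog (j %% B) q :> nat.
Proof.
move=> hq; rewrite /W /ring_at ring_idx //= /ord6.
set b := (B - j %% B) %% B; have hb : b < B by rewrite ltn_mod; lia.
rewrite (@modn_small (q + b * m)); last first.
  by rewrite nE; apply: (@leq_trans (b.+1 * m)); [rewrite mulSn; lia|rewrite leq_mul2r hb orbT].
rewrite addnC modnMDl (modn_small hq) divnMDl // divn_small // addn0.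
have -> : (B - b) %% B = j %% B.
  rewrite /b; have hj : j %% B < B by rewrite ltn_mod; lia.
  case: (posnP (j %% B)) => [->|p]; first by rewrite subn0 modnn subn0 modnn.
  by rewrite (modn_small (_ : B - j %% B < B)) ?subKn ?modn_mod //; lia.
by rewrite inordK // prog6.
Qed.

Lemma W_act q : 0 < q -> act_at W q = (q <= m).
Proof.
elim: q => // q IH _; case: (posnP q) => [->|q0]; first by have -> : act_at W 1 = (W 1).1 by []; rewrite W_sync // dvdn0 m0.
have -> : act_at W q.+1 = act_at W q && ~~ (W q.+1).1 by case: (q) q0.
rewrite IH // W_sync //=; have [h|h|->] := ltngtP q m; [by rewrite gtnNdvd|by []|by rewrite dvdnn].
Qed.

Lemma W_acc q : q <= m -> acc_at dd W r q = bacc (j %% B) r d q.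
Proof.
elim: q => // q IH hq; have -> : acc_at dd W r q.+1 =
  if act_at W q.+1 then (exec_op (W q.+1).2 (acc_at dd W r q) (d q)).1 else acc_at dd W r q by [].
by rewrite W_act // hq W_op // IH // ltnW.
Qed.

Lemma W_acc_end q : m <= q -> acc_at dd W r q = bacc (j %% B) r d m.
Proof.
elim: q => [|q IH]; first by rewrite leqn0 => /eqP e; move: m0; rewrite e.
rewrite leq_eqVlt => /orP[/eqP <-|h]; first exact: W_acc.
have -> : acc_at dd W r q.+1 =
  if act_at W q.+1 then (exec_op (W q.+1).2 (acc_at dd W r q) (d q)).1 else acc_at dd W r q by [].
by rewrite W_act // leqNgt h; apply: IH.
Qed.

Lemma W_bit q : 0 < q -> new_bit dd W r q = bbit (j %% B) r d q.-1.
Proof.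
case: q => // q _; rewrite /new_bit /bbit W_act //=; case: ltnP => // h.
by rewrite W_op // W_acc // ltnW.
Qed.

Lemma W_halt q : halt_at dd W r q.+1 = [&& q < m, prog (j %% B) q == 5 & bacc (j %% B) r d q].
Proof.
rewrite /halt_at W_act //=; case: ltnP => //= h.
by rewrite W_op // W_acc // ltnW.
Qed.

Lemma bhaltP : reflect (exists2 q, q < m & (prog (j %% B) q == 5) && bacc (j %% B) r d q) (bhalt (j %% B) r d).
Proof.
apply: (iffP hasP) => [[q hq h]|[q hq h]]; last by exists q; rewrite ?mem_iota.
by exists q => //; move: hq; rewrite mem_iota.
Qed.

Lemma block_round a h : ~~ bhalt (j %% B) r d -> exists a' h',
  far n 1 (Kround dd W r a h) (Kround (fun q => bbit (j %% B) r d q.-1) (rot_letters W) (bacc (j %% B) r d m) a' h').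
Proof.
move=> nh; have hmn : m <= n by have : 2 * m <= n.+1; [rewrite nE leq_mul2r B1 orbT|lia].
exists (act_at W n), (halt_at dd W r n).
have hh i : 1 < i -> i <= n -> ~~ halt_at dd W r i.
  case: i => // i _ _; rewrite W_halt; apply: contra nh => /andP[h1 h2].
  by apply/bhaltP; exists i.
have := round_rot a h hh; rewrite W_acc_end //.
rewrite /Kround /Kstart; set c2 := cells (new_bit dd W r) _; set c3 := cells (fun q => bbit (j %% B) r d q.-1) _.
have e q : 0 < q -> q <= n -> c2 q = c3 q by move=> q0 _; rewrite /c2 /c3 /cells W_bit.
by rewrite (Kc_ext n2 1 _ e) // e //; lia.
Qed.

Lemma block_halt a h : bhalt (j %% B) r d -> exists cl p, [/\ 0 < p, p <= n & far n 0 (Kround dd W r a h) (Kc n cl p acc)].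
Proof.
move=> /bhaltP hx; have hmn : m <= n by have : 2 * m <= n.+1; [rewrite nE leq_mul2r B1 orbT|lia].
have hx' : exists q, (q < m) && ((prog (j %% B) q == 5) && bacc (j %% B) r d q).
  by case: hx => q h1 h2; exists q; rewrite h1.
case: (ex_minnP hx') => q /andP[hq /andP[h5 hb]] hmin.
have q0 : 0 < q by rewrite lt0n; apply: contraTneq h5 => ->; apply: prog0.
have hh i : 1 < i -> i <= q -> ~~ halt_at dd W r i.
  case: i => // i _ hi; rewrite W_halt; apply/negP => H.
  by have := hmin i H; rewrite leqNgt hi.
have hs : halt_at dd W r q.+1 by rewrite W_halt hq h5.
have [cl f] := sweep_halt a h q0 (leq_trans hq hmn) hh hs.
by exists cl, q.+1; split=> //; apply: leq_trans hq hmn.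
Qed.

End Block.

(** Without a block start in cell 1 a round merely rotates the ring; this bridges the [m.-1] rounds
    between two executed blocks. *)
Lemma idle_rounds t k r d a h : (forall i, i < k -> ~~ (m %| t + i)) -> exists a' h',
  far n 0 (Kround d (ring_at t.+1) r a h) (Kround d (ring_at (t + k).+1) r a' h').
Proof.
elim: k a h => [|k IH] a h hk; first by rewrite addn0; exists a, h; exists 0.
have [a' [h' f]] := IH a h (fun i hi => hk i (leqW hi)).
have nf : ~~ (ring_at (t + k).+1 1).1 by rewrite ring_first hk.
have [i1 i2 i3] := idle d r nf.
have := @round_rot d (ring_at (t + k).+1) r a' h' _.
have -> : new_bit d (ring_at (t + k).+1) r = d by apply: functional_extensionality.
rewrite rot_ring i2 addnS.
move=> f'; exists (act_at (ring_at (t + k).+1) n), (halt_at d (ring_at (t + k).+1) r n).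
by apply: far_seq f (f' _) => // i _ _; rewrite /halt_at i1.
Qed.

Definition Kinit (d : nat -> bool) := Kround (fun q => d q.-1) (ring_at 1) false false false.

Lemma far_blocks d j : (forall i, i < j -> ~~ bhalt (i %% B) (brun i (false, d)).1 (brun i (false, d)).2) ->
  exists a h, far n j (Kinit d) (Kround (fun q => (brun j (false, d)).2 q.-1) (ring_at (j * m).+1) (brun j (false, d)).1 a h).
Proof.
elim: j => [|j IH] hj; first by exists false, false; rewrite mul0n; exists 0.
have [a [h f]] := IH (fun i hi => hj i (leqW hi)).
have nh := hj j (ltnSn j); move: f nh; rewrite [brun j.+1 _]/=; case: (brun j _) => r dj /= f nh.
have [a' [h' f']] := block_round a h nh; rewrite rot_ring in f'.
have [a2 [h2 f2]] : exists a2 h2, far n 0 (Kround (fun q => bbit (j %% B) r dj q.-1) (ring_at (j * m).+2) (bacc (j %% B) r dj m) a' h')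
   (Kround (fun q => bbit (j %% B) r dj q.-1) (ring_at (j.+1 * m).+1) (bacc (j %% B) r dj m) a2 h2).
  have e : j.+1 * m = (j * m).+1 + m.-1 by rewrite mulSn; lia.
  rewrite e; apply: idle_rounds => i hi; rewrite addSn -addnS dvdn_addr ?dvdn_mull // gtnNdvd //; lia.
exists a2, h2; apply: (@far_seq _ j.+1 0) f2; first by rewrite addn0.
by apply: far_seq f f'; rewrite addn1.
Qed.

Theorem ring_machine d :
  star (gstep flipf n) (Kinit d) (allacc n) <->
  exists j, bhalt (j %% B) (brun j (false, d)).1 (brun j (false, d)).2.
Proof.
have [H1 H2] := array_halts n2 (cells (fun q => d q.-1) (ring_at 1)) (false, false, ring_at 1 0, false).
split=> [/H1[k hk]|hx].
  case: (boolP (has (fun i => bhalt (i %% B) (brun i (false, d)).1 (brun i (false, d)).2) (iota 0 k.+1))) => [/hasP[i _ hi]|/hasPn nh].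
    by exists i.
  have [a [h f]] := @far_blocks d k.+1 (fun i hi => nh i (etrans (mem_iota 0 k.+1 i) hi)).
  by have := hk _ _ f; rewrite ltnn.
case: (ex_minnP hx) => j hj hmin.
have [a [h f]] := @far_blocks d j (fun i hi => ltac:(apply/negP => hb; have := hmin i hb; rewrite leqNgt hi; by [])).
have [cl [p [p0 pn f']]] := block_halt a h hj.
by apply: (H2 cl p p0 pn); apply: (far_seq _ f f').
Qed.

End Round.

(** * Turing machines as block programs *)

(** A rule is a block that tests bits followed by a block that changes them. *)
Section Rules.
Variables (T m : nat) (guard setb clrb : nat -> nat -> bool) (win : nat -> bool).
Hypotheses (m2 : 1 < m) (set0 : forall k, setb k 0 = false) (clr0 : forall k, clrb k 0 = false).

(** The first place of a guard block resets the accumulator, so bit 0 is never tested; the signal to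
    halt sits at place 1, as a block may not begin with it. The last pair of blocks, [k = T], has an
    empty guard and sets bit 1, which enables the rules for the next pass. *)
Definition rprog (b o : nat) : nat :=
  let k := b./2 in
  if odd b then
    (if k < T then (if win k && (o == 1) then 5 else if setb k o then 3 else if clrb k o then 4 else 0)
     else if o == 1 then 3 else 0)
  else if o == 0 then 1 else if (k < T) && guard k o then 2 else 0.

Definition rB := T.+1.*2.

Lemma rprog6 b o : rprog b o < 6.
Proof. by rewrite /rprog; do ?case: ifP => _. Qed.

Lemma rprog0 b : rprog b 0 != 5.
Proof. by rewrite /rprog andbF set0 clr0; do ?case: ifP => _. Qed.

Definition rfires k (d : nat -> bool) := all (fun o => (0 < o) && guard k o ==> d o) (iota 0 m).
Definition reffect k (d : nat -> bool) o :=
  if (o < m) && ~~ (win k && (o == 1)) then (if setb k o then true else if clrb k o then false else d o) else d o.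

Fixpoint rrules k d := if k is k'.+1 then
  let d' := rrules k' d in if (k' < T) && rfires k' d' then reffect k' d' else d' else d.
Definition rpass d := upd (rrules T d) 1 true.

Local Notation bacc := (bacc rprog).
Local Notation bbit := (bbit m rprog).
Local Notation bhalt := (bhalt m rprog).
Local Notation brun := (brun rB m rprog).

Lemma guard_acc k r d o : bacc k.*2 r d o.+1 = all (fun o => (0 < o) && ((k < T) && guard k o) ==> d o) (iota 0 o.+1).
Proof.
have hk : rprog k.*2 = fun o => if o == 0 then 1 else if (k < T) && guard k o then 2 else 0.
  by apply: functional_extensionality => q; rewrite /rprog odd_double doubleK.
elim: o => [|o IH]; first by rewrite /= hk.
rewrite -(addn1 o.+1) iotaD all_cat -IH addn1 add0n [iota _ 1]/= all_seq1.
have -> : bacc k.*2 r d o.+2 = (exec_op (rprog k.*2 o.+1) (bacc k.*2 r d o.+1) (d o.+1)).1 by [].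
rewrite hk; case: ((k < T) && guard k o.+1) => //=; by rewrite ?andbT.
Qed.

Lemma guard_end k r d : k <= T -> bacc k.*2 r d m = (k == T) || rfires k d.
Proof.
move=> hk; rewrite -(prednK (ltnW m2)) guard_acc (prednK (ltnW m2)) /rfires.
have [->|ne] := eqVneq k T; first by apply/allP => o _; rewrite ltnn /= andbF.
by apply: eq_all => o; rewrite (ltn_neqAle k T) ne hk.
Qed.

Lemma guard_bit k r d : bbit k.*2 r d = d.
Proof.
apply: functional_extensionality => o; rewrite /bbit; case: ifP => // _.
by rewrite /rprog odd_double; do ?case: ifP => _.
Qed.

Lemma guard_halt k r d : bhalt k.*2 r d = false.
Proof.
apply/negP => /hasP[o _ /andP[]]; rewrite /rprog odd_double; by do ?case: ifP => _.
Qed.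

Lemma eff_acc k r d o : bacc k.*2.+1 r d o = r.
Proof.
elim: o => //= o ->; rewrite /rprog /= odd_double /=; by do ?case: ifP => _.
Qed.

Lemma half2S k : k.*2.+1./2 = k. Proof. by rewrite /= uphalf_double. Qed.

Lemma eff_bit k r d : k < T -> bbit k.*2.+1 r d = if r then reffect k d else d.
Proof.
move=> hk; apply: functional_extensionality => o; rewrite /bbit eff_acc /rprog half2S /= odd_double /= hk /reffect.
case: r => /=; rewrite ?/reffect; case: (o < m) => //=; case: (win k && _) => //=; case: (setb k o) => //=;
  rewrite ?orbT ?orbF //; case: (clrb k o) => //=; by rewrite ?andbT ?andbF.
Qed.

Lemma eff_bit_last d : bbit T.*2.+1 true d = upd d 1 true.
Proof.
apply: functional_extensionality => o; rewrite /bbit eff_acc /rprog half2S /= odd_double /= ltnn /upd.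
by case: (o =P 1) => [->|_]; [rewrite m2 /= orbT|case: (o < m)].
Qed.

Lemma eff_halt k r d : k <= T -> bhalt k.*2.+1 r d = [&& k < T, win k & r].
Proof.
move=> hk; apply/hasP/idP => [[o]|/and3P[h1 h2 h3]].
  rewrite mem_iota eff_acc /rprog half2S /= odd_double /= => _.
  case: (k < T) => /=; last by case: (o == 1).
  by case: (win k) => /=; do ?case: ifP => //.
by exists 1; rewrite ?mem_iota // eff_acc /rprog half2S /= odd_double /= h1 h2.
Qed.

Definition dat k d := iter k rpass d.

Lemma modB k b : b < rB -> (k * rB + b) %% rB = b.
Proof. by move=> h; rewrite modnMDl modn_small. Qed.

Lemma brunS j rd : brun j.+1 rd = (bacc (j %% rB) (brun j rd).1 (brun j rd).2 m, bbit (j %% rB) (brun j rd).1 (brun j rd).2).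
Proof. by rewrite /=; case: (brun j rd). Qed.

Lemma brun_pass k d : (brun (k * rB) (false, d)).2 = dat k d ->
  forall j, j <= T -> (brun (k * rB + j.*2) (false, d)).2 = rrules j (dat k d).
Proof.
move=> h0; elim=> [|j IH] hj; first by rewrite addn0.
have b1 : j.*2 < rB by rewrite /rB; lia.
have b2 : j.*2.+1 < rB by rewrite /rB; lia.
rewrite doubleS !addnS !brunS; cbn [fst snd]; rewrite -addnS !modB //.
rewrite guard_bit guard_end ?(ltnW hj) // eff_bit // IH ?(ltnW hj) //= hj (_ : (j == T) = false) //; lia.
Qed.

Lemma brun_dat k d : (brun (k * rB) (false, d)).2 = dat k d.
Proof.
elim: k => [//|k IH]; have e : k.+1 * rB = (k * rB + T.*2).+2 by rewrite /rB; lia.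
have b1 : T.*2 < rB by rewrite /rB; lia.
have b2 : T.*2.+1 < rB by rewrite /rB; lia.
rewrite e !brunS; cbn [fst snd]; rewrite -addnS !modB // guard_bit guard_end // eqxx eff_bit_last.
by rewrite (brun_pass IH) //= -/(rpass _) -iterS.
Qed.

Theorem rules_halt d : (exists j, bhalt (j %% rB) (brun j (false, d)).1 (brun j (false, d)).2) <->
  exists k j, [/\ j < T, win j & rfires j (rrules j (dat k d))].
Proof.
have H := brun_pass (brun_dat _ _).
split=> [[j]|[k [j [hj hw hf]]]].
  have rB0 : 0 < rB by rewrite /rB.
  set k := j %/ rB; set b := j %% rB; have ej : j = k * rB + b by exact: divn_eq.
  have hb : b < rB by rewrite ltn_mod.
  have eb := odd_double_half b; case ob : (odd b) eb => /= eb; last by rewrite -eb add0n guard_halt.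
  have hb2 : b./2 <= T by rewrite /rB in hb; lia.
  rewrite -eb add1n eff_halt // => /and3P[h1 h2].
  rewrite ej -eb add1n addnS brunS; cbn [fst snd]; rewrite modB; last by rewrite /rB; lia.
  rewrite guard_end // H // => /orP[/eqP e|h3]; first by rewrite e ltnn in h1.
  by exists k, b./2.
exists (k * rB + j.*2.+1); rewrite modB; last by rewrite /rB; lia.
rewrite eff_halt ?(ltnW hj) // hj hw addnS brunS; cbn [fst snd]; rewrite modB; last by rewrite /rB; lia.
by rewrite guard_end ?(ltnW hj) // H ?(ltnW hj) // hf orbT.
Qed.

End Rules.

(** ** The rules of a machine *)

(** It supplies the number of the rule that matches a configuration: one digit for each head and the
    state as quotient. *)
Lemma digits_exist (n b : nat) (f : nat -> nat) q : (forall i, f i < b) ->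
  exists2 t, t %/ b ^ n = q & forall i, i < n -> (t %/ b ^ i) %% b = f i.
Proof.
move=> hf; have b0 : 0 < b by apply: leq_ltn_trans (hf 0).
elim: n f hf => [|n IH] f hf; first by exists q; rewrite ?divn1.
have [t h1 h2] := IH (fun i => f i.+1) (fun i => hf i.+1).
exists (t * b + f 0) => [|[|i] hi].
- by rewrite expnS divnMA divnMDl // (divn_small (hf 0)) addn0.
- by rewrite divn1 modnMDl modn_small.
by rewrite expnS divnMA divnMDl // (divn_small (hf 0)) addn0 h2.
Qed.

Section Machine.
Variables (M : machine) (S : nat).
Local Notation C := (cell (aux M)).
Local Notation K := (extra_tapes M).+1.

Definition nq := #|state M|.
Definition nA := #|{: C}|.
(** Heads start at cell [S]. As at most [S] cells of a tape are ever stored, they stay strictly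
    between 0 and [S.*2], and no move runs out of the array. *)
Definition mJ := S.*2.+1.
Definition qst (s : nat) : state M := nth (start M) (enum (state M)) s.
Definition qnum (q : state M) : nat := index q (enum (state M)).
Definition sym (a : nat) : C := nth None (enum {: C}) a.
Definition snum (a : C) : nat := index a (enum {: C}).

Lemma qnumK q : qst (qnum q) = q. Proof. by rewrite /qst nth_index // mem_enum. Qed.
Lemma qnum_lt q : qnum q < nq. Proof. by rewrite /nq cardE index_mem mem_enum. Qed.
Lemma snumK a : sym (snum a) = a. Proof. by rewrite /sym nth_index // mem_enum. Qed.
Lemma snum_lt a : snum a < nA. Proof. by rewrite /nA cardE index_mem mem_enum. Qed.

(** Bit 1 permits a rule to fire, bits [2 + s] hold the state; every cell [j] of
    a tape [i] has one bit per symbol and a bit for the head. *)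
Definition mbase := 2 + nq.
Definition addr i j a := mbase + (i * mJ + j) * nA.+1 + a.
Definition msize := mbase + K * mJ * nA.+1.

(** A digit in this radix combines the symbol under a head with the position of that head; a rule
    number has one digit per tape and the state above them. Rules are thus indexed by everything
    that a step depends on. *)
Definition radix := nA * mJ.
Definition rdig t i := (t %/ radix ^ i) %% radix.
Definition rsym t i := rdig t i %/ mJ.
Definition rpos t i := rdig t i %% mJ.
Definition rstate t := t %/ radix ^ K.
Definition rcount := nq * radix ^ K.
Definition rdelta t := delta (qst (rstate t)) [ffun i : 'I_K => sym (rsym t i)].
Definition rhalt t := halting (qst (rstate t)).
Definition shift_pos (m : direction) j := match m with MoveLeft => j.-1 | Stay => j | MoveRight => j.+1 end.
Definition rnew t i := snum ((rdelta t).2 (inord i)).1.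
Definition rto t i := shift_pos ((rdelta t).2 (inord i)).2 (rpos t i).

Definition mclr0 t o := (o == 2 + rstate t) || has (fun i => (o == addr i (rpos t i) (rsym t i)) || (o == addr i (rpos t i) nA)) (iota 0 K).
Definition mguard t o := (o == 1) || mclr0 t o.
(** Setting prevails over clearing, so a bit that a step removes and writes again survives. Clearing
    bit 1 keeps the later rules of the same pass from firing; rules of halting states change
    nothing. *)
Definition mclr t o := ~~ rhalt t && ((o == 1) || mclr0 t o).
Definition msets t o := ~~ rhalt t && ((o == 2 + qnum (rdelta t).1) ||
  has (fun i => (o == addr i (rpos t i) (rnew t i)) || (o == addr i (rto t i) nA)) (iota 0 K)).
Definition mwin t := rhalt t && accepting (qst (rstate t)).

Lemma addr_ge i j a : mbase <= addr i j a. Proof. by rewrite /addr -addnA leq_addr. Qed.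
Lemma addr_inj i j a i' j' a' : j < mJ -> j' < mJ -> a <= nA -> a' <= nA -> addr i j a = addr i' j' a' ->
  [/\ i = i', j = j' & a = a'].
Proof.
move=> hj hj' ha ha' /eqP; rewrite /addr -!(addnA mbase) eqn_add2l => /eqP E.
have := congr1 (modn^~ nA.+1) E; rewrite /= !modnMDl !modn_small // => ->.
have := congr1 (divn^~ nA.+1) E; rewrite /= !divnMDl // !divn_small // !addn0 => E'.
have := congr1 (modn^~ mJ) E'; rewrite /= !modnMDl !modn_small // => ->.
by have := congr1 (divn^~ mJ) E'; rewrite /= !divnMDl // !divn_small // !addn0 => ->.
Qed.
Lemma addr_lt i j a : i < K -> j < mJ -> a <= nA -> addr i j a < msize.
Proof.
move=> hi hj ha; rewrite /addr /msize -addnA ltn_add2l.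
have h1 : (i * mJ + j).+1 <= K * mJ.
  by apply: (@leq_trans (i.+1 * mJ)); [rewrite mulSn; lia|rewrite leq_mul2r hi orbT].
apply: (@leq_trans ((i * mJ + j).+1 * nA.+1)); last by rewrite leq_mul2r h1 orbT.
by rewrite mulSn; lia.
Qed.

Lemma eq_addr i j a i' j' a' : j < mJ -> j' < mJ -> a <= nA -> a' <= nA ->
  (addr i j a == addr i' j' a') = [&& i == i', j == j' & a == a'].
Proof.
move=> h1 h2 h3 h4; apply/eqP/and3P => [/addr_inj[] // -> -> ->|[/eqP -> /eqP -> /eqP ->] //]; by split.
Qed.

Lemma has_addr (f g : nat -> nat) i j a : i < K -> j < mJ -> a <= nA -> (forall i, i < K -> f i < mJ) -> (forall i, g i <= nA) ->
  has (fun i' => addr i j a == addr i' (f i') (g i')) (iota 0 K) = (j == f i) && (a == g i).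
Proof.
move=> hi hj ha hf hg; apply/hasP/idP => [[i']|h].
  by rewrite mem_iota => /= hi'; rewrite eq_addr ?hf // => /and3P[/eqP <-] -> ->.
by exists i; rewrite ?mem_iota // eq_addr ?hf // eqxx.
Qed.

Lemma has_addr2 (f g f' g' : nat -> nat) i j a : i < K -> j < mJ -> a <= nA ->
  (forall i, i < K -> f i < mJ) -> (forall i, g i <= nA) -> (forall i, i < K -> f' i < mJ) -> (forall i, g' i <= nA) ->
  has (fun i' => (addr i j a == addr i' (f i') (g i')) || (addr i j a == addr i' (f' i') (g' i'))) (iota 0 K) =
  (j == f i) && (a == g i) || (j == f' i) && (a == g' i).
Proof.
move=> hi hj ha hf hg hf' hg'; rewrite -(has_addr hi hj ha hf hg) -(has_addr hi hj ha hf' hg') -has_predU.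
exact: eq_has.
Qed.

(** ** Tapes as functions *)
Definition represents (t : tape C) h (F : nat -> C) :=
  [/\ scanned t = F h, forall k, k < h -> nth None (before t) k = F (h.-1 - k)
    & forall k, nth None (after t) k = F (h.+1 + k)].

Lemma represents_move t h F a mv : represents t h F -> 0 < h ->
  represents (write_move None a mv t) (shift_pos mv h) (upd F h a).
Proof.
case: t => bf sc af [/= h1 h2 h3] h0; case: mv; rewrite /write_move /=.
- have e0 : upd F h a h.-1 = F h.-1 by rewrite upd_other //; apply/eqP; lia.
  have h20 := h2 0 h0; rewrite subn0 in h20.
  case: bf h2 h20 => [|b bf] h2 h20 /=; split=> /=; rewrite ?e0 -?h20 //.
  + move=> k hk; rewrite nth_nil upd_other; last by apply/eqP; lia.
    have := h2 k.+1; rewrite nth_nil (_ : h.-1 - k.+1 = h.-2 - k); last by lia.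
    by move=> <- //; lia.
  + by case=> [|k] /=; rewrite prednK // ?addn0 ?upd_same // h3 upd_other; [congr F; lia|apply/eqP; lia].
  + move=> k hk; rewrite upd_other; last by apply/eqP; lia.
    have := h2 k.+1; rewrite (_ : h.-1 - k.+1 = h.-2 - k); last by lia.
    by move=> /= <- //; lia.
  + by case=> [|k] /=; rewrite prednK // ?addn0 ?upd_same // h3 upd_other; [congr F; lia|apply/eqP; lia].
- split=> /=; rewrite ?upd_same // => k; last by rewrite h3 upd_other //; apply/eqP; lia.
  by move=> hk; rewrite h2 // upd_other //; apply/eqP; lia.
- have h30 := h3 0; rewrite addn0 in h30.
  have bfs k : k < h.+1 -> nth None (a :: bf) k = upd F h a (h - k).
    by case: k => [|k] hk /=; rewrite ?subn0 ?upd_same // h2 // upd_other; [congr F; lia|apply/eqP; lia].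
  case: af h3 h30 => [|b af] h3 h30 /=; split=> //=; rewrite ?upd_other -?h30 //; try by apply/eqP; lia.
  + move=> k; rewrite nth_nil upd_other; last by apply/eqP; lia.
    by rewrite (_ : h.+2 + k = h.+1 + k.+1) -?h3 ?nth_nil //; lia.
  + move=> k; rewrite upd_other; last by apply/eqP; lia.
    by rewrite (_ : h.+2 + k = h.+1 + k.+1) -?h3 //; lia.
Qed.

(** The starting cell [S] always lies among the stored cells. Together with the bound on the tape
    size this confines the head. *)
Lemma move_size t a mv h : 0 < h -> S <= h + size (after t) -> h <= S + size (before t) ->
  S <= shift_pos mv h + size (after (@write_move C None a mv t)) /\
  shift_pos mv h <= S + size (before (@write_move C None a mv t)).
Proof.
by case: t => bf sc af /= h0 h1 h2; case: mv => /=; [case: bf h2|split|case: af h1] => //=; try move=> ? ?; split; lia.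
Qed.

Variable x : seq bool.
Hypothesis space : forall t, space_used (run M t x) <= S.

Fixpoint hd t (i : 'I_K) : nat := if t is t'.+1 then
  (if halted (run M t' x) then hd t' i else
   shift_pos ((delta (control (run M t' x)) [ffun i => scanned (tapes (run M t' x) i)]).2 i).2 (hd t' i)) else S.
Definition tp0 (i : 'I_K) (j : nat) : C := if (i == ord0) && (S <= j) then nth None [seq Some (inl b) | b <- x] (j - S) else None.
Fixpoint tp t (i : 'I_K) : nat -> C := if t is t'.+1 then
  (if halted (run M t' x) then tp t' i else
   upd (tp t' i) (hd t' i) ((delta (control (run M t' x)) [ffun i => scanned (tapes (run M t' x) i)]).2 i).1) else tp0 i.

Lemma runS t : run M t.+1 x = step (run M t x). Proof. by []. Qed.

Lemma tape_inv t i : let tt := tapes (run M t x) i in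
  [/\ represents tt (hd t i) (tp t i), S <= hd t i + size (after tt), hd t i <= S + size (before tt) & 0 < hd t i < S.*2].
Proof.
have bnd t' : S <= hd t' i + size (after (tapes (run M t' x) i)) -> hd t' i <= S + size (before (tapes (run M t' x) i)) ->
    0 < hd t' i < S.*2.
  move=> h1 h2; have := space t'; rewrite /space_used (bigD1 i) //= {1}/tape_size => h3.
  have h4 := leq_trans (leq_addr _ _) h3; move: h1 h2 h4.
  by move: (hd t' i) (size _) (size _) => a b c; lia.
elim: t => [|t [IH1 IH2 IH3 IH4]]; cbv zeta.
  have h1 : S <= hd 0 i + size (after (tapes (run M 0 x) i)) by rewrite /= leq_addr.
  have h2 : hd 0 i <= S + size (before (tapes (run M 0 x) i)) by rewrite /= leq_addr.
  split=> //; last exact: bnd.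
  rewrite /= /tp0; case: (i == ord0) => /=.
    case: x => [|b y] /=; split=> //=.
    - by rewrite leqnn subnn.
    - by move=> k hk; rewrite nth_nil; case: ifP => // _; rewrite nth_nil.
    - by move=> k; rewrite !nth_nil if_same.
    - by rewrite leqnn subnn.
    - by move=> k hk; rewrite nth_nil ifF //; lia.
    - by move=> k; rewrite ifT; [rewrite (_ : S.+1 + k - S = k.+1) //; lia|lia].
  by split=> //= k; rewrite ?nth_nil.
have IHs : S <= hd t.+1 i + size (after (tapes (run M t.+1 x) i)) /\ hd t.+1 i <= S + size (before (tapes (run M t.+1 x) i)) /\
    represents (tapes (run M t.+1 x) i) (hd t.+1 i) (tp t.+1 i).
  rewrite runS /= /step /halted; case: (halting _) => //.
  case: (delta _ _) => q w /=; have h0 : 0 < hd t i by case/andP: IH4.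
  have [a1 a2] := move_size (w i).1 (w i).2 h0 IH2 IH3; split=> //; split=> //.
  exact: represents_move.
by case: IHs => a1 [a2 a3]; split=> //; apply: bnd.
Qed.

Lemma scan_tp t i : scanned (tapes (run M t x) i) = tp t i (hd t i).
Proof. by have [[]] := tape_inv t i. Qed.

Lemma hd_lt t i : hd t i < mJ. Proof. by have [_ _ _] := tape_inv t i; rewrite /mJ; lia. Qed.

(** ** Simulation *)
Definition encodes t (d : nat -> bool) :=
  [/\ d 1, forall s, s < nq -> d (2 + s) = (s == qnum (control (run M t x)))
    & forall (i : 'I_K) j a, j < mJ -> a <= nA -> d (addr i j a) = if a == nA then hd t i == j else snum (tp t i j) == a].

Local Notation fires := (rfires msize mguard).
Local Notation effect := (reffect msize msets mclr mwin).
Local Notation rules := (rrules rcount msize mguard msets mclr mwin).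
Local Notation pass := (rpass rcount msize mguard msets mclr mwin).

Implicit Types d : nat -> bool.

Lemma nA0 : 0 < nA. Proof. exact: leq_ltn_trans (snum_lt None). Qed.
Lemma rpos_lt k i : rpos k i < mJ. Proof. by rewrite ltn_mod. Qed.
Lemma rsym_lt k i : rsym k i < nA.
Proof. by rewrite /rsym ltn_divLR // ltn_mod muln_gt0 nA0. Qed.
Lemma rstate_lt k : k < rcount -> rstate k < nq.
Proof. by rewrite /rcount /rstate => h; rewrite ltn_divLR // expn_gt0 muln_gt0 nA0. Qed.
Lemma mbase_lt : mbase <= msize. Proof. exact: leq_addr. Qed.

Definition matches t k := rstate k = qnum (control (run M t x)) /\
  forall i : 'I_K, rpos k i = hd t i /\ rsym k i = snum (tp t i (hd t i)).

Lemma firesP k d : k < rcount -> reflect [/\ d 1, d (2 + rstate k)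
   & forall i : 'I_K, d (addr i (rpos k i) (rsym k i)) /\ d (addr i (rpos k i) nA)] (fires k d).
Proof.
move=> hk; have hs := rstate_lt hk; have hb := mbase_lt.
apply: (iffP allP) => [h|[h1 h2 h3] o ho]; last first.
  apply/implyP => /andP[_]; rewrite /mguard => /orP[/eqP -> //|/orP[/eqP -> //|/hasP[i]]].
  rewrite mem_iota => /= hi /orP[]/eqP ->; by have [] := h3 (Ordinal hi).
have H o : o < msize -> 0 < o -> mguard k o -> d o.
  by move=> ho o0 hg; have := h o; rewrite mem_iota o0 hg; apply.
split.
- by apply: H => //; rewrite /mbase in hb; lia.
- by apply: H => //; [rewrite /mbase in hb; lia|rewrite /mguard /mclr0 eqxx orbT].
move=> i; have hp := rpos_lt k i; have ha := ltnW (rsym_lt k i); have ge j a := addr_ge i j a.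
split; apply: H; try exact: addr_lt; try by apply: leq_trans (ge _ _); rewrite /mbase.
  by rewrite /mguard /mclr0; apply/orP; right; apply/orP; right; apply/hasP; exists (i : nat); [by rewrite mem_iota /= ltn_ord|by rewrite eqxx].
by rewrite /mguard /mclr0; apply/orP; right; apply/orP; right; apply/hasP; exists (i : nat); [by rewrite mem_iota /= ltn_ord|by rewrite eqxx orbT].
Qed.

Lemma fires_matches t k d : k < rcount -> encodes t d -> fires k d <-> matches t k.
Proof.
move=> hk [e1 e2 e3]; have hs := rstate_lt hk.
have ha i : (rsym k i == nA) = false by have := rsym_lt k i; lia.
split=> [/(firesP _ hk)[f1 f2 f3]|[m1 m2]].
  split=> [|i]; first by apply/eqP; rewrite -e2.
  have [g1 g2] := f3 i; have hp := rpos_lt k i.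
  have e : rpos k i = hd t i by move: g2; rewrite e3 // eqxx => /eqP.
  by split=> //; move: g1; rewrite e3 ?(ltnW (rsym_lt _ _)) // ha e => /eqP.
apply/(firesP _ hk); split=> //; first by rewrite e2 // m1.
move=> i; have [p1 p2] := m2 i; have hp := rpos_lt k i.
by rewrite !e3 ?(ltnW (rsym_lt _ _)) // eqxx ha p1 p2 !eqxx.
Qed.

Lemma matches_exist t : exists2 k, k < rcount & matches t k.
Proof.
have r0 : 0 < radix by rewrite muln_gt0 nA0.
pose f (i : nat) := snum (tp t (inord i) (hd t (inord i))) * mJ + hd t (inord i).
have hf i : f i < radix.
  rewrite /f /radix; apply: (@leq_trans ((snum (tp t (inord i) (hd t (inord i)))).+1 * mJ)).
    by rewrite mulSn addnC ltn_add2r hd_lt.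
  by rewrite leq_mul2r snum_lt orbT.
have [k h1 h2] := @digits_exist K radix f (qnum (control (run M t x))) hf.
exists k; first by rewrite /rcount -ltn_divLR ?h1 ?qnum_lt // expn_gt0 r0.
split=> [|i]; first exact: h1.
rewrite /rpos /rsym /rdig h2 // /f inord_val modnMDl divnMDl // divn_small ?hd_lt // addn0.
by rewrite modn_small // hd_lt.
Qed.

Lemma matches_delta t k : matches t k -> rhalt k = halted (run M t x) /\
  rdelta k = delta (control (run M t x)) [ffun i => scanned (tapes (run M t x) i)].
Proof.
move=> [m1 m2]; rewrite /rhalt /rdelta m1 qnumK; split=> //; congr delta.
by apply/ffunP => i; rewrite !ffunE scan_tp; have [_ ->] := m2 i; rewrite snumK.
Qed.

Lemma effect_halt k d : rhalt k -> effect k d = d.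
Proof.
move=> h; apply: functional_extensionality => o; rewrite /reffect /msets /mclr h /=.
by case: (_ && _).
Qed.

Lemma effect_step t k d : k < rcount -> matches t k -> ~~ halted (run M t x) -> encodes t d ->
  encodes t.+1 (upd (effect k d) 1 true) /\ effect k d 1 = false.
Proof.
move=> hk hm nh [e1 e2 e3]; have [eh ed] := matches_delta hm; have [m1 m2] := hm.
have nr : rhalt k = false by rewrite eh; apply/negbTE.
have nw : mwin k = false by rewrite /mwin nr.
have nr' : ~~ rhalt k = true by rewrite nr.
have hb := mbase_lt; have hs := rstate_lt hk.
have E o : o < msize -> effect k d o = if msets k o then true else if mclr k o then false else d o.
  by move=> ho; rewrite /reffect nw ho.
have dE : run M t.+1 x = Config (rdelta k).1 (fun i => write_move None ((rdelta k).2 i).1 ((rdelta k).2 i).2 (tapes (run M t x) i)).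
  by rewrite runS /step -/(halted _) (negPf nh) -ed; case: (rdelta k).
have hS (i : 'I_K) : hd t.+1 i = rto k i.
  by rewrite /= (negPf nh) -ed /rto inord_val; have [-> _] := m2 i.
have tS (i : 'I_K) j : snum (tp t.+1 i j) = if j == rpos k i then rnew k i else snum (tp t i j).
  by rewrite /= (negPf nh) -ed /rnew inord_val /upd; have [-> _] := m2 i; case: (j =P hd t i).
have lowa (f g : nat -> nat) s : s < mbase -> has (fun i => (s == addr i (f i) (g i)) || (s == addr i (rpos k i) nA)) (iota 0 K) = false.
  by move=> h; apply/negbTE/hasPn => i _; have := addr_ge i (f i) (g i); have := addr_ge i (rpos k i) nA; lia.
have lowa' s : s < mbase -> has (fun i => (s == addr i (rpos k i) (rnew k i)) || (s == addr i (rto k i) nA)) (iota 0 K) = false.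
  by move=> h; apply/negbTE/hasPn => i _; have := addr_ge i (rpos k i) (rnew k i); have := addr_ge i (rto k i) nA; lia.
have b2 : 1 < mbase by [].
split; last by rewrite E ?(leq_trans b2 hb) // /msets /mclr nr' !andTb lowa' // orbF.
split=> [|s hs'|i j a hj ha].
- by rewrite upd_same.
- have s1 : 2 + s < mbase by rewrite /mbase ltn_add2l.
  rewrite upd_other // E ?(leq_trans s1 hb) // /msets /mclr /mclr0 nr' !andTb lowa' // lowa // !orbF !eqn_add2l e2 // dE.
  case: (s =P qnum _) => // _; rewrite m1; case: (s =P qnum _) => //.
have g1 : addr i j a != 1 by apply/eqP; have := addr_ge i j a; lia.
rewrite upd_other // E ?addr_lt // /msets /mclr /mclr0 nr' (negPf g1) !andTb !orFb.
have n2 s : s < nq -> (addr i j a == 2 + s) = false by move=> h; apply/negbTE/eqP; have := addr_ge i j a; rewrite /mbase; lia.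
rewrite !n2 ?qnum_lt // !orFb !has_addr2 ?ltn_ord //; try by [move=> ? _; exact: rpos_lt|move=> ?; exact: ltnW (rsym_lt _ _)|move=> ?; exact: ltnW (snum_lt _)].
  rewrite e3 // hS tS; have [p1 p2] := m2 i.
  have hn : rnew k i < nA := snum_lt _; have hsy := rsym_lt k i.
  have [->|na] := eqVneq a nA.
    rewrite (_ : (nA == rnew k i) = false) 1?(_ : (nA == rsym k i) = false) ?andbF ?andbT /=; try lia.
    by rewrite p1 (eq_sym (rto k i)) (eq_sym (hd t i)); case: (j == rto k i) => //; case: (j == hd t i).
  rewrite !andbF !orbF; have [ej|nj] := eqVneq j (rpos k i) => //=.
  rewrite [a == rnew k i]eq_sym; case: (rnew k i =P a) => // _.
  by rewrite p2 ej p1 eq_sym; case: eqP.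
by move=> i' hi'; rewrite -(hS (Ordinal hi')) hd_lt.
Qed.

Lemma encodes_fix t d : encodes t d -> upd d 1 true = d.
Proof. by case=> e1 _ _; rewrite -{2}(upd_id d 1) e1. Qed.

Lemma encodes_halted t d : halted (run M t x) -> encodes t d -> encodes t.+1 d.
Proof.
move=> h [e1 e2 e3]; have e : run M t.+1 x = run M t x by rewrite runS /step -/(halted _) h.
by split=> // [s hs|i j a hj ha]; [rewrite e e2|rewrite e3 //= h].
Qed.

(** The first applicable rule clears bit 1, which disables all others. *)
Lemma rules_pass t d : encodes t d ->
  encodes t.+1 (pass d) /\ forall k, k < rcount -> fires k (rules k d) -> matches t k.
Proof.
move=> he; case: (boolP (halted (run M t x))) => [hh|nh].
  have H k : k <= rcount -> rules k d = d.
    elim: k => //= k IH hk; rewrite IH ?(ltnW hk) // hk /=; case: ifP => // /(fires_matches hk he) hm.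
    by rewrite effect_halt //; have [-> _] := matches_delta hm.
  split; first by rewrite /rpass H // (encodes_fix he); exact: encodes_halted.
  by move=> k hk; rewrite H ?(ltnW hk) // => /(fires_matches hk he).
have H k : k <= rcount -> (rules k d = d /\ forall k', k' < k -> ~ matches t k') \/
    exists k', [/\ k' < k, matches t k', k' < rcount & rules k d = effect k' d].
  elim: k => [|k IH] hk; first by left.
  case: (IH (ltnW hk)) => [[e hn]|[k' [h1 h2 h3 h4]]].
    rewrite [rules k.+1 d]/= e hk /=; case: ifP => [/(fires_matches hk he) hm|hf].
      by right; exists k.
    left; split=> // k'; rewrite ltnS leq_eqVlt => /orP[/eqP -> hm|]; last exact: hn.
    by move/negP: hf; apply; apply/(fires_matches hk he).
  right; exists k'; split=> //; first exact: leqW.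
  have [_ e1] := effect_step h3 h2 nh he.
  rewrite [rules k.+1 d]/= h4 hk /=; case: ifP => // /(firesP _ hk)[].
  by rewrite e1.
split.
  case: (H rcount (leqnn _)) => [[_ hn]|[k' [h1 h2 h3 h4]]].
    by have [k hk hm] := matches_exist t; case: (hn k hk).
  by rewrite /rpass h4; have [] := effect_step h3 h2 nh he.
move=> k hk; case: (H k (ltnW hk)) => [[-> _]|[k' [h1 h2 h3 ->]]]; first by move=> /(fires_matches hk he).
by have [_ e1] := effect_step h3 h2 nh he; move=> /(firesP _ hk)[]; rewrite e1.
Qed.

Definition dinit (o : nat) : bool := [|| o == 1, o == 2 + qnum (start M) |
  has (fun i => has (fun j => (o == addr i j (snum (tp0 (inord i) j))) || ((j == S) && (o == addr i j nA))) (iota 0 mJ)) (iota 0 K)].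

Lemma dinit_encodes : encodes 0 dinit.
Proof.
have low s : s < mbase -> has (fun i => has (fun j => (s == addr i j (snum (tp0 (inord i) j))) || ((j == S) && (s == addr i j nA))) (iota 0 mJ)) (iota 0 K) = false.
  move=> h; apply/negbTE/hasPn => i _; apply/hasPn => j _.
  by have := addr_ge i j (snum (tp0 (inord i) j)); have := addr_ge i j nA; lia.
split=> // [s hs|i j a hj ha].
  by rewrite /dinit low ?orbF ?ltn_add2l // /= eqn_add2l.
have hs := qnum_lt (start M); have g := addr_ge i j a.
rewrite /dinit (_ : (_ == 1) = false) 1?(_ : (_ == 2 + _) = false) ?orFb; try by rewrite /mbase in g; lia.
have hi := ltn_ord i; apply/hasP/idP => [[i']|h].
  rewrite mem_iota => hi' /hasP[j']; rewrite mem_iota => hj'.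
  rewrite !eq_addr ?(ltnW (snum_lt _)) // => /orP[/and3P[/eqP <- /eqP <- /eqP ->]|/and4P[/eqP -> /eqP _ /eqP -> /eqP ->]].
    by have := snum_lt (tp0 (inord i) j); rewrite inord_val; case: (_ =P nA) => [->|_]; rewrite ?ltnn ?eqxx.
  by rewrite !eqxx.
exists (i : nat); rewrite ?mem_iota //; apply/hasP; exists j; rewrite ?mem_iota //; rewrite inord_val.
by case: (a =P nA) h => [-> /eqP <-|_ /eqP <-]; rewrite !eqxx ?orbT.
Qed.

Theorem machine_halts : (exists k j, [/\ j < rcount, mwin j & fires j (rules j (dat rcount msize mguard msets mclr mwin k dinit))]) <->
  exists t, halted (run M t x) && accepting (control (run M t x)).
Proof.
have E k : encodes k (dat rcount msize mguard msets mclr mwin k dinit).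
  by elim: k => [|k IH]; [exact: dinit_encodes|have [] := rules_pass IH].
split=> [[k [j [hj hw hf]]]|[t /andP[hh ha]]].
  have [_ hm] := rules_pass (E k); have m := hm _ hj hf; have [eh _] := matches_delta m.
  exists k; have [m1 _] := m; move: hw; rewrite /mwin eh m1 qnumK; by [].
have [k hk hm] := matches_exist t; have [eh _] := matches_delta hm.
exists t, k; split=> //; first by have [m1 _] := hm; rewrite /mwin eh hh m1 qnumK.
have [_ hp] := rules_pass (E t); set d := dat _ _ _ _ _ _ _ _ in hp *.
have H k' : k' <= rcount -> rules k' d = d.
  elim: k' => //= k' IH hk'; rewrite IH ?(ltnW hk') // hk' /=; case: ifP => // /(fires_matches hk' (E t)) hm'.
  by rewrite effect_halt //; have [-> _] := matches_delta hm'.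
by rewrite H ?(ltnW hk) //; apply/(fires_matches hk (E t)).
Qed.

End Machine.

(** * The reduction in the function algebra *)

Lemma E2_double f : E2 f -> E2 (fun x s => (f x s).*2).
Proof. by move=> h; apply: (E2_ext (E2_add h h)) => x s; rewrite addnn. Qed.

Lemma E2_half f : E2 f -> E2 (fun x s => (f x s)./2).
Proof. by move=> h; apply: (E2_ext (E2_div h (E2_const 2))) => x s; rewrite divn2. Qed.

Lemma E2_expc f k : E2 f -> E2 (fun x s => f x s ^ k).
Proof.
move=> h; elim: k => [|k IH]; first exact: (E2_const 1).
by apply: (E2_ext (E2_mul h IH)) => x s; rewrite expnS.
Qed.

Lemma E2b_hasl (l : seq nat) (F : nat -> seq bool -> seq nat -> bool) :
  (forall i, i \in l -> E2b (F i)) -> E2b (fun x s => has (fun i => F i x s) l).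
Proof.
elim: l => [|i l IH] h; first exact: (E2b_const false).
apply: E2b_or; first by apply: h; rewrite inE eqxx.
by apply: IH => j hj; apply: h; rewrite inE hj orbT.
Qed.

(** The function is filled in one point at a time, each partial stage being again a value in a
    finite type. *)
Lemma E2F_ffun (n : nat) (C : finType) (f : 'I_n -> seq bool -> seq nat -> C) :
  (forall i, E2F (f i)) -> @E2F {ffun 'I_n -> C} (fun x s => [ffun i => f i x s]).
Proof.
move=> h; case: n f h => [|n] f h.
  apply: (E2_ext (@E2F_const {ffun 'I_0 -> C} (ffun0 (card_ord 0)))) => x s.
  by congr (nat_of_ord (enum_rank _)); apply/ffunP => -[].
pose c0 := f ord0 [::] [::].
pose g l x s : {ffun 'I_n.+1 -> C} := [ffun i => if i \in (l : seq 'I_n.+1) then f i x s else c0].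
have hg l : @E2F {ffun 'I_n.+1 -> C} (g l).
  elim: l => [|j l IH]; first exact: (E2F_const [ffun _ => c0]).
  have := E2F_map2 (fun a (F : {ffun 'I_n.+1 -> C}) => [ffun i => if i == j then a else F i]) (h j) IH.
  move=> H; apply: (E2_ext H) => x s; congr (nat_of_ord (enum_rank _)); apply/ffunP => i.
  by rewrite !ffunE inE; case: (i =P j) => [->|].
apply: (E2_ext (hg (enum 'I_n.+1))) => x s; congr (nat_of_ord (enum_rank _)); apply/ffunP => i.
by rewrite !ffunE mem_enum.
Qed.

Lemma E2_boolfun (h : bool -> nat) P : E2b P -> E2 (fun x s => h (P x s)).
Proof.
by move=> hP; apply: (E2_ext (E2_if hP (E2_const (h true)) (E2_const (h false)))) => x s; case: (P x s).
Qed.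

Lemma E2_poly (p : {poly nat}) : E2 (fun x s => p.[size x]%R).
Proof.
rewrite /horner; move: (polyseq p) => l.
elim: l => [|a l IH]; first exact: E2_zero.
exact: (E2_add (E2_mul IH E2_len) (E2_const a)).
Qed.

(** This hook is redefined once truncated powers and the bits of an input are available. *)
Ltac e2_user := fail.
Ltac e2 := first [assumption | lazymatch goal with
 | |- E2b (fun x s => @?P x s && @?Q x s) => apply: (@E2b_and P Q); e2
 | |- E2b (fun x s => @?P x s || @?Q x s) => apply: (@E2b_or P Q); e2
 | |- E2b (fun x s => ~~ (@?P x s)) => apply: (@E2b_not P); e2
 | |- E2b (fun x s => (@?P x s) ==> (@?Q x s)) => apply: (@E2b_imp P Q); e2
 | |- E2b (fun x s => (@?P x s) <= (@?Q x s)) => apply: (@E2b_leq P Q); e2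
 | |- E2b (fun x s => (@?P x s : nat) == (@?Q x s)) => first [apply: (@E2b_eqn P Q) | apply: (@E2b_eqb P Q)]; e2
 | |- E2b (fun x s => odd (@?P x s)) => apply: (@E2b_odd P); e2
 | |- E2b (fun x s => has (fun i => @?F x i s) (iota 0 (@?n x s))) => apply: (@E2b_has n F); e2
 | |- E2b (fun x s => all (fun i => @?F x i s) (iota 0 (@?n x s))) => apply: (@E2b_all n F); e2
 | |- E2 (fun x s => (@?a x s).+1) => apply: (@E2_succ a); e2
 | |- E2 (fun x s => (@?a x s).-1) => apply: (@E2_pred a); e2
 | |- E2 (fun x s => (@?a x s).*2) => apply: (@E2_double a); e2
 | |- E2 (fun x s => (@?a x s)./2) => apply: (@E2_half a); e2
 | |- E2 (fun x s => @?a x s + @?b x s) => apply: (@E2_add a b); e2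
 | |- E2 (fun x s => @?a x s - @?b x s) => apply: (@E2_sub a b); e2
 | |- E2 (fun x s => @?a x s * @?b x s) => apply: (@E2_mul a b); e2
 | |- E2 (fun x s => @?a x s %/ @?b x s) => apply: (@E2_div a b); e2
 | |- E2 (fun x s => @?a x s %% @?b x s) => apply: (@E2_mod a b); e2
 | |- E2 (fun x s => size x) => apply: E2_len
 | |- E2 (fun x s => nth 0 s ?i) => apply: (@E2_var i)
 | |- E2 (fun x s => nth 0 (behead s) ?i) => apply: (@E2_var1 i)
 | |- E2 (fun x s => nth 0 (behead (behead s)) ?i) => apply: (@E2_var2 i)
 | |- E2 (fun x s => nat_of_bool (@?P x s)) => change (E2b P); e2
 | |- E2 (fun x s => ?f x (behead s)) => apply: (@E2_behead f); e2
 | |- E2b (fun x s => ?f x (behead s)) => apply: (@E2_behead (fun x s => nat_of_bool (f x s))); e2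
 | |- _ => first [simple apply E2_const | simple apply E2b_const | e2_user; e2 | simple apply E2b_eqn; e2 | simple apply E2_if; e2 | simple apply E2b_if; e2 | idtac]
 end].

(** ** Bits of the encoding *)
Section Encoding.
Variables (D : nat) (Pn : seq bool -> nat) (R : seq bool -> nat -> nat -> nat -> bool).
Hypotheses (D0 : 0 < D) (hP : E2 (fun x _ => Pn x)).
Hypothesis hR : forall f g h, E2 f -> E2 g -> E2 h -> E2b (fun x s => R x (f x s) (g x s) (h x s)).

Local Notation b := (2 * D).
Definition eN x := gord (Pn x) D.

Lemma E2_eN : E2 (fun x _ => eN x).
Proof. rewrite /eN /gord /ncell; e2. Qed.

Definition side_num (s : side) : nat := match s with Own => 0 | Left => 1 | Low => 2 end.
Lemma nbcE2 c s : nbc b c s = if side_num s == 0 then c else if side_num s == 1 then c.-1 else c + b.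
Proof. by case: s. Qed.

Lemma E2_end (sd : bool -> side) (nm : bool -> nat) f : E2 f ->
  E2 (fun x s => nbc b (f x s) (sd (f x s %% b.+1 == 1)) * 32 + nm (f x s %% b.+1 == 1)).
Proof.
move=> hf; have hk : E2b (fun x s => f x s %% b.+1 == 1) by e2.
have hs := E2_boolfun (fun k => side_num (sd k)) hk; have hn := E2_boolfun nm hk.
apply: E2_ext (_ : E2 (fun x s => (if side_num (sd (f x s %% b.+1 == 1)) == 0 then f x s else
  if side_num (sd (f x s %% b.+1 == 1)) == 1 then (f x s).-1 else f x s + b) * 32 + nm (f x s %% b.+1 == 1))) _.
  by e2.
by move=> x s; rewrite nbcE2.
Qed.

Lemma E2_ends1 e f : E2 f -> E2 (fun x s => (ends b 32 (f x s) e).1).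
Proof. exact: (E2_end (fun k => (edge_ends k e).1.1) (fun k => (edge_ends k e).1.2)). Qed.
Lemma E2_ends2 e f : E2 f -> E2 (fun x s => (ends b 32 (f x s) e).2).
Proof. exact: (E2_end (fun k => (edge_ends k e).2.1) (fun k => (edge_ends k e).2.2)). Qed.

Lemma E2_pres e f : E2 f -> E2b (fun x s => pres b (gconf (Pn x) D (R x)) (gfst D) (glst D) (f x s) e).
Proof.
move=> hf; rewrite /pres /edge_dom /gconf /gfst /glst /conf; cbv zeta.
have hk : E2 (fun x s => f x s %% b.+1) by e2.
have hi : E2 (fun x s => f x s %/ b.+1) by e2.
do !apply: E2b_and; try by e2.
apply: E2b_imp; first by e2.
do !apply: E2b_and; try by e2.
by apply/E2b_not/hR; e2.
Qed.

Definition peq (a c u v : nat) := (a == u) && (c == v) || (a == v) && (c == u).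

(** The list of edge types is fixed, so only the cell has to be quantified inside the function
    algebra; the types and sides unfold into a finite disjunction. *)
Lemma gadjE ext Px Rx u v : @gadj Px D Rx ext u v = has (fun c => has (fun e =>
  [&& c < ncell (Px * D) b, pres b (gconf Px D Rx) (gfst D) (glst D) c e, (ends b 32 c e).1 < gord Px D & (ends b 32 c e).2 < gord Px D] &&
  (peq (ends b 32 c e).1 (ends b 32 c e).2 u v || ext && (peq (ends b 32 c e).1 (c * 32 + 10 + e) u v || peq (c * 32 + 10 + e) (ends b 32 c e).2 u v)))
  (iota 0 22)) (iota 0 (ncell (Px * D) b)).
Proof.
apply: eq_has => c; apply: eq_in_has => e; rewrite mem_iota => /andP[_ he]; rewrite /gseg he /sege.
move: (ends b 32 c e) (pres _ _ _ _ _ _) => [A B] pr; rewrite /= /peq !xpair_eqE /= !orbF orbT /= !andbT.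
case: (c < _) => //=; case: pr => //=; case: (A < _) => //=; case: (B < _) => //=; case: ext => //=; by rewrite ?orbF.
Qed.

Lemma E2_gadj ext f g : E2 f -> E2 g -> E2b (fun x s => @gadj (Pn x) D (R x) ext (f x s) (g x s)).
Proof.
move=> hf hg.
have hn : E2 (fun x s => ncell (Pn x * D) b) by rewrite /ncell; e2.
have hN : E2 (fun x s => gord (Pn x) D) by apply: E2_eN.
apply: E2b_ext (_ : E2b (fun x s => has (fun c => has (fun e => _) (iota 0 22)) (iota 0 (ncell (Pn x * D) b)))) _; last first.
  by move=> x s; rewrite gadjE.
apply: (@E2b_has _ (fun x c s => has (fun e => [&& c < ncell (Pn x * D) b, pres b (gconf (Pn x) D (R x)) (gfst D) (glst D) c e, (ends b 32 c e).1 < gord (Pn x) D & (ends b 32 c e).2 < gord (Pn x) D] &&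
  (peq (ends b 32 c e).1 (ends b 32 c e).2 (f x s) (g x s) || ext && (peq (ends b 32 c e).1 (c * 32 + 10 + e) (f x s) (g x s) || peq (c * 32 + 10 + e) (ends b 32 c e).2 (f x s) (g x s)))) (iota 0 22)) hn).
apply: (@E2b_hasl _ (fun e x s => _)) => e _.
have hc := @E2_var 0; have h1 := E2_ends1 e hc; have h2 := E2_ends2 e hc; have h3 := E2_pres e hc.
have hf' := E2_behead hf; have hg' := E2_behead hg.
have hn' := E2_behead hn; have hN' := E2_behead hN.
by rewrite /peq; e2.
Qed.

Variable y : seq bool -> nat -> nat.
Hypothesis hy : forall f, E2 f -> E2 (fun x s => y x (f x s)).

Lemma nth10 (a0 a1 a2 a3 a4 a5 a6 a7 a8 a9 : bool) p : nth false [:: a0; a1; a2; a3; a4; a5; a6; a7; a8; a9] p =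
  [|| (p == 0) && a0, (p == 1) && a1, (p == 2) && a2, (p == 3) && a3, (p == 4) && a4, (p == 5) && a5,
      (p == 6) && a6, (p == 7) && a7, (p == 8) && a8 | (p == 9) && a9].
Proof. by do 10?[case: p => [|p]; first by rewrite /= ?orbF]; rewrite /= nth_nil. Qed.

Definition wbit (D : nat) (yx : nat -> nat) u := (u %% 32 < 10) && ~~ kst (2 * D) (gfst D) (glst D) 32 (tri_of D yx) (thr D (tri_of D yx)) (thr D (tri_of D yx)) u.

Lemma triN yx i : (tri_of D yx i == None) = (i %% D == yx (i %/ D)).
Proof. by rewrite /tri_of; case: (i %% D == _). Qed.
Lemma triF yx i : (tri_of D yx i == Some false) = (i %% D != yx (i %/ D)) && ~~ (i %% D < yx (i %/ D)).
Proof. by rewrite /tri_of; case: (i %% D == _) => //=; case: (_ < _). Qed.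
Lemma triT yx i : (tri_of D yx i == Some true) = (i %% D != yx (i %/ D)) && (i %% D < yx (i %/ D)).
Proof. by rewrite /tri_of; case: (i %% D == _) => //=; case: (_ < _). Qed.

Lemma E2_wbit f : E2 f -> E2b (fun x s => wbit D (y x) (f x s)).
Proof.
move=> hf.
have hi : E2 (fun x s => f x s %/ 32 %/ b.+1) by e2.
have hk : E2 (fun x s => f x s %/ 32 %% b.+1) by e2.
have hp : E2 (fun x s => f x s %% 32) by e2.
have hyy g : E2 g -> E2 (fun x s => y x (g x s %/ D)) by move=> hg; apply: hy; e2.
have hN g : E2 g -> E2b (fun x s => tri_of D (y x) (g x s) == None).
  move=> hg; apply: E2b_ext (_ : E2b (fun x s => g x s %% D == y x (g x s %/ D))) _; last by move=> x s; rewrite triN.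
  by have hyg := hyy g hg; e2.
have hF g : E2 g -> E2b (fun x s => tri_of D (y x) (g x s) == Some false).
  move=> hg; apply: E2b_ext (_ : E2b (fun x s => (g x s %% D != y x (g x s %/ D)) && ~~ (g x s %% D < y x (g x s %/ D)))) _; last by move=> x s; rewrite triF.
  by have hyg := hyy g hg; e2.
have hT g : E2 g -> E2b (fun x s => tri_of D (y x) (g x s) == Some true).
  move=> hg; apply: E2b_ext (_ : E2b (fun x s => (g x s %% D != y x (g x s %/ D)) && (g x s %% D < y x (g x s %/ D)))) _; last by move=> x s; rewrite triT.
  by have hyg := hyy g hg; e2.
have hthr g : E2 g -> E2 (fun x s => thr D (tri_of D (y x)) (g x s)).
  by move=> hg; rewrite /thr; apply: E2_if; [exact: hN|e2|e2].
have hr := hthr _ hi; have hgm : E2 (fun x s => thr D (tri_of D (y x)) (f x s %/ 32 %/ b.+1 + f x s %/ 32 %% b.+1)).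
  by apply: hthr; e2.
have h1 := hN _ hi; have h2 := hF _ hi; have h3 := hT _ hi.
rewrite /wbit /kst /kpart /gfst /glst; cbv zeta.
apply: E2b_and; first by e2.
apply: E2b_not; apply: E2b_and; first by e2.
apply: E2b_if; first by e2.
  by do !first [apply: E2b_if | apply: E2b_or]; try by e2.
apply: E2b_ext (_ : E2b (fun x s => _)) _; last by move=> x s; rewrite nth10.
cbv beta; by e2.
Qed.

End Encoding.

(** ** The machine *)
Section MachineEncoding.
Variables (M : machine) (p : {poly nat}).
Local Notation K := (extra_tapes M).+1.
Definition sp (x : seq bool) : nat := p.[size x]%R.

Lemma E2_sp : E2 (fun x _ => sp x). Proof. exact: E2_poly. Qed.
Lemma E2_mJ : E2 (fun x _ => mJ (sp x)). Proof. have := E2_sp => h; rewrite /mJ; e2. Qed.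
Lemma E2_radix : E2 (fun x _ => radix M (sp x)). Proof. have := E2_mJ => h; rewrite /radix; e2. Qed.
Lemma E2_radixc i : E2 (fun x _ => radix M (sp x) ^ i). Proof. exact: E2_expc E2_radix. Qed.
Lemma E2_rcount : E2 (fun x _ => rcount M (sp x)). Proof. have := E2_radixc K => h; rewrite /rcount; e2. Qed.
Lemma E2_msize : E2 (fun x _ => msize M (sp x)). Proof. have := E2_mJ => h; rewrite /msize; e2. Qed.

Lemma E2_addr i f g : E2 f -> E2 g -> E2 (fun x s => addr M (sp x) i (f x s) (g x s)).
Proof. move=> hf hg; have h := E2_mJ; rewrite /addr; e2. Qed.
Lemma E2_rdig i f : E2 f -> E2 (fun x s => rdig M (sp x) (f x s) i).
Proof. move=> hf; have h := E2_radix; have h' := E2_radixc i; rewrite /rdig; e2. Qed.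
Lemma E2_rsym i f : E2 f -> E2 (fun x s => rsym M (sp x) (f x s) i).
Proof. move=> hf; have h := E2_rdig i hf; have h' := E2_mJ; rewrite /rsym; e2. Qed.
Lemma E2_rpos i f : E2 f -> E2 (fun x s => rpos M (sp x) (f x s) i).
Proof. move=> hf; have h := E2_rdig i hf; have h' := E2_mJ; rewrite /rpos; e2. Qed.
Lemma E2_rstate f : E2 f -> E2 (fun x s => rstate M (sp x) (f x s)).
Proof. move=> hf; have h := E2_radixc K; rewrite /rstate; e2. Qed.

Lemma E2F_state f : E2 f -> E2F (fun x s => qst M (rstate M (sp x) (f x s))).
Proof.
move=> hf; apply: (@E2F_ofnat _ (nq M) (qst M)); last exact: E2_rstate.
by move=> k; rewrite /nq cardE => hk; rewrite /qst !nth_default.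
Qed.

Lemma E2F_scan f : E2 f -> E2F (fun x s => [ffun i : 'I_K => sym M (rsym M (sp x) (f x s) i)]).
Proof.
move=> hf; apply: (@E2F_ffun _ _ (fun (i : 'I_K) x s => sym M (rsym M (sp x) (f x s) i))) => i.
apply: (@E2F_ofnat _ (nA M) (sym M)); last exact: E2_rsym.
by move=> k; rewrite /nA cardE => hk; rewrite /sym !nth_default.
Qed.

Lemma E2_delta (h : state M * {ffun 'I_K -> cell (aux M) * direction} -> nat) f : E2 f ->
  E2 (fun x s => h (rdelta M (sp x) (f x s))).
Proof.
move=> hf; exact: (E2F_nat (fun qv => h (delta qv.1 qv.2)) (E2F_pair (E2F_state hf) (E2F_scan hf))).
Qed.

Lemma E2_qstate (h : state M -> bool) f : E2 f -> E2b (fun x s => h (qst M (rstate M (sp x) (f x s)))).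
Proof. by move=> hf; apply: (E2b_F h (E2F_state hf)). Qed.

Definition dir_num (d : direction) := match d with MoveLeft => 0 | Stay => 1 | MoveRight => 2 end.

Lemma E2_rnew i f : E2 f -> E2 (fun x s => rnew M (sp x) (f x s) i).
Proof. by move=> hf; apply: (E2_delta (fun qw => snum (qw.2 (inord i)).1) hf). Qed.
Lemma E2_rto i f : E2 f -> E2 (fun x s => rto M (sp x) (f x s) i).
Proof.
move=> hf; have h1 := E2_rpos i hf; have h2 := E2_delta (fun qw => dir_num (qw.2 (inord i)).2) hf.
apply: E2_ext (_ : E2 (fun x s => if dir_num ((rdelta M (sp x) (f x s)).2 (inord i)).2 == 0 then (rpos M (sp x) (f x s) i).-1 else
  if dir_num ((rdelta M (sp x) (f x s)).2 (inord i)).2 == 1 then rpos M (sp x) (f x s) i else (rpos M (sp x) (f x s) i).+1)) _; first by e2.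
by move=> x s; rewrite /rto; case: (_.2).
Qed.

Lemma E2_mclr0 f g : E2 f -> E2 g -> E2b (fun x s => mclr0 M (sp x) (f x s) (g x s)).
Proof.
move=> hf hg; have h1 := E2_rstate hf; rewrite /mclr0; apply: E2b_or; first by e2.
apply: (@E2b_hasl _ (fun i x s => (g x s == addr M (sp x) i (rpos M (sp x) (f x s) i) (rsym M (sp x) (f x s) i)) || (g x s == addr M (sp x) i (rpos M (sp x) (f x s) i) (nA M)))) => i _.
have h2 := E2_addr i (E2_rpos i hf) (E2_rsym i hf); have h3 := E2_addr i (E2_rpos i hf) (E2_const (nA M)); by e2.
Qed.

Lemma E2_mguard f g : E2 f -> E2 g -> E2b (fun x s => mguard M (sp x) (f x s) (g x s)).
Proof. by move=> hf hg; have h := E2_mclr0 hf hg; rewrite /mguard; e2. Qed.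
Lemma E2_rhalt f : E2 f -> E2b (fun x s => rhalt M (sp x) (f x s)).
Proof. by move=> hf; apply: (E2_qstate (@halting M) hf). Qed.
Lemma E2_mwin f : E2 f -> E2b (fun x s => mwin M (sp x) (f x s)).
Proof. by move=> hf; apply: (E2_qstate (fun q => halting q && accepting q) hf). Qed.
Lemma E2_mclr f g : E2 f -> E2 g -> E2b (fun x s => mclr M (sp x) (f x s) (g x s)).
Proof. by move=> hf hg; have h := E2_mclr0 hf hg; have h' := E2_rhalt hf; rewrite /mclr; e2. Qed.
Lemma E2_mset f g : E2 f -> E2 g -> E2b (fun x s => msets M (sp x) (f x s) (g x s)).
Proof.
move=> hf hg; have h' := E2_rhalt hf; have h1 := E2_delta (fun qw => qnum qw.1) hf.
rewrite /msets; apply: E2b_and; first by e2.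
apply: E2b_or; first by e2.
apply: (@E2b_hasl _ (fun i x s => (g x s == addr M (sp x) i (rpos M (sp x) (f x s) i) (rnew M (sp x) (f x s) i)) || (g x s == addr M (sp x) i (rto M (sp x) (f x s) i) (nA M)))) => i _.
have h2 := E2_addr i (E2_rpos i hf) (E2_rnew i hf); have h3 := E2_addr i (E2_rto i hf) (E2_const (nA M)); by e2.
Qed.

Definition prog_of x := rprog (rcount M (sp x)) (mguard M (sp x)) (msets M (sp x)) (mclr M (sp x)) (mwin M (sp x)).

Lemma E2_prog f g : E2 f -> E2 g -> E2 (fun x s => prog_of x (f x s) (g x s)).
Proof.
move=> hf hg; have hk := E2_half hf; have h0 := E2_rcount.
have h1 := E2_mguard hk hg; have h2 := E2_mset hk hg; have h3 := E2_mclr hk hg; have h4 := E2_mwin hk.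
rewrite /prog_of /rprog; cbv zeta; by e2.
Qed.

Lemma inpE x j : inp x j = if j < size x then (nth false x j).+1 else 0.
Proof.
rewrite /inp; case: ltnP => h; first by rewrite (drop_nth false h).
by rewrite drop_oversize.
Qed.

Lemma E2_tp0 i f : E2 f -> E2 (fun x s => snum (@tp0 M (sp x) x (inord i) (f x s))).
Proof.
move=> hf; have h := E2_sp.
pose sy k : cell (aux M) := if k is k'.+1 then Some (inl (k' != 0)) else None.
have h1 : E2 (fun x s => inp x (f x s - sp x)) by apply: E2_inp; e2.
have h2 : E2 (fun x s => snum (sy (inp x (f x s - sp x)))).
  by apply: (@E2_table 2 (fun k => snum (sy k))) => // -[|[|[|k]]].
rewrite /tp0; case: (inord i == ord0 :> 'I_K); last by apply: E2_ext (E2_const (@snum M None)) _.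
apply: E2_ext (_ : E2 (fun x s => if sp x <= f x s then snum (sy (inp x (f x s - sp x))) else @snum M None)) _.
  by e2.
move=> x s; rewrite andTb; case: (sp x <= f x s) => //; rewrite inpE /sy; case: ltnP => hs.
  by rewrite (nth_map false) //; case: (nth _ _ _).
by rewrite nth_default // size_map.
Qed.

Lemma E2_dinit f : E2 f -> E2b (fun x s => @dinit M (sp x) x (f x s)).
Proof.
move=> hf; rewrite /dinit; apply: E2b_or; first by e2.
apply: E2b_or; first by e2.
apply: (@E2b_hasl _ (fun i x s => has (fun j => (f x s == addr M (sp x) i j (snum (@tp0 M (sp x) x (inord i) j))) || ((j == sp x) && (f x s == addr M (sp x) i j (nA M)))) (iota 0 (mJ (sp x))))) => i _.
have h0 := E2_mJ; have h1 := E2_sp; have hv := @E2_var 0; have hf' := E2_behead hf.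
apply: (@E2b_has _ (fun x j s => (f x s == addr M (sp x) i j (snum (@tp0 M (sp x) x (inord i) j))) || ((j == sp x) && (f x s == addr M (sp x) i j (nA M)))) h0).
have h2 := E2_addr i hv (E2_tp0 i hv); have h3 := E2_addr i hv (E2_const (nA M)).
by e2.
Qed.

Definition cB x := rB (rcount M (sp x)).
Definition cm x := msize M (sp x).
Definition cn x := (cB x * cm x).-1.

Lemma E2_cB : E2 (fun x _ => cB x). Proof. have h := E2_rcount; rewrite /cB /rB; e2. Qed.
Lemma E2_cn : E2 (fun x _ => cn x). Proof. have h := E2_cB; have h' := E2_msize; rewrite /cn /cm; e2. Qed.

Definition site0 x := Kinit (cn x) (cB x) (cm x) (prog_of x) (@dinit M (sp x) x).
Definition site1 x := allacc (cn x).

Lemma E2F_ring f : E2 f -> E2F (fun x s => ring (cB x) (cm x) (prog_of x) (f x s)).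
Proof.
move=> hf; have h1 := E2_cB; have h2 : E2 (fun x _ => cm x) := E2_msize.
have hp : E2 (fun x s => prog_of x ((cB x - f x s %/ cm x) %% cB x) (f x s %% cm x)) by apply: E2_prog; e2.
apply: E2F_pair; first by apply: E2F_b; e2.
apply: (@E2F_ofnat _ 6 ord6) => // k hk.
by rewrite /ord6 /inord /insubd !insubF // ltnNge hk.
Qed.

Lemma E2F_cell f : E2 f -> E2F (fun x s => cells (fun q => @dinit M (sp x) x q.-1) (ring_at (cn x) (cB x) (cm x) (prog_of x) 1) (f x s)).
Proof.
move=> hf; apply: E2F_pair; first by apply: E2F_b; apply: E2_dinit; e2.
by have h := E2_cn; apply: E2F_ring; e2.
Qed.

Lemma E2F_site0 f : E2 f -> E2F (fun x s => site0 x (f x s)).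
Proof.
move=> hf; have h := E2_cn; have hc := E2F_cell hf; have hc1 := E2F_cell (E2_const 1).
rewrite /site0 /Kinit /Kround /Kstart /Kc.
apply: E2F_if; first by e2.
  exact: E2F_const.
apply: E2F_if; first by e2.
  exact: (E2F_map lm hc).
apply: E2F_if; first by e2.
  have hr : E2F (fun x s => ring_at (cn x) (cB x) (cm x) (prog_of x) 1 0) by apply: E2F_ring; e2.
  exact: (E2F_map2 (fun a c => ag a false false (false, false, c, false)) hc1 hr).
exact: (E2F_map rm hc).
Qed.

Lemma E2F_site1 f : E2 f -> E2F (fun x s => site1 x (f x s)).
Proof.
by move=> hf; have h := E2_cn; rewrite /site1 /allacc; apply: E2F_if; [e2|exact: E2F_const|exact: E2F_const].
Qed.

Definition yword (st : seq bool -> nat -> site) x := word_of_sites wall (cn x) (st x).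

Lemma E2_yword st : (forall f, E2 f -> E2F (fun x s => st x (f x s))) ->
  forall f, E2 f -> E2 (fun x s => yword st x (f x s)).
Proof.
move=> hst f hf; have h := E2_cn; rewrite /yword /word_of_sites /wnum /letters_of.
apply: (@E2F_nat _ (@lnum site)); apply: E2F_if; first by e2.
  by apply: (E2F_map (fun ab : site * site => inl ab : letter site)); apply: E2F_pair; apply: hst; e2.
exact: E2F_const.
Qed.

Definition cR x := RW wall flipf (cn x).
Lemma E2_cR f g h : E2 f -> E2 g -> E2 h -> E2b (fun x s => cR x (f x s) (g x s) (h x s)).
Proof.
move=> hf hg hh; have hn := E2_cn; rewrite /cR /RW /rcompat.
have hl k : E2 k -> E2F (fun x s => @numl site wall (k x s)).
  move=> hk; apply: (@E2F_ofnat _ (nletters site) (@numl site wall)) => // j hj.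
  by rewrite /numl !nth_default // -cardE.
apply: E2b_and.
  exact: (E2b_F (fun ab : letter site * letter site => compat flipf ab.1 ab.2) (E2F_pair (hl _ hg) (hl _ hh))).
apply: E2b_and; apply: E2b_imp; try by e2.
  exact: (E2b_F (opens wall) (hl _ hg)).
exact: (E2b_F (closes wall) (hl _ hh)).
Qed.

End MachineEncoding.

(** ** Bit strings *)

Lemma eq_mkseq_in T (f g : nat -> T) n : (forall i, i < n -> f i = g i) -> mkseq f n = mkseq g n.
Proof. by move=> h; apply/eq_in_map => i; rewrite mem_iota => /andP[_ hi]; apply: h. Qed.

Lemma mkseq_cat T (f g : nat -> T) n m :
  mkseq f n ++ mkseq g m = mkseq (fun i => if i < n then f i else g (i - n)) (n + m).
Proof.
rewrite /mkseq iotaD map_cat add0n; congr cat.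
  by apply/eq_in_map => i; rewrite mem_iota => /andP[_ ->].
apply: (@eq_from_nth _ (g 0)) => [|i]; rewrite ?size_map ?size_iota // => hi.
by rewrite !(nth_map 0) ?size_iota // !nth_iota // ltnNge leq_addr /= addKn.
Qed.

Lemma map_enum T (f : nat -> T) n : [seq f (val u) | u <- enum 'I_n] = mkseq f n.
Proof. by rewrite /mkseq -val_enum_ord -map_comp. Qed.

Lemma pairs_enum T (a : nat -> nat -> T) n :
  [seq a (val u) (val v) | u <- enum 'I_n, v <- enum 'I_n] = mkseq (fun i => a (i %/ n) (i %% n)) (n * n).
Proof.
have -> : [seq a (val u) (val v) | u <- enum 'I_n, v <- enum 'I_n] = flatten (mkseq (fun u => mkseq (a u) n) n).
  by rewrite -map_enum; congr flatten; apply: eq_map => u; rewrite map_enum.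
have H k : flatten (mkseq (fun u => mkseq (a u) n) k) = mkseq (fun i => a (i %/ n) (i %% n)) (k * n).
  elim: k => [|k IH]; first by rewrite mul0n.
  rewrite mkseqS -cats1 flatten_cat IH /= cats0 mulSn [n + _]addnC mkseq_cat.
  apply: eq_mkseq_in => i hi; case: ltnP => // h; have hin : i - k * n < n by rewrite ltn_subLR.
  rewrite -{2 3}(subnKC h) modnMDl divnMDl ?(leq_ltn_trans _ hin) //.
  by rewrite divn_small // addn0 modn_small.
exact: H.
Qed.

(** [2 ^ i], as long as [2 ^ i.-1] does not exceed [k]. *)
Definition pw k i := recn 1 (fun _ c => if c <= k then c + c else c) i.

Lemma pwE k i : 0 < k -> pw k i = 2 ^ minn i (trunc_log 2 k).+1.
Proof.
move=> k0; elim: i => [|i IH]; first by rewrite min0n.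
have -> : pw k i.+1 = if pw k i <= k then pw k i + pw k i else pw k i by [].
rewrite IH; have [h|h] := leqP i (trunc_log 2 k).
  rewrite (minn_idPl (leqW h)) (minn_idPl _) // ifT; first by rewrite expnS mul2n addnn.
  by apply: leq_trans (trunc_logP (isT : 1 < 2) k0); rewrite leq_exp2l.
rewrite (minn_idPr h) (minn_idPr _); last exact: leqW.
by rewrite ifF //; apply/negbTE; rewrite -ltnNge trunc_log_ltn.
Qed.

Lemma E2_pw f g : E2 f -> E2 g -> E2 (fun x s => pw (f x s) (g x s)).
Proof.
move=> hf hg; apply: (@E2_recb (fun x s => (f x s).*2.+1) _ _ (fun x _ c s => if c <= f x s then c + c else c)).
- e2. - exact: (E2_const 1). - by [].
- have h : E2 (fun x s => f x (behead (behead s))) by apply: E2_behead (E2_behead hf).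
  by e2.
move=> x s i _; rewrite -[X in X <= _]/(pw (f x s) i).
case: (posnP (f x s)) => [->|h0].
  by elim: i => // i IH; rewrite -[pw 0 i.+1]/(if pw 0 i <= 0 then pw 0 i + pw 0 i else pw 0 i); case: (pw 0 i) IH => [|c].
rewrite pwE //; apply: (@leq_trans (2 ^ (trunc_log 2 (f x s)).+1)); first by rewrite leq_exp2l // geq_minr.
by rewrite expnS mul2n leqW // leq_double trunc_logP.
Qed.

(** The logarithm counts the positive exponents whose power of two does not exceed [k]. *)
Lemma tlE k : \sum_(0 <= i < k) (pw k i.+1 <= k) = trunc_log 2 k.
Proof.
case: (posnP k) => [->|k0]; first by rewrite big_nil trunc_log0.
set t := trunc_log 2 k; have tk : t <= k by apply: leq_trans (ltnW (ltn_expl t (isT : 1 < 2))) (trunc_logP _ k0).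
rewrite (eq_big_nat _ _ (F2 := fun i => (i < t : nat))); last first.
  move=> i hi; rewrite pwE // -/t; congr nat_of_bool; have [h|h] := ltnP i t.
    by rewrite (minn_idPl (leqW h)); apply: leq_trans (trunc_logP (isT : 1 < 2) k0); rewrite leq_exp2l.
  by rewrite (minn_idPr _) //; apply/negbTE; rewrite -ltnNge trunc_log_ltn.
rewrite -(subnKC tk); elim: (k - t) => [|j IH]; last by rewrite addnS big_nat_recr //= IH ltnNge leq_addr addn0.
rewrite addn0 (eq_big_nat _ _ (F2 := fun=> 1)); last by move=> i /andP[_ ->].
by rewrite sum_nat_const_nat subn0 muln1.
Qed.

Lemma nat_bitsE k : nat_bits k = mkseq (fun i => odd (k %/ pw k i)) (trunc_log 2 k).+1.
Proof.
rewrite /nat_bits -/(mkseq _ _); apply: eq_mkseq_in => i; rewrite ltnS => hi; case: (posnP k) => [->|k0]; first by rewrite !div0n.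
by rewrite pwE // (minn_idPl (leqW hi)).
Qed.

(** ** Encodings of instances *)
Section Enc.
Variables (N : seq bool -> nat) (a : seq bool -> nat -> nat -> bool) (sb tb : seq bool -> nat -> bool) (thr : seq bool -> nat).
Hypotheses (hN : E2 (fun x _ => N x)) (hT : E2 (fun x _ => thr x)).
Hypothesis ha : forall f g, E2 f -> E2 g -> E2b (fun x s => a x (f x s) (g x s)).
Hypotheses (hs : forall f, E2 f -> E2b (fun x s => sb x (f x s))) (ht : forall f, E2 f -> E2b (fun x s => tb x (f x s))).

Definition ebit x i := if i < N x + 1 then i < N x else
  let i1 := i - (N x + 1) in if i1 < N x * N x then a x (i1 %/ N x) (i1 %% N x) else
  let i2 := i1 - N x * N x in if i2 < N x then sb x i2 else let i3 := i2 - N x in tb x i3.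
Definition elen x := N x + 1 + (N x * N x + (N x + N x)).

Definition base_bits x := rcons (nseq (N x) true) false ++
  [seq a x (val u) (val v) | u <- enum 'I_(N x), v <- enum 'I_(N x)] ++
  [seq sb x (val u) | u <- enum 'I_(N x)] ++ [seq tb x (val u) | u <- enum 'I_(N x)].

Lemma base_bitsE x : base_bits x = mkseq (ebit x) (elen x).
Proof.
rewrite /base_bits pairs_enum !map_enum.
have -> : rcons (nseq (N x) true) false = mkseq (fun i => i < N x) (N x + 1).
  rewrite addn1 mkseqS ltnn; congr rcons; apply: (@eq_from_nth _ false); first by rewrite size_nseq size_mkseq.
  by move=> i; rewrite size_nseq => hi; rewrite nth_nseq nth_mkseq // hi.
by rewrite !mkseq_cat.
Qed.

Lemma E2_ebit f : E2 f -> E2b (fun x s => ebit x (f x s)).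
Proof.
move=> hf; rewrite /ebit; cbv zeta; have h1 : E2 (fun x s => f x s - (N x + 1)) by e2.
have h2 : E2 (fun x s => f x s - (N x + 1) - N x * N x) by e2.
have h3 : E2 (fun x s => f x s - (N x + 1) - N x * N x - N x) by e2.
have b1 := hs h2; have b2 := ht h3.
have b3 : E2b (fun x s => a x ((f x s - (N x + 1)) %/ N x) ((f x s - (N x + 1)) %% N x)) by apply: ha; e2.
by e2.
Qed.

Lemma E2_elen : E2 (fun x _ => elen x). Proof. by rewrite /elen; e2. Qed.

Definition tbit x i := if i < elen x then ebit x i else let j := i - elen x in if j < 1 then false else odd (thr x %/ pw (thr x) (j - 1)).
Definition tlen x := elen x + (1 + (\sum_(0 <= i < thr x) (pw (thr x) i.+1 <= thr x)).+1).

Lemma threshold_bitsE x : base_bits x ++ int_bits (Posz (thr x)) = mkseq (tbit x) (tlen x).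
Proof.
rewrite base_bitsE /int_bits /= nat_bitsE.
have -> : false :: mkseq (fun i => odd (thr x %/ pw (thr x) i)) (trunc_log 2 (thr x)).+1 =
   mkseq (fun _ => false) 1 ++ mkseq (fun i => odd (thr x %/ pw (thr x) i)) (trunc_log 2 (thr x)).+1 by [].
by rewrite !mkseq_cat /tlen tlE.
Qed.

Lemma E2_tbit f : E2 f -> E2b (fun x s => tbit x (f x s)).
Proof.
move=> hf; rewrite /tbit; cbv zeta; have h1 := E2_elen; have h2 := E2_ebit hf.
have h3 : E2 (fun x s => pw (thr x) (f x s - elen x - 1)) by apply: E2_pw; e2.
by e2.
Qed.

Lemma E2_tlen : E2 (fun x _ => tlen x).
Proof.
rewrite /tlen; have h1 := E2_elen; apply: E2_add => //; apply: E2_succ; apply: E2_succ.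
apply: (@E2_sum _ (fun x i s => (pw (thr x) i.+1 <= thr x : nat))) => //.
have h3 : E2 (fun x s => pw (thr x) (nth 0 s 0).+1) by apply: E2_pw; e2.
by e2.
Qed.

End Enc.

(** * Reachability in exponential graphs *)

Lemma sum_lt k t : t <= k -> \sum_(0 <= i < k) (i < t) = t.
Proof.
move=> tk; rewrite -{1}(subnKC tk); elim: (k - t) => [|j IH]; last by rewrite addnS big_nat_recr //= IH ltnNge leq_addr addn0.
rewrite addn0 (eq_big_nat _ _ (F2 := fun=> 1)); last by move=> i /andP[_ ->].
by rewrite sum_nat_const_nat subn0 muln1.
Qed.

(** Bounded minimisation as a sum: it counts the numbers that precede the first element of [P], and
    the value [d] means that there is none below [d]. *)
Definition first (P : pred nat) d := \sum_(0 <= i < d) all (fun j => ~~ P j) (iota 0 i.+1).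

Lemma firstE P d t : t <= d -> (forall i, i < t -> ~~ P i) -> (t < d -> P t) -> first P d = t.
Proof.
move=> td h1 h2; rewrite /first (eq_big_nat _ _ (F2 := fun i => (i < t : nat))); first exact: sum_lt.
move=> i /andP[_ hi]; congr nat_of_bool; have [it|ti] := ltnP i t.
  by apply/allP => j; rewrite mem_iota => /andP[_ hj]; apply: h1; lia.
apply/negbTE/allPn; exists t; first by rewrite mem_iota ltnS ti.
by rewrite negbK h2 // (leq_ltn_trans ti).
Qed.

Section Climb.
Variables (leaf ex : pred nat).

Fixpoint tree j e := if j is j'.+1 then
  if ex j' then tree j' e.*2 || tree j' e.*2.+1 else tree j' e.*2 && tree j' e.*2.+1 else leaf e.

(** The value of a leaf passes up unchanged through every node that it decides,
    and through every node of which it is a descendant on the right. *)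
Definition turns c j := ~~ odd (c %/ 2 ^ j) && (leaf c != ex j).

Variables (d K : nat).
Definition climb c := let j := first (turns c) d in let c' := (c %/ 2 ^ j).+1 * 2 ^ j in
  if (j < d) && (c' < K) then c' else c.

(** The number of a leaf records which turns to the right are still open, so the search needs no
    stack. From the leaf that decides a left subtree one either keeps its value, when this settles
    the parent, or jumps to the leftmost leaf of the right subtree; the last leaf reached carries
    the value of the whole. *)
Lemma climb_tree j e : j <= d -> e.+1 * 2 ^ j <= K -> exists2 k, k < 2 ^ j &
  let c := iter k climb (e * 2 ^ j) in [/\ c %/ 2 ^ j = e, leaf c = tree j e & forall i, i < j -> ~~ turns c i].
Proof.
elim: j e => [|j IH] e hj hK; first by exists 0; rewrite //= expn0 muln1 divn1; split.
have e2 : 2 ^ j.+1 = 2 ^ j + 2 ^ j by rewrite expnS mul2n addnn.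
have j0 : 0 < 2 ^ j by rewrite expn_gt0.
have [||k1 hk1 /= [d1 l1 t1]] := IH e.*2; [exact: ltnW| |].
  by apply: leq_trans hK; rewrite e2 -addnn; nia.
set c1 := iter k1 climb _ in d1 l1 t1.
have s1 : e * 2 ^ j.+1 = e.*2 * 2 ^ j by rewrite expnS mulnA muln2.
have h1 c : c %/ 2 ^ j.+1 = c %/ 2 ^ j %/ 2 by rewrite expnSr divnMA.
have [hx|hx] := eqVneq (leaf c1) (ex j).
  exists k1; first by rewrite e2 ltn_addr.
  rewrite s1 -/c1; split.
  - by rewrite h1 d1 -muln2 mulnK.
  - by rewrite /= -l1 -hx; case: (leaf c1).
  - by move=> i; rewrite ltnS leq_eqVlt => /orP[/eqP ->|]; [rewrite /turns hx eqxx andbF|apply: t1].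
have tj : turns c1 j by rewrite /turns d1 odd_double.
have [||k2 hk2 /= [d2 l2 t2]] := IH e.*2.+1; [exact: ltnW| |].
  by apply: leq_trans hK; rewrite e2 -addnn; nia.
have hc : climb c1 = e.*2.+1 * 2 ^ j.
  rewrite /climb (@firstE _ _ j) ?(ltnW hj) // hj d1 ifT //= (leq_trans _ hK) // e2 -addnn; nia.
set c2 := iter k2 climb _ in d2 l2 t2.
exists (k2 + k1.+1); first by rewrite e2; lia.
rewrite s1 iterD iterS -/c1 hc -/c2; split.
- by rewrite h1 d2 -addn1 -muln2 divnMDl // divn_small // addn0.
- by rewrite /= -l1 -l2; move: hx; case: (leaf c1); case: (ex j).
- by move=> i; rewrite ltnS leq_eqVlt => /orP[/eqP ->|]; [rewrite /turns d2 /= odd_double|apply: t2].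
Qed.

Lemma tree_climb N : 2 ^ d <= N -> 2 ^ d <= K -> leaf (iter N climb 0) = tree d 0.
Proof.
move=> hN hK; have [||k hk] := @climb_tree d 0; rewrite ?mul1n // mul0n => /= [[_ <- ht]].
have hs : climb (iter k climb 0) = iter k climb 0 by rewrite {1}/climb (@firstE _ _ d) ?ltnn.
rewrite -(subnK (leq_trans (ltnW hk) hN)) iterD; congr leaf.
by elim: (N - k) => //= i ->.
Qed.

Lemma tree_or h k e : (forall i, i < k -> ex (h + i)) ->
  tree (h + k) e = has (fun M => tree h (e * 2 ^ k + M)) (iota 0 (2 ^ k)).
Proof.
elim: k e => [|k IH] e hx; first by rewrite addn0 /= expn0 muln1 addn0 orbF.
have hx' i : i < k -> ex (h + i) by move=> hi; apply/hx/ltnW.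
have e2 : 2 ^ k.+1 = 2 ^ k + 2 ^ k by rewrite expnS mul2n addnn.
rewrite addnS /= hx // !IH // e2 iotaD has_cat add0n; congr (_ || _).
  by apply: eq_has => M; congr tree; rewrite -addnn; nia.
have := iotaDl (2 ^ k) 0 (2 ^ k); rewrite addn0 => ->; rewrite has_map; apply: eq_has => M /=.
by congr tree; rewrite -addnn; nia.
Qed.

End Climb.

Section Savitch.
Variables (n S T : nat) (st : rel nat).
Local Notation q := (2 ^ n.+1).

(** Each level of Savitch's recursion takes [n.+1] bits of the leaf number: [n] bits for the guessed
    midpoint, read as alternatives, and the lowest one for the half to be checked, where both have
    to succeed. *)
Fixpoint halves k e : nat * nat := if k is k'.+1 then
  let AB := halves k' (e %/ q) in let M := e %% q %/ 2 in if odd e then (M, AB.2) else (AB.1, M) else (S, T).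

Definition quant i := i %% n.+1 != 0.
Definition near_eq A B := (A == B) || st A B.
Definition near_leaf L c := near_eq (halves L c).1 (halves L c).2.

Fixpoint within_steps l A B := if l is l'.+1 then has (fun M => within_steps l' A M && within_steps l' M B) (iota 0 (2 ^ n)) else near_eq A B.

Lemma tree_within L l e : l <= L ->
  tree (near_leaf L) quant (l * n.+1) e = within_steps l (halves (L - l) e).1 (halves (L - l) e).2.
Proof.
elim: l e => [|l IH] e hl; first by rewrite subn0.
have -> : l.+1 * n.+1 = (l * n.+1).+1 + n by rewrite mulSn; lia.
rewrite tree_or; last by move=> i hi; rewrite /quant addSn -addnS modnMDl modn_small.
apply: eq_in_has => M; rewrite mem_iota add0n => /andP[_ hM].
rewrite [tree _ _ _ _]/= /quant modnMl eqxx /= !IH ?(ltnW hl) //.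
have -> : L - l = (L - l.+1).+1 by lia.
have q2 : q = 2 ^ n * 2 by rewrite expnSr.
have e1 b : (b < 2) -> (e * 2 ^ n + M).*2 + b = e * q + (M * 2 + b) by rewrite q2 -muln2; lia.
have s1 b : (b < 2) -> M * 2 + b < q by rewrite q2; lia.
have h b : b < 2 -> halves (L - l.+1).+1 ((e * 2 ^ n + M).*2 + b) =
   if odd b then (M, (halves (L - l.+1) e).2) else ((halves (L - l.+1) e).1, M).
  move=> hb; have a4 : odd (e * q + (M * 2 + b)) = odd b by rewrite -e1 // oddD odd_double.
  have a1 : (e * q + (M * 2 + b)) %/ q = e by rewrite divnMDl ?expn_gt0 // divn_small ?s1 // addn0.
  have a2 : (e * q + (M * 2 + b)) %% q = M * 2 + b by rewrite modnMDl modn_small ?s1.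
  have a3 : (M * 2 + b) %/ 2 = M by rewrite divnMDl // (divn_small hb) addn0.
  by rewrite e1 //= a1 a2 a3 a4.
by have := h 0 isT; have := h 1 isT; rewrite addn0 addn1 => -> ->.
Qed.

Lemma withinP l A B : A < 2 ^ n -> B < 2 ^ n -> within_steps l A B <->
  exists s, [/\ path st A s, last A s = B, all (fun M => M < 2 ^ n) s & size s <= 2 ^ l].
Proof.
elim: l A B => [|l IH] A B hA hB /=.
  rewrite /near_eq; split=> [/orP[/eqP <-|h]|[[|M [|M' s]] [] //=]].
  - by exists [::].
  - by exists [:: B]; rewrite /= h hB.
  - by move=> _ -> _ _; rewrite eqxx.
  - by rewrite andbT => h <- _ _; rewrite h orbT.
split=> [/hasP[M]|[s [h1 h2 h3 h4]]].
  rewrite mem_iota => /andP[_ hM] /andP[/(IH _ _ hA hM)[s [a1 a2 a3 a4]] /(IH _ _ hM hB)[s' [b1 b2 b3 b4]]].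
  exists (s ++ s'); rewrite cat_path last_cat a2 a1 b1 b2 all_cat a3 b3 size_cat; split=> //.
  by rewrite expnS mul2n -addnn leq_add.
set M := last A (take (2 ^ l) s); have hs := cat_take_drop (2 ^ l) s.
move: h1 h2 h3; rewrite -hs cat_path last_cat all_cat -/M => /andP[a1 b1] b2 /andP[a3 b3].
have hM : M < 2 ^ n.
  by rewrite /M; case: (take _ s) a3 => // C u /allP h; apply: h (mem_last _ _).
apply/hasP; exists M; first by rewrite mem_iota.
apply/andP; split.
  by apply/(IH _ _ hA hM); exists (take (2 ^ l) s); split=> //; rewrite size_take_min geq_minl.
apply/(IH _ _ hM hB); exists (drop (2 ^ l) s); split=> //.
by rewrite size_drop leq_subLR addnn -mul2n -expnS.
Qed.

(** A path can be shortened to one without repetition; this visits fewer than [2 ^ n] further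
    numbers, so [n] halvings suffice. *)
Theorem savitch : S < 2 ^ n -> T < 2 ^ n ->
  tree (near_leaf n) quant (n * n.+1) 0 <-> exists s, [/\ path st S s, last S s = T & all (fun M => M < 2 ^ n) s].
Proof.
move=> hS hT; rewrite tree_within // subnn /= withinP //; split=> [[s [h1 h2 h3 _]]|[s [h1 h2 h3]]]; first by exists s.
move: h2; case/shortenP: h1 => s' p' u' hs' h2; exists s'; split=> //.
  by apply/allP => M /hs'; apply: (allP h3).
have hsub : {subset S :: s' <= iota 0 (2 ^ n)}.
  move=> M; rewrite inE mem_iota => /orP[/eqP -> //|/hs']; exact: (allP h3).
by have := uniq_leq_size u' hsub; rewrite size_iota /=; apply: ltnW.
Qed.

End Savitch.

(** * Sets of vertices as numbers *)

Definition nsum n (f : nat -> bool) := \sum_(0 <= i < n) f i * 2 ^ i.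

Lemma nsum_lt n f : nsum n f < 2 ^ n.
Proof.
rewrite /nsum; elim: n => [|n IH]; first by rewrite big_nil.
by rewrite big_nat_recr //= expnS mul2n -addnn -addSn leq_add // -[X in _ <= X]mul1n leq_mul2r leq_b1 orbT.
Qed.

Lemma nsum_bit n f i : i < n -> odd (nsum n f %/ 2 ^ i) = f i.
Proof.
elim: n => // n IH; rewrite /nsum big_nat_recr //= -/(nsum n f) ltnS leq_eqVlt => /orP[/eqP ->|h].
  by rewrite addnC divnMDl ?expn_gt0 // divn_small ?nsum_lt // addn0; case: (f n).
have -> : 2 ^ n = 2 ^ (n - i.+1) * 2 * 2 ^ i by rewrite -mulnA -expnS -expnD subnK.
by rewrite !mulnA addnC divnMDl ?expn_gt0 // oddD IH // oddM andbF.
Qed.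

Definition setof n A : {set 'I_n} := [set i : 'I_n | odd (A %/ 2 ^ i)].
Definition numof n (X : {set 'I_n}) := nsum n (fun i => oapp (mem X) false (insub i)).

Lemma numof_lt n (X : {set 'I_n}) : numof X < 2 ^ n. Proof. exact: nsum_lt. Qed.
Lemma numof_bit n (X : {set 'I_n}) (u : 'I_n) : odd (numof X %/ 2 ^ u) = (u \in X).
Proof. by rewrite nsum_bit // valK. Qed.
Lemma numofK n : cancel (@numof n) (@setof n).
Proof. by move=> X; apply/setP => u; rewrite inE numof_bit. Qed.
Lemma numof_nsum n (f : nat -> bool) : numof [set u : 'I_n | f u] = nsum n f.
Proof.
by apply: eq_big_nat => i /andP[_ hi]; rewrite (insubT (fun i => i < n) hi) /= inE.
Qed.

Lemma iota_all n (Q : pred nat) : reflect (forall u : 'I_n, Q u) (all Q (iota 0 n)).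
Proof.
apply: (iffP allP) => [h u|h i]; first by apply: h; rewrite mem_iota /=.
by rewrite mem_iota => /andP[_ hi]; exact: (h (Ordinal hi)).
Qed.

Lemma iota_has n (Q : pred nat) : reflect (exists u : 'I_n, Q u) (has Q (iota 0 n)).
Proof.
apply: (iffP hasP) => [[i]|[u h]]; last by exists (val u); rewrite ?mem_iota /=.
by rewrite mem_iota => /andP[_ hi] h; exists (Ordinal hi).
Qed.

Lemma numbers_sets n (e : rel {set 'I_n}) (st : rel nat) (X Y : {set 'I_n}) :
  (forall A B, st A B = e (setof n A) (setof n B)) ->
  (exists s, [/\ path st (numof X) s, last (numof X) s = numof Y & all (fun A => A < 2 ^ n) s]) <->
  (exists s, path e X s /\ last X s = Y).
Proof.
move=> h; split=> [[s [h1 h2 _]]|[s [h1 h2]]].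
  exists (map (@setof n) s); rewrite -[X]numofK path_map last_map h2 !numofK; split=> //.
  by rewrite -(eq_path (e := st)) // => A B; rewrite /= h.
exists (map (@numof n) s); rewrite path_map last_map h2; split=> //.
  by rewrite (eq_path (e' := e)) // => A B; rewrite /= h !numofK.
by apply/allP => A /mapP[Z _ ->]; exact: numof_lt.
Qed.

Lemma reconf_path (T : finType) (adjacent : rel {set T}) (ok : {set T} -> Prop) (okb : pred {set T}) X Y :
  (forall Z, ok Z <-> okb Z) ->
  reconfigurable adjacent ok X Y <-> okb X /\ exists s, path (fun A B => okb B && adjacent A B) X s /\ last X s = Y.
Proof.
move=> h.
have H A s : path (fun A B => okb B && adjacent A B) A s = path adjacent A s && all okb s.
  by elim: s A => //= B s IH A; rewrite IH; case: (okb B); case: (adjacent A B); rewrite /= ?andbF.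
split=> [[s [h1 h2 h3]]|[hX [s []]]].
  split; first by apply/h/h3; rewrite inE eqxx.
  by exists s; rewrite H h1; split=> //; apply/allP => Z hZ; apply/h/h3; rewrite inE hZ orbT.
rewrite H => /andP[h1 /allP h2] h3; exists s; split=> // Z; rewrite inE => /orP[/eqP ->|hZ]; first exact/h.
exact/h/h2.
Qed.

(** ** Feasibility *)

Section Dense.
Variables (T : finType) (G : sgraph T).

Definition min_degree2 (Y : {set T}) := [forall u in Y, [exists v in Y, [exists w in Y, [&& v != w, G u v & G u w]]]].

Lemma cycle_dense c : ucycle G c -> 2 < size c -> min_degree2 [set u in c].
Proof.
move=> /andP[hc hu] hs; apply/forall_inP => u; rewrite inE => /rot_to[i s e].
have hc' : cycle G (u :: s) by rewrite -e rot_cycle.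
have hu' : uniq (u :: s) by rewrite -e rot_uniq.
have hs' : 2 < size (u :: s) by rewrite -e size_rot.
have hm z : (z \in c) = (z \in u :: s) by rewrite -e mem_rot.
case: s hc' hu' hs' hm {e} => [|v [|w s]] // hc' hu' _ hm.
apply/exists_inP; exists v; first by rewrite inE hm !inE eqxx orbT.
apply/exists_inP; exists (last w s); first by rewrite inE hm -[[:: u, v, w & s]]/([:: u; v] ++ (w :: s)) mem_cat mem_last orbT.
move: hc' hu'; rewrite [cycle _ _]/= rcons_path => /and3P[-> _ /andP[_ h1]] /and3P[_ h2 _].
rewrite adj_sym h1 !andbT; apply: contraNneq h2 => ->; exact: mem_last.
Qed.

(** A path is prolonged at its head by a neighbour other than the next vertex of the path, which
    exists since there are two neighbours. If that neighbour is on the path, a cycle of length at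
    least three closes; otherwise the path grows, which must stop at [#|T|] vertices. *)
Lemma dense_cycle Y : min_degree2 Y -> Y != set0 -> exists c : seq T, [/\ {subset c <= Y}, 2 < size c & ucycle G c].
Proof.
move=> hY /set0Pn[x0 hx0].
have H k : (exists c : seq T, [/\ {subset c <= Y}, 2 < size c & ucycle G c]) \/
   (exists x s, [/\ size s = k, path G x s, uniq (x :: s) & {subset x :: s <= Y}]).
  elim: k => [|k [|[x [s [hk hp hu hs]]]]]; [|by left|].
    by right; exists x0, [::]; split=> // z; rewrite inE => /eqP ->.
  have hx : x \in Y by apply: hs; rewrite inE eqxx.
  have /exists_inP[v hv /exists_inP[w hw /and3P[vw xv xw]]] := forall_inP hY x hx.
  have [z [hz xz zy]] : exists z, [/\ z \in Y, G x z & forall y s', s = y :: s' -> z != y].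
    case: s {hk hp hu hs} => [|y s]; first by exists v.
    have [e|n] := eqVneq v y; last by exists v; split=> // y' s' [<- _].
    by exists w; split=> // y' s' [<- _]; rewrite -e eq_sym.
  have zx : z != x by apply: contraTneq xz => ->; rewrite adj_irr.
  case: (boolP (z \in s)) => [zs|nzs]; last first.
    right; exists z, (x :: s); rewrite /= hk adj_sym xz hp inE (negPf zx) nzs; split=> // t.
    by rewrite inE => /orP[/eqP ->|/hs].
  left; case: s hp hu hs zs zy {hk} => // y s hp hu hs.
  rewrite inE => /orP[/eqP -> /(_ y s erefl)|zs _]; first by rewrite eqxx.
  move: hp hu hs; case/splitPr: zs => p1 p2; rewrite -cat_rcons => hp hu hs.
  exists [:: x, y & rcons p1 z]; split=> //.
  - by move=> t ht; apply: hs; rewrite !inE mem_cat; move: ht; rewrite !inE => /or3P[] ->; rewrite ?orbT.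
  - by rewrite /= size_rcons.
  apply/andP; split; last first.
    by move: hu; rewrite -[[:: x, y & rcons p1 z ++ p2]]/([:: x, y & rcons p1 z] ++ p2) cat_uniq => /andP[].
  move: hp => /=; rewrite cat_path => /and3P[h1 h2 _].
  by rewrite rcons_path last_rcons h1 h2 adj_sym xz.
case: (H #|T|) => // -[x [s [hk _ /card_uniqP hu _]]].
by have := max_card (mem (x :: s)); rewrite hu /= hk ltnn.
Qed.

(** This replaces the search for a cycle by a search for a set of vertices, and sets are numbers
    below [2 ^ n]. *)
Lemma forest_dense Z : induces_forest G Z <-> forall Y : {set T}, Y \subset Z -> min_degree2 Y -> Y = set0.
Proof.
split=> [h Y hYZ hY|h [c [h1 h2 h3]]].
  apply/eqP/negPn/negP => /(dense_cycle hY)[c [h1 h2 h3]]; apply: h; exists c; split=> // z /h1; exact: subsetP.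
have := h [set u in c]; rewrite cycle_dense // => /(_ _ isT) e.
case: c h1 h2 h3 e => // u c h1 _ _ e; have : u \in [set z in u :: c] by rewrite inE inE eqxx.
by rewrite e ?inE //; apply/subsetP => z; rewrite inE; apply: h1.
Qed.

End Dense.

Section Feasible.
Variables (n N : nat) (G : sgraph 'I_n) (a : rel nat) (bit : nat -> nat -> bool).
Hypotheses (hN : N = 2 ^ n) (ha : forall u v : 'I_n, a u v = G u v) (hb : forall A (u : 'I_n), bit A u = odd (A %/ 2 ^ u)).

Definition independentb (m : pred nat) :=
  all (fun u => all (fun v => m u && m v ==> ~~ a u v) (iota 0 n)) (iota 0 n).
Definition forestb (m : pred nat) := ~~ has (fun M => has (fun u => bit M u) (iota 0 n) &&
  all (fun u => bit M u ==> (m u && has (fun v => has (fun w => [&& v != w, bit M v, bit M w, a u v & a u w]) (iota 0 n)) (iota 0 n)))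
   (iota 0 n)) (iota 0 N).
Definition bipartiteb (m : pred nat) := has (fun M =>
  all (fun u => all (fun v => [&& m u, m v & a u v] ==> (bit M u != bit M v)) (iota 0 n)) (iota 0 n)) (iota 0 N).

Variables (m : pred nat) (Z : {set 'I_n}).
Hypothesis hm : forall u : 'I_n, m u = (u \in Z).

Lemma independentbP : independent G Z <-> independentb m.
Proof.
split=> [h|/iota_all h u v hu hv].
  by apply/iota_all => u; apply/iota_all => v; rewrite !hm ha; apply/implyP => /andP[]; apply: h.
by move/iota_all: (h u) => /(_ v); rewrite !hm ha hu hv.
Qed.

Lemma bipartitebP : induces_bipartite G Z <-> bipartiteb m.
Proof.
split=> [[col h]|/hasP[M _ /iota_all h]].
  apply/hasP; exists (numof [set u | col u]); first by rewrite mem_iota /= hN numof_lt.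
  apply/iota_all => u; apply/iota_all => v; rewrite !hm ha !hb !numof_bit !inE.
  by apply/implyP => /and3P[]; apply: h.
exists (fun u : 'I_n => bit M u) => u v hu hv huv; move/iota_all: (h u) => /(_ v).
by rewrite !hm ha hu hv huv.
Qed.

Lemma forestbP : induces_forest G Z <-> forestb m.
Proof.
rewrite forest_dense; split=> [h|/hasPn h Y hY hd].
  apply/hasPn => M _; apply/negP => /andP[/iota_has[u0 h0] /iota_all hd].
  have e (u : 'I_n) : bit M u = (u \in setof n M) by rewrite inE hb.
  have : setof n M = set0.
    apply: h; first by apply/subsetP => u; rewrite -e => hu; have := hd u; rewrite hu hm => /andP[].
    apply/forall_inP => u; rewrite -e => hu; have := hd u; rewrite hu => /andP[_ /iota_has[v /iota_has[w]]].
    rewrite !e !ha => /and5P[vw hv hw h1 h2]; apply/exists_inP; exists v => //; apply/exists_inP; exists w => //.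
    by rewrite h1 h2 vw.
  by move/setP/(_ u0); rewrite -e h0 inE.
apply/eqP/negPn/negP => /set0Pn[u0 hu0]; have := h (numof Y); rewrite mem_iota /= hN numof_lt => /(_ isT).
have e (u : 'I_n) : bit (numof Y) u = (u \in Y) by rewrite hb numof_bit.
rewrite negb_and => /orP[/iota_has[]|/negP[]]; first by exists u0; rewrite e.
apply/iota_all => u; rewrite e; apply/implyP => hu; rewrite hm (subsetP hY) //=.
have /exists_inP[v hv /exists_inP[w hw /and3P[vw uv uw]]] := forall_inP hd u hu.
by apply/iota_has; exists v; apply/iota_has; exists w; rewrite !e hv hw !ha uv uw andbT /= andbT.
Qed.

End Feasible.

Definition feasibleb (P : vertex_problem) n N a bit (m : pred nat) :=
  match P with
  | IndependentSet | VertexCover => independentb n a m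
  | FeedbackVertexSet | InducedForest => forestb n N a bit m
  | OddCycleTransversal | InducedBipartite => bipartiteb n N a bit m
  end.

Lemma feasiblebP P n (G : sgraph 'I_n) (a : rel nat) (bit : nat -> nat -> bool) (m : pred nat) (X : {set 'I_n}) :
  (forall u v : 'I_n, a u v = G u v) -> (forall A (u : 'I_n), bit A u = odd (A %/ 2 ^ u)) ->
  (forall u : 'I_n, m u = (u \in X)) ->
  feasible P G X <-> feasibleb P n (2 ^ n) a bit (fun i => m i (+) small P).
Proof.
move=> ha hb hm.
have h1 (u : 'I_n) : m u (+) true = (u \in ~: X) by rewrite addbT inE hm.
have h0 (u : 'I_n) : m u (+) false = (u \in X) by rewrite addbF hm.
case: P; rewrite /feasible /feasibleb /small.
- exact: (independentbP ha h0).
- rewrite -(independentbP ha h1); split=> h u v; first by rewrite !inE => hu hv; apply: contra hu => /h; rewrite (negPf hv) orbF.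
  by move=> huv; apply/negPn; rewrite negb_or; apply/negP => /andP[hu hv]; have := h u v; rewrite !inE hu hv huv => /(_ isT isT).
- exact: (forestbP erefl ha hb h1). - exact: (forestbP erefl ha hb h0).
- exact: (bipartitebP erefl ha hb h1). - exact: (bipartitebP erefl ha hb h0).
Qed.

(** ** Single steps *)

Variant mode := Tar | Tj | Ts.

Definition stepb (o : mode) n (a : rel nat) (x y : pred nat) :=
  match o with
  | Tar => has (fun v => all (fun i => y i == (if i == v then ~~ x i else x i)) (iota 0 n)) (iota 0 n)
  | _ => has (fun u => has (fun v => [&& x u, ~~ x v, (if o is Ts then a u v else true) &
      all (fun i => y i == (i == v) || (i != u) && x i) (iota 0 n)]) (iota 0 n)) (iota 0 n)
  end.

Definition mode_step (o : mode) n (G : sgraph 'I_n) : rel {set 'I_n} :=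
  match o with Tar => @TAR_step _ | Tj => @TJ_step _ | Ts => TS_step G end.

Lemma stepbE o n (G : sgraph 'I_n) (a : rel nat) (x y : pred nat) (X Y : {set 'I_n}) :
  (forall u v : 'I_n, a u v = G u v) -> (forall u : 'I_n, x u = (u \in X)) -> (forall u : 'I_n, y u = (u \in Y)) ->
  stepb o n a x y = mode_step o G X Y.
Proof.
move=> ha hx hy.
have H u v : all (fun i => y i == (i == val v) || (i != val u) && x i) (iota 0 n) = (Y == v |: (X :\ u)).
  apply/iota_all/eqP => [h|e i]; last by rewrite hx hy e !inE.
  by apply/setP => i; have := h i; rewrite hx hy !inE => /eqP.
have K v : all (fun i => y i == (if i == val v then ~~ x i else x i)) (iota 0 n) =
   (v \notin X) && (Y == v |: X) || (v \in X) && (Y == X :\ v).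
  apply/iota_all/orP => [h|].
    case: (boolP (v \in X)) => hv; [right|left]; apply/eqP/setP => i; have := h i; rewrite hx hy !inE -val_eqE => /eqP ->;
    by case: (val i =P val v) => //= /val_inj ->; rewrite hv.
  case=> /andP[hv /eqP e] i; rewrite hx hy e !inE -val_eqE; by case: (val i =P val v) => //= /val_inj ->; rewrite ?hv ?(negPf hv).
case: o; rewrite /stepb /mode_step.
- by apply/iota_has/existsP => -[v h]; exists v; move: h; rewrite K.
- apply/iota_has/existsP => -[u h]; exists u; [move: h => /iota_has[v h]; apply/existsP|move: h => /existsP[v h]; apply/iota_has];
  by exists v; move: h; rewrite !hx H.
- apply/iota_has/existsP => -[u h]; exists u; [move: h => /iota_has[v h]; apply/existsP|move: h => /existsP[v h]; apply/iota_has];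
  by exists v; move: h; rewrite !hx H ha.
Qed.

(** * Membership *)

Definition xb (x : seq bool) i := nth false x i.
Definition xadj x n u v := xb x (n + 1 + (u * n + v)).
Definition xsrc x n i := xb x (n + 1 + n * n + i).
Definition xtgt x n i := xb x (n + 1 + (n * n + n) + i).
(** Throughout, [C] is the number that encodes the input. It caps the powers of two, which keeps
    their values within the function algebra, and it is large enough for those that occur to be
    exact. *)
Definition bitp C A i := odd (A %/ pw C i).
Definition weight C n A := \sum_(0 <= i < n) bitp C A i.

Definition okp (P : vertex_problem) (o : mode) x n C k g A :=
  feasibleb P n (pw C n) (xadj x n) (bitp C) (fun i => bitp C A i (+) small P) &&
  (if o is Tar then (if small P then (g == 0) && (weight C n A <= k) else (g == 1) || (k <= weight C n A)) else true).
Definition nearp P o x n C k g A B := (A == B) || okp P o x n C k g B && stepb o n (xadj x n) (bitp C A) (bitp C B).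

Definition srcp x n C := \sum_(0 <= i < n) xsrc x n i * pw C i.
Definition tgtp x n C := \sum_(0 <= i < n) xtgt x n i * pw C i.

(** The left component of [halves] as an iteration: the most significant level comes first and later
    levels overwrite its midpoint. *)
Definition lefts n C S c := recn S (fun i a => if odd (c %/ pw C (n.+1 * (n - 1 - i))) then c %/ pw C (n.+1 * (n - 1 - i)) %% pw C n.+1 %/ 2 else a) n.
Definition rights n C T c := recn T (fun i a => if odd (c %/ pw C (n.+1 * (n - 1 - i))) then a else c %/ pw C (n.+1 * (n - 1 - i)) %% pw C n.+1 %/ 2) n.
Definition leafp P o x n C k g c := nearp P o x n C k g (lefts n C (srcp x n C) c) (rights n C (tgtp x n C) c).

Definition turnp P o x n C k g c := \sum_(0 <= i < n * n.+1)
  all (fun j => ~~ (~~ odd (c %/ pw C j) && (leafp P o x n C k g c != quant n j))) (iota 0 i.+1).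
Definition climbp P o x n C k g c := let j := turnp P o x n C k g c in
  if (j < n * n.+1) && ((c %/ pw C j).+1 * pw C j < pw C (n * n.+1)) then (c %/ pw C j).+1 * pw C j else c.
Definition lastp P o x n C k g := recn 0 (fun _ c => climbp P o x n C k g c) (pw C (n * n.+1)).

(** Only encodings of instances belong to the language, so the feasibility of both given sets is
    part of the test. *)
Definition acceptp P o x n C k g := [&& okp P o x n C k g (srcp x n C), okp P o x n C k g (tgtp x n C)
  & leafp P o x n C k g (lastp P o x n C k g)].

Definition blen n := n + 1 + (n * n + (n + n)).
Definition logp k := \sum_(0 <= i < k) (pw k i.+1 <= k).
Definition shapep x n := [&& blen n <= size x, all (fun i => xb x i == (i < n)) (iota 0 n.+1),
  all (fun u => all (fun v => xadj x n u v == xadj x n v u) (iota 0 n)) (iota 0 n) & all (fun u => ~~ xadj x n u u) (iota 0 n)].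
(** Here [g] is the sign and [k] the absolute value of the threshold; the condition [0 < k] for
    negative signs excludes a second encoding of zero. *)
Definition tailp (o : mode) x n k g := match o with
  | Tar => [&& size x == blen n + (1 + (logp k).+1), xb x (blen n) == (g == 1), (g == 1) ==> (0 < k) &
     all (fun i => xb x (blen n + 1 + i) == odd (k %/ pw k i)) (iota 0 (logp k).+1)]
  | _ => (size x == blen n) && (\sum_(0 <= i < n) xsrc x n i == \sum_(0 <= i < n) xtgt x n i)
  end.
(** The order, the threshold and the sign are found by exhaustive search and compared with the
    input, which avoids a separate parser. *)
Definition langp P o x C := has (fun n => has (fun k => has (fun g =>
  [&& shapep x n, tailp o x n k g & acceptp P o x n C k g]) (iota 0 2)) (iota 0 (if o is Tar then C.+1 else 1))) (iota 0 (size x).+1).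

Lemma E2b_addb P Q : E2b P -> E2b Q -> E2b (fun x s => P x s (+) Q x s).
Proof. by move=> hP hQ; apply: (E2b_ext (E2b_not (E2b_eqb hP hQ))) => x s; case: (P x s); case: (Q x s). Qed.

Lemma E2b_xb f : E2 f -> E2b (fun x s => xb x (f x s)).
Proof.
move=> hf; apply: (E2b_ext (E2b_eqn (E2_inp hf) (E2_const 2))) => x s; rewrite inpE /xb; case: ltnP => h.
  by case: (nth _ _ _).
by rewrite nth_default.
Qed.

Lemma E2b_xadj fn f g : E2 fn -> E2 f -> E2 g -> E2b (fun x s => xadj x (fn x s) (f x s) (g x s)).
Proof. by move=> *; apply: E2b_xb; e2. Qed.
Lemma E2b_xsrc fn f : E2 fn -> E2 f -> E2b (fun x s => xsrc x (fn x s) (f x s)).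
Proof. by move=> *; apply: E2b_xb; e2. Qed.
Lemma E2b_xtgt fn f : E2 fn -> E2 f -> E2b (fun x s => xtgt x (fn x s) (f x s)).
Proof. by move=> *; apply: E2b_xb; e2. Qed.
Lemma E2b_bitp fC f g : E2 fC -> E2 f -> E2 g -> E2b (fun x s => bitp (fC x s) (f x s) (g x s)).
Proof. by move=> h1 h2 h3; rewrite /bitp; have h := E2_pw h1 h3; e2. Qed.

Ltac e2_behead := lazymatch goal with
  | |- E2 (fun x s => ?f x (behead (behead s))) => refine (@E2_behead (fun x s => f x (behead s)) _)
  | |- E2 (fun x s => ?f x (behead (behead (behead s)))) => refine (@E2_behead (fun x s => f x (behead (behead s))) _)
  | |- E2 (fun x s => ?f x (behead (behead (behead (behead s))))) => refine (@E2_behead (fun x s => f x (behead (behead (behead s)))) _)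
  | |- E2b (fun x s => ?f x (behead (behead s))) => refine (@E2_behead (fun x s => nat_of_bool (f x (behead s))) _)
  | |- E2 (fun x s => nth 0 (behead (behead (behead s))) ?i) => apply: (@E2_var3 i)
  end.
Ltac e2_user ::= first [e2_behead | simple apply E2b_xb | simple apply E2b_xadj | simple apply E2b_xsrc | simple apply E2b_xtgt
  | simple apply E2b_bitp | simple apply E2_pw | simple apply E2b_addb | simple apply E2b_eqb].

Lemma E2_weight fC fn f : E2 fC -> E2 fn -> E2 f -> E2 (fun x s => weight (fC x s) (fn x s) (f x s)).
Proof.
move=> h1 h2 h3; apply: (@E2_sum _ (fun x i s => (bitp (fC x s) (f x s) i : nat))) => //.
by e2.
Qed.

Lemma E2b_feasp P fn fC fA : E2 fn -> E2 fC -> E2 fA -> E2b (fun x s =>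
  feasibleb P (fn x s) (pw (fC x s) (fn x s)) (xadj x (fn x s)) (bitp (fC x s)) (fun i => bitp (fC x s) (fA x s) i (+) small P)).
Proof.
move=> h1 h2 h3.
by case: P; rewrite /feasibleb /independentb /forestb /bipartiteb /small; e2.
Qed.

Lemma E2b_stepb o fn fC fA fB : E2 fn -> E2 fC -> E2 fA -> E2 fB -> E2b (fun x s =>
  stepb o (fn x s) (xadj x (fn x s)) (bitp (fC x s) (fA x s)) (bitp (fC x s) (fB x s))).
Proof. by move=> h1 h2 h3 h4; case: o; rewrite /stepb; e2. Qed.

Lemma E2b_okp P o fn fC fk fg fA : E2 fn -> E2 fC -> E2 fk -> E2 fg -> E2 fA ->
  E2b (fun x s => okp P o x (fn x s) (fC x s) (fk x s) (fg x s) (fA x s)).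
Proof.
move=> h1 h2 h3 h4 h5; have hf := E2b_feasp P h1 h2 h5; have hw := E2_weight h2 h1 h5.
by rewrite /okp; apply: E2b_and => //; case: o => //; [case: (small P)| |]; e2.
Qed.

Lemma E2b_nearp P o fn fC fk fg fA fB : E2 fn -> E2 fC -> E2 fk -> E2 fg -> E2 fA -> E2 fB ->
  E2b (fun x s => nearp P o x (fn x s) (fC x s) (fk x s) (fg x s) (fA x s) (fB x s)).
Proof.
move=> h1 h2 h3 h4 h5 h6; have ho := E2b_okp P o h1 h2 h3 h4 h6; have hs := E2b_stepb o h1 h2 h5 h6.
by rewrite /nearp; e2.
Qed.

Lemma E2_srcp fn fC : E2 fn -> E2 fC -> E2 (fun x s => srcp x (fn x s) (fC x s)).
Proof. by move=> h1 h2; apply: (@E2_sum _ (fun x i s => xsrc x (fn x s) i * pw (fC x s) i)) => //; e2. Qed.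
Lemma E2_tgtp fn fC : E2 fn -> E2 fC -> E2 (fun x s => tgtp x (fn x s) (fC x s)).
Proof. by move=> h1 h2; apply: (@E2_sum _ (fun x i s => xtgt x (fn x s) i * pw (fC x s) i)) => //; e2. Qed.

Lemma recn_le (h : nat -> nat -> nat) a b n : a <= b -> (forall i c, c <= b -> h i c <= b) -> recn a h n <= b.
Proof. by move=> ha hh; elim: n => //= n IH; apply: hh. Qed.

Lemma E2_lefts fn fC fS fc : E2 fn -> E2 fC -> E2 fS -> E2 fc -> E2 (fun x s => lefts (fn x s) (fC x s) (fS x s) (fc x s)).
Proof.
move=> h1 h2 h3 h4; apply: (@E2_recb (fun x s => fS x s + fc x s) _ _ (fun x i a s =>
  if odd (fc x s %/ pw (fC x s) ((fn x s).+1 * (fn x s - 1 - i))) then fc x s %/ pw (fC x s) ((fn x s).+1 * (fn x s - 1 - i)) %% pw (fC x s) (fn x s).+1 %/ 2 else a)) => //.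
- by e2.
- by e2.
move=> x s i _; apply: recn_le => [|j c hc]; first exact: leq_addr.
by case: odd => //; apply: leq_trans (leq_div _ _) _; apply: leq_trans (leq_mod _ _) _; apply: leq_trans (leq_div _ _) (leq_addl _ _).
Qed.

Lemma E2_rights fn fC fS fc : E2 fn -> E2 fC -> E2 fS -> E2 fc -> E2 (fun x s => rights (fn x s) (fC x s) (fS x s) (fc x s)).
Proof.
move=> h1 h2 h3 h4; apply: (@E2_recb (fun x s => fS x s + fc x s) _ _ (fun x i a s =>
  if odd (fc x s %/ pw (fC x s) ((fn x s).+1 * (fn x s - 1 - i))) then a else fc x s %/ pw (fC x s) ((fn x s).+1 * (fn x s - 1 - i)) %% pw (fC x s) (fn x s).+1 %/ 2)) => //.
- by e2.
- by e2.
move=> x s i _; apply: recn_le => [|j c hc]; first exact: leq_addr.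
by case: odd => //; apply: leq_trans (leq_div _ _) _; apply: leq_trans (leq_mod _ _) _; apply: leq_trans (leq_div _ _) (leq_addl _ _).
Qed.

Lemma E2b_leafp P o fn fC fk fg fc : E2 fn -> E2 fC -> E2 fk -> E2 fg -> E2 fc ->
  E2b (fun x s => leafp P o x (fn x s) (fC x s) (fk x s) (fg x s) (fc x s)).
Proof.
move=> h1 h2 h3 h4 h5; apply: E2b_nearp => //.
  by apply: E2_lefts => //; apply: E2_srcp.
by apply: E2_rights => //; apply: E2_tgtp.
Qed.

Lemma E2_turns (lf : seq bool -> seq nat -> bool) fn fC fc : E2b lf -> E2 fn -> E2 fC -> E2 fc ->
  E2 (fun x s => \sum_(0 <= i < fn x s * (fn x s).+1)
    all (fun j => ~~ (~~ odd (fc x s %/ pw (fC x s) j) && (lf x s != quant (fn x s) j))) (iota 0 i.+1)).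
Proof.
move=> hl h1 h2 h3.
apply: (@E2_sum _ (fun x i s => (all (fun j => ~~ (~~ odd (fc x s %/ pw (fC x s) j) && (lf x s != quant (fn x s) j))) (iota 0 i.+1) : nat))); first by e2.
have hl2 : E2b (fun x s => lf x (behead (behead s))) := E2_behead (E2_behead hl).
rewrite /quant; apply: (@E2b_all _ (fun x j s => ~~ (~~ odd (fc x (behead s) %/ pw (fC x (behead s)) j) && (lf x (behead s) != (j %% (fn x (behead s)).+1 != 0))))); first by e2.
by e2.
Qed.

Lemma E2_turnp P o fn fC fk fg fc : E2 fn -> E2 fC -> E2 fk -> E2 fg -> E2 fc ->
  E2 (fun x s => turnp P o x (fn x s) (fC x s) (fk x s) (fg x s) (fc x s)).
Proof. by move=> h1 h2 h3 h4 h5; apply: E2_turns (E2b_leafp P o h1 h2 h3 h4 h5) h1 h2 h5. Qed.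

Lemma E2_climbp P o fn fC fk fg fc : E2 fn -> E2 fC -> E2 fk -> E2 fg -> E2 fc ->
  E2 (fun x s => climbp P o x (fn x s) (fC x s) (fk x s) (fg x s) (fc x s)).
Proof.
by move=> h1 h2 h3 h4 h5; have ht := E2_turnp P o h1 h2 h3 h4 h5; rewrite /climbp; cbv zeta; e2.
Qed.

Lemma E2_lastp P o fn fC fk fg : E2 fn -> E2 fC -> E2 fk -> E2 fg ->
  E2 (fun x s => lastp P o x (fn x s) (fC x s) (fk x s) (fg x s)).
Proof.
move=> h1 h2 h3 h4; apply: (@E2_recb (fun x s => pw (fC x s) (fn x s * (fn x s).+1)) _ _ (fun x _ c s =>
  climbp P o x (fn x s) (fC x s) (fk x s) (fg x s) c)); try by e2.
- by apply: (@E2_climbp P o (fun x s => fn x (behead (behead s))) (fun x s => fC x (behead (behead s))) (fun x s => fk x (behead (behead s))) (fun x s => fg x (behead (behead s)))); e2.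
move=> x s i _; apply: recn_le => // j c hc; rewrite /climbp; cbv zeta.
by case: ifP => // /andP[_ /ltnW].
Qed.

Lemma E2b_acceptp P o fn fC fk fg : E2 fn -> E2 fC -> E2 fk -> E2 fg ->
  E2b (fun x s => acceptp P o x (fn x s) (fC x s) (fk x s) (fg x s)).
Proof.
move=> h1 h2 h3 h4; have hs := E2_srcp h1 h2; have ht := E2_tgtp h1 h2; have hl := E2_lastp P o h1 h2 h3 h4.
apply: E2b_and; first exact: E2b_okp.
by apply: E2b_and; [exact: E2b_okp|exact: E2b_leafp].
Qed.

Lemma E2b_shapep fn : E2 fn -> E2b (fun x s => shapep x (fn x s)).
Proof. by move=> h; rewrite /shapep /blen; e2. Qed.

Lemma E2b_tailp o fn fk fg : E2 fn -> E2 fk -> E2 fg -> E2b (fun x s => tailp o x (fn x s) (fk x s) (fg x s)).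
Proof.
move=> h1 h2 h3.
have hl : E2 (fun x s => logp (fk x s)).
  by apply: (@E2_sum _ (fun x i s => (pw (fk x s) i.+1 <= fk x s : nat))) => //; e2.
have hs : E2 (fun x s => \sum_(0 <= i < fn x s) xsrc x (fn x s) i).
  by apply: (@E2_sum _ (fun x i s => (xsrc x (fn x s) i : nat))) => //; e2.
have ht : E2 (fun x s => \sum_(0 <= i < fn x s) xtgt x (fn x s) i).
  by apply: (@E2_sum _ (fun x i s => (xtgt x (fn x s) i : nat))) => //; e2.
by case: o; rewrite /tailp /blen; e2.
Qed.

Lemma E2b_langp P o : E2b (fun x s => langp P o x (nth 0 s 0)).
Proof.
rewrite /langp; have hsz : E2 (fun x s => (size x).+1) by e2.
have hC := E2_var 0; have hC1 : E2 (fun x s => if o is Tar then (nth 0 s 0).+1 else 1) by case: o; e2.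
apply: (@E2b_has _ (fun x n s => has (fun k => has (fun g => [&& shapep x n, tailp o x n k g & acceptp P o x n (nth 0 s 0) k g]) (iota 0 2)) (iota 0 (if o is Tar then (nth 0 s 0).+1 else 1)))) => //.
apply: (@E2b_has _ (fun x k s => has (fun g => [&& shapep x (nth 0 s 0), tailp o x (nth 0 s 0) k g & acceptp P o x (nth 0 s 0) (nth 0 (behead s) 0) k g]) (iota 0 2))); first exact: (E2_behead hC1).
apply: (@E2b_has _ (fun x g s => [&& shapep x (nth 0 (behead s) 0), tailp o x (nth 0 (behead s) 0) (nth 0 s 0) g & acceptp P o x (nth 0 (behead s) 0) (nth 0 (behead (behead s)) 0) (nth 0 s 0) g])); first by e2.
apply: E2b_and; first by apply: (@E2b_shapep (fun x s => nth 0 (behead (behead s)) 0)); e2.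
have v0 := E2_var 0; have v1 := E2_var1 0; have v2 := E2_var2 0; have v3 := E2_var3 0.
by apply: E2b_and; [exact: (E2b_tailp o v2 v1 v0)|exact: (E2b_acceptp P o v2 v3 v1 v0)].
Qed.

From mathcomp Require Import all_classical all_reals all_analysis.

(** * Compilation of stack programs to Turing machines *)

Section Compile.

Definition tcell := cell void.
Definition enc (b : bool) : tcell := Some (inl b).
Definition dec (a : tcell) : option bool := if a is Some (inl b) then Some b else None.

Definition action := option (nat * tcell * direction)%type.

Fixpoint st (c : cmd) : finType :=
  match c with
  | Push _ _ => bool
  | Seq a b => (st a + st b)%type
  | If _ _ a b => option (st a + st b)%type
  | While _ _ a => option (st a)
  | _ => unit
  end.

Fixpoint ent (c : cmd) : st c :=
  match c with
  | Push _ _ => false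
  | Seq a b => inl (ent a)
  | If _ _ a b => None
  | While _ _ a => None
  | _ => tt
  end.

(** [None] as a successor state means that the command is finished. *)
Fixpoint nxt (c : cmd) : st c -> (nat -> tcell) -> option (st c) * action :=
  match c return st c -> (nat -> tcell) -> option (st c) * action with
  | Skip => fun _ _ => (None, None)
  | Push r b => fun q v =>
      if q then (None, Some (r, enc b, Stay)) else (Some true, Some (r, v r, MoveLeft))
  | Pop r => fun _ _ => (None, Some (r, None, MoveRight))
  | Seq a b => fun q v =>
      match q with
      | inl q => let: (q', x) := nxt q v in
                 (Some (if q' is Some q'' then inl q'' else inr (ent b)), x)
      | inr q => let: (q', x) := nxt q v in (omap inr q', x)
      end
  | If r P a b => fun q v =>
      match q with
      | None => (Some (Some (if P (dec (v r)) then inl (ent a) else inr (ent b))), None)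
      | Some (inl q) => let: (q', x) := nxt q v in (omap (fun y => Some (inl y)) q', x)
      | Some (inr q) => let: (q', x) := nxt q v in (omap (fun y => Some (inr y)) q', x)
      end
  | While r P a => fun q v =>
      match q with
      | None => (if P (dec (v r)) then Some (Some (ent a)) else None, None)
      | Some q => let: (q', x) := nxt q v in (Some q', x)
      end
  end.

Definition tps := nat -> tape tcell.
Definition scan (T : tps) r := scanned (T r).
Definition act (x : action) (T : tps) : tps :=
  if x is Some (r, w, d) then upd T r (write_move None w d (T r)) else T.

Definition oksz B (T : tps) := forall r, tape_size (T r) <= B.+1.

Inductive runs B c : st c -> tps -> nat -> tps -> Prop :=
  | runs_exit q T x : nxt q (scan T) = (None, x) -> oksz B (act x T) ->
      runs B q T 1 (act x T)
  | runs_step q q' T T' x n : nxt q (scan T) = (Some q', x) ->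
      oksz B (act x T) -> runs B q' (act x T) n T' -> runs B q T n.+1 T'.

Lemma runs_seq2 B a b (q : st b) T n T' :
  runs B q T n T' -> @runs B (Seq a b) (inr q) T n T'.
Proof.
elim=> {q T n T'} [q T x e ok|q q' T T' x n e ok _ IH].
  by apply: runs_exit => //=; rewrite e.
by apply: (@runs_step B (Seq a b) _ (inr q')) => //=; rewrite e.
Qed.

Lemma runs_seq1 B a b (q : st a) T n T' m T'' :
  runs B q T n T' -> runs B (ent b) T' m T'' ->
  @runs B (Seq a b) (inl q) T (n + m) T''.
Proof.
move=> h; elim: h m T'' => {q T n T'} [q T x e ok|q q' T T' x n e ok _ IH] m T'' h.
  by apply: (@runs_step B (Seq a b) _ (inr (ent b))) (runs_seq2 a h) => //=; rewrite e.
by rewrite addSn; apply: (@runs_step B (Seq a b) _ (inl q')) (IH _ _ h) => //=; rewrite e.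
Qed.

Lemma runs_if1 B r P a b (q : st a) T n T' :
  runs B q T n T' -> @runs B (If r P a b) (Some (inl q)) T n T'.
Proof.
elim=> {q T n T'} [q T x e ok|q q' T T' x n e ok _ IH].
  by apply: runs_exit => //=; rewrite e.
by apply: (@runs_step B (If r P a b) _ (Some (inl q'))) => //=; rewrite e.
Qed.

Lemma runs_if2 B r P a b (q : st b) T n T' :
  runs B q T n T' -> @runs B (If r P a b) (Some (inr q)) T n T'.
Proof.
elim=> {q T n T'} [q T x e ok|q q' T T' x n e ok _ IH].
  by apply: runs_exit => //=; rewrite e.
by apply: (@runs_step B (If r P a b) _ (Some (inr q'))) => //=; rewrite e.
Qed.

Lemma runs_while B r P a (q : st a) T n T' m T'' :
  runs B q T n T' -> @runs B (While r P a) None T' m T'' ->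
  @runs B (While r P a) (Some q) T (n + m) T''.
Proof.
move=> h; elim: h m T'' => {q T n T'} [q T x e ok|q q' T T' x n e ok _ IH] m T'' h.
  by apply: runs_step ok h => /=; rewrite e.
by rewrite addSn; apply: runs_step ok (IH _ _ h) => /=; rewrite e.
Qed.

(** The head scans the top of the stack, which grows to the left. Popping leaves a blank behind on
    the left, which the next push reuses, so the tape never needs more than one cell beyond the
    height of the stack. *)
Definition models B (t : tape tcell) (s : seq bool) :=
  exists a b, [/\ before t = nseq a None,
    scanned t :: after t = map enc s ++ nseq b None, a + size s <= B & b <= 1].

Definition reps B (T : tps) (s : stacks) := forall r, models B (T r) (s r).

Lemma rep_size B t s : models B t s -> tape_size t <= B.+1.
Proof.
move=> [a [b [h1 h2 h3 h4]]]; rewrite /tape_size h1 size_nseq.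
by move/(congr1 size): h2; rewrite /= size_cat size_map size_nseq; lia.
Qed.

Lemma reps_ok B T s : reps B T s -> oksz B T.
Proof. by move=> h r; apply: rep_size (h r). Qed.

Lemma rep_top B t s : models B t s -> dec (scanned t) = ohead s.
Proof. by move=> [a [[|[|b]] [_ + _ _]]] //; case: s => [|? ?] //= [->]. Qed.

Lemma reps_upd B T s r t l : reps B T s -> models B t l -> reps B (upd T r t) (upd s r l).
Proof. by move=> h1 h2 i; rewrite /upd; case: eqP. Qed.

Lemma rep_pop B t b l : models B t (b :: l) -> models B (write_move None None MoveRight t) l.
Proof.
move=> [a [k [h1 [h2 h3] h4 h5]]]; rewrite /write_move.
case E: (after t) => [|x r] /=.
  exists a.+1, 1; rewrite h1 /=; move: h3 h4; rewrite E; case: l => [|? ?] //=.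
  by split=> //; lia.
by exists a.+1, k; rewrite h1 -E /= h3; split=> //; move: h4 => /=; lia.
Qed.

Lemma rep_push B t b l : models B t l -> size l < B ->
  let t1 := write_move None (scanned t) MoveLeft t in
  tape_size t1 <= B.+1 /\ models B (write_move None (enc b) Stay t1) (b :: l).
Proof.
move=> [[|a] [k [h1 h2 h3 h4]]] h5; rewrite /write_move h1 /=; split.
- by move/(congr1 size): h2; rewrite /tape_size /= size_cat size_map size_nseq; lia.
- by exists 0, k; split=> //=; rewrite h2.
- move/(congr1 size): h2; rewrite /tape_size /= size_cat size_map !size_nseq; lia.
- by exists a, k; split=> //=; rewrite ?h2 //; lia.
Qed.

Lemma exec_runs B c s s' t T : exec B c s s' t -> reps B T s ->
  exists2 T', runs B (ent c) T t T' & reps B T' s'.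
Proof.
move=> h; elim: h T => {c s s' t} [s|s r b hs|s r b l hs|c1 c2 s1 s2 s3 t1 t2 _ IH1 _ IH2
  |r P c1 c2 s s' t hP _ IH|r P c1 c2 s s' t hP _ IH|r P c s hP
  |r P c s s' s'' t t' hP _ IH1 _ IH2] T hT /=.
- by exists T => //; apply: (@runs_exit _ Skip tt T None) => //; apply: reps_ok hT.
- have [h1 h2] := rep_push b (hT r) hs.
  set t1 := write_move None _ MoveLeft _ in h1 h2.
  exists (upd (upd T r t1) r (write_move None (enc b) Stay t1)).
    apply: (@runs_step _ (Push r b) false true _ _ (Some (r, scan T r, MoveLeft))) => //.
      by move=> i; rewrite /= /upd; case: eqP => // _; apply: reps_ok hT i.
    have := @runs_exit B (Push r b) true (upd T r t1) (Some (r, enc b, Stay)) erefl.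
    rewrite /= upd_same; apply=> i; rewrite /upd; case: eqP => _; first exact: rep_size h2.
    by apply: reps_ok hT i.
  by rewrite upd_upd; apply: reps_upd.
- have h := hT r; rewrite hs in h.
  have h' : reps B (upd T r (write_move None None MoveRight (T r))) (upd s r l).
    by apply: reps_upd hT (rep_pop h).
  by eexists; [apply: (@runs_exit _ (Pop r) tt) => //; apply: reps_ok h'|].
- have [T' h1 /IH2[T'' h2 h3]] := IH1 _ hT.
  by exists T'' => //; apply: runs_seq1 h1 h2.
- have [T' h1 h2] := IH _ hT; exists T' => //.
  apply: (@runs_step _ (If r P c1 c2) _ _ _ _ None); last exact: runs_if1 h1.
    by rewrite /= (rep_top (hT r)) hP.
  exact: reps_ok hT.
- have [T' h1 h2] := IH _ hT; exists T' => //.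
  apply: (@runs_step _ (If r P c1 c2) _ _ _ _ None); last exact: runs_if2 h1.
    by rewrite /= (rep_top (hT r)) (negPf hP).
  exact: reps_ok hT.
- exists T => //; apply: (@runs_exit _ (While r P c) None T None).
    by rewrite /= (rep_top (hT r)) (negPf hP).
  exact: reps_ok hT.
- have [T' h1 /IH2[T'' h2 h3]] := IH1 _ hT; exists T'' => //.
  apply: (@runs_step _ (While r P c) _ _ _ _ None); last exact: runs_while h1 h2.
    by rewrite /= (rep_top (hT r)) hP.
  exact: reps_ok hT.
Qed.

(** The machine runs [c], then accepts iff stack [ra] is nonempty. *)
Variables (c : cmd) (ra K : nat).

Definition mstate := (st c + option bool)%type.

Definition mdelta (q : mstate) (v : {ffun 'I_K.+1 -> tcell}) :
    mstate * {ffun 'I_K.+1 -> tcell * direction} :=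
  let w r := v (inord r) in
  let: (q', x) := match q with
    | inl q => let: (q', x) := nxt q w in (if q' is Some q' then inl q' else inr None, x)
    | _ => (inr (Some (isSome (dec (w ra)))), None) end in
  (q', [ffun i : 'I_K.+1 => if x is Some (r, a, d) then if i == r :> nat then (a, d) else (v i, Stay)
                  else (v i, Stay)]).

Definition mach : machine :=
  @Machine K mstate void (inl (ent c)) (fun q => if q is inr (Some _) then true else false)
    (fun q => if q is inr (Some b) then b else false) mdelta.

Definition mcfg (q : mstate) (T : tps) : config mach :=
  @Config mach q (fun i : 'I_K.+1 => T i).

Lemma nxt_ext c' (q : st c') v v' : (forall r, r <= regs c' -> v r = v' r) ->
  nxt q v = nxt q v'.
Proof.
elim: c' q => [|p b|p|a IHa b IHb|p P a IHa b IHb|p P a IHa] //= q h.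
- by rewrite h.
- by case: q => q; rewrite ?(IHa q) ?(IHb q) // => r hr; apply: h; rewrite leq_max hr ?orbT.
- case: q => [[q|q]|]; rewrite ?(IHa q) ?(IHb q) ?h ?leq_maxl // => r hr.
    by apply: h; rewrite !leq_max hr ?orbT.
  by apply: h; rewrite !leq_max hr ?orbT.
- case: q => [q|]; rewrite ?(IHa q) ?h ?leq_maxl // => r hr.
  by apply: h; rewrite !leq_max hr ?orbT.
Qed.

Lemma mstep_run (q : st c) T q' x : regs c <= K -> nxt q (scan T) = (q', x) ->
  step (mcfg (inl q) T) = mcfg (if q' is Some q' then inl q' else inr None) (act x T).
Proof.
move=> hK e; rewrite /step /= /mdelta.
set v := finfun _; have -> : nxt q (fun r => v (inord r)) = nxt q (scan T).
  by apply: nxt_ext => r hr; rewrite ffunE inordK // ltnS (leq_trans hr).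
rewrite e /mcfg; congr Config; apply: functional_extensionality => i.
rewrite ffunE; case: x e => [[[r a] d]|] e /=; last by rewrite ffunE; case: (T i).
by rewrite /upd; case: eqP => [->//|_]; rewrite ffunE; case: (T i).
Qed.

Lemma runs_iter B (q : st c) T n T' : regs c <= K -> oksz B T -> runs B q T n T' ->
  (forall j, j <= n -> exists q1 T1, iter j (@step mach) (mcfg (inl q) T) = mcfg q1 T1 /\ oksz B T1)
  /\ iter n (@step mach) (mcfg (inl q) T) = mcfg (inr None) T' /\ oksz B T'.
Proof.
move=> hK hT h; elim: h hT => {q T n T'} [q T x e ok|q q' T T' x n e ok _ IH] hT.
  have E := mstep_run hK e; split=> [[|[|j]] // _|]; last by rewrite /= E.
    by exists (inl q), T.
  by exists (inr None), (act x T); rewrite /= E.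
have E := mstep_run hK e; have [IH1 IH2] := IH ok.
split=> [[|j] hj|]; first by exists (inl q), T.
  by rewrite iterSr E; apply: IH1.
by rewrite iterSr E.
Qed.

Definition stk0 (x : seq bool) : stacks := upd (fun _ => [::]) 0 x.

Lemma oksz_space B q T : oksz B T -> space_used (mcfg q T) <= K.+1 * B.+1.
Proof.
move=> ok; apply: (@leq_trans (\sum_(i < K.+1) B.+1)); last by rewrite sum_nat_const card_ord.
by apply: leq_sum => i _; apply: ok.
Qed.

Lemma mach_correct B x s' t : regs c <= K -> ra <= K -> size x <= B ->
  exec B c (stk0 x) s' t ->
  [/\ forall j, space_used (run mach j x) <= K.+1 * B.+1,
      forall j, t < j -> halted (run mach j x),
      forall j, t < j -> accepting (control (run mach j x)) = (s' ra != [::])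
    & forall j, t < j -> output (run mach j x) = s' 0].
Proof.
move=> hK hr hx hc.
pose T0 r := tape_of (None : tcell) (if r == 0 then [seq enc b | b <- x] else [::]).
have hT0 : reps B T0 (stk0 x).
  move=> r; rewrite /T0 /stk0 /upd; case: (r == 0); last by exists 0, 1.
  case: (x) hx => [|b y] hx; first by exists 0, 1.
  by exists 0, 0; rewrite /= cats0.
have Ei : init mach x = mcfg (inl (ent c)) T0 by [].
have [T' h1 h2] := exec_runs hc hT0.
have [h3 [h4 h5]] := runs_iter hK (reps_ok hT0) h1.
have E1 : iter t.+1 (@step mach) (init mach x) = mcfg (inr (Some (s' ra != [::]))) T'.
  rewrite iterS Ei h4 /step /= /mdelta; congr Config.
    rewrite ffunE inordK ?ltnS // (rep_top (h2 ra)).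
    by case: (s' ra).
  by apply: functional_extensionality => i; rewrite !ffunE; case: (T' i).
have E2 j : t < j -> iter j (@step mach) (init mach x) = mcfg (inr (Some (s' ra != [::]))) T'.
  by move=> /subnK <-; rewrite iterD E1; elim: (j - _) => //= n ->.
split=> j; rewrite /run.
- have [hj|hj] := leqP j t.
    rewrite Ei; have [q1 [T1 [-> ok]]] := h3 j hj.
    exact: oksz_space.
  by rewrite E2 //; apply: oksz_space.
- by move=> hj; rewrite E2.
- by move=> hj; rewrite E2.
- move=> hj; rewrite E2 // /output /=.
  have [a [b [_ E _ _]]] := h2 0.
  rewrite -[LHS]/(@leading_bits mach (scanned (T' 0) :: after (T' 0))) E.
  by elim: (s' 0) => [|d l] /=; [case: b {E}|move=> ->].
Qed.

End Compile.

(** * From programs and bounded recursion to complexity classes *)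

Lemma PSPACE_of_prog (c : cmd) (ra k : nat) (L : language) :
  (forall x, exists s' t, exec (k * (size x).+1) c (stk0 x) s' t /\ (s' ra != [::] <-> L x)) ->
  PSPACE L.
Proof.
move=> h; pose K := maxn (regs c) ra.
exists (mach c ra K), ((K.+1)%:P * (k.+1%:P * ('X + 1) + 1))%R => x.
have [s' [t [he hL]]] := h x.
(* Raising the bound from [k] to [k.+1] ensures that the input itself fits, also for [k = 0]. *)
have he' : exec (k.+1 * (size x).+1) c (stk0 x) s' t.
  elim: he => *; [exact: exec_skip|apply: exec_push; nia|apply: exec_pop; eassumption
    |apply: exec_seq; eassumption|exact: exec_if1|exact: exec_if0|exact: exec_while0
    |apply: exec_while1; eassumption].
have [||| h1 h2 h3 _] := @mach_correct c ra K _ _ _ _ _ _ _ he'; rewrite ?leq_maxl ?leq_maxr //.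
  by nia.
split=> [j|].
  apply: leq_trans (h1 j) _; rewrite !hornerE /=.
  by rewrite -[X in _ <= X]/(K.+1 * (k.+1 * (size x + 1) + 1))%N !addn1.
by exists t.+1; rewrite ?h2 ?h3.
Qed.

Lemma polytime_of_prog (c : cmd) (k : nat) (f : seq bool -> seq bool) :
  (forall x, exists B s' t, [/\ exec B c (stk0 x) s' t, s' 0 = f x, size x <= B & t <= (size x + 2) ^ k]) ->
  polytime f.
Proof.
move=> h; exists (mach c 0 (regs c)), (('X + 2) ^+ k + 1)%R => x.
have [B [s' [t [he hf hx ht]]]] := h x.
have [||| _ h2 _ h4] := @mach_correct c 0 (regs c) _ _ _ _ _ _ _ he => //.
rewrite !hornerE; set j := (_ + _)%R; have hj : t < j.
  by rewrite -[j]/((size x + 1 + 1) ^ k + 1)%N -(addnA (size x)) addn1 ltnS.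
by rewrite h2 // h4.
Qed.

(** Stack 0 is read in two ways, as the input and as the numeral of [bcode x], and so is also the
    environment. Then [mu] is exponential in the length of the input, and any polynomial in it has
    linearly many binary digits. *)
Theorem PSPACE_of_E2 (f : func) (L : language) : E2 f ->
  (forall x, f x [:: bcode x] != 0 <-> L x) -> PSPACE L.
Proof.
move=> hf hL; have hr (r : nat) : r \in [:: 0] -> r < 1 by rewrite inE => /eqP ->.
have [c [T [[k hT] h]]] := E2_computes hf hr isT.
apply: (@PSPACE_of_prog c 1 (4 * k + 1)) => x; set B := _ * _.
have E : env (stk0 x) [:: 0] = [:: bcode x] by [].
have hmu : mu x [:: bcode x] <= 2 ^ (4 * (size x).+1).
  have := code_lt x; have h0 := size_code x; rewrite /mu /= addn0 [4 * _]mulnC expnM.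
  have : 2 <= 2 ^ (size x).+1 by rewrite expnS; have := expn_gt0 2 (size x); lia.
  move: (2 ^ _) => p hp h1; apply: (@leq_trans (2 * p)); first by lia.
  apply: (@leq_trans (p ^ 2)); first by rewrite expnS expn1 leq_mul2r hp orbT.
  by rewrite leq_pexp2l //; lia.
have hlt : T x [:: bcode x] < 2 ^ B.
  apply: leq_ltn_trans (hT _ _) _.
  apply: (@leq_ltn_trans (2 ^ (4 * (size x).+1 * k))).
    by rewrite expnM; apply: leq_exp2r'.
  by rewrite ltn_exp2l // /B; nia.
have [||t _ he] := h B (stk0 x) _ _ hlt.
- by move=> [|r].
- by move=> [|r] //=; rewrite /B /stk0 upd_same; nia.
by exists (upd (stk0 x) 1 (bin (f x [:: bcode x]))), t; split=> //; rewrite upd_same -hL -[X in bin X]/(f x _); case: (f x _) => // n; have := binK n.+1; case: (bin n.+1).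
Qed.

(** With an environment of numbers that are polynomial in the length, the same programs run in
    polynomial time. The bits are computed from the last to the first, so that pushing them leaves
    the output in the right order. *)
Theorem polytime_of_E2 (F G : func) (f : seq bool -> seq bool) : E2 F -> E2 G ->
  (forall x, f x = mkseq (fun i => F x [:: i] != 0) (G x [::])) -> polytime f.
Proof.
move=> hF hG hf.
have hr0 (r : nat) : r \in [::] -> r < 1 by [].
have hr1 (r : nat) : r \in [:: 1] -> r < 3 by rewrite inE => /eqP ->.
have [c1 [T1 [hT1 h1]]] := E2_computes hG hr0 isT.
have [c2 [T2 [hT2 h2]]] := E2_computes hF hr1 isT.
pose body := Seq (decp 1 3) (Seq c2 (Seq (If 3 isSome (Push 2 true) (Push 2 false)) (clearp 3))).
pose prog := Seq c1 (Seq (While 1 isSome body) (Seq (clearp 0) (mv2p 2 0 3))).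
have pG := E2_polyb hG; have pF := E2_polyb hF.
have [k3 hk3] := polyb_bound hT2; have [k4 hk4] := polyb_bound pF.
pose W x := 8 * G x [::] + 20 + (mu x [::] + G x [::]) ^ k3 + 2 * (mu x [::] + G x [::]) ^ k4.
pose tm x := T1 x [::] + (G x [::] * W x + 1 + (2 * size x + 1 + (10 * G x [::] + 2))).
have [k hk] : exists k, forall x, tm x <= (size x + 2) ^ k.
  suff [k hk] : polyb (fun x s => T1 x s + (G x s * (8 * G x s + 20 + (mu x s + G x s) ^ k3 +
      2 * (mu x s + G x s) ^ k4) + 1 + (2 * size x + 1 + (10 * G x s + 2)))).
    by exists k => x; have := hk x [::]; rewrite /mu /= add0n.
  have hx : polyb (fun x _ => size x).
    by apply: polyb_le polyb_mu _ => x s; rewrite /mu; lia.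
  have pc z T : polyb T -> polyb (fun x s => z * T x s).
    by move=> hT; apply: polyb_mul (polyb_const z) hT.
  have pm : polyb (fun x s => mu x s + G x s) by apply: polyb_add => //; apply: polyb_mu.
  apply: polyb_add => //; apply: polyb_add; last first.
    by apply: polyb_add; (apply: polyb_add; last exact: polyb_const); apply: pc.
  apply: polyb_add; last exact: polyb_const.
  apply: polyb_mul => //; apply: polyb_add; last by apply: pc; apply: polyb_pow.
  by apply: polyb_add; [apply: polyb_add; [exact: pc|exact: polyb_const]|exact: polyb_pow].
apply: (@polytime_of_prog prog k) => x; set N := G x [::].
set s := stk0 x.
have [B hB] : exists B, tm x + size x <= B by exists (tm x + size x).
have hBB n : n <= B -> n < 2 ^ B by move=> hn; apply: leq_ltn_trans hn (ltn_expl _ _).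
have WE : W x = 8 * N + 20 + (mu x [::] + N) ^ k3 + 2 * (mu x [::] + N) ^ k4 by [].
have tmE : tm x = T1 x [::] + (N * W x + 1 + (2 * size x + 1 + (10 * N + 2))) by [].
pose S i := upd (upd s 1 (bin i)) 2 (mkseq (fun j => F x [:: i + j] != 0) (N - i)).
have hNB : N <= B by rewrite tmE in hB; lia.
have [u [hu hex]] : runp B prog s (upd (upd s 1 [::]) 0 (f x)) (tm x).
  apply: (@run_seq _ _ _ (upd s 1 (bin N)) (T1 x [::])) (leqnn _).
    by apply: h1; [case|case=> [|r] //=; rewrite /s /stk0 upd_same; lia|apply: hBB; rewrite -[T1 _ _]/(T1 x [::]); rewrite tmE in hB; lia].
  have -> : upd s 1 (bin N) = S N.
    by apply: functional_extensionality => -[|[|[|r]]]; rewrite /S /upd ?subnn.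
  apply: (@run_seq _ _ _ (S 0) (N * W x + 1)) (leqnn _).
    suff loop i : i <= N -> runp B (While 1 isSome body) (S i) (S 0) (i * W x + 1) by apply: loop.
    elim: i => [|i IH] hi; first by apply: run_while0.
    have hNW : W x <= N * W x by nia.
    have hWB : W x <= B by rewrite tmE in hB; lia.
    have hW2 : T2 x [:: i] <= (mu x [::] + N) ^ k3 by apply: hk3; rewrite /mu /=; lia.
    have hW3 : F x [:: i] <= (mu x [::] + N) ^ k4 by apply: hk4; rewrite /mu /=; lia.
    apply: (@run_while1 _ _ _ _ (S i) (W x).-1 (i * W x + 1)) => //; last by rewrite mulSn; lia.
    - by rewrite (_ : S i.+1 1 = bin i.+1) ?isSome_bin.
    - have sbi := size_bin i; have sbi1 := size_bin i.+1; have sbF := size_bin (F x [:: i]).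
      set s1 := upd (S i.+1) 1 (bin i).
      apply: (@run_seq _ _ _ s1 (8 * i.+1 + 8) (T2 x [:: i] + (3 + (2 * F x [:: i] + 1)))); last by lia.
        by apply: run_decn => //; rewrite (_ : S i.+1 1 = bin i.+1) //; lia.
      have E0 : s1 0 = x by [].
      have Ei : env s1 [:: 1] = [:: i] by rewrite /= /s1 upd_same binK.
      apply: (@run_seq _ _ _ (upd s1 3 (bin (F x [:: i])))) (leqnn _).
        apply: run_eqs (h2 B s1 _ _ _) _ _; rewrite ?Ei ?E0.
        + by case=> [|[|[|r]]].
        + case=> [|[|[|r]]]; rewrite /s1 /S /s /stk0 /upd //= ?size_mkseq; lia.
        + by apply: hBB; lia.
        + by [].
        + by [].
      apply: (@run_seq _ _ _ (upd (S i) 3 (bin (F x [:: i])))) (leqnn _).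
        have E : upd (S i) 3 (bin (F x [:: i])) = upd (upd s1 3 (bin (F x [:: i]))) 2
            ((F x [:: i] != 0) :: mkseq (fun j => F x [:: i.+1 + j] != 0) (N - i.+1)).
          rewrite (_ : _ :: _ = mkseq (fun j => F x [:: i + j] != 0) (N - i)); first by rewrite /s1 /S; stk.
          rewrite -[N - i]prednK ?subn_gt0 // -subnS /mkseq /= addn0; congr (_ :: _).
          by rewrite -[1]addn0 iotaDl -map_comp; apply: eq_map => j /=; rewrite addnA addn1.
        rewrite E; apply: run_if; rewrite upd_same isSome_bin lt0n.
        by case: (F x [:: i] != 0); apply: run_push; rewrite //= /s1 /S /upd /= size_mkseq; lia.
      apply: run_eqs (run_clear _ _ _) _ _; rewrite ?upd_same; last by lia.
      by rewrite upd_upd; apply: functional_extensionality => r; rewrite /S /s /stk0 /upd; case: r => [|[|[|[|r]]]].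
    - by apply: IH; lia.
  apply: (@run_seq _ _ _ (upd (S 0) 0 [::]) (2 * size x + 1)) (leqnn _).
    by apply: run_eqs (run_clear _ _ _) _ _; rewrite // /S /s /stk0 /upd.
  have E2 : upd (S 0) 0 [::] 2 = f x by rewrite hf /S /upd /= subn0.
  have szf : size (f x) = N by rewrite hf size_mkseq.
  apply: run_eqs (@run_mv2 B 2 0 3 _ _ _ _ _ _ _) _ _ => //; rewrite ?E2 ?szf //.
  apply: functional_extensionality => -[|[|[|r]]] //=.
exists B, (upd (upd s 1 [::]) 0 (f x)), u; split=> //.
- by lia.
- exact: leq_trans hu (hk x).
Qed.

(** * Correctness of the membership test *)

Lemma iff_eq (a b : bool) : (a <-> b) -> a = b.
Proof. by move=> [h1 h2]; apply/idP/idP. Qed.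

Lemma eq_recn a (h h' : nat -> nat -> nat) k : (forall i c, i < k -> h i c = h' i c) -> recn a h k = recn a h' k.
Proof. by elim: k => //= k IH hh; rewrite IH ?hh // => i c hi; apply/hh/ltnW. Qed.

Lemma recn_iter f a k : recn a (fun _ => f) k = iter k f a.
Proof. by elim: k => //= k ->. Qed.

Lemma lefts_halves n S T k c : recn S (fun i a => if odd (c %/ 2 ^ (n.+1 * (k - 1 - i))) then c %/ 2 ^ (n.+1 * (k - 1 - i)) %% 2 ^ n.+1 %/ 2 else a) k = (halves n S T k c).1.
Proof.
elim: k c => // k IH c; have e0 : k.+1 - 1 - k = 0 by lia.
rewrite [LHS]/= e0 muln0 expn0 divn1 [RHS]/=; case: (odd c) => //=; rewrite -IH; apply: eq_recn => i a hi.
have -> : k.+1 - 1 - i = (k - 1 - i).+1 by lia.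
by rewrite mulnS expnD divnMA.
Qed.

Lemma rights_halves n S T k c : recn T (fun i a => if odd (c %/ 2 ^ (n.+1 * (k - 1 - i))) then a else c %/ 2 ^ (n.+1 * (k - 1 - i)) %% 2 ^ n.+1 %/ 2) k = (halves n S T k c).2.
Proof.
elim: k c => // k IH c; have e0 : k.+1 - 1 - k = 0 by lia.
rewrite [LHS]/= e0 muln0 expn0 divn1 [RHS]/=; case: (odd c) => //=; rewrite -IH; apply: eq_recn => i a hi.
have -> : k.+1 - 1 - i = (k - 1 - i).+1 by lia.
by rewrite mulnS expnD divnMA.
Qed.

Definition respects (P : vertex_problem) (o : mode) n (k : int) (Z : {set 'I_n}) : Prop :=
  if o is Tar then respects_threshold P k Z else True.

Section Accept.
Variables (P : vertex_problem) (o : mode) (x : seq bool) (n C k g : nat) (kk : int).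
Hypotheses (hC : forall i, i <= n * n.+1 + 1 -> pw C i = 2 ^ i) (hk : k = `|kk|%N) (hg : g = (kk < 0)%R).
Variables (G : sgraph 'I_n) (X Y : {set 'I_n}).
Hypotheses (hG : forall u v : 'I_n, xadj x n u v = G u v) (hX : forall u : 'I_n, xsrc x n u = (u \in X)) (hY : forall u : 'I_n, xtgt x n u = (u \in Y)).
Local Notation S := (srcp x n C).
Local Notation T := (tgtp x n C).

Lemma hCn i : i <= n.+1 -> pw C i = 2 ^ i.
Proof. by move=> h; case: n h hC => [|m] h hC'; apply: hC'; nia. Qed.

Lemma bitpE A (u : 'I_n) : bitp C A u = (u \in setof n A).
Proof. by rewrite /bitp hCn ?inE //; apply: leqW (ltnW (ltn_ord u)). Qed.

Lemma srcpE : S = numof X.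
Proof.
have -> : X = [set u : 'I_n | xsrc x n u] by apply/setP => u; rewrite inE hX.
by rewrite numof_nsum; apply: eq_big_nat => i /andP[_ hi]; rewrite hCn // leqW // ltnW.
Qed.
Lemma tgtpE : T = numof Y.
Proof.
have -> : Y = [set u : 'I_n | xtgt x n u] by apply/setP => u; rewrite inE hY.
by rewrite numof_nsum; apply: eq_big_nat => i /andP[_ hi]; rewrite hCn // leqW // ltnW.
Qed.

Lemma weightE A : weight C n A = #|setof n A|.
Proof.
rewrite /weight big_mkord -sum1_card [RHS]big_mkcond; apply: eq_bigr => u _.
by rewrite bitpE; case: (u \in _).
Qed.

Definition okset (Z : {set 'I_n}) := feasible P G Z /\ respects P o kk Z.

Lemma okpP A : okp P o x n C k g A <-> okset (setof n A).
Proof.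
have hf : feasible P G (setof n A) <-> feasibleb P n (pw C n) (xadj x n) (bitp C) (fun i => bitp C A i (+) small P).
  rewrite hCn // (@feasiblebP P n G (xadj x n) (bitp C) (bitp C A) (setof n A)) //.
    by move=> B u; rewrite bitpE inE.
  by move=> u; rewrite bitpE.
have hr : is_true (if o is Tar then (if small P then (g == 0) && (weight C n A <= k) else (g == 1) || (k <= weight C n A)) else true) <-> respects P o kk (setof n A).
  rewrite /respects; case: o => //; rewrite weightE hg hk /respects_threshold; move: #|_| => w; case: kk => m.
    have -> : (Posz m < 0)%R = false by [].
    by rewrite absz_nat; case: P => /=; lia.
  have -> : (Negz m < 0)%R = true by [].
  by rewrite NegzE; case: P => /=; split=> //; lia.
rewrite /okp /okset; split=> [/andP[h1 h2]|[/hf h1 /hr h2]]; last by apply/andP; split.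
by split; [apply/hf|apply/hr].
Qed.

Definition setok (Z : {set 'I_n}) := okp P o x n C k g (numof Z).
Lemma setokP Z : okset Z <-> setok Z.
Proof. by rewrite /setok okpP numofK. Qed.

Definition stepp : rel nat := fun A B => okp P o x n C k g B && stepb o n (xadj x n) (bitp C A) (bitp C B).

Lemma steppE A B : stepp A B = setok (setof n B) && mode_step o G (setof n A) (setof n B).
Proof.
rewrite /stepp (@stepbE o n G (xadj x n) (bitp C A) (bitp C B) (setof n A) (setof n B)) //; last by move=> u; rewrite bitpE.
  by congr (_ && _); apply: iff_eq; rewrite -setokP okpP.
by move=> u; rewrite bitpE.
Qed.

Lemma leafpE c : leafp P o x n C k g c = near_leaf n S T stepp n c.
Proof.
have e : n.+1 * n = n * n.+1 by rewrite mulnC.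
have h i : i < n -> pw C (n.+1 * (n - 1 - i)) = 2 ^ (n.+1 * (n - 1 - i)).
  by move=> hi; apply: hC; rewrite -e; apply: leq_trans (leq_addr _ _); rewrite leq_mul2l; apply/orP; right; lia.
rewrite /leafp /near_leaf -lefts_halves -rights_halves /lefts /rights.
have -> : recn S (fun i a => if odd (c %/ pw C (n.+1 * (n - 1 - i))) then c %/ pw C (n.+1 * (n - 1 - i)) %% pw C n.+1 %/ 2 else a) n =
  recn S (fun i a => if odd (c %/ 2 ^ (n.+1 * (n - 1 - i))) then c %/ 2 ^ (n.+1 * (n - 1 - i)) %% 2 ^ n.+1 %/ 2 else a) n.
  by apply: eq_recn => i a hi; rewrite h // hCn.
have -> // : recn T (fun i a => if odd (c %/ pw C (n.+1 * (n - 1 - i))) then a else c %/ pw C (n.+1 * (n - 1 - i)) %% pw C n.+1 %/ 2) n =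
  recn T (fun i a => if odd (c %/ 2 ^ (n.+1 * (n - 1 - i))) then a else c %/ 2 ^ (n.+1 * (n - 1 - i)) %% 2 ^ n.+1 %/ 2) n.
by apply: eq_recn => i a hi; rewrite h // hCn.
Qed.

Local Notation d := (n * n.+1).
Lemma climbpE c : climbp P o x n C k g c = climb (near_leaf n S T stepp n) (quant n) d (2 ^ d) c.
Proof.
have hd j : j <= d -> pw C j = 2 ^ j by move=> h; apply: hC; apply: leq_trans h (leq_addr _ _).
have -> : climb (near_leaf n S T stepp n) (quant n) d (2 ^ d) c =
  let j := turnp P o x n C k g c in if (j < d) && ((c %/ 2 ^ j).+1 * 2 ^ j < 2 ^ d) then (c %/ 2 ^ j).+1 * 2 ^ j else c.
  rewrite /climb; have -> // : first (turns (near_leaf n S T stepp n) (quant n) c) d = turnp P o x n C k g c.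
  rewrite /first /turnp; apply: eq_big_nat => i /andP[_ hi]; congr nat_of_bool; apply: eq_in_all => j.
  by rewrite mem_iota => /andP[_ hj]; rewrite /turns hd ?leafpE //; lia.
rewrite /climbp; cbv zeta; rewrite (hd d) //; case: ltnP => //= hj; by rewrite hd // ltnW.
Qed.

Lemma lastpE : leafp P o x n C k g (lastp P o x n C k g) = tree (near_leaf n S T stepp n) (quant n) d 0.
Proof.
rewrite leafpE -(@tree_climb _ _ d (2 ^ d) (2 ^ d)) //; congr near_leaf; rewrite /lastp recn_iter hC ?leq_addr //.
by apply: eq_iter => c; apply: climbpE.
Qed.

Lemma acceptpP : acceptp P o x n C k g <->
  [/\ okset X, okset Y & reconfigurable (mode_step o G) okset X Y].
Proof.
rewrite /acceptp lastpE srcpE tgtpE -!/(setok _).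
have := savitch stepp (numof_lt X) (numof_lt Y).
rewrite (numbers_sets (e := fun A B => setok B && mode_step o G A B) X Y steppE) => hs.
have hr := reconf_path (mode_step o G) X Y setokP.
split=> [/and3P[h1 h2 /hs h3]|[/setokP h1 /setokP h2 /hr[_ /hs h3]]]; last by rewrite h1 h2 h3.
by split; [exact/setokP|exact/setokP|exact/hr].
Qed.

End Accept.

(** ** Parsing *)

Definition rgraph n (G : rel 'I_n) (u v : nat) := oapp (fun u' => oapp (G u') false (insub v)) false (insub u).
Definition rset n (X : {set 'I_n}) (u : nat) := oapp (mem X) false (insub u).

Definition bits_of n (G : rel 'I_n) (X Y : {set 'I_n}) := rcons (nseq n true) false ++
  [seq G u v | u <- enum 'I_n, v <- enum 'I_n] ++ set_bits X ++ set_bits Y.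

Definition mbits n (a : rel nat) (s t : pred nat) := mkseq (ebit (fun _ => n) (fun _ => a) (fun _ => s) (fun _ => t) [::]) (blen n).

Lemma mbitsE n (G : rel 'I_n) (X Y : {set 'I_n}) (a : rel nat) (s t : pred nat) :
  (forall u v : 'I_n, a u v = G u v) -> (forall u : 'I_n, s u = (u \in X)) -> (forall u : 'I_n, t u = (u \in Y)) ->
  bits_of G X Y = mbits n a s t.
Proof.
move=> ha hs ht; rewrite /mbits -[blen n]/(elen (fun _ => n) [::]) -base_bitsE /base_bits /bits_of /set_bits.
congr (_ ++ _); congr (_ ++ _).
  by congr flatten; apply: eq_map => u; apply: eq_map => v; rewrite ha.
by congr (_ ++ _); apply: eq_map => u; rewrite ?hs ?ht.
Qed.

Lemma blen_bounds n : n + 1 + n * n + n + n = blen n. Proof. by rewrite /blen; lia. Qed.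

Lemma mbits_nth n a s t : [/\ forall i, i <= n -> nth false (mbits n a s t) i = (i < n),
  forall u v, u < n -> v < n -> nth false (mbits n a s t) (n + 1 + (u * n + v)) = a u v,
  forall i, i < n -> nth false (mbits n a s t) (n + 1 + n * n + i) = s i
  & forall i, i < n -> nth false (mbits n a s t) (n + 1 + (n * n + n) + i) = t i].
Proof.
have hb := blen_bounds n.
split.
- by move=> i hi; rewrite nth_mkseq ?/ebit; [rewrite ifT //|]; lia.
- move=> u v hu hv; have h : u * n + v < n * n by apply: (@leq_trans (u.+1 * n)); [rewrite mulSn; lia|rewrite leq_mul2r hu orbT].
  rewrite nth_mkseq; last by lia.
  rewrite /ebit ifF; last by lia.
  by rewrite addKn h divnMDl ?modnMDl ?divn_small ?modn_small ?addn0 // (leq_ltn_trans _ hv).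
- move=> i hi; rewrite nth_mkseq; last by lia.
  rewrite /ebit ifF; last by lia.
  by rewrite -addnA addKn ifF ?addKn ?hi //; lia.
- move=> i hi; rewrite nth_mkseq; last by lia.
  rewrite /ebit ifF; last by lia.
  rewrite -addnA addKn ifF; last by lia.
  by rewrite -addnA addKn ifF ?addKn //; lia.
Qed.

Lemma size_mbits n a s t : size (mbits n a s t) = blen n. Proof. exact: size_mkseq. Qed.

Lemma parse n (G : sgraph 'I_n) X Y z x : x = bits_of G X Y ++ z ->
  [/\ shapep x n, size x = blen n + size z, forall i, xb x (blen n + i) = nth false z i,
    forall u v : 'I_n, xadj x n u v = G u v & (forall u : 'I_n, xsrc x n u = (u \in X)) /\ (forall u : 'I_n, xtgt x n u = (u \in Y))].
Proof.
rewrite (@mbitsE _ _ _ _ (rgraph G) (rset X) (rset Y)); first last.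
- by move=> u; rewrite /rset valK. - by move=> u; rewrite /rset valK. - by move=> u v; rewrite /rgraph !valK.
move=> ex; have hb := blen_bounds n; have [h1 h2 h3 h4] := mbits_nth n (rgraph G) (rset X) (rset Y).
have sx : size x = blen n + size z by rewrite ex size_cat size_mbits.
have hn i : i < blen n -> xb x i = nth false (mbits n (rgraph G) (rset X) (rset Y)) i.
  by move=> hi; rewrite /xb ex nth_cat size_mbits hi.
have hadj (u v : 'I_n) : xadj x n u v = G u v.
  have h : u * n + v < n * n by apply: (@leq_trans (u.+1 * n)); [rewrite mulSn; have := ltn_ord v; lia|rewrite leq_mul2r ltn_ord orbT].
  rewrite /xadj hn; last by lia.
  by rewrite h2 // /rgraph !valK.
split=> //.
- rewrite /shapep sx leq_addr; apply/and4P; split=> //.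
  + apply/allP => i; rewrite mem_iota => /andP[_ hi]; rewrite hn; last by lia.
    by rewrite h1.
  + by apply/iota_all => u; apply/iota_all => v; rewrite !hadj adj_sym.
  + by apply/iota_all => u; rewrite hadj adj_irr.
- by move=> i; rewrite /xb ex nth_cat size_mbits ltnNge leq_addr /= addKn.
split=> u; have hu := ltn_ord u.
  by rewrite /xsrc hn ?h3 /rset ?valK //; lia.
by rewrite /xtgt hn ?h4 /rset ?valK //; lia.
Qed.

Lemma unparse x n : shapep x n -> exists (G : sgraph 'I_n) (X Y : {set 'I_n}), x = bits_of G X Y ++ drop (blen n) x.
Proof.
move=> /and4P[hs /allP hx /iota_all hsym /iota_all hirr].
have gs : symmetric (fun u v : 'I_n => xadj x n u v) by move=> u v; have /iota_all/(_ v)/eqP := hsym u.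
have gi : irreflexive (fun u : 'I_n => [eta xadj x n u]) by move=> u; apply/negbTE/hirr.
exists (SGraph gs gi), [set u : 'I_n | xsrc x n u], [set u : 'I_n | xtgt x n u].
rewrite (@mbitsE _ _ _ _ (xadj x n) (xsrc x n) (xtgt x n)) //; try by move=> u; rewrite inE.
have hb := blen_bounds n.
rewrite -{1}(cat_take_drop (blen n) x); congr cat.
have st : size (take (blen n) x) = blen n by rewrite size_takel.
apply: (@eq_from_nth _ false) => [|i]; first by rewrite st size_mbits.
rewrite st => hi; rewrite nth_take // nth_mkseq // /ebit -/(xb x i).
case: ltnP => h1; first by apply/eqP/hx; rewrite mem_iota; lia.
case: ltnP => h2; first by rewrite /xadj -divn_eq subnKC.
case: ltnP => h3; first by rewrite /xsrc; congr xb; lia.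
by rewrite /xtgt; congr xb; lia.
Qed.

(** A nonempty string of length [l] has a code of at least [2 ^ l.-1], so the truncation in [pw]
    does not set in up to the exponent [l]. *)
Lemma pw_code x i : 0 < size x -> i <= size x -> pw (bcode x) i = 2 ^ i.
Proof.
move=> x0 hi; have h := code_size x.
have h1 : 2 ^ (size x).-1 <= bcode x.
  by move: h; rewrite -{1}(prednK x0) expnS mul2n -addnn; have : 0 < 2 ^ (size x).-1 by [rewrite expn_gt0]; lia.
have c0 : 0 < bcode x by apply: leq_trans h1; rewrite expn_gt0.
have h2 := trunc_log_max (isT : 1 < 2) h1.
by rewrite pwE // (minn_idPl _) //; lia.
Qed.

Lemma logpE k : logp k = trunc_log 2 k. Proof. exact: tlE. Qed.

Lemma int_bitsE (kk : int) (k := `|kk|%N) : int_bits kk = (kk < 0)%R :: mkseq (fun i => odd (k %/ pw k i)) (logp k).+1.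
Proof. by rewrite /int_bits nat_bitsE logpE. Qed.

Lemma size_int_bits kk : size (int_bits kk) = 1 + (logp `|kk|%N).+1.
Proof. by rewrite int_bitsE -cat1s size_cat size_mkseq. Qed.

Lemma nth_int_bits (kk : int) (k := `|kk|%N) i : i < (logp k).+1 -> nth false (int_bits kk) i.+1 = odd (k %/ pw k i).
Proof. by move=> hi; rewrite int_bitsE; apply: nth_mkseq. Qed.

Section Language.
Variables (P : vertex_problem) (x : seq bool).

(** The input contains an adjacency matrix and two characteristic vectors, so it is longer than the
    [n * n.+1] bits of a position in the search tree. *)
Lemma shape_pw n : shapep x n -> forall i, i <= n * n.+1 + 1 -> pw (bcode x) i = 2 ^ i.
Proof.
move=> /and4P[hs _ _ _] i hi; have hb := blen_bounds n; have e : n * n.+1 = n + n * n by rewrite mulnS.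
by apply: pw_code; lia.
Qed.

Lemma tar_member : language_of (TAR_problem P) x <-> langp P Tar x (bcode x).
Proof.
split=> [[[I kk] /= e [s hs]]|].
  set n := order_of I; set k := `|kk|%N; set g := nat_of_bool (kk < 0)%R.
  have [h1 h2 h3 h4 [h5 h6]] := @parse n (graph I) (source I) (target I) (int_bits kk) x (esym e).
  have sz : size (int_bits kk) = 1 + (logp k).+1 by exact: size_int_bits.
  have nx : n < (size x).+1 by rewrite h2 -blen_bounds; lia.
  (* The binary digits of [k] are part of [x], so the code of [x] is a sufficient bound for the
     search. *)
  have kx : k < (bcode x).+1.
    apply: leq_trans (trunc_log_ltn k (isT : 1 < 2)) _; apply: leq_trans (code_size x); rewrite leq_exp2l // h2 sz logpE.
    by rewrite add1n; apply: leq_trans (leq_addl _ _); apply: leqW.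
  apply/hasP; exists n; first by rewrite mem_iota.
  apply/hasP; exists k; first by rewrite mem_iota.
  apply/hasP; exists g; first by rewrite mem_iota /g; case: (_ < _)%R.
  apply/and3P; split; first exact: h1.
    rewrite /tailp; apply/and4P; split.
    - by rewrite h2 sz.
    - by rewrite -[blen n]addn0 h3 int_bitsE /g /=; case: (_ < _)%R.
    - by rewrite /g /k; case: (kk) => m; rewrite ?absz_nat //=; lia.
    - apply/allP => i; rewrite mem_iota add0n => /andP[_ hi].
      by rewrite -addnA h3 add1n nth_int_bits.
  apply/(acceptpP P Tar (kk := kk) (shape_pw h1) (erefl _) (erefl _) h4 h5 h6).
  have [hA hB hC] := hs.
  by split; [apply: hC; rewrite inE eqxx|rewrite -hB; apply: hC; apply: mem_last|exists s].
move=> /hasP[n _ /hasP[k _ /hasP[g hg /and3P[h1 h2 h3]]]].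
have hg2 : g < 2 by move: hg; rewrite mem_iota.
have [G [X [Y e]]] := unparse h1; have [_ _ _ h4 [h5 h6]] := parse e.
move: h2 => /and4P[/eqP h7 /eqP h8 /implyP h9 /allP h10].
pose kk : int := if g == 1 then (- Posz k)%R else Posz k.
have kE : k = `|kk|%N by rewrite /kk; case: (g == 1); rewrite ?abszN absz_nat.
have gE : g = (kk < 0)%R.
  rewrite /kk; have [g0|g1] : g = 0 \/ g = 1 by lia.
    by rewrite g0.
  have k0 : 0 < k by apply: h9; rewrite g1.
  by rewrite g1 eqxx; have -> : (- Posz k < 0)%R = true by lia.
have [[f1 r1] [f2 r2] h11] := (acceptpP P Tar (shape_pw h1) kE gE h4 h5 h6).1 h3.
exists (ThresholdInstance (ReconfInstance f1 f2) kk) => //=.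
rewrite -[x in RHS](cat_take_drop (blen n)).
have -> : encode_base (ReconfInstance f1 f2) = take (blen n) x.
  by rewrite e take_size_cat // (@mbitsE _ _ _ _ (xadj x n) (xsrc x n) (xtgt x n)) // size_mbits.
congr cat; apply: (@eq_from_nth _ false).
  by rewrite size_drop h7 size_int_bits -kE; lia.
case=> [|i] hi.
  by rewrite nth_drop addn0 -[RHS]/(xb x (blen n)) h8 gE int_bitsE /=; case: (_ < _)%R.
rewrite size_int_bits -kE in hi; have hi' : i < (logp k).+1 by lia.
rewrite nth_drop nth_int_bits -kE //.
by have := h10 i; rewrite mem_iota add0n -addnA add1n => /(_ hi')/eqP.
Qed.

Lemma token_member o : o <> Tar -> (exists2 I : token_instance P, encode_base I = x &
    reconfigurable (mode_step o (graph I)) (feasible P (graph I)) (source I) (target I)) <-> langp P o x (bcode x).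
Proof.
move=> ho.
have hsum n (f : nat -> bool) (X : {set 'I_n}) : (forall u : 'I_n, f u = (u \in X)) -> \sum_(0 <= i < n) f i = #|X|.
  move=> h; rewrite big_mkord -sum1_card [RHS]big_mkcond; apply: eq_bigr => u _.
  by rewrite h; case: (u \in X).
have hlen : (if o is Tar then (bcode x).+1 else 1) = 1 by case: o ho.
have htail n k g : tailp o x n k g = (size x == blen n) && (\sum_(0 <= i < n) xsrc x n i == \sum_(0 <= i < n) xtgt x n i) by case: o ho {hlen}.
have hok n k g : okp P o x n (bcode x) k g = okp P o x n (bcode x) 0 0.
  by apply: functional_extensionality => A; rewrite /okp; case: o ho {hlen htail}.
have hacc n k g : acceptp P o x n (bcode x) k g = acceptp P o x n (bcode x) 0 0.
  by rewrite /acceptp /lastp /climbp /turnp /leafp /nearp (hok n k g).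
have hresp n (Z : {set 'I_n}) : respects P o (Posz 0) Z by case: o ho {hlen htail hacc hok}.
have hO n (G : sgraph 'I_n) Z : okset P o (Posz 0) G Z <-> feasible P G Z by split=> [[]|].
have hR n (G : sgraph 'I_n) X Y : reconfigurable (mode_step o G) (feasible P G) X Y <->
   reconfigurable (mode_step o G) (okset P o (Posz 0) G) X Y.
  by split=> -[s [a1 a2 a3]]; exists s; split=> // Z /a3 /hO.
split=> [[I /= e hI]|].
  set n := order_of I.
  have [h1 h2 h3 h4 [h5 h6]] := @parse n (graph I) (source I) (target I) [::] x (etrans (esym e) (esym (cats0 _))).
  apply/hasP; exists n; first by rewrite mem_iota h2 -blen_bounds; lia.
  apply/hasP; exists 0; first by rewrite mem_iota hlen.
  apply/hasP; exists 0; first by [].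
  apply/and3P; split; first exact: h1.
    by rewrite htail (hsum _ _ _ h5) (hsum _ _ _ h6) h2 addn0 eqxx (token_size I) eqxx.
  apply/(acceptpP P o (kk := Posz 0) (shape_pw h1) (erefl _) (erefl _) h4 h5 h6).
  by split; [apply/hO/source_feasible|apply/hO/target_feasible|apply/hR].
move=> /hasP[n _ /hasP[k hk /hasP[g hg /and3P[h1 h2 h3]]]].
have [G [X [Y e]]] := unparse h1; have [_ _ _ h4 [h5 h6]] := parse e.
move: h2; rewrite htail => /andP[/eqP h7 /eqP h8]; rewrite hacc in h3.
have [f1 f2 h11] := (acceptpP P o (kk := Posz 0) (shape_pw h1) (erefl _) (erefl _) h4 h5 h6).1 h3.
have cXY : #|X| = #|Y| by rewrite -(hsum _ _ _ h5) -(hsum _ _ _ h6).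
pose I := ReconfInstance (proj1 (hO _ _ _) f1) (proj1 (hO _ _ _) f2).
exists (@TokenInstance P I cXY); last exact/hR.
by rewrite [RHS]e drop_oversize ?h7 // cats0.
Qed.

End Language.

Theorem membership P : [/\ PSPACE (language_of (TAR_problem P)), PSPACE (language_of (TJ_problem P)) & PSPACE (language_of (TS_problem P))].
Proof.
have H o x : (langp P o x (bcode x) : nat) != 0 <-> langp P o x (bcode x) by case: langp.
split.
- by apply: (PSPACE_of_E2 (E2b_langp P Tar)) => x; rewrite /= H tar_member.
- apply: (PSPACE_of_E2 (E2b_langp P Tj)) => x; rewrite /= H -token_member //.
- apply: (PSPACE_of_E2 (E2b_langp P Ts)) => x; rewrite /= H -token_member //.
Qed.

(** * Straight-line drawings are planar *)

Section Straight.
Import Order.TTheory GRing.Theory Num.Theory numFieldNormedType.Exports.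
Variable R : realType.
Local Open Scope ring_scope.

Definition Zr (z : Z) : R := (int_of_Z z)%:~R.

Lemma ZrD a b : Zr (Z.add a b) = Zr a + Zr b.
Proof. by rewrite /Zr -[Z.add a b]/(a + b) rmorphD intrD. Qed.
Lemma ZrM a b : Zr (Z.mul a b) = Zr a * Zr b.
Proof. by rewrite /Zr -[Z.mul a b]/(a * b) rmorphM intrM. Qed.
Lemma Zr_le a b : Z.le a b -> Zr a <= Zr b.
Proof. by move=> h; rewrite /Zr ler_int; lia. Qed.
Lemma Zr_lt a b : Z.lt a b -> Zr a < Zr b.
Proof. by move=> h; rewrite /Zr ltr_int; lia. Qed.
Lemma Zr_inj : injective Zr.
Proof. by move=> a b /intr_inj /(can_inj int_of_ZK). Qed.

Definition Zp (p : Z * Z) : R * R := (Zr p.1, Zr p.2).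

Definition line (p q : R * R) (t : R) : R * R :=
  ((1 - t) * p.1 + t * q.1, (1 - t) * p.2 + t * q.2).

Lemma conv_le (s A B M : R) : 0 <= s <= 1 -> A <= M -> B <= M -> (1 - s) * A + s * B <= M.
Proof.
move=> /andP[s0 s1] hA hB.
have p : 0 <= (1 - s) * (M - A) by apply: mulr_ge0; rewrite subr_ge0.
have q : 0 <= s * (M - B) by apply: mulr_ge0; rewrite ?subr_ge0.
lra.
Qed.

Lemma conv_lt (s A B M : R) : 0 < s < 1 -> A <= M -> B <= M -> A + B < M + M ->
  (1 - s) * A + s * B < M.
Proof.
move=> /andP[s0 s1] hA hB hAB; have [lA|lA] := ltP A M.
  have p : 0 < (1 - s) * (M - A) by apply: mulr_gt0; rewrite subr_gt0.
  have q : 0 <= s * (M - B) by apply: mulr_ge0; rewrite ?subr_ge0 // ltW.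
  lra.
have p : 0 <= (1 - s) * (M - A) by apply: mulr_ge0; rewrite subr_ge0 // ltW.
have q : 0 < s * (M - B) by apply: mulr_gt0; rewrite ?subr_gt0 //; lra.
lra.
Qed.

(** Evaluate the linear form [n] at the common point: the two sides force the value [m], but an
    interior point of the segment not contained in the line misses it. The case [c == d] treats a
    vertex, where the parameter [t] is arbitrary. *)
Lemma sep_line a b c d s t : sep (a, b) (c, d) -> 0 < s < 1 ->
  ((c == d) || (0 < t < 1)) -> line (Zp a) (Zp b) s <> line (Zp c) (Zp d) t.
Proof.
move=> [n [m [h1 h2 h3 h4 h5]]] /andP[s0 s1] ht e.
pose f (p : R * R) := Zr n.1 * p.1 + Zr n.2 * p.2.
have fE p : f (Zp p) = Zr (dot n p) by rewrite /f /dot ZrD !ZrM.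
have fl p q x : f (line p q x) = (1 - x) * f p + x * f q by rewrite /f /line /=; lra.
have := congr1 f e; rewrite !fl !fE.
move: h1 h2 h3 h4 h5; cbn [fst snd] => /Zr_le h1 /Zr_le h2 /Zr_le h3 /Zr_le h4 h5.
have {}h5 : Zr (dot n a) + Zr (dot n b) < Zr m + Zr m \/ Zr m + Zr m < Zr (dot n c) + Zr (dot n d).
  by case: h5 => /Zr_lt; rewrite !ZrD -Z.add_diag ?ZrD; [left|right].
move: h1 h2 h3 h4 h5; move: (Zr (dot n a)) (Zr (dot n b)) (Zr m) => A B M h1 h2.
have s' : 0 <= s <= 1 by rewrite !ltW.
case/orP: ht => [/eqP->|ht].
  move: (Zr (dot n d)) => D h3 h4 h5 E.
  have E2 : (1 - s) * A + s * B = D by rewrite E; lra.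
  case: h5 => h5; first by have : (1 - s) * A + s * B < M by [apply: conv_lt; rewrite ?s0]; lra.
  by have := conv_le s' h1 h2; lra.
have ht' : 0 <= t <= 1 by case/andP: ht => t0 t1; rewrite !ltW.
move: (Zr (dot n c)) (Zr (dot n d)) => C D h3 h4 h5 E.
have nC : - C <= - M by lra. have nD : - D <= - M by lra.
case: h5 => h5.
  have : (1 - s) * A + s * B < M by apply: conv_lt; rewrite ?s0.
  by have := conv_le ht' nC nD; lra.
have : (1 - t) * - C + t * - D < - M by apply: conv_lt => //; lra.
by have := conv_le s' h1 h2; lra.
Qed.

Lemma line_inj p q : p <> q -> injective (line p q).
Proof.
move=> ne s t e; apply/eqP; apply: contra_notT ne => st.
have st' : s - t != 0 by rewrite subr_eq0.
case: p q e => a b [c d] [] /= e1 e2; congr (_, _).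
  by apply: (mulfI st'); move: e1; lra.
by apply: (mulfI st'); move: e2; lra.
Qed.

Lemma affine_cont (a b : R) : continuous (fun t : R => (1 - t) * a + t * b).
Proof.
move=> t; apply: cvgD; apply: cvgM; try exact: cvg_cst; try exact: cvg_id.
by apply: cvgB; [apply: cvg_cst|apply: cvg_id].
Qed.

Lemma line_cont p q : continuous (line p q).
Proof.
move=> t; have h1 := @affine_cont p.1 q.1 t; have h2 := @affine_cont p.2 q.2 t.
exact: (cvg_pair h1 h2).
Qed.

Theorem planar_of_sep N (G : sgraph 'I_N) (pos : 'I_N -> Z * Z) :
  (forall u v, u <> v -> pos u <> pos v) ->
  (forall u v w, G u v -> sep (pos u, pos v) (pos w, pos w)) ->
  (forall u v u' v', G u v -> G u' v' -> [set u; v]%SET <> [set u'; v']%SET ->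
     sep (pos u, pos v) (pos u', pos v')) ->
  planar R G.
Proof.
move=> h1 h2 h3.
(* Arcs are indexed by sets of two vertices, so an orientation is chosen once for every edge. *)
pose ep (e : {set 'I_N}) := [pick p : 'I_N * 'I_N | G p.1 p.2 && (e == [set p.1; p.2]%SET)].
have epP e : e \in edges G -> exists p, [/\ ep e = Some p, G p.1 p.2 & e = [set p.1; p.2]%SET].
  rewrite inE => /existsP[u /existsP[v h]]; rewrite /ep; case: pickP => [p /andP[g /eqP E]|].
    by exists p.
  by move=> /(_ (u, v)); rewrite h.
pose arc (e : {set 'I_N}) : R -> R * R :=
  if ep e is Some p then line (Zp (pos p.1)) (Zp (pos p.2)) else fun=> (0, 0).
have Zp_inj : injective Zp by move=> [a b] [c d] [/Zr_inj -> /Zr_inj ->].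
exists (Zp \o pos), arc; split.
- by move=> u v /Zp_inj e; case: (u =P v) => // /h1.
- move=> e /epP[[u v] [E g Ee]]; rewrite /arc E /=; split.
  + exact/continuous_subspaceT/line_cont.
  + move=> s t _ _; apply: line_inj => /Zp_inj; apply: h1 => uv.
    by move: g; rewrite /= uv adj_irr.
  + exists u, v; split=> //; first by rewrite /line subr0 !mul1r !mul0r !addr0 -surjective_pairing.
    by rewrite /line subrr !mul1r !mul0r !add0r -surjective_pairing.
- move=> e /epP[[u v] [E g Ee]] t ht w; rewrite /arc E /=.
  have -> : Zp (pos w) = line (Zp (pos w)) (Zp (pos w)) 0.
    by rewrite /line subr0 !mul1r !mul0r !addr0 -surjective_pairing.
  apply: sep_line; [exact: h2|by move: ht; rewrite in_itv|by rewrite eqxx].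
- move=> e e' /epP[[u v] [E g Ee]] /epP[[u' v'] [E' g' Ee']] ne s t hs ht; rewrite /arc E E' /=.
  rewrite !in_itv /= in hs ht.
  apply: sep_line; [|exact: hs|by rewrite ht orbT].
  by apply: h3 => //; rewrite -Ee -Ee'; exact/eqP.
Qed.

End Straight.

(** * The grid graph is planar, narrow and of bounded degree *)

Section Shape.
Variables (P D : nat) (R : nat -> nat -> nat -> bool).
Hypothesis D0 : 0 < D.

Local Notation I := (P * D).
Local Notation b := (2 * D).
Local Notation gpres := (pres b (gconf P D R) (gfst D) (glst D)).
Local Notation gends := (ends b 32).
Local Notation V := (vtx b 32).
Local Notation N := (gord P D).
Local Notation G ext := (ggraph P R D0 ext).

Definition gpos (u : nat) := vert_at (u %/ 32 %/ b.+1) (u %/ 32 %% b.+1) (u %% 32).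

Lemma gposE i k p : k <= b -> p < 32 -> gpos (V i k p) = vert_at i k p.
Proof. by move=> hk hp; rewrite /gpos vtx_div // vtx_mod // cidx_div // cidx_mod. Qed.

Lemma addpE (p q : Z * Z) : addp p q = (Z.add p.1 q.1, Z.add p.2 q.2). Proof. by []. Qed.

Transparent vert_off scale corner.

Lemma end_at i k s p : k <= b -> (s <> Own -> 0 < k) -> p < 10 ->
  vert_at (nb_i i s) (nb_k k s) p = addp (cell_at i k) (end_off k (s, p)).
Proof.
move=> hk hs hp; have vo k' : vert_off k' p = part_off k' p by rewrite /vert_off hp.
rewrite /vert_at vo /end_off /=; case: s hs => hs //=.
  have {}hs : 0 < k by apply: hs.
  by case: (part_off k.-1 p) => x y; rewrite !addpE /cell_at /scale; cbn [fst snd]; congr pair; lia.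
have {}hs : 0 < k by apply: hs.
by case: (part_off k.-1 p) => x y; rewrite !addpE /cell_at /scale; cbn [fst snd]; congr pair; lia.
Qed.

Lemma wpos i k e : k <= b -> e < 22 -> gpos (cidx b i k * 32 + 10 + e) = corner_at i k e 2.
Proof. by move=> hk he; rewrite -addnA -/(V i k (10 + e)) gposE //; lia. Qed.

Lemma edge_parts k e : edge_dom k e ->
  (edge_ends (k == 1) e).1.2 < 10 /\ (edge_ends (k == 1) e).2.2 < 10.
Proof.
by move=> /dom_lt; case: (k == 1); do 22?[case: e => [|e] //].
Qed.

Lemma gpos_ends i k e : k <= b -> edge_dom k e ->
  gpos (gends (cidx b i k) e).1 = corner_at i k e 0 /\ gpos (gends (cidx b i k) e).2 = corner_at i k e 1.
Proof.
move=> hk he; have [h1 h2] := edge_parts he; have hs := edge_sides (dom_lt he) he.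
rewrite endsE //; cbn [fst snd].
have nk s : nb_k k s <= b by case: s => /=; lia.
rewrite !gposE //; try lia.
  by rewrite !end_at //; [move=> n; apply: hs; right|move=> n; apply: hs; left].
exact: b0.
Qed.

Opaque vert_off scale corner.

Lemma gpos_sege i k e j : k <= b -> edge_dom k e -> j < 3 ->
  (gpos (sege D (cidx b i k) e j).1, gpos (sege D (cidx b i k) e j).2) = seg_at i k e j.
Proof.
move=> hk he; have [h1 h2] := gpos_ends i hk he; have h3 := wpos i hk (dom_lt he).
by case: j => [|[|[|j]]] // _; rewrite /sege -[nth _ _ _]/(_, _) /seg_at /shifted /seg; cbn [fst snd];
 rewrite ?h1 ?h2 ?h3.
Qed.

Lemma gseg_cell ext c e j : gseg P D R ext c e j -> exists i k, [/\ i < I, k <= b, c = cidx b i k & edge_dom k e].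
Proof.
case/and5P=> hc hp _ _ _; exists (c %/ b.+1), (c %% b.+1); split.
- by rewrite ltn_divLR.
- by rewrite -ltnS ltn_mod.
- by rewrite /cidx -divn_eq.
exact: pres_dom hp.
Qed.

Lemma adj_seg ext (u v : 'I_N) : G ext u v -> exists i k e j,
  [/\ k <= b, edge_dom k e, j < 3, (sege D (cidx b i k) e j = (val u, val v) \/ sege D (cidx b i k) e j = (val v, val u)) &
   (gpos u, gpos v) = seg_at i k e j \/ (gpos v, gpos u) = seg_at i k e j].
Proof.
move=> /gadjP[c [e [j [h1 h2]]]]; have [i [k [hi hk ec he]]] := gseg_cell h1; subst c.
have hj : j < 3 by case/and5P: h1 => _ _ _ _ /and3P[].
exists i, k, e, j; split=> //; have := gpos_sege i hk he hj.
by case: h2 => -> <-; [left|right].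
Qed.

Lemma sep_flip (p q : Z * Z) s : sep (p, q) s -> sep (q, p) s.
Proof.
move=> [n [c h]]; exists n, c; move: h; cbn [fst snd] => -[h1 h2 h3 h4 h5]; split=> //.
by rewrite [Z.add (dot n q) _]Z.add_comm.
Qed.

Lemma sep_flipr (p q : Z * Z) s : sep s (p, q) -> sep s (q, p).
Proof. by move=> /sep_sym /sep_flip /sep_sym. Qed.

Theorem ggraph_planar (F : realType) ext : planar F (G ext).
Proof.
have pv (u : 'I_N) : exists i k p, [/\ k <= b, p < 32, val u = V i k p & gpos u = vert_at i k p].
  by have [i [k [p [_ hk hp e]]]] := vtxP u; exists i, k, p; split=> //; rewrite -(gposE i hk hp) -e.
apply: (@planar_of_sep _ _ _ (fun u => gpos u)).
- move=> u v n; have [i [k [p [hk hp e ->]]]] := pv u; have [i' [k' [p' [hk' hp' e' ->]]]] := pv v.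
  apply: vert_neq => // E; apply: n; apply: val_inj; rewrite e e'.
  by case: E => -> -> ->.
- move=> u v w /adj_seg[i [k [e [j [hk he hj _ h]]]]].
  have [i' [k' [p' [hk' hp' e' ->]]]] := pv w.
  by case: h => h; [|apply: sep_flip]; rewrite h; apply: vert_seg.
move=> u v u' v' /adj_seg[i [k [e [j [hk he hj hs h]]]]] /adj_seg[i' [k' [e' [j' [hk' he' hj' hs' h']]]]] n.
have hn : (i, k, e, j) <> (i', k', e', j').
  move=> [e1 e2 e3 e4]; subst i' k' e' j'; apply: n.
  have H (x y x' y' : 'I_N) (p q : nat * nat) : p = (val x, val y) -> q = (val x', val y') -> p = q ->
      [set x; y]%SET = [set x'; y']%SET :> {set 'I_N}.
    by move=> -> -> [/val_inj -> /val_inj ->].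
  case: hs => hs; case: hs' => hs'.
  - exact: H hs hs' _.
  - by rewrite (@finset.setUC _ [set u']%SET); apply: H hs hs' _.
  - by rewrite (@finset.setUC _ [set u]%SET); apply: H hs hs' _.
  - by rewrite (@finset.setUC _ [set u]%SET) (@finset.setUC _ [set u']%SET); apply: H hs hs' _.
have := seg_seg he he' hj hj' hn.
by case: h => <-; case: h' => <- // S; [apply: sep_flipr|apply: sep_flip|apply: sep_flip; apply: sep_flipr].
Qed.

(** Adjacent vertices lie in the same or in consecutive rows. *)
Definition gwidth := 3 * (b.+1 * 32).

Lemma seg_near c e j : c < ncell I b -> edge_dom (c %% b.+1) e -> j < 3 ->
  [/\ c * 32 <= (sege D c e j).1 + b.+1 * 32, (sege D c e j).1 < (c + b.+1) * 32,
      c * 32 <= (sege D c e j).2 + b.+1 * 32 & (sege D c e j).2 < (c + b.+1) * 32].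
Proof.
move=> hc he hj; have [h1 h2] := edge_parts he; have e22 := dom_lt he.
have H s p : p < 10 -> c * 32 <= nbc b c s * 32 + p + b.+1 * 32 /\ nbc b c s * 32 + p < (c + b.+1) * 32.
  by move=> hp; case: s => /=; lia.
have [a1 a2] := H (edge_ends (c %% b.+1 == 1) e).1.1 _ h1.
have [a3 a4] := H (edge_ends (c %% b.+1 == 1) e).2.1 _ h2.
by case: j hj => [|[|[|j]]] // _; rewrite /sege /ends; cbn [nth fst snd]; split=> //; lia.
Qed.

Lemma adj_near ext (u v : 'I_N) : G ext u v -> v <= u + gwidth /\ u <= v + gwidth.
Proof.
move=> /gadjP[c [e [j [/and5P[hc hp _ _ /and3P[he hj _]] h2]]]].
have := seg_near hc (pres_dom hp) hj.
by rewrite /gwidth; case: h2 => ->; cbn [fst snd] => -[? ? ? ?]; split; lia.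
Qed.

Lemma ggraph_bandwidth ext : bandwidth (G ext) <= gwidth.
Proof.
rewrite /bandwidth; case: arg_minnP => [|f _ hf]; first by apply/injectiveP => x y; rewrite !ffunE; apply: enum_rank_inj.
apply: leq_trans (hf [ffun x => enum_rank x] _) _.
  by apply/injectiveP => x y; rewrite !ffunE; apply: enum_rank_inj.
apply/bigmax_leqP => u _; apply/bigmax_leqP => v huv; rewrite !ffunE.
have vr (w : 'I_N) : enum_rank w = w :> nat.
  have hw : enum_rank w < N by rewrite -[X in _ < X](card_ord N) ltn_ord.
  by rewrite -{2}(enum_rankK w) (enum_val_nth w) nth_enum_ord.
rewrite !vr; have [h1 h2] := adj_near huv; lia.
Qed.

(** The neighbours of [u] are numbered within [gwidth D] of [u] on either side, which leaves room
    for at most [(2 * gwidth D).+1] of them. *)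
Lemma ggraph_degree ext : max_degree (G ext) <= (2 * gwidth).+1.
Proof.
apply/bigmax_leqP => u _.
pose f (v : 'I_N) : 'I_(2 * gwidth).+1 := inord (v + gwidth - u).
have hf : {in G ext u &, injective f}.
  move=> v w /adj_near[h1 h2] /adj_near[h3 h4] /(congr1 val); rewrite /f /= !inordK; [|lia|lia].
  by move=> e; apply: val_inj => /=; lia.
by rewrite -(card_in_image hf) -[X in _ <= X]card_ord max_card.
Qed.

End Shape.

(** * Hardness *)

Lemma iter_halted M (t : nat) (c : config M) : halted c -> iter t (@step M) c = c.
Proof. by move=> h; elim: t => //= t ->; rewrite /step; move: h; rewrite /halted => ->. Qed.

Lemma run_halted M s t x : halted (run M s x) -> s <= t -> run M t x = run M s x.
Proof. by move=> h e; rewrite /run -(subnK e) iterD iter_halted. Qed.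

Lemma addr_base M S i j a : 2 <= addr M S i j a.
Proof. by rewrite /addr /mbase; lia. Qed.

Lemma mclr0_0 M S k : mclr0 M S k 0 = false.
Proof.
rewrite /mclr0 /=; apply/negbTE/hasPn => i _.
by rewrite ![0 == _]eq_sym !gtn_eqF // (leq_trans _ (addr_base M S _ _ _)).
Qed.

Lemma mclr_0 M S k : mclr M S k 0 = false.
Proof. by rewrite /mclr mclr0_0 andbF. Qed.

Lemma mset_0 M S k : msets M S k 0 = false.
Proof.
rewrite /msets; apply/negbTE; rewrite negb_and; apply/orP; right; rewrite /=.
apply/hasPn => i _.
by rewrite ![0 == _]eq_sym !gtn_eqF // (leq_trans _ (addr_base M S _ _ _)).
Qed.

Section Reduction.
Variables (M : machine) (p : {poly nat}) (v : vertex_problem).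
Hypothesis space : forall x t, space_used (run M t x) <= p.[size x]%R.
Local Notation D := (nletters site).
Local Notation D0 := (nletters_gt0 wall).

Definition cP x := (cn M p x).+1.
Definition y0 := yword M p (site0 M p).
Definition y1 := yword M p (site1 M p).

Lemma cm2 x : 1 < cm M p x. Proof. by rewrite /cm /msize /mbase; lia. Qed.
Lemma cB2 x : 1 < cB M p x. Proof. by rewrite /cB /rB; lia. Qed.
Lemma cPE x : cP x = cB M p x * cm M p x.
Proof. by rewrite /cP /cn prednK // muln_gt0; have := cm2 x; have := cB2 x; lia. Qed.
Lemma cn2 x : 1 < cn M p x.
Proof.
have : 2 * 2 <= cP x by rewrite cPE; apply: leq_mul; [apply: cB2|apply: cm2].
by rewrite /cP; lia.
Qed.

Lemma walled0 x : walled wall (cn M p x) (site0 M p x).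
Proof. by split; rewrite /site0 /Kinit /Kround /Kstart /Kc //= ltnSn. Qed.
Lemma walled1 x : walled wall (cn M p x) (site1 M p x).
Proof. by split; rewrite /site1 /allacc //= ltnSn. Qed.
Lemma site0_out x q : cn M p x < q -> site0 M p x q = wall.
Proof. by move=> h; rewrite /site0 /Kinit /Kround /Kstart /Kc h orbT. Qed.
Lemma site1_out x q : cn M p x < q -> site1 M p x q = wall.
Proof. by move=> h; rewrite /site1 /allacc h orbT. Qed.

Lemma y0_ok x : word_ok (cP x) D (cR M p x) (y0 x).
Proof. exact: (word_of_sites_ok flipf (walled0 x)). Qed.
Lemma y1_ok x : word_ok (cP x) D (cR M p x) (y1 x).
Proof. exact: (word_of_sites_ok flipf (walled1 x)). Qed.
Lemma y01 x q : cP x <= q -> y0 x q = y1 x q.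
Proof. by move=> h; rewrite /y0 /y1 /yword !word_of_sites_out. Qed.

Lemma accepts_word x : (exists t, halted (run M t x) && accepting (control (run M t x))) <->
  star (word_step (cP x) D (cR M p x)) (y0 x) (y1 x).
Proof.
have n0 : 0 < cn M p x by apply: ltnW (cn2 x).
have := flips_word flipf_sym n0 (walled0 x) (walled1 x) (@site0_out x) (@site1_out x).
rewrite -/(cP x) -/(cR M p x) -/(y0 x) -/(y1 x) => ->.
have := ring_machine (cn2 x) (cB2 x) (ltnW (cm2 x)) (cPE x) (prog := prog_of M p x) (rprog6 _ _ _ _ _)
  (rprog0 _ _ _ (fun k => mset_0 _ _ k) (fun k => mclr_0 _ _ k)) (@dinit M (sp p x) x).
rewrite -/(site0 M p x) -/(site1 M p x) => ->.
have := rules_halt (rcount M (sp p x)) (mguard M (sp p x)) (msets M (sp p x)) (mclr M (sp p x)) (mwin M (sp p x)) (cm2 x) (@dinit M (sp p x) x).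
rewrite -/(prog_of M p x) -/(cB M p x) => ->.
by rewrite -(machine_halts (S := sp p x) (space x)).
Qed.

Definition rN x := eN D cP x.
(** The size of a minimum cover has to be computed by the reduction. It is obtained as the size of
    the source cover, a sum of bits. *)
Definition rkap x := \sum_(0 <= i < rN x) wbit D (y0 x) i.
Definition rthr x := if small v then (rkap x).+1 else rN x - (rkap x).+1.
Definition rbit (y : seq bool -> nat -> nat) x i := if small v then wbit D (y x) i else ~~ wbit D (y x) i.
Definition radj x := gadj (cP x) D (cR M p x) (pext v).

Lemma E2_cP : E2 (fun x _ => cP x). Proof. exact: E2_succ (E2_cn M p). Qed.
Lemma E2_y0 f : E2 f -> E2 (fun x s => y0 x (f x s)).
Proof. by apply: E2_yword => g; apply: E2F_site0. Qed.
Lemma E2_y1 f : E2 f -> E2 (fun x s => y1 x (f x s)).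
Proof. by apply: E2_yword => g; apply: E2F_site1. Qed.
Lemma E2_rN : E2 (fun x _ => rN x). Proof. exact: E2_eN E2_cP. Qed.
Lemma E2_radj f g : E2 f -> E2 g -> E2b (fun x s => radj x (f x s) (g x s)).
Proof. by move=> hf hg; exact: (E2_gadj D E2_cP (@E2_cR M p) (pext v) hf hg). Qed.
Lemma E2_rbit y : (forall f, E2 f -> E2 (fun x s => y x (f x s))) -> forall f, E2 f -> E2b (fun x s => rbit y x (f x s)).
Proof. by move=> hy f hf; rewrite /rbit; case: (small v); [|apply: E2b_not]; apply: E2_wbit. Qed.
Lemma E2_rthr : E2 (fun x _ => rthr x).
Proof.
have h : E2 (fun x _ => rkap x).
  apply: (@E2_sum _ (fun x i s => (wbit D (y0 x) i : nat)) E2_rN).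
  exact: (E2_wbit D E2_y0 (E2_var 0)).
by rewrite /rthr; have h' := E2_rN; case: (small v); e2.
Qed.

Let G x := ggraph (cP x) (cR M p x) D0 (pext v).

Definition rbase x : reconf_instance v :=
  ReconfInstance (winst_feasible (ltn0Sn _) D0 v (y0_ok x)) (winst_feasible (ltn0Sn _) D0 v (y1_ok x)).

Lemma rcard x : #|source (rbase x)| = #|target (rbase x)|.
Proof. exact: (winst_card (ltn0Sn _) D0 v (y0_ok x) (y1_ok x)). Qed.

Definition rtoken x : token_instance v := TokenInstance (rcard x).
Definition rthreshold x : threshold_instance v := ThresholdInstance (rbase x) (wthreshold (cP x) D v).

Lemma rbitE y x (u : 'I_(rN x)) : (u \in winst (cP x) D v (y x)) = rbit y x u.
Proof.
have e : (u \in wset (cP x) D (y x)) = wbit D (y x) u by rewrite inE.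
by rewrite /winst /pside /rbit -e; case: (small v); rewrite ?inE.
Qed.

Lemma rbaseE x : encode_base (rbase x) = base_bits rN radj (rbit y0) (rbit y1) x.
Proof.
rewrite /encode_base /base_bits /set_bits /=.
by congr (_ ++ (_ ++ (_ ++ _))); apply: eq_map => u; exact: rbitE.
Qed.

Lemma rkapE x : rkap x = kappa (cP x) D.
Proof.
have [_ <-] := wset_mc (ltn0Sn _) D0 (y0_ok x).
rewrite /rkap big_mkord -sum1_card [RHS]big_mkcond /=; apply: eq_bigr => u _.
have -> : (u \in wset (cn M p x).+1 D (y0 x)) = wbit D (y0 x) u by rewrite inE.
by case: (wbit _ _ _).
Qed.

Lemma rthrE x : wthreshold (cP x) D v = Posz (rthr x).
Proof.
rewrite /wthreshold /rthr rkapE; case: (small v) => //; rewrite -[rN x]/(gord (cP x) D).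
suff h : kappa (cP x) D < gord (cP x) D by rewrite subzn.
have N0 : 0 < gord (cP x) D by rewrite /gord /ncell !muln_gt0 D0.
rewrite /kappa ltn_subrL N0 andbT; apply/card_gt0P; exists (grep (Ordinal N0)); exact: imset_f.
Qed.

Lemma polytime_base : polytime (fun x => encode_base (rbase x)).
Proof.
have hN := E2_rN; have h0 := E2_rbit E2_y0; have h1 := E2_rbit E2_y1.
apply: (polytime_of_E2 (E2_ebit hN E2_radj h0 h1 (E2_var 0)) (E2_elen hN)) => x.
rewrite rbaseE base_bitsE; apply: eq_mkseq_in => i _ /=.
by case: ebit.
Qed.

Lemma polytime_threshold : polytime (fun x => encode_base (rbase x) ++ int_bits (wthreshold (cP x) D v)).
Proof.
have hN := E2_rN; have h0 := E2_rbit E2_y0; have h1 := E2_rbit E2_y1.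
apply: (polytime_of_E2 (E2_tbit hN E2_rthr E2_radj h0 h1 (E2_var 0)) (E2_tlen hN E2_rthr)) => x.
rewrite rbaseE rthrE threshold_bitsE; apply: eq_mkseq_in => i _ /=.
by case: tbit.
Qed.

Lemma rplanar (F : realType) x : planar_bounded F (gwidth D) (2 * gwidth D).+1 (rbase x).
Proof. by split; [apply: ggraph_planar|apply: ggraph_bandwidth|apply: ggraph_degree]. Qed.

End Reduction.

Theorem hardness (F : realType) (v : vertex_problem) :
  let c := gwidth (nletters site) in let d := (2 * c).+1 in
  [/\ @PSPACE_hard_on (TAR_problem v) (fun I : threshold_instance v => planar_bounded F c d I),
      @PSPACE_hard_on (TJ_problem v) (fun I : token_instance v => planar_bounded F c d I)
    & @PSPACE_hard_on (TS_problem v) (fun I : token_instance v => planar_bounded F c d I)].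
Proof.
move=> c d.
suff H L : PSPACE L -> exists (M : machine) (p : {poly nat}), (forall x t, space_used (run M t x) <= p.[size x]%R) /\
   forall x, L x <-> star (word_step (cP M p x) (nletters site) (cR M p x)) (y0 M p x) (y1 M p x).
  split=> L /H[M [p [sp hL]]].
  - exists (fun x => encode_base (rbase M p v x) ++ int_bits (wthreshold (cP M p x) (nletters site) v)); first exact: polytime_threshold.
    move=> x; exists (rthreshold M p v x); split=> //; first exact: rplanar.
    rewrite hL; symmetry; exact: (glue_TAR (ltn0Sn _) (nletters_gt0 wall) v (y0_ok M p x) (y1_ok M p x) (@y01 M p x)).
  - exists (fun x => encode_base (rbase M p v x)); first exact: polytime_base.
    move=> x; exists (rtoken M p v x); split=> //; first exact: rplanar.
    rewrite hL; symmetry; exact: (glue_TJ (ltn0Sn _) (nletters_gt0 wall) v (y0_ok M p x) (y1_ok M p x) (@y01 M p x)).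
  - exists (fun x => encode_base (rbase M p v x)); first exact: polytime_base.
    move=> x; exists (rtoken M p v x); split=> //; first exact: rplanar.
    rewrite hL; symmetry; exact: (glue_TS (ltn0Sn _) (nletters_gt0 wall) v (y0_ok M p x) (y1_ok M p x) (@y01 M p x)).
move=> [M [p h]]; exists M, p; split=> [x t|x]; first by case: (h x).
have [sp [t ht ha]] := h x.
have hx : forall x t, space_used (run M t x) <= p.[size x]%R by move=> z; case: (h z).
rewrite -(accepts_word hx) -ha; split=> [k|[s /andP[h1 h2]]]; first by exists t; rewrite ht.
(* Halted configurations do not change, so the halting time that decides membership and the time of
   acceptance see the same configuration. *)
have [st|ts] := leqP s t; first by rewrite (run_halted h1 st).
by rewrite -(run_halted ht (ltnW ts)).
Qed.

Theorem theorem17 (R : realType) :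
  exists c d : nat, forall P : vertex_problem,
    [/\ @PSPACE_complete_on (TAR_problem P)
          (fun I : threshold_instance P => planar_bounded R c d I),
        @PSPACE_complete_on (TJ_problem P)
          (fun I : token_instance P => planar_bounded R c d I)
      & @PSPACE_complete_on (TS_problem P)
          (fun I : token_instance P => planar_bounded R c d I)].
Proof.
(* Both constants depend on the alphabet of the universal array only, neither on the language nor on
   the problem. *)
exists (gwidth (nletters site)), (2 * gwidth (nletters site)).+1 => P.
have [m1 m2 m3] := membership P; have [h1 h2 h3] := hardness R P.
by split; split.
Qed.
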